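(* Let $(M,g)$ be a complete Kähler manifold of real dimension $2n$ satisfying, for some $\nu>2$ and some constant $C_S>0$, the Sobolev type inequality $$\left(\int_M |\phi|^{\frac{2\nu}{\nu-2}}\right)^{\frac{\nu-2}{\nu}}\leq C_S\int_M|\nabla\phi|^2$$ for every compactly supported smooth function $\phi$ on $M$. Denote by $\mu_1\leq\dots\leq\mu_{n^2}$ the eigenvalues of the Kähler curvature operator of $(M,g)$. Suppose that there exists a function $\kappa:M\to\mathbb{R}$ such that $\kappa\leq 0$ and $$\frac{\mu_1(x)+\cdots+\mu_n(x)}{n+1}\geq\kappa(x)$$ at every point $x\in M$. Then every (real-valued) harmonic function $u$ on $M$ is constant, provided that $|\nabla u|\in L^2$ and $\|\kappa\|_{\nu/2}<\frac{2}{C_S(n+1)}$, where $$\|\kappa\|_{\nu/2}:=\left(\int_M|\kappa|^{\frac{\nu}{2}}\right)^{\frac{2}{\nu}}.$$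
   Context: Manifolds are connected. Integrals are with respect to the Riemannian volume. The curvature operator $\mathfrak{R}:\Lambda^2TM\to\Lambda^2TM$ is the self-adjoint operator defined by $g(\mathfrak{R}(X\wedge Y),Z\wedge W)=Rm(X,Y,Z,W)$, where $\Lambda^2$ carries the inner product for which $e_i\wedge e_j$ ($i<j$) is orthonormal whenever $(e_i)$ is, and the sign of $Rm$ is such that $g(\mathfrak{R}(X\wedge Y),X\wedge Y)$ is the sectional curvature of the plane spanned by orthonormal $X,Y$. Identifying $\Lambda^2T_xM=\mathfrak{so}(T_xM)$, on a Kähler manifold of complex dimension $n$ the operator $\mathfrak{R}$ vanishes on the orthogonal complement of $\mathfrak{u}(n)\subset\mathfrak{so}(2n)$ and so induces $\mathfrak{R}_{\mathfrak{u}(n)}:\mathfrak{u}(n)\to\mathfrak{u}(n)$, called the Kähler curvature operator; since $\dim_{\mathbb{R}}\mathfrak{u}(n)=n^2$ it has $n^2$ eigenvalues at each point. *)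

(* Defs.v *)
From HB Require Import structures.
From mathcomp Require Import all_boot all_order all_algebra.
From mathcomp Require Import all_classical all_reals all_analysis.

Set Implicit Arguments.
Unset Strict Implicit.
Unset Printing Implicit Defensive.

Import Order.TTheory GRing.Theory Num.Theory.
Import numFieldNormedType.Exports.

Local Open Scope classical_set_scope.
Local Open Scope ring_scope.

(* Vectors are rows: a linear map with matrix A acts by v |-> v *m A, as in the
   library's Jacobian, 'd f x v = v *m 'J f x. *)

Section Calculus.
Context {R : realType} {m : nat}.

Definition partial {W : normedModType R} (k : 'I_m) (f : 'rV[R]_m -> W) :
    'rV[R]_m -> W :=
  'D_(delta_mx 0 k) f.

(* C^oo on an open set U: the iterated partial derivatives of all orders exist
   and are continuous at the points of U. *)
Definition smooth_on {W : normedModType R} (U : set 'rV[R]_m)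
    (f : 'rV[R]_m -> W) : Prop :=
  forall (s : seq 'I_m) (x : 'rV[R]_m), U x ->
    let h := foldr (fun k f' => partial k f') f s in
    {for x, continuous h} /\
    forall k : 'I_m, derivable h x (delta_mx 0 k).

End Calculus.

(* Lebesgue integral over R^m of a nonnegative Borel function, as an iterated
   integral (Tonelli). *)
Fixpoint integral_rV {R : realType} (m : nat) :
    ('rV[R]_m -> \bar R) -> \bar R :=
  match m with
  | 0 => fun f => f 0
  | m'.+1 => fun f =>
      (\int[@lebesgue_measure R]_t
         integral_rV (fun y : 'rV[R]_m' => f (row_mx (t%:M : 'rV[R]_1) y)))%E
  end.

Record manifold (R : realType) (m : nat) := Manifold {
  carrier :> ptopologicalType;
  manifold_hausdorff : hausdorff_space carrier;
  manifold_second_countable : @second_countable carrier;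
  manifold_connected : connected [set: carrier];
  chart : Type;
  chart_dom : chart -> set carrier;
  chart_coord : chart -> carrier -> 'rV[R]_m;
  chart_param : chart -> 'rV[R]_m -> carrier;
  chart_at : carrier -> chart;
  chart_atP : forall x, chart_dom (chart_at x) x;
  open_dom : forall i, open (chart_dom i);
  open_codom : forall i, open (chart_coord i @` chart_dom i);
  coordK : forall i x, chart_dom i x -> chart_param i (chart_coord i x) = x;
  coord_continuous : forall i x, chart_dom i x -> {for x, continuous (chart_coord i)};
  param_continuous : forall i y, (chart_coord i @` chart_dom i) y ->
    {for y, continuous (chart_param i)};
  transition_smooth : forall i j,
    smooth_on (chart_coord i @` (chart_dom i `&` chart_dom j)) (chart_coord j \o chart_param i)
}.

Section Manifold.
Context {R : realType} {m : nat} {M : manifold R m}.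

Definition chart_codom (i : chart M) : set 'rV[R]_m := chart_coord i @` chart_dom i.

(* coordinates of x in the chart chosen at x; all pointwise quantities below
   are tensorial, so that this choice does not matter *)
Definition coord_at (x : M) : 'rV[R]_m := chart_coord (chart_at x) x.

Definition transition_jacobian (i j : chart M) (x : M) : 'M[R]_m :=
  'J (chart_coord j \o chart_param i) (chart_coord i x).

Definition smooth_fun (f : M -> R) : Prop :=
  forall i : chart M, smooth_on (chart_codom i) (f \o chart_param i).

Definition compactly_supported (f : M -> R) : Prop :=
  compact (closure [set x : M | f x != 0]).

Definition differential (f : M -> R) (x : M) : 'rV[R]_m :=
  \row_k partial k (f \o chart_param (chart_at x)) (coord_at x).

End Manifold.

Definition borel {R : realType} {m : nat} (M : manifold R m) :=
  g_sigma_algebraType (@open M).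

(* g(X, Y) for the Gram matrix G of g in a basis *)
Definition inner {R : realType} {m : nat} (G : 'M[R]_m) (X Y : 'rV[R]_m) : R :=
  (X *m G *m Y^T) 0 0.

Record metric {R : realType} {m : nat} (M : manifold R m) := Metric {
  gmat : chart M -> 'rV[R]_m -> 'M[R]_m;
  gmat_smooth : forall i, smooth_on (chart_codom i) (gmat i);
  gmat_sym : forall i y, chart_codom i y -> (gmat i y)^T = gmat i y;
  gmat_posdef : forall i y, chart_codom i y ->
    forall X : 'rV[R]_m, X != 0 -> 0 < inner (gmat i y) X X;
  gmat_transition : forall i j x, chart_dom i x -> chart_dom j x ->
    gmat i (chart_coord i x) =
    transition_jacobian i j x *m gmat j (chart_coord j x)
      *m (transition_jacobian i j x)^T
}.

Section LocalGeometry.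
Context {R : realType} {m : nat}.
Variable G : 'rV[R]_m -> 'M[R]_m.

Definition dmetric (l i j : 'I_m) : 'rV[R]_m -> R :=
  partial l (fun y => G y i j).

(* christoffel k i j is Gamma^k_ij *)
Definition christoffel (k i j : 'I_m) (y : 'rV[R]_m) : R :=
  2^-1 * \sum_(l < m) invmx (G y) k l *
    (dmetric i j l y + dmetric j i l y - dmetric l i j y).

(* the component along d_l of R(d_i, d_j) d_k, where
   R(X, Y) Z = D_X D_Y Z - D_Y D_X Z - D_[X, Y] Z *)
Definition riemann (i j k l : 'I_m) (y : 'rV[R]_m) : R :=
  partial i (christoffel l j k) y - partial j (christoffel l i k) y
  + \sum_(p < m) (christoffel p j k y * christoffel l i p y
                  - christoffel p i k y * christoffel l j p y).

(* Rm(X, Y, Z, W) = g(R(X, Y) W, Z), so that Rm(X, Y, X, Y) is the sectional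
   curvature for orthonormal X, Y *)
Definition Rm (X Y Z W : 'rV[R]_m) (y : 'rV[R]_m) : R :=
  \sum_(i < m) \sum_(j < m) \sum_(l < m)
    X 0 i * Y 0 j * W 0 l * inner (G y) (\row_k riemann i j l k y) Z.

(* for J d_a = \sum_b J_ab d_b, the component along d_b of (D_k J) d_a *)
Definition covariant_derivative_endo (J : 'rV[R]_m -> 'M[R]_m)
    (k a b : 'I_m) (y : 'rV[R]_m) : R :=
  partial k (fun z => J z a b) y
  + \sum_(c < m) (J y a c * christoffel b k c y
                  - christoffel c k a y * J y c b).

Definition hessian (f : 'rV[R]_m -> R) (i j : 'I_m) (y : 'rV[R]_m) : R :=
  partial i (partial j f) y
  - \sum_(k < m) christoffel k i j y * partial k f y.

End LocalGeometry.

(* Lambda^2 T is modelled by the skew-symmetric matrices A, A standing for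
   \sum_(i < j) A_ij d_i /\ d_j *)
Section Bivectors.
Context {R : realType} {m : nat}.

Definition wedge (X Y : 'rV[R]_m) : 'M[R]_m := X^T *m Y - Y^T *m X.

Definition bivector (A : 'M[R]_m) : Prop := A^T = - A.

(* 1/2 \sum A_ij B_kl G_ik G_jl; the e_i /\ e_j, i < j, are orthonormal whenever
   the e_i are *)
Definition inner2 (G A B : 'M[R]_m) : R :=
  2^-1 * \tr (A^T *m G *m B *m G).

(* the identification of Lambda^2 T with so(T); X /\ Y is sent to
   Z |-> g(X, Z) Y - g(Y, Z) X *)
Definition so_of_bivector (G A : 'M[R]_m) : 'M[R]_m := G *m A.

End Bivectors.

Section Riemannian.
Context {R : realType} {m : nat} {M : manifold R m}.
Variable g : metric M.

Definition g_at (x : M) : 'M[R]_m := gmat g (chart_at x) (coord_at x).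

Definition gradient (f : M -> R) (x : M) : 'rV[R]_m :=
  differential f x *m invmx (g_at x).

Definition grad_norm (f : M -> R) (x : M) : R :=
  Num.sqrt (inner (g_at x) (gradient f x) (gradient f x)).

Definition laplacian (f : M -> R) (x : M) : R :=
  \sum_(i < m) \sum_(j < m) invmx (g_at x) i j *
    hessian (gmat g (chart_at x)) (f \o chart_param (chart_at x)) i j (coord_at x).

Definition harmonic_fun (f : M -> R) : Prop :=
  smooth_fun f /\ forall x : M, laplacian f x = 0.

Definition riemannian_volume (vol : {measure set (borel M) -> \bar R}) : Prop :=
  forall (i : chart M) (A : set (borel M)), measurable A -> A `<=` chart_dom i ->
    vol A = integral_rV (fun y : 'rV[R]_m =>
      (\1_(chart_coord i @` A) y * Num.sqrt (\det (gmat g i y)))%:E).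

(* L is the length of a C^1 curve from p to q lying in the domain of one chart
   (a C^1 function on [0, 1] extends to a C^1 function on the line) *)
Definition chart_curve_length (p q : M) (L : R) : Prop :=
  exists (i : chart M) (c : R -> 'rV[R]_m),
    [/\ chart_dom i p /\ c 0 = chart_coord i p,
        chart_dom i q /\ c 1 = chart_coord i q,
        (forall t : R, 0 <= t <= 1 -> chart_codom i (c t)),
        (forall t : R, derivable c t 1) /\ continuous (derive1 c) &
        L = \int[@lebesgue_measure R]_(t in `[0, 1])
              Num.sqrt (inner (gmat g i (c t)) (derive1 c t) (derive1 c t))].

(* lengths of piecewise C^1 curves; by compactness, every such curve is a
   finite concatenation of C^1 curves lying in chart domains *)
Inductive curve_length : M -> M -> R -> Prop :=
| curve_length_nil p : curve_length p p 0
| curve_length_cons p q r L1 L2 : chart_curve_length p q L1 ->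
    curve_length q r L2 -> curve_length p r (L1 + L2).

Definition riemannian_distance (p q : M) : R :=
  inf [set L : R | curve_length p q L].

Definition metrically_complete : Prop :=
  forall u : nat -> M,
    (forall e : R, 0 < e -> exists N : nat, forall k l : nat,
      (N <= k)%N -> (N <= l)%N -> riemannian_distance (u k) (u l) < e) ->
    exists p : M, forall e : R, 0 < e -> exists N : nat, forall k : nat,
      (N <= k)%N -> riemannian_distance (u k) p < e.

Definition curvature_operator (x : M) (T : {linear 'M[R]_m -> 'M[R]_m}) : Prop :=
  (forall A, bivector A -> bivector (T A)) /\
  forall X Y Z W : 'rV[R]_m,
    inner2 (g_at x) (T (wedge X Y)) (wedge Z W) =
    Rm (gmat g (chart_at x)) X Y Z W (coord_at x).

Definition sobolev_inequality (vol : {measure set (borel M) -> \bar R})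
    (nu C : R) : Prop :=
  forall phi : M -> R, smooth_fun phi -> compactly_supported phi ->
    ((\int[vol]_x (`|phi x| `^ (2 * nu / (nu - 2)))%:E) `^ ((nu - 2) / nu)
     <= C%:E * \int[vol]_x (grad_norm phi x ^+ 2)%:E)%E.

(* Kaehler structure: an orthogonal, parallel (hence integrable) almost complex
   structure *)
Record kahler_structure := KahlerStructure {
  Jmat : chart M -> 'rV[R]_m -> 'M[R]_m;
  Jmat_smooth : forall i, smooth_on (chart_codom i) (Jmat i);
  Jmat_transition : forall i j x, chart_dom i x -> chart_dom j x ->
    Jmat i (chart_coord i x) *m transition_jacobian i j x =
    transition_jacobian i j x *m Jmat j (chart_coord j x);
  Jmat_sqr : forall i y, chart_codom i y -> Jmat i y *m Jmat i y = - 1%:M;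
  Jmat_orthogonal : forall i y, chart_codom i y -> forall X Y : 'rV[R]_m,
    inner (gmat g i y) (X *m Jmat i y) (Y *m Jmat i y) =
    inner (gmat g i y) X Y;
  Jmat_parallel : forall i y, chart_codom i y -> forall k a b : 'I_m,
    covariant_derivative_endo (gmat g i) (Jmat i) k a b y = 0
}.

Definition J_at (J : kahler_structure) (x : M) : 'M[R]_m :=
  Jmat J (chart_at x) (coord_at x).

(* u(n) inside so(T_x M), seen in Lambda^2 T_x M *)
Definition unitary_bivector (J : kahler_structure) (x : M) (A : 'M[R]_m) : Prop :=
  bivector A /\
  so_of_bivector (g_at x) A *m J_at J x = J_at J x *m so_of_bivector (g_at x) A.

End Riemannian.

(* mu lists in increasing order, with multiplicity, the eigenvalues of the
   restriction of the curvature operator to u(n), whose dimension is n ^ 2 *)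
Definition kahler_curvature_eigenvalues {R : realType} {n : nat}
    {M : manifold R (2 * n)} {g : metric M} (J : kahler_structure g) (x : M)
    (mu : 'I_(n ^ 2) -> R) : Prop :=
  (forall a b : 'I_(n ^ 2), (a <= b)%N -> mu a <= mu b) /\
  exists (T : {linear 'M[R]_(2 * n) -> 'M[R]_(2 * n)})
         (E : 'I_(n ^ 2) -> 'M[R]_(2 * n)),
    [/\ curvature_operator g x T,
        forall a, unitary_bivector J x (E a),
        forall a b, inner2 (g_at g x) (E a) (E b) = (a == b)%:R &
        forall a, T (E a) = mu a *: E a].

(* Main.v *)
(** Let F = |grad u|^2 and let A be the Hessian of u. Since u is harmonic, the
    field X (A - J A J), X = grad u, has divergence tr (A A) - tr (A J A J), which
    is nonnegative, is twice the square norm of the J-commuting part of A, and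
    bounds the square norm of the field when multiplied by F. Integrating against
    cutoffs and using that F is integrable, it vanishes: u is pluriharmonic, and A
    anticommutes with J. This gives the refined Kato inequality
    |X A|^2 <= |A|^2 F / 2. The Ricci curvature is a combination of the mu_a with
    weights in [0, 1] of total n, so Ric >= (n + 1) kappa, and Bochner's formula
    yields, for v = sqrt (F + e), that half the Laplacian of F is at least
    2 |dv|^2 - (n + 1) |kappa| F. Testing with phi^2 and estimating the curvature
    term by the inequalities of Hoelder and Sobolev,
      (1 + 1 / (1 + d) - (n + 1) C_S ||kappa||) int |d (phi v)|^2
        <= (1 + 1 / d) int (F + e) |d phi|^2
    for every d > 0. The right-hand side can be made small, whereas by the Sobolev
    inequality the integral on the left stays away from 0 unless F = 0.

    Cutoffs phi with small gradient come from completeness without the Hopf-Rinow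
    theorem: a failure of their construction at a point and a scale propagates to
    a nearby point at half the scale, which produces a Cauchy sequence whose limit
    would have no cutoff at any small scale. *)
Require Import Defs.
From HB Require Import structures.
From mathcomp Require Import all_boot all_order all_fingroup all_algebra.
From mathcomp Require Import all_classical all_reals all_analysis.
From mathcomp Require Import measurable_realfun ring lra.

Set Implicit Arguments.
Unset Strict Implicit.
Unset Printing Implicit Defensive.

Import Order.TTheory GRing.Theory Num.Theory.
Import numFieldNormedType.Exports.

Local Open Scope classical_set_scope.
Local Open Scope ring_scope.

(** * Calculus on R^m *)

(** Two difficulties shape the proof. [kappa] is an arbitrary function, and [integral_rV] is an
    iterated integral whose inner integrals are not known to be measurable; integrals of nonnegative
    functions are therefore handled as suprema over the simple functions below them, which are
    monotone, homogeneous and superadditive. In the Hoelder step |kappa| is replaced by a continuous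
    function between 0 and |kappa|. Moreover [vol] is prescribed chart by chart, and neither Fubini
    nor a change of variables is used: the divergence theorem comes from translation invariance of
    the iterated integral, and the chart independence of the divergence from the fact that all
    charts compute the same measure.

    The constant 2 in the hypothesis on [kappa] is the limit of 1 + 1 / (1 + d) as d tends to 0: one
    unit is the usual Kato inequality, the other is the gain of its refinement. The shift e keeps v
    smooth at the zeros of grad u; its contribution e int |d phi|^2 is not controlled by the energy,
    so e is chosen after phi. *)

Lemma near_forall {T : topologicalType} {I : finType} (x : T) (P : I -> T -> Prop) :
  (forall i, \forall y \near x, P i y) -> \forall y \near x, forall i, P i y.
Proof. by move=> H; exact: filter_forall. Qed.

Lemma cvg_sumr {R : realType} {T I : Type} (F : set_system T) {FF : Filter F}
    (r : seq I) (f : I -> T -> R) (a : I -> R) :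
  (forall i, f i x @[x --> F] --> a i) ->
  \sum_(i <- r) f i x @[x --> F] --> \sum_(i <- r) a i.
Proof.
move=> H; elim: r => [|i r IHr].
  by rewrite big_nil; under eq_cvg do rewrite big_nil; exact: cvg_cst.
by rewrite big_cons; under eq_cvg do rewrite big_cons; exact: cvgD.
Qed.

Lemma continuous_at_eq {T S : topologicalType} (f g : T -> S) (x : T) :
  {near x, f =1 g} -> {for x, continuous f} -> {for x, continuous g}.
Proof.
move=> E c; have Ex : f x = g x := nbhs_singleton E.
change (g @ x --> g x); rewrite -Ex.
by apply: cvg_trans c; apply: near_eq_cvg.
Qed.

(** * Differentiability and mean value estimates *)

Section Differentiability.
Context {R : realType}.

Lemma is_deriveE {V W : normedModType R} (x v : V) (f : V -> W) df :
  is_derive x v f df -> 'D_v f x = df.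
Proof. by case. Qed.

(** The differential is a chosen continuous linear map satisfying the first order expansion;
    exhibiting one such map lets [getPex] validate the choice. *)
Lemma differentiable_remainder {V W : normedModType R} (f : V -> W)
    (df : {linear V -> W}) (x : V) :
  continuous df ->
  (forall e : R, 0 < e ->
     \forall y \near x, `|f y - f x - df (y - x)| <= e * `|y - x|) ->
  differentiable f x.
Proof.
move=> cdf H; apply/diffP => /=.
apply: (@getPex _ (fun (df : {linear V -> W}) => continuous df /\
  forall y, f y = f (lim (nbhs x)) + df (y - lim (nbhs x))
                  +o_(y \near x) (y - lim (nbhs x)))).
exists df; split=> //; rewrite lim_id //.
pose F : filter_on V := nbhs x.
have E : f = (cst (f x) + (fun y => df (y - x))) +o_F (fun y => y - x).
  by apply/eqaddoP => e /H; apply: filterS => y; rewrite !fctE opprD addrA.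
by move=> y; rewrite {1}E.
Qed.

Lemma is_derive_line {V W : normedModType R} (f : V -> W) (a v : V) (t : R) :
  derivable f (a + t *: v) v ->
  is_derive t 1 (fun s : R => f (a + s *: v)) ('D_v f (a + t *: v)).
Proof.
move=> df.
have E : (fun h : R => h^-1 *: (((fun s : R => f (a + s *: v)) \o shift t) (h *: 1) - f (a + t *: v)))
  = (fun h : R => h^-1 *: ((f \o shift (a + t *: v)) (h *: v) - f (a + t *: v))).
  apply/funext => h /=; congr (_ *: (f _ - _)).
  by rewrite scalerDl [h *: 1]mulr1 addrCA.
split; first by rewrite /derivable E.
by rewrite /derive E.
Qed.

(** Mean value theorem on the line through a, for s of either sign. With l a value of the derivative
    it is a first order expansion, with l = 0 a Lipschitz bound. *)
Lemma line_increment {V : normedModType R} (f : V -> R) (a v : V) (s l e : R) :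
  (forall t : R, `|t| <= `|s| -> derivable f (a + t *: v) v /\
     `|'D_v f (a + t *: v) - l| <= e) ->
  `|f (a + s *: v) - f a - s * l| <= e * `|s|.
Proof.
move=> H.
pose g (t : R) : R := f (a + t *: v).
have dg (t : R) : `|t| <= `|s| -> is_derive t 1 g ('D_v f (a + t *: v)).
  by move=> /H [d _]; apply: is_derive_line.
have key (b c : R) : b <= c -> (forall t : R, b <= t <= c -> `|t| <= `|s|) ->
    exists2 t, `|t| <= `|s| & g c - g b = 'D_v f (a + t *: v) * (c - b).
  move=> bc Hbc.
  have [t tI E] : exists2 t, t \in `[b, c]%R & g c - g b = 'D_v f (a + t *: v) * (c - b).
    apply: (@MVT_segment R g (fun t => 'D_v f (a + t *: v))) => //.
      move=> t tI; apply: dg; apply: Hbc.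
      by move: tI; rewrite in_itv /= => /andP[/ltW -> /ltW ->].
    apply: derivable_within_continuous => t; rewrite in_itv /= => tI.
    by have [] := dg t (Hbc _ tI).
  by exists t => //; apply: Hbc; move: tI; rewrite in_itv.
have g0 : g 0 = f a by rewrite /g scale0r addr0.
case: (leP 0 s) => s0.
  have [|t ts E] := key 0 s s0.
    by move=> t /andP[t0 ts]; rewrite !ger0_norm.
  have [_ Ht] := H t ts.
  rewrite -g0 -/(g s) E subr0 [_ * s]mulrC -mulrBr normrM mulrC.
  by apply: ler_wpM2r.
have [|t ts E] := key s 0 (ltW s0).
  by move=> t /andP[st t0]; rewrite !ler0_norm ?lerN2 // ltW.
have [_ Ht] := H t ts.
have -> : f (a + s *: v) - f a - s * l = s * ('D_v f (a + t *: v) - l).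
  by have := E; rewrite g0 {1}/g => E'; lra.
by rewrite normrM mulrC; apply: ler_wpM2r.
Qed.

End Differentiability.

Section RowCalculus.
Context {R : realType}.

Lemma rV_norm_lt m (x : 'rV[R]_m) (e : R) : 0 < e ->
  (forall k, `|x 0 k| < e) -> `|x| < e.
Proof.
move=> e0 H; have : ball (0 : 'rV[R]_m) e x.
  split=> // i j; rewrite -ball_normE /= mxE sub0r normrN ord1; exact: H.
by rewrite -ball_normE /= sub0r normrN.
Qed.

Lemma rV_coord_le m (x : 'rV[R]_m) k : `|x 0 k| <= `|x|.
Proof.
rewrite [leRHS]/Num.Def.normr /= mx_normrE; apply/bigmax_geP; right => /=.
by exists (0, k).
Qed.

Lemma rV_norm_le m (x : 'rV[R]_m) (e : R) : 0 <= e ->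
  (forall k, `|x 0 k| <= e) -> `|x| <= e.
Proof.
move=> e0 H; apply/ler_addgt0Pr => d d0; apply/ltW/rV_norm_lt.
  by rewrite ltr_wpDl.
by move=> k; rewrite (le_lt_trans (H k)) // ltrDl.
Qed.

Lemma continuous_rVP m (T : topologicalType) (f : T -> 'rV[R]_m) x :
  {for x, continuous f} <-> forall k, {for x, continuous (fun y => f y 0 k)}.
Proof.
split=> [H k|H].
  apply: (@continuous_comp _ _ _ f (fun v : 'rV[R]_m => v 0 k)) => //.
  exact: coord_continuous.
apply/cvgrPdist_lt => e e0.
have H' k : \forall y \near x, `|f x 0 k - f y 0 k| < e.
  by move: (H k) => /cvgrPdist_lt /(_ _ e0).
have : \forall y \near x, forall k, `|f x 0 k - f y 0 k| < e.
  exact: near_forall.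
apply: filterS => y Hy; apply: rV_norm_lt => // k.
by rewrite !mxE.
Qed.

(** Vertices of the staircase path from 0 to h, whose edges are parallel to the axes. *)
Definition head_row m (h : 'rV[R]_m) (n : nat) : 'rV[R]_m :=
  \row_k (if (k < n)%N then h 0 k else 0).

(** The increment of f is telescoped along the staircase [head_row]; on each edge only one
    coordinate moves and [line_increment] applies. *)
Lemma C1_differentiable m (f : 'rV[R]_m -> R) (x : 'rV[R]_m) :
  (\forall y \near x, forall k, derivable f y (delta_mx 0 k)) ->
  (forall k, {for x, continuous (partial k f)}) ->
  differentiable f x.
Proof.
move=> Hd Hc.
pose L (h : 'rV[R]_m) : R := \sum_k h 0 k * partial k f x.
have Llin : linear L.
  move=> c u v; rewrite /L scaler_sumr -big_split /=; apply: eq_bigr => k _.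
  by rewrite !mxE mulrDl -mulrA.
pose LM := GRing.isLinear.Build _ _ _ _ _ Llin.
pose LL : {linear 'rV[R]_m -> R} := HB.pack L LM.
have cL : continuous LL.
  move=> u; rewrite /= /continuous_at /L.
  by apply: (@cvg_sumr R _ _ (nbhs u) _ _ (fun k h => h 0 k * partial k f x)) => k;
    apply: cvgM; [exact: coord_continuous|exact: cvg_cst].
apply: (@differentiable_remainder R _ _ f LL) => // e e0.
(* One share for each of the m edges; the added 1 keeps the denominator positive when m = 0. *)
pose e' := e / (m%:R + 1).
have m1 : 0 < m%:R + 1 :> R by rewrite ltr_wpDl.
have e'0 : 0 < e' by rewrite divr_gt0.
have Hc' : \forall y \near x, forall k, `|partial k f x - partial k f y| < e'.
  have H k : \forall y \near x, `|partial k f x - partial k f y| < e'.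
    by have /cvgrPdist_lt/(_ _ e'0) := Hc k.
  exact: near_forall.
have /nbhs_ballP[r /= r0 Hr] : \forall y \near x,
  (forall k, derivable f y (delta_mx 0 k)) /\
  forall k, `|partial k f x - partial k f y| < e' by apply: filterI.
apply/nbhs_ballP; exists r => //= y; rewrite -ball_normE /= => xy.
set h := y - x.
have hr : `|h| < r by rewrite /h distrC.
pose p n := head_row h n.
have p0 : x + p 0%N = x.
  by apply/rowP => k; rewrite !mxE ltn0 addr0.
have pm : x + p m = y.
  by apply/rowP => k; rewrite !mxE ltn_ord addrC subrK.
have pS (k : 'I_m) : x + p k.+1 = (x + p k) + h 0 k *: delta_mx 0 k.
  rewrite -addrA; congr (_ + _); apply/rowP => j; rewrite !mxE eqxx /=.
  rewrite ltnS leq_eqVlt -val_eqE /= eq_sym.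
  case: eqVneq => [/val_inj <-|kj] /=; first by rewrite ltnn add0r mulr1.
  by rewrite mulr0 addr0.
have step (k : 'I_m) :
    `|f (x + p k.+1) - f (x + p k) - h 0 k * partial k f x| <= e' * `|h|.
  rewrite pS; apply: (@le_trans _ _ (e' * `|h 0 k|)); last first.
    by rewrite ler_pM2l // rV_coord_le.
  apply: line_increment => t th.
  have [] : (forall j, derivable f (x + p k + t *: delta_mx 0 k) (delta_mx 0 j)) /\
    (forall j, `|partial j f x - partial j f (x + p k + t *: delta_mx 0 k)| < e').
    apply: Hr; rewrite -ball_normE /= -addrA opprD addNKr normrN.
    apply: (le_lt_trans _ hr); apply: rV_norm_le => // j; rewrite !mxE eqxx /=.
    case: eqVneq => [->|kj] /=.
      by rewrite ltnn mulr1 add0r (le_trans th) // rV_coord_le.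
    rewrite mulr0 addr0; case: ifP => _; last by rewrite normr0.
    by have := rV_coord_le h j; rewrite !mxE.
  by move=> /(_ k) d /(_ k) /ltW; rewrite distrC.
have -> : f y - f x - LL h =
   \sum_(k < m) (f (x + p k.+1) - f (x + p k) - h 0 k * partial k f x).
  rewrite big_split /= sumrN; congr (_ - _).
  rewrite -(big_mkord xpredT (fun k => f (x + p k.+1) - f (x + p k))).
  by rewrite telescope_sumr // pm p0.
apply: (le_trans (ler_norm_sum _ _ _)).
apply: (@le_trans _ _ (\sum_(k < m) e' * `|h|)).
  by apply: ler_sum => k _; apply: step.
rewrite sumr_const card_ord -mulr_natl mulrA; apply: ler_wpM2r => //.
rewrite /e' mulrCA -[leRHS]mulr1 ler_pM2l // ler_pdivrMr // mul1r lerDl //.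
Qed.

Lemma differentiable_rV m (V : normedModType R) (F : V -> 'rV[R]_m) x :
  (forall k, differentiable (fun y => F y 0 k) x) -> differentiable F x.
Proof.
move=> H.
have -> : F = \sum_(k < m) (fun y => F y 0 k *: (delta_mx 0 k : 'rV[R]_m)).
  by apply/funext => y; rewrite fct_sumE [LHS]row_sum_delta.
by apply: differentiable_sum => k; apply: differentiableZl.
Qed.

End RowCalculus.


Section Partials.
Context {R : realType}.

Lemma diff_partial m (f : 'rV[R]_m -> R) (x v : 'rV[R]_m) :
  differentiable f x -> 'd f x v = \sum_k v 0 k * partial k f x.
Proof.
move=> df; rewrite [in LHS](row_sum_delta v) linear_sum; apply: eq_bigr => k _.
by rewrite linearZ /partial deriveE.
Qed.

Lemma is_derive_comp_rV (V : normedModType R) m (T : V -> 'rV[R]_m)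
    (f : 'rV[R]_m -> R) (x v : V) :
  differentiable T x -> differentiable f (T x) ->
  is_derive x v (f \o T) (\sum_j 'D_v (fun y => T y 0 j) x * partial j f (T x)).
Proof.
move=> dT df; have dfT : differentiable (f \o T) x by exact: differentiable_comp.
split; first exact: diff_derivable.
rewrite deriveE // diff_comp //= diff_partial //.
apply: eq_bigr => j _; congr (_ * _).
by rewrite -deriveE // derive_mx ?mxE //; apply: diff_derivable.
Qed.

Lemma is_derive_comp1 (V : normedModType R) (phi : R -> R) (f : V -> R) (x v : V) :
  differentiable f x -> derivable phi (f x) 1 ->
  is_derive x v (phi \o f) (derive1 phi (f x) * 'D_v f x).
Proof.
move=> df /derivable1_diffP dphi.
have dfT : differentiable (phi \o f) x by exact: differentiable_comp.
split; first exact: diff_derivable.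
rewrite deriveE // diff_comp //= derive1E' // deriveE //.
by rewrite -[X in 'd phi _ X = _]mulr1 [LHS]linearZ mulrC.
Qed.

(** The second difference of f over a square of side s is symmetric in the two directions, and two
    nested mean value estimates show that it is s^2 times either mixed derivative up to o(s^2). *)
Lemma partial_comm m (i j : 'I_m) (f : 'rV[R]_m -> R) (x : 'rV[R]_m) :
  (\forall y \near x, [/\ forall k, derivable f y (delta_mx 0 k),
     forall k l, derivable (partial k f) y (delta_mx 0 l) &
     True]) ->
  (forall k l, {for x, continuous (partial k (partial l f))}) ->
  partial i (partial j f) x = partial j (partial i f) x.
Proof.
have key (i' j' : 'I_m) (e : R) : 0 < e ->
    (\forall y \near x, [/\ forall k, derivable f y (delta_mx 0 k),
     forall k l, derivable (partial k f) y (delta_mx 0 l) & True]) ->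
    (forall k l, {for x, continuous (partial k (partial l f))}) ->
    exists2 r : R, 0 < r & forall s : R, `|s| < r ->
      `|f (x + s *: delta_mx 0 j' + s *: delta_mx 0 i') - f (x + s *: delta_mx 0 i')
        - (f (x + s *: delta_mx 0 j') - f x)
        - s * (s * partial j' (partial i' f) x)| <= e * `|s| * `|s|.
  move=> e0 Hd Hc.
  have Hc' : \forall y \near x,
      `|partial j' (partial i' f) x - partial j' (partial i' f) y| < e.
    by have /cvgrPdist_lt/(_ _ e0) := Hc j' i'.
  have /nbhs_ballP[r /= r0 Hr] : \forall y \near x,
    [/\ forall k, derivable f y (delta_mx 0 k),
       forall k l, derivable (partial k f) y (delta_mx 0 l) & True] /\
    `|partial j' (partial i' f) x - partial j' (partial i' f) y| < e
    by apply: filterI.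
  (* Half the radius, because the two displacements add up when i' = j'. *)
  exists (r / 2) => [|s sr]; first by rewrite divr_gt0.
  have inball (a b : R) : `|a| <= `|s| -> `|b| <= `|s| ->
      ball x r (x + a *: delta_mx 0 i' + b *: delta_mx 0 j').
    move=> ha hb; rewrite -ball_normE /= -addrA opprD addNKr normrN.
    apply: (@le_lt_trans _ _ (`|s| + `|s|)); last by lra.
    apply: rV_norm_le => [|k]; first by rewrite addr_ge0.
    rewrite !mxE eqxx /=; apply: (le_trans (ler_normD _ _)); rewrite !normrM.
    by apply: lerD; rewrite -[leRHS]mulr1; apply: ler_pM => //; case: eqP;
      rewrite ?normr1 ?normr0.
  pose g y := f (y + s *: delta_mx 0 j') - f y.
  have -> : f (x + s *: delta_mx 0 j' + s *: delta_mx 0 i') - f (x + s *: delta_mx 0 i')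
        - (f (x + s *: delta_mx 0 j') - f x) = g (x + s *: delta_mx 0 i') - g x.
    by rewrite /g (addrAC x).
  apply: line_increment => t ts.
  have b0 := inball t 0 ts; rewrite scale0r addr0 normr0 in b0.
  have [[d0 _ _] _] := Hr _ (b0 (normr_ge0 _)).
  have [[d1 _ _] _] := Hr _ (inball t s ts (lexx _)).
  have dsh : is_derive (x + t *: delta_mx 0 i') (delta_mx 0 i')
      (fun y => f (y + s *: delta_mx 0 j'))
      (partial i' f (x + t *: delta_mx 0 i' + s *: delta_mx 0 j')).
    have E : (fun h : R => h^-1 *: (((fun y => f (y + s *: delta_mx 0 j')) \o shift (x + t *: delta_mx 0 i'))
        (h *: delta_mx 0 i') - f (x + t *: delta_mx 0 i' + s *: delta_mx 0 j')))
      = (fun h : R => h^-1 *: ((f \o shift (x + t *: delta_mx 0 i' + s *: delta_mx 0 j'))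
          (h *: delta_mx 0 i') - f (x + t *: delta_mx 0 i' + s *: delta_mx 0 j'))).
      by apply/funext => h /=; rewrite -!addrA.
    by split; [rewrite /derivable E; exact: d1|rewrite /derive E].
  have dg : is_derive (x + t *: delta_mx 0 i') (delta_mx 0 i') g
     (partial i' f (x + t *: delta_mx 0 i' + s *: delta_mx 0 j')
      - partial i' f (x + t *: delta_mx 0 i')).
    by apply: is_deriveB => //; apply: derivableP; exact: d0.
  split; first exact: ex_derive.
  rewrite (is_deriveE dg); apply: line_increment => t' ts'.
  have [[_ d2 _] /ltW d3] := Hr _ (inball t t' ts ts').
  by split; [exact: d2|rewrite distrC].
move=> Hd Hc.
apply/eqP; rewrite -subr_eq0 -normr_le0; apply/ler_addgt0Pr => e e0.
have e2 : 0 < e / 2 by rewrite divr_gt0.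
have [r1 r10 H1] := key i j (e / 2) e2 Hd Hc.
have [r2 r20 H2] := key j i (e / 2) e2 Hd Hc.
pose s : R := Num.min r1 r2 / 2.
have m0 : 0 < Num.min r1 r2 by rewrite lt_min r10.
have s0 : 0 < s by rewrite divr_gt0.
have sm : s < Num.min r1 r2 by rewrite /s; lra.
have ss : `|s| = s by rewrite gtr0_norm.
have := H1 s; have := H2 s; rewrite ss.
move: sm; rewrite lt_min => /andP[-> ->] /(_ isT) + /(_ isT).
rewrite [x + s *: delta_mx 0 i + s *: delta_mx 0 j]addrAC.
set D : R := f (_ + _ + _); set D1 : R := f (_ + _); set D2 : R := f (_ + _).
set p : R := partial j _ _; set q : R := partial i _ _ => h1 h2.
rewrite add0r -(ler_pM2l s0) -(ler_pM2l s0).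
have <- : `|s * (s * (q - p))| = s * (s * `|q - p|) by rewrite (normrM s) (normrM s) (gtr0_norm s0).
have -> : s * (s * (q - p)) = (D - D2 - (D1 - f x) - s * (s * p)) - (D - D1 - (D2 - f x) - s * (s * q)) by ring.
apply: (le_trans (ler_normB _ _)).
apply: (le_trans (lerD h2 h1)).
by rewrite le_eqVlt; apply/orP; left; apply/eqP; field.
Qed.

End Partials.

(** * Classes C^n and their closure properties *)

Section Regularity.
Context {R : realType} {m : nat}.
Implicit Types (U : set 'rV[R]_m) (f g : 'rV[R]_m -> R).

(** A graded, recursive form of smoothness: closure under products and compositions is proved by
    induction on n, where the derivative loses one degree. *)
Fixpoint Cn n U f : Prop :=
  match n with
  | 0 => forall x, U x -> {for x, continuous f}
  | n'.+1 => (forall x, U x -> {for x, continuous f} /\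
                forall k, derivable f x (delta_mx 0 k)) /\
             forall k, Cn n' U (partial k f)
  end.

(** The derivative taken first stands at the end of the list, so lists are peeled off from the right
    to match the recursion of [Cn]. *)
Lemma smooth_onP U f : smooth_on U f <-> forall n, Cn n U f.
Proof.
split=> [H n|H].
  elim: n f H => [|n IH] f H /=; first by move=> x Ux; have [] := H [::] x Ux.
  split=> [x Ux|k]; first exact: (H [::] x Ux).
  apply: IH => s x Ux; have := H (rcons s k) x Ux.
  by rewrite foldr_rcons.
move=> s; elim/last_ind: s f H => [|s k IH] f H.
  by move=> x Ux /=; have [/(_ x Ux)[? ?] _] := H 1%N.
move=> x Ux; rewrite foldr_rcons; apply: IH => // n.
by have [_] := H n.+1; exact.
Qed.

Lemma CnW n U f : Cn n.+1 U f -> Cn n U f.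
Proof.
elim: n f => [|n IH] f [H1 H2]; first by move=> x Ux; have [] := H1 x Ux.
by split=> // k; apply: IH; exact: H2.
Qed.

Lemma Cn0 n U f : Cn n U f -> forall x, U x -> {for x, continuous f}.
Proof. by case: n => [|n] //= [H _] x /H[]. Qed.

Variable U : set 'rV[R]_m.
Hypothesis openU : open U.

Lemma partial_eq_on f g : (forall x, U x -> f x = g x) ->
  forall k x, U x -> partial k f x = partial k g x.
Proof.
move=> fg k x Ux; apply: near_eq_derive; near=> y; apply: fg.
by near: y; exact: open_nbhs_nbhs.
Unshelve. all: by end_near. Qed.

Lemma Cn_eq n f g : (forall x, U x -> f x = g x) -> Cn n U f -> Cn n U g.
Proof.
elim: n f g => [|n IH] f g fg /=.
  move=> H x Ux; apply: continuous_at_eq (H x Ux); near=> y; apply: fg.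
  by near: y; exact: open_nbhs_nbhs.
move=> [H1 H2]; split=> [x Ux|k].
  have [c d] := H1 x Ux; split.
    apply: continuous_at_eq c; near=> y; apply: fg.
    by near: y; exact: open_nbhs_nbhs.
  move=> k; apply: near_eq_derivable (d k); near=> y; apply: fg.
  by near: y; exact: open_nbhs_nbhs.
by apply: IH (H2 k) => x Ux; apply: partial_eq_on.
Unshelve. all: by end_near. Qed.

Lemma C1_diff n f x : Cn n.+1 U f -> U x -> differentiable f x.
Proof.
move=> [H1 H2] Ux; apply: C1_differentiable.
  have : \forall y \near x, U y by exact: open_nbhs_nbhs.
  by apply: filterS => y /H1[].
by move=> k; apply: Cn0 (H2 k) _ Ux.
Qed.

Lemma Cn_cst n (c : R) : Cn n U (cst c).
Proof.
elim: n c => [|n IH] c /=; first by move=> x _; exact: cst_continuous.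
split=> [x _|k]; first by split; [exact: cst_continuous|move=> k; exact: derivable_cst].
by apply: (@Cn_eq _ (cst 0)) => // x _; rewrite /partial derive_cst.
Qed.

Lemma CnD n f g : Cn n U f -> Cn n U g -> Cn n U (fun x => f x + g x).
Proof.
elim: n f g => [|n IH] f g /=.
  by move=> Hf Hg x Ux; apply: continuousD; [exact: Hf|exact: Hg].
move=> [Hf1 Hf2] [Hg1 Hg2]; split=> [x Ux|k].
  have [? df] := Hf1 x Ux; have [? dg] := Hg1 x Ux.
  by split=> [|k]; [exact: continuousD|exact: derivableD].
apply: Cn_eq (IH _ _ (Hf2 k) (Hg2 k)) => x Ux.
have [? df] := Hf1 x Ux; have [? dg] := Hg1 x Ux.
by rewrite /partial -deriveD.
Qed.

Lemma CnM n f g : Cn n U f -> Cn n U g -> Cn n U (fun x => f x * g x).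
Proof.
elim: n f g => [|n IH] f g Hf Hg /=.
  by move=> x Ux; apply: continuousM; [exact: Hf|exact: Hg].
have [[Hf1 Hf2] [Hg1 Hg2]] := (Hf, Hg); split=> [x Ux|k].
  have [? df] := Hf1 x Ux; have [? dg] := Hg1 x Ux.
  by split=> [|k]; [exact: continuousM|exact: derivableM].
have fn := CnW Hf; have gn := CnW Hg.
apply: Cn_eq (CnD (IH _ _ fn (Hg2 k)) (IH _ _ gn (Hf2 k))) => x Ux.
have [? df] := Hf1 x Ux; have [? dg] := Hg1 x Ux.
by rewrite /partial (deriveM (df k) (dg k)).
Qed.

Lemma Cn_sum n I (r : seq I) (F : I -> 'rV[R]_m -> R) :
  (forall i, Cn n U (F i)) -> Cn n U (fun x => \sum_(i <- r) F i x).
Proof.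
move=> H; elim: r => [|i r IH].
  by apply: Cn_eq (Cn_cst n 0) => x _; rewrite big_nil.
by apply: Cn_eq (CnD (H i) IH) => x _; rewrite big_cons.
Qed.

End Regularity.

Section Composition.
Context {R : realType}.

Fixpoint Cn1 n (D : set R) (phi : R -> R) : Prop :=
  match n with
  | 0 => forall t, D t -> {for t, continuous phi}
  | n'.+1 => (forall t, D t -> derivable phi t 1) /\ Cn1 n' D (derive1 phi)
  end.

Lemma Cn1_eq n (D : set R) phi psi : open D -> (forall t, D t -> phi t = psi t) ->
  Cn1 n D phi -> Cn1 n D psi.
Proof.
move=> oD; elim: n phi psi => [|n IH] phi psi E /=.
  move=> H t Dt; apply: continuous_at_eq (H t Dt); near=> y; apply: E.
  by near: y; exact: open_nbhs_nbhs.
move=> [H1 H2]; split=> [t Dt|].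
  apply: near_eq_derivable (H1 t Dt); near=> y; apply: E.
  by near: y; exact: open_nbhs_nbhs.
apply: IH H2 => t Dt; rewrite !derive1E; apply: near_eq_derive; near=> y; apply: E.
by near: y; exact: open_nbhs_nbhs.
Unshelve. all: by end_near. Qed.

Lemma Cn_comp1 n m (U : set 'rV[R]_m) (D : set R) (phi : R -> R) f :
  open U -> (forall x, U x -> D (f x)) -> Cn1 n D phi -> Cn n U f ->
  Cn n U (phi \o f).
Proof.
move=> oU; elim: n phi => [|n IH] phi UD Hp Hf.
  by move=> x Ux; apply: continuous_comp; [exact: Hf|exact/Hp/UD].
have [Hp1 Hp2] := Hp; have [Hf1 Hf2] := Hf.
have dc x k : U x -> is_derive x (delta_mx 0 k) (phi \o f)
    (derive1 phi (f x) * partial k f x).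
  by move=> Ux; apply: is_derive_comp1; [exact: (C1_diff oU Hf Ux)|exact/Hp1/UD].
split=> [x Ux|k].
  split; last by move=> k; have [] := dc x k Ux.
  apply: continuous_comp; first by have [] := Hf1 x Ux.
  by apply/differentiable_continuous/derivable1_diffP/Hp1/UD.
apply: (Cn_eq oU) (CnM oU (IH _ UD Hp2 (CnW Hf)) (Hf2 k)) => x Ux /=.
by rewrite /partial (is_deriveE (dc x k Ux)).
Qed.

Lemma Cn_comp n m p (U : set 'rV[R]_m) (V : set 'rV[R]_p)
    (T : 'rV[R]_m -> 'rV[R]_p) f :
  open U -> open V -> (forall x, U x -> V (T x)) ->
  (forall j, Cn n U (fun x => T x 0 j)) -> Cn n V f -> Cn n U (f \o T).
Proof.
move=> oU oV UV; elim: n f => [|n IH] f HT Hf.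
  move=> x Ux; apply: continuous_comp; last exact/Hf/UV.
  by apply/continuous_rVP => j; exact: HT.
have [Hf1 Hf2] := Hf.
have dT x : U x -> differentiable T x.
  by move=> Ux; apply: differentiable_rV => j; exact: (C1_diff oU (HT j) Ux).
have dc x k : U x -> is_derive x (delta_mx 0 k) (f \o T)
    (\sum_j partial k (fun y => T y 0 j) x * partial j f (T x)).
  by move=> Ux; apply: is_derive_comp_rV; [exact: dT|exact: (C1_diff oV Hf (UV _ Ux))].
split=> [x Ux|k].
  split; last by move=> k; have [] := dc x k Ux.
  apply: continuous_comp; first exact/differentiable_continuous/dT.
  by have [] := Hf1 _ (UV x Ux).
have H : Cn n U (fun x => \sum_j partial k (fun y => T y 0 j) x * (partial j f \o T) x).
  apply: Cn_sum => // j; apply: CnM => //; first by have [_] := HT j; exact.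
  by apply: IH => [i|]; [exact: CnW|exact: Hf2].
by apply: (Cn_eq oU) H => x Ux; rewrite /partial (is_deriveE (dc x k Ux)).
Qed.

End Composition.


(** * Smooth functions of one variable and flat functions *)

Section SmoothRealFunctions.
Context {R : realType}.

Definition smooth1 (D : set R) (phi : R -> R) := forall n, Cn1 n D phi.

(* Membership in a family stable under differentiation, so that every iterated
   derivative is again in the family. *)
Lemma smooth1_family (D : set R) (S : set (R -> R)) : open D ->
  (forall phi, S phi -> exists2 psi, S psi &
     forall t, D t -> is_derive t 1 phi (psi t)) ->
  forall phi, S phi -> smooth1 D phi.
Proof.
move=> oD H phi Sphi n; elim: n phi Sphi => [|n IH] phi Sphi.
  have [psi _ d] := H phi Sphi; move=> t Dt.
  by apply/differentiable_continuous/derivable1_diffP; have [] := d t Dt.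
have [psi Spsi d] := H phi Sphi; split.
  by move=> t Dt; have [] := d t Dt.
by apply: Cn1_eq (IH psi Spsi) => // t Dt; rewrite derive1E (is_deriveE (d t Dt)).
Qed.

Lemma smooth1_expR : smooth1 setT (@expR R).
Proof.
apply: (@smooth1_family setT [set @expR R]) => //; first exact: openT.
by move=> _ ->; exists expR => // t _; exact: is_derive_expR.
Qed.

Definition pos_set : set R := [set t | 0 < t].

Lemma open_pos_set : open pos_set.
Proof. exact: open_gt. Qed.

Lemma is_derive_comp_real (f g : R -> R) (t df dg : R) :
  is_derive t 1 f df -> is_derive (f t) 1 g dg -> is_derive t 1 (g \o f) (dg * df).
Proof.
move=> f' g'; have [f1 g1] : derivable f t 1 /\ derivable g (f t) 1.
  by split; [case: f'|case: g'].
split.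
  apply/derivable1_diffP; apply: differentiable_comp; apply/derivable1_diffP.
    exact: f1.
  exact: g1.
rewrite -derive1E derive1_comp; [|exact: f1|exact: g1].
by rewrite !derive1E (is_deriveE f') (is_deriveE g').
Qed.

Lemma is_derive_inv (t : R) : t != 0 -> is_derive t 1 (fun y : R => y^-1) (- t ^- 2).
Proof.
move=> t0; split; first exact: derivableV.
by rewrite (@deriveV _ _ id) // derive_id scaleNr [_ *: _]mulr1.
Qed.

Lemma smooth1_inv : smooth1 pos_set (fun t => t^-1).
Proof.
(* The multiples of the powers of 1 / t form a family stable under derivation. *)
pose S : set (R -> R) := [set phi | exists (c : R) k, phi = fun t => c * t^-1 ^+ k].
have : S (fun t => t^-1).
  by exists 1, 1%N; apply/funext => t; rewrite mul1r expr1.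
apply: smooth1_family; first exact: open_pos_set.
move=> _ [c [k ->]]; exists (fun t => (- c * k%:R) * t^-1 ^+ k.+1).
  by exists (- c * k%:R), k.+1.
move=> t t0; have tn : t != 0 by rewrite gt_eqF.
have d := is_derive_inv tn.
have -> : (fun y : R => c * y^-1 ^+ k) = horner (c *: 'X^k) \o (fun y : R => y^-1).
  by apply/funext => y; rewrite /= !hornerE.
have d' := is_derive_comp_real d (is_derive_poly (c *: 'X^k) t^-1).
apply: is_derive_eq d' _; rewrite derivZ derivXn !hornerE hornerMn hornerXn.
rewrite -mulr_natl -exprVn; case: k => [|k]; first by rewrite !(mulr0, mul0r).
by rewrite !exprS; ring.
Qed.

Lemma smooth1_ln : smooth1 pos_set (@ln R).
Proof.
have dl t : pos_set t -> is_derive t 1 (@ln R) t^-1 by move=> /is_derive1_ln.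
case=> [|n].
  by move=> t t0; apply: continuous_ln.
split; first by move=> t /dl[].
apply: Cn1_eq (@smooth1_inv n); first exact: open_pos_set.
by move=> t /dl d; rewrite derive1E (is_deriveE d).
Qed.

(* P(1/t) e^(-1/t) for t > 0 and 0 for t <= 0 *)
Definition flat (P : {poly R}) (t : R) : R :=
  if 0 < t then P.[t^-1] * expR (- t^-1) else 0.

Lemma exprn_le_expR (x : R) n : 0 <= x -> x ^+ n <= n`!%:R * expR x.
Proof.
move=> x0; case: n => [|n].
  by rewrite expr0 mul1r; have := expR_ge1Dx x; lra.
have f0 : 0 < (n.+1)`!%:R :> R by rewrite ltr0n fact_gt0.
rewrite mulrC -ler_pdivrMr //; apply: le_trans (expR_ge1Dxn n x0).
by rewrite lerDr.
Qed.

Lemma horner_expR_bounded (P : {poly R}) :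
  exists2 C : R, 0 <= C & forall x, 0 <= x -> `|P.[x] * expR (- x)| <= C.
Proof.
exists (\sum_(i < size P) `|P`_i| * i`!%:R).
  by apply: sumr_ge0 => i _; rewrite mulr_ge0.
move=> x x0; rewrite horner_coef mulr_suml.
apply: (le_trans (ler_norm_sum _ _ _)); apply: ler_sum => i _.
rewrite -mulrA normrM; apply: ler_wpM2l => //.
rewrite normrM (ger0_norm (expR_ge0 _)) ger0_norm ?exprn_ge0 //.
by rewrite expRN ler_pdivrMr ?expR_gt0 //; exact: exprn_le_expR.
Qed.

(** The polynomial X^2 P times the exponential is bounded at 1 / t. Quadratic decay at 0 gives the
    derivative 0 there. *)
Lemma flat_quadratic (P : {poly R}) :
  exists2 C : R, 0 <= C & forall t, `|flat P t| <= C * t ^+ 2.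
Proof.
have [C C0 H] := horner_expR_bounded ('X^2 * P).
exists C => // t; rewrite /flat; case: ifPn => t0; last first.
  by rewrite normr0 mulr_ge0 // sqr_ge0.
have := H t^-1; rewrite invr_ge0 (ltW t0) => /(_ isT).
rewrite hornerM hornerXn -mulrA normrM (ger0_norm (sqr_ge0 _)) exprVn.
by rewrite ler_pdivrMl ?exprn_gt0 // [C * _]mulrC.
Qed.

(** The derivative of P(1/t) e^(-1/t) is t^-2 (P - P')(1/t) e^(-1/t), of the same shape, so the
    functions [flat P] form a family stable under derivation, including at 0. *)
Lemma is_derive_flat (P : {poly R}) (t : R) :
  is_derive t 1 (flat P) (flat ('X^2 * (P - P^`())) t).
Proof.
have [t0|t0|t0] := ltgtP t 0.
- have -> : flat ('X^2 * (P - P^`())) t = 0 by rewrite /flat ltNge ltW.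
  apply: (@near_eq_is_derive R R R (cst 0) (flat P)).
  near=> s; rewrite /flat ltNge ltW //; near: s.
  by apply: open_nbhs_nbhs; split; [exact: open_lt|].
- have tn : t != 0 by rewrite gt_eqF.
  have d := is_derive_inv tn.
  have dP := is_derive_comp_real d (is_derive_poly P t^-1).
  have dN : is_derive t 1 (fun y : R => - y^-1) (t ^- 2).
    by rewrite -[t ^- 2]opprK; exact: is_deriveN.
  have dE := is_derive_comp_real dN (is_derive_expR (- t^-1)).
  apply: (@near_eq_is_derive R R R ((horner P \o (fun y : R => y^-1)) * (expR \o (fun y : R => - y^-1)))).
    near=> s; rewrite /flat ifT //; near: s.
    by apply: open_nbhs_nbhs; split; [exact: open_gt|].
  apply: is_derive_eq (is_deriveM dP dE) _.
  rewrite /flat t0 hornerM hornerXn hornerD hornerN -exprVn.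
  change (P.[t^-1] * (expR (- t^-1) * t^-1 ^+ 2) + expR (- t^-1) * (P^`().[t^-1] * - t^-1 ^+ 2)
    = t^-1 ^+ 2 * (P.[t^-1] - P^`().[t^-1]) * expR (- t^-1)).
  by ring.
rewrite t0 [X in is_derive _ _ _ X](_ : _ = 0); last by rewrite /flat ltxx.
have [C C0 H] := flat_quadratic P.
have f0 : flat P 0 = 0 by rewrite /flat ltxx.
have lim0 : h^-1 *: ((flat P \o shift 0) (h *: 1) - flat P 0) @[h --> 0^'] --> (0 : R).
  apply/cvgrPdist_le => e e0; near=> h.
  have h0 : h != 0 by near: h; exact: nbhs_dnbhs_neq.
  rewrite f0 subr0 sub0r normrN /= addr0 [h *: 1]mulr1 normrM normfV.
  rewrite ler_pdivrMl ?normr_gt0 //; apply: (le_trans (H h)).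
  rewrite -real_normK ?num_real // expr2 mulrCA ler_pM2l ?normr_gt0 //.
  have hC : `|h| <= e / (C + 1).
    near: h; apply: dnbhs0_le; rewrite divr_gt0 // ltr_wpDl //.
  rewrite ler_pdivlMr ?ltr_wpDl // in hC; apply: le_trans hC.
  by rewrite mulrC ler_wpM2l // lerDl.
by split; [apply/cvg_ex; exists 0|exact: cvg_lim].
Unshelve. all: by end_near. Qed.

End SmoothRealFunctions.


(* Equivalent to [smooth_on] for scalar functions. *)
Record smooth {R : realType} {m : nat} (U : set 'rV[R]_m) (f : 'rV[R]_m -> R) : Prop :=
  Smooth { smoothP : forall n, Cn n U f }.

Section SmoothFunctions.
Context {R : realType} {m : nat}.
Variable U : set 'rV[R]_m.
Hypothesis oU : open U.
Implicit Types f g : 'rV[R]_m -> R.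

Lemma smooth_on_smooth f : smooth_on U f <-> smooth U f.
Proof. by split=> [/smooth_onP|[]] H; [split|apply/smooth_onP]. Qed.

Lemma smooth_ext f g : (forall x, U x -> f x = g x) -> smooth U f -> smooth U g.
Proof. by move=> fg [H]; split=> n; exact: Cn_eq (H n). Qed.

Lemma smooth_cst (c : R) : smooth U (fun=> c).
Proof. by split=> n; exact: Cn_cst. Qed.

Lemma smoothD f g : smooth U f -> smooth U g -> smooth U (fun x => f x + g x).
Proof. by move=> [Hf] [Hg]; split=> n; exact: CnD. Qed.

Lemma smoothM f g : smooth U f -> smooth U g -> smooth U (fun x => f x * g x).
Proof. by move=> [Hf] [Hg]; split=> n; exact: CnM. Qed.

Lemma smoothN f : smooth U f -> smooth U (fun x => - f x).
Proof.
by move=> H; apply: smooth_ext (smoothM (smooth_cst (-1)) H) => x _; rewrite mulN1r.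
Qed.

Lemma smoothB f g : smooth U f -> smooth U g -> smooth U (fun x => f x - g x).
Proof. by move=> Hf Hg; exact: smoothD Hf (smoothN Hg). Qed.

Lemma smooth_sum I (r : seq I) (F : I -> 'rV[R]_m -> R) :
  (forall i, smooth U (F i)) -> smooth U (fun x => \sum_(i <- r) F i x).
Proof.
by move=> H; split=> n; apply: Cn_sum => // i; have [] := H i.
Qed.

Lemma smooth_prod I (r : seq I) (F : I -> 'rV[R]_m -> R) :
  (forall i, smooth U (F i)) -> smooth U (fun x => \prod_(i <- r) F i x).
Proof.
move=> H; elim: r => [|i r IH].
  by apply: smooth_ext (smooth_cst 1) => x _; rewrite big_nil.
by apply: smooth_ext (smoothM (H i) IH) => x _; rewrite big_cons.
Qed.

Lemma smooth_partial f k : smooth U f -> smooth U (partial k f).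
Proof.
by move=> [H]; split=> n; have [_] := H n.+1; exact.
Qed.

Lemma smooth_continuous f x : smooth U f -> U x -> {for x, continuous f}.
Proof. by move=> [H] Ux; exact: Cn0 (H 0%N) _ Ux. Qed.

Lemma smooth_derivable f x k : smooth U f -> U x -> derivable f x (delta_mx 0 k).
Proof. by move=> [H] Ux; have [/(_ x Ux)[_]] := H 1%N; exact. Qed.

Lemma smooth_diff f x : smooth U f -> U x -> differentiable f x.
Proof. by move=> [H] Ux; exact: (C1_diff oU (H 1%N)). Qed.

Lemma smooth_partial_comm f i j x : smooth U f -> U x ->
  partial i (partial j f) x = partial j (partial i f) x.
Proof.
move=> H Ux; apply: partial_comm.
  have : \forall y \near x, U y by exact: open_nbhs_nbhs.
  apply: filterS => y Uy; split; [move=> k|move=> k l|by []].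
    exact: smooth_derivable H Uy.
  exact: smooth_derivable (smooth_partial _ H) Uy.
by move=> k l; exact: smooth_continuous (smooth_partial _ (smooth_partial _ H)) Ux.
Qed.

Lemma smooth_comp1 (D : set R) phi f : smooth1 D phi ->
  (forall x, U x -> D (f x)) -> smooth U f -> smooth U (fun x => phi (f x)).
Proof.
move=> Hp HD [Hf]; split=> n.
exact: (Cn_comp1 oU HD (Hp n) (Hf n)).
Qed.

Lemma smooth_comp p (V : set 'rV[R]_p) (T : 'rV[R]_m -> 'rV[R]_p) (f : 'rV[R]_p -> R) :
  open V -> (forall x, U x -> V (T x)) ->
  (forall j, smooth U (fun x => T x 0 j)) -> smooth V f ->
  smooth U (fun x => f (T x)).
Proof.
move=> oV UV HT [Hf]; split=> n.
by apply: (Cn_comp oU oV UV _ (Hf n)) => j; have [] := HT j.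
Qed.

Lemma smooth_inv f : (forall x, U x -> 0 < f x) -> smooth U f ->
  smooth U (fun x => (f x)^-1).
Proof. exact: smooth_comp1 smooth1_inv. Qed.

Lemma smooth_sqrt f : (forall x, U x -> 0 < f x) -> smooth U f ->
  smooth U (fun x => Num.sqrt (f x)).
Proof.
move=> f0 Hf.
have H : smooth U (fun x => expR (2^-1 * ln (f x))).
  apply: (smooth_comp1 smooth1_expR) => //.
  exact: smoothM (smooth_cst _) (smooth_comp1 smooth1_ln f0 Hf).
apply: smooth_ext H => x /f0 fx.
by rewrite -powR12_sqrt ?ltW // /powR gt_eqF.
Qed.

Lemma smooth_flat (P : {poly R}) f : smooth U f ->
  smooth U (fun x => flat P (f x)).
Proof.
apply: (@smooth_comp1 setT) => //.
apply: (@smooth1_family _ setT [set phi | exists P, phi = flat P]) => //.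
- exact: openT.
- move=> _ [Q ->]; exists (flat ('X^2 * (Q - Q^`()))); first by eexists.
  by move=> t _; exact: is_derive_flat.
- by exists P.
Qed.

Lemma smooth_coord (k : 'I_m) : smooth U (fun x => x 0 k).
Proof.
split=> -[|n].
  by move=> x _; exact: coord_continuous.
have d x l : is_derive x (delta_mx 0 l) (fun x : 'rV[R]_m => x 0 k) ((delta_mx 0 l : 'rV[R]_m) 0 k).
  have dc := differentiable_coord x 0 k.
  split; first exact: diff_derivable.
  rewrite deriveE //.
  pose f (y : 'rV[R]_m) : R := y 0 k.
  have lf : linear f by move=> c u v; rewrite /f !mxE.
  pose LM := GRing.isLinear.Build _ _ _ _ _ lf.
  pose LL : {linear 'rV[R]_m -> R} := HB.pack f LM.
  have -> : (fun x : 'rV[R]_m => x 0 k) = LL by [].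
  have cL : continuous LL by move=> y; exact: (@coord_continuous R 1 m 0 k).
  rewrite (diff_lin x cL); exact: erefl.
split=> [x _|l].
  split; first exact: coord_continuous.
  by move=> l; have [] := d x l.
apply: (Cn_eq oU) (Cn_cst oU n ((delta_mx 0 l : 'rV[R]_m) 0 k)) => x _.
by rewrite /partial (is_deriveE (d x l)).
Qed.

Lemma partialM f g k x : smooth U f -> smooth U g -> U x ->
  partial k (fun y => f y * g y) x = f x * partial k g x + g x * partial k f x.
Proof.
move=> Hf Hg Ux; rewrite /partial.
by rewrite (deriveM (smooth_derivable Hf Ux) (smooth_derivable Hg Ux)).
Qed.

Lemma partialD f g k x : smooth U f -> smooth U g -> U x ->
  partial k (fun y => f y + g y) x = partial k f x + partial k g x.
Proof.
move=> Hf Hg Ux; rewrite /partial.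
by rewrite (deriveD (smooth_derivable Hf Ux) (smooth_derivable Hg Ux)).
Qed.

Lemma partial_cst (c : R) k (x : 'rV[R]_m) : partial k (fun=> c) x = 0.
Proof. exact: derive_cst. Qed.

Lemma partial_sum I (r : seq I) (F : I -> 'rV[R]_m -> R) k x :
  (forall i, smooth U (F i)) -> U x ->
  partial k (fun y => \sum_(i <- r) F i y) x = \sum_(i <- r) partial k (F i) x.
Proof.
move=> H Ux; elim: r => [|i r IH].
  rewrite big_nil; transitivity (partial k (fun=> 0 : R) x).
    by apply: (partial_eq_on oU) => // y _; rewrite big_nil.
  exact: partial_cst.
rewrite big_cons -IH -partialD //; last exact: smooth_sum.
by apply: (partial_eq_on oU) => // y _; rewrite big_cons.
Qed.

Lemma partial_comp1 (phi : R -> R) (dphi : R) f k x : smooth U f -> U x ->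
  is_derive (f x) 1 phi dphi -> partial k (fun y => phi (f y)) x = dphi * partial k f x.
Proof.
move=> Hf Ux d; have d1 : derivable phi (f x) 1 by case: d.
have := is_derive_comp1 (delta_mx 0 k) (smooth_diff Hf Ux) d1.
by move=> /is_deriveE; rewrite derive1E (is_deriveE d).
Qed.

Lemma partial_comp p (V : set 'rV[R]_p) (T : 'rV[R]_m -> 'rV[R]_p) (f : 'rV[R]_p -> R) k x :
  open V -> smooth V f -> (forall j, smooth U (fun x => T x 0 j)) ->
  U x -> V (T x) ->
  partial k (fun y => f (T y)) x = \sum_j partial k (fun y => T y 0 j) x * partial j f (T x).
Proof.
move=> oV Hf HT Ux VT; apply: (@is_deriveE R); apply: is_derive_comp_rV.
  by apply: differentiable_rV => j; exact: smooth_diff.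
by have [Hn] := Hf; exact: (C1_diff oV (Hn 1%N)).
Qed.

End SmoothFunctions.

Lemma smooth_glue {R : realType} {m} (U : set 'rV[R]_m) (f : 'rV[R]_m -> R) :
  (forall x, U x -> exists V g, [/\ open V, V x, smooth V g &
     forall y, V y -> g y = f y]) -> smooth U f.
Proof.
move=> H; apply/smooth_on_smooth => s x Ux; have [V [g [oV Vx Hg E]]] := H x Ux.
have /smooth_on_smooth Hf := smooth_ext oV E Hg; exact: (Hf s x Vx).
Qed.

(** * Calculus of matrix-valued functions *)

Section MatrixCalculus.
Context {R : realType} {m : nat}.

Definition smooth_mx {p q} (U : set 'rV[R]_m) (B : 'rV[R]_m -> 'M[R]_(p, q)) :=
  forall i j, smooth U (fun y => B y i j).

Definition pmx {p q} (k : 'I_m) (B : 'rV[R]_m -> 'M[R]_(p, q)) (y : 'rV[R]_m) :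
  'M[R]_(p, q) := \matrix_(i, j) partial k (fun z => B z i j) y.

Lemma pmxE {p q} k (B : 'rV[R]_m -> 'M[R]_(p, q)) y i j :
  pmx k B y i j = partial k (fun z => B z i j) y.
Proof. by rewrite mxE. Qed.

Variable U : set 'rV[R]_m.
Hypothesis oU : open U.

Lemma smooth_on_mx {p q} (B : 'rV[R]_m -> 'M[R]_(p, q)) :
  smooth_on U B -> smooth_mx U B.
Proof.
move=> H i j; apply/smooth_on_smooth.
have E s : forall x, U x -> foldr (fun k f => partial k f) B s x i j =
    foldr (fun k f => partial k f) (fun y => B y i j) s x.
  elim: s => [//|k s IH] x Ux /=.
  have [_ /(_ k) d] := H s x Ux.
  rewrite {1}/partial (derive_mx d) mxE; exact: (partial_eq_on oU IH).
move=> s x Ux /=; have [c d] := H s x Ux; split.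
  have nE : {near x, (fun y => foldr (fun k f => partial k f) B s y i j) =1
      foldr (fun k f => partial k f) (fun y => B y i j) s}.
    near=> y; apply: E; near: y; exact: open_nbhs_nbhs.
  apply: continuous_at_eq nE _.
  by apply: (@continuous_comp _ _ _ _ (fun N : 'M[R]_(p, q) => N i j)) => //;
    exact: coord_continuous.
move=> k; have /derivable_mxP/(_ i j) := d k.
apply: near_eq_derivable; near=> y; apply: E; near: y; exact: open_nbhs_nbhs.
Unshelve. all: by end_near. Qed.

Lemma smooth_mx_ext {p q} (B C : 'rV[R]_m -> 'M[R]_(p, q)) :
  (forall y, U y -> B y = C y) -> smooth_mx U B -> smooth_mx U C.
Proof. by move=> E H i j; apply: smooth_ext (H i j) => // y /E ->. Qed.

Lemma smooth_mx_cst {p q} (B : 'M[R]_(p, q)) : smooth_mx U (fun=> B).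
Proof. by move=> i j; exact: smooth_cst. Qed.

Lemma smooth_mxD {p q} (B C : 'rV[R]_m -> 'M[R]_(p, q)) :
  smooth_mx U B -> smooth_mx U C -> smooth_mx U (fun y => B y + C y).
Proof.
by move=> HB HC i j; apply: smooth_ext (smoothD oU (HB i j) (HC i j)) => // y _; rewrite mxE.
Qed.

Lemma smooth_mxN {p q} (B : 'rV[R]_m -> 'M[R]_(p, q)) :
  smooth_mx U B -> smooth_mx U (fun y => - B y).
Proof.
by move=> HB i j; apply: smooth_ext (smoothN oU (HB i j)) => // y _; rewrite mxE.
Qed.

Lemma smooth_mxZ {p q} (f : 'rV[R]_m -> R) (B : 'rV[R]_m -> 'M[R]_(p, q)) :
  smooth U f -> smooth_mx U B -> smooth_mx U (fun y => f y *: B y).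
Proof.
by move=> Hf HB i j; apply: smooth_ext (smoothM oU Hf (HB i j)) => // y _; rewrite mxE.
Qed.

Lemma smooth_tr {p q} (B : 'rV[R]_m -> 'M[R]_(p, q)) :
  smooth_mx U B -> smooth_mx U (fun y => (B y)^T).
Proof. by move=> HB i j; apply: smooth_ext (HB j i) => // y _; rewrite mxE. Qed.

Lemma smooth_mulmx {p q r} (B : 'rV[R]_m -> 'M[R]_(p, q)) (C : 'rV[R]_m -> 'M[R]_(q, r)) :
  smooth_mx U B -> smooth_mx U C -> smooth_mx U (fun y => B y *m C y).
Proof.
move=> HB HC i j.
apply: (@smooth_ext _ _ _ oU (fun y => \sum_k B y i k * C y k j)).
  by move=> y _; rewrite mxE.
by apply: smooth_sum => // k; exact: smoothM.
Qed.

Lemma smooth_pmx {p q} (B : 'rV[R]_m -> 'M[R]_(p, q)) k :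
  smooth_mx U B -> smooth_mx U (pmx k B).
Proof.
move=> HB i j; apply: smooth_ext (smooth_partial k (HB i j)) => // y _.
by rewrite mxE.
Qed.

Lemma smooth_det {p} (B : 'rV[R]_m -> 'M[R]_p) :
  smooth_mx U B -> smooth U (fun y => \det (B y)).
Proof.
move=> HB; rewrite /determinant; apply: smooth_sum => // s.
by apply: smoothM => //; [exact: smooth_cst|exact: smooth_prod].
Qed.

Lemma smooth_invmx {p} (B : 'rV[R]_m -> 'M[R]_p) :
  (forall y, U y -> 0 < \det (B y)) -> smooth_mx U B ->
  smooth_mx U (fun y => invmx (B y)).
Proof.
move=> dB HB.
apply: (@smooth_mx_ext _ _ (fun y => (\det (B y))^-1 *: \adj (B y))).
  by move=> y /dB d; rewrite /invmx unitmxE unitfE gt_eqF.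
apply: smooth_mxZ; first by apply: smooth_inv => //; exact: smooth_det.
move=> i j; apply: (@smooth_ext _ _ _ oU (fun y => (-1) ^+ (j + i) *
    \det (row' j (col' i (B y))))); first by move=> y _; rewrite mxE.
apply: smoothM => //; first exact: smooth_cst.
by apply: smooth_det => k l; apply: smooth_ext (HB _ _) => // y _; rewrite !mxE.
Qed.

Lemma pmx_eq {p q} (B C : 'rV[R]_m -> 'M[R]_(p, q)) k y :
  (forall y, U y -> B y = C y) -> U y -> pmx k B y = pmx k C y.
Proof.
move=> E Uy; apply/matrixP => i j; rewrite !mxE.
by apply: (partial_eq_on oU) => // z /E ->.
Qed.

Lemma pmx_cst {p q} (B : 'M[R]_(p, q)) k y : pmx k (fun=> B) y = 0.
Proof. by apply/matrixP => i j; rewrite !mxE partial_cst. Qed.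

Lemma pmxD {p q} (B C : 'rV[R]_m -> 'M[R]_(p, q)) k y :
  smooth_mx U B -> smooth_mx U C -> U y ->
  pmx k (fun y => B y + C y) y = pmx k B y + pmx k C y.
Proof.
move=> HB HC Uy; apply/matrixP => i j; rewrite !mxE -(partialD _ (HB i j) (HC i j)) //.
by apply: (partial_eq_on oU) => // z _; rewrite mxE.
Qed.

Lemma pmxN {p q} (B : 'rV[R]_m -> 'M[R]_(p, q)) k y :
  smooth_mx U B -> U y -> pmx k (fun y => - B y) y = - pmx k B y.
Proof.
move=> HB Uy; apply/eqP; rewrite -addr_eq0 addrC -(pmxD _ HB (smooth_mxN HB) Uy).
apply/eqP; rewrite -[RHS](pmx_cst (0 : 'M[R]_(p, q)) k y).
by apply: (pmx_eq _ _ Uy) => z _; rewrite subrr.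
Qed.

Lemma pmxM {p q r} (B : 'rV[R]_m -> 'M[R]_(p, q)) (C : 'rV[R]_m -> 'M[R]_(q, r)) k y :
  smooth_mx U B -> smooth_mx U C -> U y ->
  pmx k (fun y => B y *m C y) y = pmx k B y *m C y + B y *m pmx k C y.
Proof.
move=> HB HC Uy; apply/matrixP => i j; rewrite !mxE.
transitivity (partial k (fun z => \sum_l B z i l * C z l j) y).
  by apply: (partial_eq_on oU) => // z _; rewrite mxE.
rewrite (partial_sum oU) //; last by move=> l; exact: smoothM.
rewrite -big_split /=; apply: eq_bigr => l _.
by rewrite (partialM _ (HB i l) (HC l j)) // !mxE addrC [C y l j * _]mulrC.
Qed.

Lemma pmx_tr {p q} (B : 'rV[R]_m -> 'M[R]_(p, q)) k y :
  U y -> pmx k (fun y => (B y)^T) y = (pmx k B y)^T.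
Proof.
move=> Uy; apply/matrixP => i j; rewrite !mxE.
by apply: (partial_eq_on oU) => // z _; rewrite mxE.
Qed.

Lemma pmx_comm {p q} (B : 'rV[R]_m -> 'M[R]_(p, q)) k l y :
  smooth_mx U B -> U y -> pmx k (pmx l B) y = pmx l (pmx k B) y.
Proof.
move=> HB Uy; apply/matrixP => i j.
transitivity (partial k (partial l (fun z => B z i j)) y).
  by rewrite mxE; apply: (partial_eq_on oU) => // z _; rewrite mxE.
rewrite (smooth_partial_comm oU) // [RHS]mxE.
by apply: (partial_eq_on oU) => // z _; rewrite mxE.
Qed.

Lemma partial_prod1 I (r : seq I) (F : I -> 'rV[R]_m -> R) k y :
  (forall i, smooth U (F i)) -> U y -> (forall i, F i y = 1) ->
  partial k (fun z => \prod_(i <- r) F i z) y = \sum_(i <- r) partial k (F i) y.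
Proof.
move=> HF Uy F1; elim: r => [|i r IH].
  rewrite big_nil; transitivity (partial k (fun=> 1 : R) y).
    by apply: (partial_eq_on oU) => // z _; rewrite big_nil.
  by rewrite partial_cst.
transitivity (partial k (fun z => F i z * \prod_(i <- r) F i z) y).
  by apply: (partial_eq_on oU) => // z _; rewrite big_cons.
rewrite (partialM (U := U)) //; last exact: smooth_prod.
rewrite F1 IH big_cons [X in _ + X * _](_ : _ = 1) ?mul1r 1?addrC //.
by rewrite big1.
Qed.

Lemma partial_prod0 n (F : 'I_n -> 'rV[R]_m -> R) k y i j :
  (forall i, smooth U (F i)) -> U y -> i != j -> F i y = 0 -> F j y = 0 ->
  partial k (fun z => \prod_i F i z) y = 0.
Proof.
move=> HF Uy ij Fi Fj.
have HP : smooth U (fun z => \prod_(l | (l != i) && (l != j)) F l z).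
  apply: (@smooth_ext _ _ _ oU (fun z => \prod_(l <- [seq l <- index_enum 'I_n | (l != i) && (l != j)]) F l z)).
    by move=> z _; rewrite big_filter.
  exact: smooth_prod.
transitivity (partial k (fun z => F i z * (F j z * \prod_(l | (l != i) && (l != j)) F l z)) y).
  apply: (partial_eq_on oU) => // z _; rewrite (bigD1 i) //= (bigD1 j) 1?eq_sym //=.
rewrite (partialM (U := U)) //; last exact: smoothM.
by rewrite Fi Fj !mul0r addr0.
Qed.

(** Only the identity permutation contributes: any other one moves some i and also the image of i,
    so its product has two off-diagonal factors, which vanish at y. *)
Lemma partial_det1 {p} (B : 'rV[R]_m -> 'M[R]_p) k y :
  smooth_mx U B -> U y -> B y = 1%:M ->
  partial k (fun z => \det (B z)) y = \tr (pmx k B y).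
Proof.
move=> HB Uy B1; rewrite /determinant.
have Hs (s : {perm 'I_p}) : smooth U (fun z => \prod_i B z i (s i)).
  exact: smooth_prod.
rewrite (partial_sum oU) //; last first.
  by move=> s; apply: smoothM => //; exact: smooth_cst.
have E (s : {perm 'I_p}) : partial k (fun z => (-1) ^+ s * \prod_i B z i (s i)) y =
    (-1) ^+ s * partial k (fun z => \prod_i B z i (s i)) y.
  rewrite (partialM (U := U)) //; last exact: smooth_cst.
  by rewrite partial_cst mulr0 addr0.
rewrite (bigD1 1%g) //= [X in _ + X]big1 ?addr0; last first.
  move=> s s1; rewrite E.
  have [i si] : exists i, s i != i.
    apply/existsP; rewrite -negb_forall; apply: contra s1 => /forallP H.
    by apply/eqP/permP => i; rewrite perm1; exact/eqP.
  rewrite (@partial_prod0 _ _ _ _ i (s i)) ?mulr0 //.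
  - by rewrite eq_sym.
  - by rewrite B1 mxE eq_sym (negbTE si).
  - by rewrite B1 mxE (inj_eq perm_inj) eq_sym (negbTE si).
rewrite E odd_perm1 expr0 mul1r partial_prod1 //.
  by apply: eq_bigr => i _; rewrite perm1 mxE.
by move=> i; rewrite perm1 B1 mxE eqxx.
Qed.

Lemma partial_det {p} (B : 'rV[R]_m -> 'M[R]_p) k y :
  smooth_mx U B -> U y -> B y \in unitmx ->
  partial k (fun z => \det (B z)) y = \det (B y) * \tr (invmx (B y) *m pmx k B y).
Proof.
move=> HB Uy uB.
have HC : smooth_mx U (fun z => invmx (B y) *m B z).
  by apply: smooth_mulmx => //; exact: smooth_mx_cst.
transitivity (partial k (fun z => \det (B y) * \det (invmx (B y) *m B z)) y).
  apply: (partial_eq_on oU) => // z _.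
  by rewrite -det_mulmx mulmxA mulmxV // mul1mx.
rewrite (partialM (U := U)) //; [|exact: smooth_cst|exact: smooth_det].
rewrite partial_cst mulr0 addr0 partial_det1 //; last by rewrite mulVmx.
rewrite pmxM //; last exact: smooth_mx_cst.
by rewrite pmx_cst mul0mx add0r.
Qed.

End MatrixCalculus.

(** * Linear algebra of curvature operators *)


Section PositiveDefinite.
Context {R : realType}.

Definition posdef m (G : 'M[R]_m) : Prop :=
  G^T = G /\ forall X : 'rV[R]_m, X != 0 -> 0 < inner G X X.

Lemma inner_congr m p (G : 'M[R]_m) (P : 'M[R]_(p, m)) (X Y : 'rV[R]_p) :
  inner (P *m G *m P^T) X Y = inner G (X *m P) (Y *m P).
Proof. by rewrite /inner trmx_mul !mulmxA. Qed.

(** The rows of [P] are an orthonormal basis. Induction on the dimension: [L] clears the first row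
    and column and leaves the Schur complement [S], which is again positive definite. *)
Lemma orthonormal_frame m (G : 'M[R]_m) : posdef G ->
  exists P : 'M[R]_m, P *m G *m P^T = 1%:M.
Proof.
elim: m G => [|m IH] G [Gs Gp]; first by exists 1%:M; apply/matrixP => -[].
move: G Gs Gp; rewrite -[m.+1]/(1 + m)%N => G Gs Gp.
pose a := ulsubmx G 0 0; pose c := dlsubmx G; pose d := drsubmx G.
have EG : G = block_mx a%:M c^T c d.
  rewrite -[LHS]submxK; congr block_mx; first exact: mx11_scalar.
  by rewrite trmx_dlsub Gs.
have a0 : 0 < a.
  have := Gp (row_mx 1%:M 0); rewrite /inner EG mul_row_block tr_row_mx mul_row_col.
  rewrite !mul1mx !mul0mx !addr0 trmx1 trmx0 mulmx1 mulmx0 addr0 mxE eqxx mulr1n.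
  apply; apply/negP => /eqP/rowP/(_ (lshift m 0)); rewrite row_mxEl !mxE /= => /eqP.
  by rewrite oner_eq0.
have an0 : a != 0 by rewrite gt_eqF.
have ds : d^T = d by rewrite /d trmx_drsub Gs.
pose S := d - a^-1 *: (c *m c^T).
pose L : 'M[R]_(1 + m) := block_mx 1%:M 0 (- a^-1 *: c) 1%:M.
have EL : L *m G *m L^T = block_mx a%:M 0 0 S.
  rewrite EG tr_block_mx mulmx_block !mul1mx !mul0mx !addr0 mulmx_block.
  rewrite trmx0 !trmx1 !mulmx0 !mulmx1 !addr0 linearZ /=.
  have E1 : (- a^-1) *: c *m a%:M + c = 0.
    by rewrite mul_mx_scalar scalerA mulrN mulfV // scaleN1r addNr.
  rewrite E1 mul0mx add0r mul_scalar_mx scalerA mulrN mulfV // scaleN1r addNr.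
  by rewrite -scalemxAl scaleNr addrC.
have Sp : posdef S.
  split; first by rewrite /S linearB /= linearZ /= trmx_mul trmxK ds.
  move=> Y Y0; have := Gp (row_mx 0 Y *m L).
  rewrite -inner_congr EL.
  have -> : inner (block_mx a%:M 0 0 S : 'M[R]_(1 + m)) (row_mx (0 : 'rV[R]_1) Y)
      (row_mx (0 : 'rV[R]_1) Y) = inner S Y Y.
    by rewrite /inner mul_row_block tr_row_mx mul_row_col !(mul0mx, mulmx0) !add0r mul0mx add0r.
  apply.
  have uL : L \in unitmx.
    by rewrite unitmxE det_lblock !det1 mulr1 unitr1.
  apply/negP => /eqP H; move/eqP: Y0; apply.
  have : row_mx (0 : 'rV[R]_1) Y = 0 by rewrite -[LHS](mulmxK uL) H mul0mx.
  by rewrite -row_mx0 => /eq_row_mx[].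
have [Q EQ] := IH S Sp.
pose D : 'M[R]_(1 + m) := block_mx (Num.sqrt a)^-1%:M 0 0 Q.
exists (D *m L).
have -> : D *m L *m G *m (D *m L)^T = D *m (L *m G *m L^T) *m D^T.
  by rewrite trmx_mul !mulmxA.
rewrite EL tr_block_mx !mulmx_block !trmx0 !(mul0mx, mulmx0, addr0, add0r) EQ.
rewrite tr_scalar_mx -!scalar_mxM.
have -> : (Num.sqrt a)^-1 * a * (Num.sqrt a)^-1 = 1.
  by rewrite mulrAC -invfM -expr2 sqr_sqrtr ?ltW // mulVf.
by rewrite -scalar_mx_block.
Qed.

Section Frame.
Context {m : nat} (G P : 'M[R]_m).
Hypothesis PGP : P *m G *m P^T = 1%:M.

Lemma frame_unit : P \in unitmx.
Proof. by have [] := mulmx1_unit (etrans (mulmxA _ _ _) PGP). Qed.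

Lemma frame_GPK : G *m P^T *m P = 1%:M.
Proof. by apply: mulmx1C; rewrite mulmxA. Qed.

Lemma frame_PG : P^T *m P *m G = 1%:M.
Proof. by apply: mulmx1C; rewrite mulmxA frame_GPK. Qed.

Lemma frame_inv : invmx G = P^T *m P.
Proof.
have uG : G \in unitmx by have [] := mulmx1_unit frame_PG.
by rewrite -[LHS]mul1mx -frame_PG mulmxK.
Qed.

Lemma frame_det : 0 < \det G.
Proof.
have H : \det P ^+ 2 * \det G = 1.
  by rewrite -(det1 R m) -PGP !det_mulmx det_tr expr2 mulrAC.
have P0 : \det P != 0.
  by apply/eqP => d0; move: H; rewrite d0 expr0n mul0r => /eqP; rewrite eq_sym oner_eq0.
have := @ltr01 R; rewrite -H pmulr_rgt0 // lt_def sqr_ge0 andbT.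
by rewrite expf_neq0.
Qed.

End Frame.

Lemma posdef_det m (G : 'M[R]_m) : posdef G -> 0 < \det G.
Proof. by move=> /orthonormal_frame[P /frame_det]. Qed.

Lemma posdef_unit m (G : 'M[R]_m) : posdef G -> G \in unitmx.
Proof. by move=> /posdef_det d; rewrite unitmxE unitfE gt_eqF. Qed.

End PositiveDefinite.

(** * Complex structures on a Euclidean space *)

Section Euclidean.
Context {R : realType}.

Definition dot m (x y : 'rV[R]_m) : R := \sum_i x 0 i * y 0 i.

Lemma dotE m (x y : 'rV[R]_m) : dot x y = (x *m y^T) 0 0.
Proof. by rewrite mxE; apply: eq_bigr => i _; rewrite mxE. Qed.

Lemma inner1 m (x y : 'rV[R]_m) : inner 1%:M x y = dot x y.
Proof. by rewrite /inner mulmx1 dotE. Qed.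

Lemma dotC m (x y : 'rV[R]_m) : dot x y = dot y x.
Proof. by apply: eq_bigr => i _; rewrite mulrC. Qed.

Lemma dotDl m (x y z : 'rV[R]_m) : dot (x + y) z = dot x z + dot y z.
Proof. by rewrite -big_split; apply: eq_bigr => i _; rewrite !mxE mulrDl. Qed.

Lemma dotZl m (c : R) (x z : 'rV[R]_m) : dot (c *: x) z = c * dot x z.
Proof. by rewrite mulr_sumr; apply: eq_bigr => i _; rewrite !mxE mulrA. Qed.

Lemma dotNl m (x z : 'rV[R]_m) : dot (- x) z = - dot x z.
Proof. by rewrite -scaleN1r dotZl mulN1r. Qed.

Lemma dotDr m (x y z : 'rV[R]_m) : dot z (x + y) = dot z x + dot z y.
Proof. by rewrite dotC dotDl !(dotC z). Qed.

Lemma dotZr m (c : R) (x z : 'rV[R]_m) : dot z (c *: x) = c * dot z x.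
Proof. by rewrite dotC dotZl (dotC z). Qed.

Lemma dotNr m (x z : 'rV[R]_m) : dot z (- x) = - dot z x.
Proof. by rewrite dotC dotNl (dotC z). Qed.

Lemma dot_ge0 m (x : 'rV[R]_m) : 0 <= dot x x.
Proof. by apply: sumr_ge0 => i _; rewrite -expr2 sqr_ge0. Qed.

Lemma dot_eq0 m (x : 'rV[R]_m) : dot x x = 0 -> x = 0.
Proof.
move=> H; apply/rowP => i; rewrite mxE.
have sq k : 0 <= x 0 k * x 0 k by rewrite -expr2 sqr_ge0.
have := psumr_eq0P (fun k _ => sq k) H (i := i) isT.
by move/eqP; rewrite mulf_eq0 orbb => /eqP.
Qed.

Lemma dot_mulmx m (x y : 'rV[R]_m) (A : 'M[R]_m) : dot (x *m A) y = dot x (y *m A^T).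
Proof. by rewrite !dotE trmx_mul trmxK mulmxA. Qed.

Lemma dot_delta m (x : 'rV[R]_m) j : dot x (delta_mx 0 j) = x 0 j.
Proof.
rewrite /dot (bigD1 j) //= mxE !eqxx mulr1 big1 ?addr0 // => i ij.
by rewrite mxE (negbTE ij) andbF mulr0.
Qed.

Lemma dot_sqr m (x : 'rV[R]_m) : dot x x = \sum_j x 0 j ^+ 2.
Proof. by apply: eq_bigr => i _; rewrite expr2. Qed.

(** Bessel's inequality for two orthogonal vectors of equal length, multiplied by the squared length
    so that x = 0 is allowed. *)
Lemma bessel_pair m (x y a : 'rV[R]_m) : dot x y = 0 -> dot y y = dot x x ->
  dot x a ^+ 2 + dot y a ^+ 2 <= dot x x * dot a a.
Proof.
move=> xy yy; have [x0|xn0] := eqVneq (dot x x) 0.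
  have E z : dot (0 : 'rV[R]_m) z = 0 by rewrite -(scale0r 0) dotZl mul0r.
  by rewrite (dot_eq0 x0) (dot_eq0 (etrans yy x0)) !E !expr0n /= mul0r addr0.
have xp : 0 < dot x x by rewrite lt_def xn0 dot_ge0.
have := dot_ge0 (dot x x *: a - dot x a *: x - dot y a *: y).
rewrite !(dotDl, dotDr, dotNl, dotNr, dotZl, dotZr) yy (dotC y x) xy (dotC a x) (dotC a y).
set s := dot x x in xp *; set p := dot x a; set q := dot y a; set t := dot a a.
have -> : s * (s * t - p * p - q * q) + (s * - (p * p) - p * - (p * s) - p * - (q * 0)) +
  (s * - (q * q) - q * - (p * 0) - q * - (q * s)) = s * (s * t - (p ^+ 2 + q ^+ 2)) by ring.
by rewrite pmulr_rge0 // subr_ge0.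
Qed.

Section ComplexStructure.
Context {m : nat} (J : 'M[R]_m).
Hypothesis (JT : J^T = - J) (JJ : J *m J = - 1%:M).

Lemma dot_J (x : 'rV[R]_m) : dot x (x *m J) = 0.
Proof.
have : dot x (x *m J) = - dot x (x *m J).
  by rewrite {1}dotC dot_mulmx JT mulmxN dotNr.
by lra.
Qed.

Lemma dot_JJ (x y : 'rV[R]_m) : dot (x *m J) (y *m J) = dot x y.
Proof. by rewrite dot_mulmx JT mulmxN -mulmxA JJ mulmxN mulmx1 opprK. Qed.

(* Rows x and xJ are orthogonal of equal length, and A sends them to vectors of
   equal length; this halves the trivial bound. *)
Lemma mulmx_sqr_le (A : 'M[R]_m) (x : 'rV[R]_m) :
  J *m A = A *m J \/ J *m A = - (A *m J) ->
  dot (x *m A) (x *m A) <= 2^-1 * \tr (A *m A^T) * dot x x.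
Proof.
move=> AJ.
have E : dot (x *m J *m A) (x *m J *m A) = dot (x *m A) (x *m A).
  by case: AJ => AJ; rewrite -mulmxA AJ ?mulmxN ?dotNl ?dotNr ?opprK mulmxA dot_JJ.
have coord (y : 'rV[R]_m) j : (y *m A) 0 j = dot y (col j A)^T.
  by rewrite !mxE; apply: eq_bigr => i _; rewrite !mxE.
have H : dot (x *m A) (x *m A) + dot (x *m J *m A) (x *m J *m A)
    <= dot x x * \tr (A *m A^T).
  rewrite !dot_sqr -big_split /= mxtrace_mulC /mxtrace mulr_sumr; apply: ler_sum => j _.
  rewrite !coord; apply: le_trans (bessel_pair _ (dot_J x) (dot_JJ x x)) _.
  rewrite le_eqVlt; apply/orP; left; apply/eqP; congr (_ * _); rewrite mxE.
  by apply: eq_bigr => i _; rewrite !mxE.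
by move: H; rewrite E; lra.
Qed.

End ComplexStructure.
End Euclidean.


(** * The unitary algebra and the lower bound on the Ricci curvature *)

Section UnitaryTrace.
Context {R : realType} {n : nat}.
Local Notation m := (2 * n)%N.
Variables (J : 'M[R]_m).
Hypothesis (JT : J^T = - J) (JJ : J *m J = - 1%:M).

(** This is [inner2] for the identity Gram matrix; the half compensates for each pair i < j being
    counted twice on skew matrices. *)
Definition ip (A B : 'M[R]_m) : R := 2^-1 * \sum_i \sum_j A i j * B i j.

Lemma ipC A B : ip A B = ip B A.
Proof. by congr (_ * _); do 2! apply: eq_bigr => ? _; rewrite mulrC. Qed.

Lemma ipDl A B C : ip (A + B) C = ip A C + ip B C.
Proof.
rewrite /ip -mulrDr; congr (_ * _); rewrite -big_split; apply: eq_bigr => i _.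
by rewrite -big_split; apply: eq_bigr => j _; rewrite mxE mulrDl.
Qed.

Lemma ipZl c A C : ip (c *: A) C = c * ip A C.
Proof.
rewrite /ip mulrCA; congr (_ * _); rewrite mulr_sumr; apply: eq_bigr => i _.
by rewrite mulr_sumr; apply: eq_bigr => j _; rewrite mxE mulrA.
Qed.

Lemma ipDr A B C : ip C (A + B) = ip C A + ip C B.
Proof. by rewrite ipC ipDl !(ipC C). Qed.

Lemma ipZr c A C : ip C (c *: A) = c * ip C A.
Proof. by rewrite ipC ipZl (ipC C). Qed.

Lemma ip0l A : ip 0 A = 0.
Proof. by rewrite -(scale0r 0) ipZl mul0r. Qed.

Lemma ipNl A C : ip (- A) C = - ip A C.
Proof. by rewrite -scaleN1r ipZl mulN1r. Qed.

Lemma ipNr A C : ip C (- A) = - ip C A.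
Proof. by rewrite ipC ipNl (ipC C). Qed.

Lemma ip_suml I (r : seq I) (F : I -> 'M[R]_m) C :
  ip (\sum_(i <- r) F i) C = \sum_(i <- r) ip (F i) C.
Proof.
elim: r => [|i r IH]; first by rewrite !big_nil ip0l.
by rewrite !big_cons ipDl IH.
Qed.

Lemma ip_sumr I (r : seq I) (F : I -> 'M[R]_m) C :
  ip C (\sum_(i <- r) F i) = \sum_(i <- r) ip C (F i).
Proof. by rewrite ipC ip_suml; apply: eq_bigr => i _; rewrite ipC. Qed.

Lemma ip_ge0 A : 0 <= ip A A.
Proof.
rewrite mulr_ge0 ?invr_ge0 //; do 2! apply: sumr_ge0 => ? _.
by rewrite -expr2 sqr_ge0.
Qed.

Lemma ip_eq0 A : ip A A = 0 -> A = 0.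
Proof.
move/eqP; rewrite mulf_eq0 invr_eq0 pnatr_eq0 /= => /eqP H.
have sq i j : 0 <= A i j * A i j by rewrite -expr2 sqr_ge0.
have sq' i : 0 <= \sum_j A i j * A i j by apply: sumr_ge0.
apply/matrixP => i j; rewrite mxE.
have Hi := psumr_eq0P (fun k _ => sq' k) H (i := i) isT.
have := psumr_eq0P (fun k _ => sq i k) Hi (i := j) isT.
by move/eqP; rewrite mulf_eq0 orbb => /eqP.
Qed.

Lemma ip_trace A B : ip A B = 2^-1 * \tr (A^T *m B).
Proof.
congr (_ * _); rewrite exchange_big /mxtrace; apply: eq_bigr => j _; rewrite mxE.
by apply: eq_bigr => i _; rewrite mxE.
Qed.

Lemma wedgeE (X Y : 'rV[R]_m) i j : wedge X Y i j = X 0 i * Y 0 j - Y 0 i * X 0 j.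
Proof. by rewrite !mxE !big_ord1 !mxE. Qed.

Lemma ip_wedge (X Y Z W : 'rV[R]_m) :
  ip (wedge X Y) (wedge Z W) = dot X Z * dot Y W - dot X W * dot Y Z.
Proof.
have D (a b c d : 'rV[R]_m) : dot a b * dot c d = \sum_i \sum_j a 0 i * b 0 i * (c 0 j * d 0 j).
  by rewrite mulr_suml; apply: eq_bigr => i _; rewrite mulr_sumr.
have E : \sum_i \sum_j wedge X Y i j * wedge Z W i j =
   dot X Z * dot Y W + dot Y W * dot X Z - dot X W * dot Y Z - dot Y Z * dot X W.
  rewrite !D -!sumrN -!big_split /=; apply: eq_bigr => i _.
  rewrite -!sumrN -!big_split /=; apply: eq_bigr => j _.
  by rewrite !wedgeE; ring.
by rewrite /ip E; field.
Qed.

Lemma ip_wedge_skew (X Y : 'rV[R]_m) (E : 'M[R]_m) : E^T = - E ->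
  ip (wedge X Y) E = dot (X *m E) Y.
Proof.
move=> ET; have Eij i j : E j i = - E i j by rewrite -[in LHS](trmxK E) mxE ET mxE.
have S1 : \sum_i \sum_j X 0 i * Y 0 j * E i j = dot (X *m E) Y.
  rewrite exchange_big; apply: eq_bigr => j _; rewrite mxE mulr_suml.
  by apply: eq_bigr => i _; ring.
have S2 : \sum_i \sum_j Y 0 i * X 0 j * E i j = - dot (X *m E) Y.
  rewrite -S1 exchange_big -sumrN; apply: eq_bigr => i _; rewrite -sumrN.
  by apply: eq_bigr => j _; rewrite (Eij i j); ring.
have -> : ip (wedge X Y) E = 2^-1 * (\sum_i \sum_j X 0 i * Y 0 j * E i j
    - \sum_i \sum_j Y 0 i * X 0 j * E i j).
  congr (_ * _); rewrite -sumrB; apply: eq_bigr => i _; rewrite -sumrB.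
  by apply: eq_bigr => j _; rewrite wedgeE mulrBl.
by rewrite S1 S2; field.
Qed.

Lemma wedge_mulmx (X Y : 'rV[R]_m) (A : 'M[R]_m) :
  wedge (X *m A) (Y *m A) = A^T *m wedge X Y *m A.
Proof. by rewrite /wedge !trmx_mul mulmxBr mulmxBl !mulmxA. Qed.

(* orthogonal projection onto the matrices commuting with J *)
Definition upr (A : 'M[R]_m) := 2^-1 *: (A + J^T *m A *m J).

Lemma upr_wedge (X Y : 'rV[R]_m) :
  upr (wedge X Y) = 2^-1 *: (wedge X Y + wedge (X *m J) (Y *m J)).
Proof. by rewrite /upr -wedge_mulmx. Qed.

Let uspec (E : 'M[R]_m) := E^T = - E /\ E *m J = J *m E.

Lemma ip_upr_unitary (X Y : 'rV[R]_m) E : uspec E ->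
  ip (upr (wedge X Y)) E = ip (wedge X Y) E.
Proof.
move=> [ET EJ]; rewrite upr_wedge ipZl ipDl !ip_wedge_skew //.
by rewrite -mulmxA -EJ mulmxA dot_JJ //; field.
Qed.

Lemma ip_upr (X Y : 'rV[R]_m) :
  ip (upr (wedge X Y)) (upr (wedge X Y)) = 2^-1 *
   (dot X X * dot Y Y - dot X Y ^+ 2 + dot (X *m J) X * dot (Y *m J) Y
    - dot (X *m J) Y * dot (Y *m J) X).
Proof.
rewrite upr_wedge ipZl ipZr ipDl !(ipDr (wedge X Y) (wedge (X *m J) (Y *m J))) !ip_wedge !dot_JJ //.
by rewrite (dotC Y X) (dotC X (X *m J)) (dotC Y (Y *m J)) (dotC X (Y *m J)) (dotC Y (X *m J)); field.
Qed.

Variable E : 'I_(n ^ 2) -> 'M[R]_m.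
Hypothesis (Eu : forall a, (E a)^T = - E a /\ E a *m J = J *m E a).
Hypothesis (Eo : forall a b, ip (E a) (E b) = (a == b)%:R).

Let d (j : 'I_m) : 'rV[R]_m := delta_mx 0 j.

(** Twice the trace of the projection onto u(n), hence twice its dimension: each basis bivector
    occurs for two ordered pairs. *)
Lemma ip_upr_basis : \sum_i \sum_j ip (upr (wedge (d i) (d j))) (upr (wedge (d i) (d j)))
  = 2 * (n ^ 2)%:R.
Proof.
have dd i j : dot (d i) (d j) = (i == j)%:R by rewrite dot_delta mxE eqxx eq_sym.
have dJ i j : dot (d i *m J) (d j) = J i j by rewrite dot_delta -rowE mxE.
have Jij i j : J j i = - J i j by rewrite -[in LHS](trmxK J) mxE JT mxE.
have -> : \sum_i \sum_j ip (upr (wedge (d i) (d j))) (upr (wedge (d i) (d j))) =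
    \sum_i \sum_j 2^-1 * (1 - (i == j)%:R + J i j ^+ 2).
  apply: eq_bigr => i _; apply: eq_bigr => j _; rewrite ip_upr !dd !dJ !eqxx.
  have J0 : J i i = 0 by have := Jij i i; lra.
  by rewrite J0 (Jij i j); case: eqP => _ /=; field.
have row i : \sum_j 2^-1 * (1 - (i == j)%:R + J i j ^+ 2) = n%:R.
  rewrite -mulr_sumr big_split sumrB /= sumr_const card_ord.
  have -> : \sum_(j < m) (i == j)%:R = 1 :> R.
    rewrite (bigD1 i) //= eqxx big1 ?addr0 // => j ji.
    by rewrite eq_sym (negbTE ji).
  have -> : \sum_j J i j ^+ 2 = 1.
    have H : dot (d i *m J) (d i *m J) = 1 by rewrite dot_JJ // dd eqxx.
    rewrite -[RHS]H dot_sqr.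
    by apply: eq_bigr => j _; rewrite -rowE mxE.
  by rewrite subrK -mulr_natl natrM; field.
under eq_bigr do rewrite row.
by rewrite sumr_const card_ord -[LHS]mulr_natl natrX natrM; ring.
Qed.

(** The orthonormal family [E] is not assumed to span u(n); this follows from its cardinality. The
    square norm of the defect [D] is the Bessel deficit, and summed over all pairs of basis vectors
    the two terms of the deficit both equal 2 n^2. So [D] vanishes on basis vectors, hence
    everywhere by bilinearity. *)
Lemma upr_expansion (X Y : 'rV[R]_m) :
  upr (wedge X Y) = \sum_a ip (wedge X Y) (E a) *: E a.
Proof.
pose D (X Y : 'rV[R]_m) := upr (wedge X Y) - \sum_a ip (wedge X Y) (E a) *: E a.
have DD X' Y' : ip (D X' Y') (D X' Y') =
    ip (upr (wedge X' Y')) (upr (wedge X' Y')) - \sum_a ip (wedge X' Y') (E a) ^+ 2.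
  rewrite /D !(ipDl, ipDr, ipNl, ipNr) !(ip_suml, ip_sumr).
  have E1 : \sum_a ip (upr (wedge X' Y')) (ip (wedge X' Y') (E a) *: E a) =
      \sum_a ip (wedge X' Y') (E a) ^+ 2.
    by apply: eq_bigr => a _; rewrite ipZr ip_upr_unitary // -expr2.
  have E2 : \sum_a ip (ip (wedge X' Y') (E a) *: E a) (upr (wedge X' Y')) =
      \sum_a ip (wedge X' Y') (E a) ^+ 2.
    by rewrite -E1; apply: eq_bigr => a _; rewrite ipC.
  have E3 : \sum_a ip (ip (wedge X' Y') (E a) *: E a)
        (\sum_b ip (wedge X' Y') (E b) *: E b) = \sum_a ip (wedge X' Y') (E a) ^+ 2.
    apply: eq_bigr => a _; rewrite ipZl ip_sumr (bigD1 a) //= ipZr Eo eqxx mulr1.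
    rewrite big1 ?addr0 -?expr2 // => b ba.
    by rewrite ipZr Eo eq_sym (negbTE ba) mulr0.
  by rewrite E1 E2 E3; ring.
have sumE : \sum_i \sum_j \sum_a ip (wedge (d i) (d j)) (E a) ^+ 2 = 2 * (n ^ 2)%:R.
  have -> : \sum_i \sum_j \sum_a ip (wedge (d i) (d j)) (E a) ^+ 2 =
      \sum_a \sum_i \sum_j (E a) i j ^+ 2.
    rewrite [RHS]exchange_big; apply: eq_bigr => i _.
    rewrite [RHS]exchange_big; apply: eq_bigr => j _; apply: eq_bigr => a _.
    have [ET _] := Eu a.
    by rewrite ip_wedge_skew // dot_delta -rowE mxE.
  transitivity (\sum_(a < n ^ 2) (2 : R)); last first.
    by rewrite sumr_const card_ord -[LHS]mulr_natr.
  apply: eq_bigr => a _; have := Eo a a; rewrite eqxx /ip => H.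
  have <- : \sum_i \sum_j E a i j * E a i j = \sum_i \sum_j E a i j ^+ 2.
    by do 2! apply: eq_bigr => ? _; rewrite expr2.
  have H' : 2^-1 * (\sum_i \sum_j E a i j * E a i j) = 1 := H.
  by lra.
have D0 i j : D (d i) (d j) = 0.
  have tot : \sum_i \sum_j ip (D (d i) (d j)) (D (d i) (d j)) = 0.
    transitivity (\sum_i \sum_j (ip (upr (wedge (d i) (d j))) (upr (wedge (d i) (d j)))
       - \sum_a ip (wedge (d i) (d j)) (E a) ^+ 2)).
      by apply: eq_bigr => k _; apply: eq_bigr => l _; rewrite DD.
    under eq_bigr do rewrite sumrB.
    by rewrite sumrB ip_upr_basis sumE subrr.
  have ge i' : 0 <= \sum_j ip (D (d i') (d j)) (D (d i') (d j)).
    by apply: sumr_ge0 => k _; exact: ip_ge0.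
  have Hi := psumr_eq0P (fun k _ => ge k) tot (i := i) isT.
  by have /ip_eq0 := psumr_eq0P (fun k _ => ip_ge0 (D (d i) (d k))) Hi (i := j) isT.
have Dl X1 X2 c Y' : D (c *: X1 + X2) Y' = c *: D X1 Y' + D X2 Y'.
  rewrite /D.
  have -> : wedge (c *: X1 + X2) Y' = c *: wedge X1 Y' + wedge X2 Y'.
    by rewrite /wedge linearP /= mulmxDl mulmxDr -scalemxAl -scalemxAr scalerBr opprD addrACA.
  have -> : \sum_a ip (c *: wedge X1 Y' + wedge X2 Y') (E a) *: E a =
     c *: (\sum_a ip (wedge X1 Y') (E a) *: E a) + \sum_a ip (wedge X2 Y') (E a) *: E a.
    rewrite scaler_sumr -big_split; apply: eq_bigr => a _.
    by rewrite ipDl ipZl scalerDl scalerA.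
  have -> : upr (c *: wedge X1 Y' + wedge X2 Y') = c *: upr (wedge X1 Y') + upr (wedge X2 Y').
    rewrite /upr mulmxDr mulmxDl -scalemxAr -scalemxAl.
    by apply/matrixP => i j; rewrite !mxE; ring.
  by rewrite scalerBr; apply/matrixP => i j; rewrite !mxE; ring.
have DN X' Y' : D Y' X' = - D X' Y'.
  have W : wedge Y' X' = - wedge X' Y' by rewrite /wedge opprB.
  rewrite /D W.
  have -> : upr (- wedge X' Y') = - upr (wedge X' Y').
    by rewrite /upr mulmxN mulNmx -opprD scalerN.
  have -> : \sum_a ip (- wedge X' Y') (E a) *: E a = - \sum_a ip (wedge X' Y') (E a) *: E a.
    by rewrite -sumrN; apply: eq_bigr => a _; rewrite ipNl scaleNr.
  by rewrite opprK [RHS]opprB addrC.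
have Dl0 Y' : (forall i, D (d i) Y' = 0) -> forall X', D X' Y' = 0.
  move=> H X'; rewrite (row_sum_delta X').
  have D00 : D 0 Y' = 0.
    have := Dl 0 0 (-1) Y'; rewrite scaler0 addr0 scaleN1r.
    by move/eqP; rewrite -subr_eq0 opprD opprK addrCA subrr addr0 => /eqP.
  elim: (index_enum _) => [|i r IH]; first by rewrite big_nil.
  by rewrite big_cons Dl IH H scaler0 addr0.
apply/eqP; rewrite -subr_eq0; apply/eqP; apply: (Dl0 Y) => i; rewrite -/(D _ _).
by rewrite DN Dl0 ?oppr0 // => j; rewrite DN D0 oppr0.
Qed.

(* Ric(x, x) >= (mu_1 + ... + mu_n) |x|^2: it is a combination of the mu_a with
   weights |x E_a|^2 in [0, |x|^2] of total n |x|^2. *)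
Lemma ricci_lower_bound (T : 'M[R]_m -> 'M[R]_m) (mu : 'I_(n ^ 2) -> R) (x : 'rV[R]_m) :
  (forall c A B, T (c *: A + B) = c *: T A + T B) ->
  (forall a, T (E a) = mu a *: E a) ->
  (forall a b : 'I_(n ^ 2), (a <= b)%N -> mu a <= mu b) ->
  (forall X Y Z W : 'rV[R]_m,
     ip (T (wedge (X *m J) (Y *m J))) (wedge Z W) = ip (T (wedge X Y)) (wedge Z W)) ->
  (\sum_(a < n ^ 2 | (a < n)%N) mu a) * dot x x <=
  \sum_j ip (T (wedge x (d j))) (wedge x (d j)).
Proof.
move=> Tlin TE mono TJ.
have T0 : T 0 = 0.
  have := Tlin (-1) 0 0; rewrite scaler0 addr0 scaleN1r.
  by move/eqP; rewrite -subr_eq0 opprD opprK addrCA subrr addr0 => /eqP.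
have Tsum (c : 'I_(n ^ 2) -> R) : T (\sum_a c a *: E a) = \sum_a (c a * mu a) *: E a.
  elim: (index_enum _) => [|a r IH]; first by rewrite !big_nil.
  by rewrite !big_cons Tlin IH TE scalerA.
have TZ c A : T (c *: A) = c *: T A by rewrite -[c *: A]addr0 Tlin T0 addr0.
have TD A B : T (A + B) = T A + T B by rewrite -[A in LHS]scale1r Tlin scale1r.
pose w a := dot (x *m E a) (x *m E a).
have ipE a j : ip (wedge x (d j)) (E a) = (x *m E a) 0 j.
  by have [ET _] := Eu a; rewrite ip_wedge_skew // dot_delta.
have step j : ip (T (wedge x (d j))) (wedge x (d j)) =
    \sum_a mu a * (x *m E a) 0 j ^+ 2.
  (* By [TJ] the pairing does not change when the bivector is replaced by its projection onto u(n),
     where the eigenvectors [E a] are available. *)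
  transitivity (ip (T (upr (wedge x (d j)))) (wedge x (d j))).
    by rewrite upr_wedge TZ TD ipZl ipDl TJ; field.
  rewrite upr_expansion Tsum ip_suml; apply: eq_bigr => a _.
  by rewrite ipZl (ipC (E a)) ipE; ring.
have -> : \sum_j ip (T (wedge x (d j))) (wedge x (d j)) = \sum_a mu a * w a.
  under eq_bigr do rewrite step.
  rewrite exchange_big; apply: eq_bigr => a _.
  by rewrite -mulr_sumr /w dot_sqr.
have w0 a : 0 <= w a by exact: dot_ge0.
have w1 a : w a <= dot x x.
  have [ET EJ] := Eu a.
  have := mulmx_sqr_le JT JJ x (or_introl (esym EJ)).
  have -> : 2^-1 * \tr (E a *m (E a)^T) = 1.
    by rewrite mxtrace_mulC -ip_trace Eo eqxx.
  by rewrite mul1r.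
have wsum : \sum_a w a = n%:R * dot x x.
  have -> : \sum_a w a = \sum_j ip (upr (wedge x (d j))) (upr (wedge x (d j))).
    transitivity (\sum_a \sum_j ip (wedge x (d j)) (E a) ^+ 2).
      by apply: eq_bigr => a _; rewrite /w dot_sqr; apply: eq_bigr => j _; rewrite ipE.
    rewrite exchange_big; apply: eq_bigr => j _.
    rewrite {2}upr_expansion ip_sumr; apply: eq_bigr => a _.
    by rewrite ipZr ip_upr_unitary // -expr2.
  have xJ0 : dot (x *m J) x = 0 by rewrite dotC dot_J.
  have -> : \sum_j ip (upr (wedge x (d j))) (upr (wedge x (d j))) =
      \sum_j 2^-1 * (dot x x - x 0 j ^+ 2 + (x *m J) 0 j ^+ 2).
    apply: eq_bigr => j _; rewrite ip_upr xJ0 !dot_delta mxE !eqxx.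
    by rewrite (dot_mulmx (d j)) JT mulmxN dotNr (dotC (d j)) dot_delta /=; field.
  rewrite -mulr_sumr big_split sumrB /= -!dot_sqr dot_JJ // sumr_const card_ord.
  by rewrite subrK -[dot x x *+ _]mulr_natl natrM; field.
have [n0|n0] := posnP n.
  have ne : 'I_(n ^ 2) -> False by case=> k; rewrite n0.
  by rewrite !big1 ?mul0r // => a; case: (ne a).
have nn2 : (n <= n ^ 2)%N by rewrite -{1}(expn1 n) leq_pexp2l.
have nn : (n.-1 < n ^ 2)%N by rewrite (leq_trans _ nn2) // ltn_predL.
(* The threshold is the n-th eigenvalue, of index n - 1. The weights [w a] and the weights c on the
   first n indices have the same total, so subtracting [th] from every eigenvalue does not change
   the difference of the two sums, and it makes every term nonnegative. *)
pose th := mu (Ordinal nn); pose c := dot x x.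
have c0 : 0 <= c by exact: dot_ge0.
have sum1 : \sum_(a < n ^ 2) (a < n)%N%:R = n%:R :> R.
  transitivity (\sum_(a < n ^ 2 | (a < n)%N) (1 : R)).
    by rewrite [RHS]big_mkcond; apply: eq_bigr => a _; case: ifP.
  by rewrite -(big_ord_widen _ (fun=> 1 : R) nn2) sumr_const card_ord.
have -> : (\sum_(a < n ^ 2 | (a < n)%N) mu a) = \sum_(a < n ^ 2) mu a * (a < n)%N%:R.
  by rewrite big_mkcond; apply: eq_bigr => a _; case: ifP => _; rewrite ?mulr1 ?mulr0.
rewrite -subr_ge0.
have -> : \sum_a mu a * w a - (\sum_(a < n ^ 2) mu a * (a < n)%N%:R) * c =
    \sum_a (mu a - th) * (w a - c * (a < n)%N%:R).
  have E1 : \sum_(a < n ^ 2) th * (w a - c * (a < n)%N%:R) = 0.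
    by rewrite -mulr_sumr sumrB wsum -mulr_sumr sum1 -/c [c * _]mulrC subrr mulr0.
  transitivity (\sum_a (mu a - th) * (w a - c * (a < n)%N%:R)
    + \sum_(a < n ^ 2) th * (w a - c * (a < n)%N%:R)); last by rewrite E1 addr0.
  rewrite mulr_suml -sumrB -big_split; apply: eq_bigr => a _ /=.
  by ring.
apply: sumr_ge0 => a _; case: (ltnP a n) => an /=.
  rewrite mulr1 mulr_le0 // ?subr_le0 ?w1 //.
  by apply: mono => /=; rewrite -ltnS prednK.
rewrite mulr0 subr0 mulr_ge0 // subr_ge0; apply: mono => /=.
exact: leq_trans (leq_pred n) an.
Qed.

End UnitaryTrace.

(** * Riemannian and Kaehler geometry in a chart *)


Section AbstractIdentities.
Context {R : realType}.

Lemma mxDE p q (A B : 'M[R]_(p, q)) i j : (A + B) i j = A i j + B i j.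
Proof. by rewrite mxE. Qed.

Lemma mxNE p q (A : 'M[R]_(p, q)) i j : (- A) i j = - A i j.
Proof. by rewrite mxE. Qed.

Lemma commutator_cancel p q (a b c d e c' e' : 'M[R]_(p, q)) :
  a + (b + c) + (d + e) - (a + (d + c') + (b + e')) = c - c' + (e - e').
Proof. by apply/matrixP => i j; rewrite !(mxDE, mxNE); ring. Qed.

Lemma skew_cancel m (G A B P Q : 'M[R]_m) :
  G *m P^T - G *m Q^T + (G *m (A^T *m B^T) - G *m (B^T *m A^T)) +
  (P - Q + (B *m A - A *m B)) *m G =
  P *m G + B *m (A *m G + G *m A^T) + ((A *m G + G *m A^T) *m B^T + G *m P^T) -
  (Q *m G + A *m (B *m G + G *m B^T) + ((B *m G + G *m B^T) *m A^T + G *m Q^T)).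
Proof.
rewrite !(mulmxDl, mulmxDr, mulNmx, mulmxA).
by apply/matrixP => i j; rewrite !(mxDE, mxNE); ring.
Qed.

(* The three symmetries of a curvature tensor imply the symmetry by pairs. *)
Lemma pair_symmetry (I : Type) (K : I -> I -> I -> I -> R) :
  (forall a b c d, K b a c d = - K a b c d) ->
  (forall a b c d, K a b d c = - K a b c d) ->
  (forall a b c d, K a b c d + K b c a d + K c a b d = 0) ->
  forall i j k l, K i j k l = K k l i j.
Proof.
move=> s12 s34 B i j k l.
have B1 := B i j k l; have B2 := B j k l i; have B3 := B k l i j; have B4 := B l i j k.
rewrite (s34 j k i l) (s34 k l i j) (s12 j l k i) in B2.
rewrite (s12 i l k j) (s34 i l j k) (s12 k i l j) (s34 k i j l) in B3.
rewrite (s12 i l j k) (s34 i j k l) (s34 j l k i) in B4.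
move: (K i j k l) (K k l i j) (K j k i l) (K i l j k) (K k i j l) (K j l k i) B1 B2 B3 B4.
by move=> a b c d e f B1 B2 B3 B4; lra.
Qed.

Lemma sum3_rev m (F : 'I_m -> 'I_m -> 'I_m -> R) :
  \sum_i \sum_j \sum_k F k j i = \sum_i \sum_j \sum_k F i j k.
Proof.
transitivity (\sum_i \sum_k \sum_j F k j i).
  by apply: eq_bigr => i _; rewrite exchange_big.
by rewrite exchange_big; apply: eq_bigr => k _; rewrite exchange_big.
Qed.

Lemma sum4_rev m (F : 'I_m -> 'I_m -> 'I_m -> 'I_m -> R) :
  \sum_i \sum_j \sum_k \sum_l F l k j i = \sum_i \sum_j \sum_k \sum_l F i j k l.
Proof.
transitivity (\sum_i \sum_j \sum_l \sum_k F l k j i).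
  by apply: eq_bigr => i _; apply: eq_bigr => j _; rewrite exchange_big.
rewrite (sum3_rev (fun l j i => \sum_k F l k j i)); apply: eq_bigr => l _.
transitivity (\sum_j \sum_k \sum_i F l k j i); last by rewrite exchange_big.
by apply: eq_bigr => j _; rewrite exchange_big.
Qed.

End AbstractIdentities.

Record local_metric {R : realType} {m : nat} (U : set 'rV[R]_m)
    (G : 'rV[R]_m -> 'M[R]_m) : Prop := LocalMetric {
  lm_open : open U;
  lm_smooth : smooth_mx U G;
  lm_posdef : forall y, U y -> posdef (G y)
}.

(** * Levi-Civita connection and curvature tensor *)

Section LeviCivita.
Context {R : realType} {m : nat}.
Variables (U : set 'rV[R]_m) (G : 'rV[R]_m -> 'M[R]_m).
Hypothesis LM : local_metric U G.
Let oU : open U := lm_open LM.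
Let smG : smooth_mx U G := lm_smooth LM.
Let pG : forall y, U y -> posdef (G y) := lm_posdef LM.

Definition Gam (k : 'I_m) (y : 'rV[R]_m) : 'M[R]_m :=
  \matrix_(a, b) christoffel G b k a y.

(** Only the column index is a vector index, so p vector fields are differentiated at once; [Rmx_J]
    applies this to the field of identity matrices. *)
Definition cov {p} (k : 'I_m) (Y : 'rV[R]_m -> 'M[R]_(p, m)) (y : 'rV[R]_m) :
  'M[R]_(p, m) := pmx k Y y + Y y *m Gam k y.

Definition nab (Y : 'rV[R]_m -> 'rV[R]_m) (y : 'rV[R]_m) : 'M[R]_m :=
  \matrix_(k, a) cov k Y y 0 a.

Definition Rmx (i j : 'I_m) (y : 'rV[R]_m) : 'M[R]_m :=
  \matrix_(k, l) riemann G i j k l y.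

(** Christoffel symbols of the first kind, arranged like [Gam]. *)
Definition low (k : 'I_m) (y : 'rV[R]_m) : 'M[R]_m := \matrix_(a, l)
  (2^-1 * (dmetric G k a l y + dmetric G a k l y - dmetric G l k a y)).

Lemma row_nab Y k y : row k (nab Y y) = cov k Y y.
Proof. by apply/rowP => a; rewrite !mxE. Qed.

Lemma nabE Y y k a : nab Y y k a = cov k Y y 0 a.
Proof. by rewrite mxE. Qed.

Lemma detG y : U y -> 0 < \det (G y).
Proof. by move=> Uy; exact: posdef_det (pG Uy). Qed.

Lemma unitG y : U y -> G y \in unitmx.
Proof. by move=> Uy; exact: posdef_unit (pG Uy). Qed.

Lemma symG y : U y -> (G y)^T = G y.
Proof. by move=> /pG[]. Qed.

Lemma dmetric_sym l i j y : U y -> dmetric G l i j y = dmetric G l j i y.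
Proof.
move=> Uy; apply: (partial_eq_on oU) Uy => z Uz.
by rewrite -[in RHS](symG Uz) mxE.
Qed.

Lemma GamE k y : U y -> Gam k y = low k y *m invmx (G y).
Proof.
move=> Uy; apply/matrixP => a b; rewrite !mxE /christoffel mulr_sumr.
apply: eq_bigr => l _.
have -> : invmx (G y) l b = invmx (G y) b l.
  by rewrite -[in RHS](symG Uy) -trmx_inv mxE.
by rewrite mxE; ring.
Qed.

Lemma Gam_low k y : U y -> Gam k y *m G y = low k y.
Proof. by move=> Uy; rewrite GamE // mulmxKV // unitG. Qed.

Lemma metric_compat k y : U y -> pmx k G y = Gam k y *m G y + G y *m (Gam k y)^T.
Proof.
move=> Uy; have -> : G y *m (Gam k y)^T = (Gam k y *m G y)^T.
  by rewrite trmx_mul (symG Uy).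
rewrite Gam_low //; apply/matrixP => a l; rewrite !mxE -/(dmetric G k a l y).
by rewrite (dmetric_sym k l a Uy); field.
Qed.

Lemma torsion_free k a b y : U y -> Gam k y a b = Gam a y k b.
Proof.
move=> Uy; rewrite !mxE /christoffel; congr (_ * _); apply: eq_bigr => l _.
by rewrite (dmetric_sym l k a Uy); congr (_ * _); ring.
Qed.

Lemma smooth_invG : smooth_mx U (fun y => invmx (G y)).
Proof. by apply: smooth_invmx => //; exact: detG. Qed.

Lemma smooth_Gam k : smooth_mx U (Gam k).
Proof.
apply: (@smooth_mx_ext _ _ _ oU _ _ (fun y => low k y *m invmx (G y))).
  by move=> y Uy; rewrite GamE.
apply: smooth_mulmx => //; last exact: smooth_invG.
move=> a l; have H i j c : smooth U (dmetric G i j c) by exact: smooth_partial (smG j c).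
have := smoothM oU (smooth_cst oU 2^-1) (smoothB oU (smoothD oU (H k a l) (H a k l)) (H l k a)).
by apply: smooth_ext => // y _; rewrite mxE.
Qed.

Lemma smooth_cov {p} k (Y : 'rV[R]_m -> 'M[R]_(p, m)) :
  smooth_mx U Y -> smooth_mx U (cov k Y).
Proof.
move=> HY; apply: smooth_mxD => //; first exact: smooth_pmx.
by apply: smooth_mulmx => //; exact: smooth_Gam.
Qed.

Lemma smooth_nab Y : smooth_mx U Y -> smooth_mx U (nab Y).
Proof.
move=> HY k a; apply: (@smooth_ext _ _ _ oU (fun y => cov k Y y 0 a)).
  by move=> y _; rewrite nabE.
exact: smooth_cov.
Qed.

Lemma RmxE i j y : Rmx i j y = pmx i (Gam j) y - pmx j (Gam i) y
  + (Gam j y *m Gam i y - Gam i y *m Gam j y).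
Proof.
have E k a b : (fun z => Gam k z a b) = christoffel G b k a.
  by apply/funext => z; rewrite mxE.
apply/matrixP => k l; rewrite !mxE !E /riemann; congr (_ + _).
by rewrite -sumrB; apply: eq_bigr => q _; rewrite !mxE.
Qed.

Lemma Rmx_skew12 i j y : Rmx j i y = - Rmx i j y.
Proof. by rewrite !RmxE opprD !opprB. Qed.

(** The coordinate fields commute, so no bracket term appears; the second partial derivatives cancel
    and the derivatives and commutator of [Gam] remain. *)
Lemma ricci_identity {p} i j (Y : 'rV[R]_m -> 'M[R]_(p, m)) y :
  smooth_mx U Y -> U y ->
  cov i (cov j Y) y - cov j (cov i Y) y = Y y *m Rmx i j y.
Proof.
move=> HY Uy.
have cc k l : cov k (cov l Y) y = pmx k (pmx l Y) y + (pmx k Y y *m Gam l y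
    + Y y *m pmx k (Gam l) y) + (pmx l Y y *m Gam k y + Y y *m Gam l y *m Gam k y).
  rewrite {1}/cov (pmxD (U := U)) //; [|exact: smooth_pmx|]; last first.
    by apply: smooth_mulmx => //; exact: smooth_Gam.
  by rewrite (pmxM (U := U)) //; [rewrite /cov mulmxDl|exact: smooth_Gam].
rewrite !cc (pmx_comm oU i j HY Uy) RmxE !mulmxDr !mulmxN !mulmxA.
exact: commutator_cancel.
Qed.

Lemma bianchi i j k l y : U y ->
  Rmx i j y k l + Rmx j k y i l + Rmx k i y j l = 0.
Proof.
move=> Uy.
have S a b c z : U z -> christoffel G a b c z = christoffel G a c b z.
  by move=> Uz; have := torsion_free b c a Uz; rewrite !mxE.
have dS p a b c : partial p (christoffel G a b c) y = partial p (christoffel G a c b) y.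
  by apply: (partial_eq_on oU) Uy => z Uz; exact: S.
rewrite !mxE /riemann.
rewrite (dS i l j k) (dS j l k i) (dS k l i j).
have E : \sum_(p < m) (christoffel G p j k y * christoffel G l i p y - christoffel G p i k y * christoffel G l j p y)
  + \sum_(p < m) (christoffel G p k i y * christoffel G l j p y - christoffel G p j i y * christoffel G l k p y)
  + \sum_(p < m) (christoffel G p i j y * christoffel G l k p y - christoffel G p k j y * christoffel G l i p y) = 0.
  rewrite -!big_split big1 // => p _ /=.
  have key (a b c x z w : R) : a * x - b * z + (b * z - c * w) + (c * w - a * x) = 0 by ring.
  by rewrite (S p j k y Uy) (S p k i y Uy) (S p i j y Uy); exact: key.
have key (a b c s1 s2 s3 : R) : s1 + s2 + s3 = 0 ->
  a - b + s1 + (b - c + s2) + (c - a + s3) = 0 by move=> H; lra.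
exact: key E.
Qed.

(** Each second partial derivative of [G] is expanded by metric compatibility; the vanishing of
    their commutator is the skewness of the curvature in its last two indices. *)
Lemma Rmx_skew34 i j y : U y -> (Rmx i j y *m G y)^T = - (Rmx i j y *m G y).
Proof.
move=> Uy.
have cc k l : pmx k (pmx l G) y = pmx k (Gam l) y *m G y
    + Gam l y *m (Gam k y *m G y + G y *m (Gam k y)^T)
    + ((Gam k y *m G y + G y *m (Gam k y)^T) *m (Gam l y)^T + G y *m (pmx k (Gam l) y)^T).
  transitivity (pmx k (fun z => Gam l z *m G z + G z *m (Gam l z)^T) y).
    by apply: (pmx_eq oU) Uy => z Uz; exact: metric_compat.
  have sT : smooth_mx U (fun z => (Gam l z)^T) by apply: smooth_tr => //; exact: smooth_Gam.
  rewrite (pmxD (U := U)) //; [|by apply: smooth_mulmx => //; exact: smooth_Gam|exact: smooth_mulmx].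
  rewrite (pmxM (U := U)) //; last exact: smooth_Gam.
  by rewrite (pmxM (U := U)) // -metric_compat // (pmx_tr oU).
have := pmx_comm oU i j smG Uy; rewrite !cc RmxE => H.
apply/eqP; rewrite -subr_eq0 opprK; apply/eqP.
rewrite trmx_mul (symG Uy) !linearD !linearN /= !trmx_mul.
move/eqP: H; rewrite -subr_eq0 => /eqP <-.
exact: skew_cancel.
Qed.

Definition Kmx i j k l y := (Rmx i j y *m G y) k l.

Lemma Rmx_pair i j k l y : U y -> Kmx i j k l y = Kmx k l i j y.
Proof.
move=> Uy.
have s12 a b c d : Kmx b a c d y = - Kmx a b c d y.
  by rewrite /Kmx Rmx_skew12 mulNmx mxE.
have s34 a b c d : Kmx a b d c y = - Kmx a b c d y.
  by have := Rmx_skew34 a b Uy => /matrixP/(_ c d); rewrite mxE [RHS]mxE.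
apply: (@pair_symmetry R 'I_m (fun a b c d => Kmx a b c d y)) => // a b c d.
have KE a' b' c' d' : Kmx a' b' c' d' y = \sum_p Rmx a' b' y c' p * G y p d'.
  by rewrite /Kmx mxE.
rewrite !KE -!big_split big1 // => p _ /=.
by rewrite -!mulrDl bianchi // mul0r.
Qed.

Definition RmG (X Y Z W : 'rV[R]_m) y := Rm G X Y Z W y.

Lemma RmE X Y Z W y : RmG X Y Z W y =
  \sum_i \sum_j \sum_k \sum_l X 0 i * Y 0 j * W 0 k * Z 0 l * Kmx i j k l y.
Proof.
apply: eq_bigr => i _; apply: eq_bigr => j _; apply: eq_bigr => k _.
have -> : \row_k0 riemann G i j k k0 y = row k (Rmx i j y).
  by apply/rowP => a; rewrite !mxE.
rewrite /inner -row_mul mxE mulr_sumr; apply: eq_bigr => l _.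
by rewrite /Kmx !mxE; ring.
Qed.

Lemma Rm_matrix X Y Z W y : RmG X Y Z W y =
  \sum_i \sum_j X 0 i * Y 0 j * inner (G y) (W *m Rmx i j y) Z.
Proof.
rewrite RmE; apply: eq_bigr => i _; apply: eq_bigr => j _.
rewrite /inner mxE mulr_sumr exchange_big; apply: eq_bigr => l _.
rewrite [Z^T _ _]mxE -mulmxA mxE mulr_suml mulr_sumr; apply: eq_bigr => k _.
by rewrite /Kmx; ring.
Qed.

Lemma Rm_pair X Y Z W y : U y -> RmG X Y Z W y = RmG Z W X Y y.
Proof.
move=> Uy; rewrite !RmE.
have s12 a b c d : Kmx b a c d y = - Kmx a b c d y.
  by rewrite /Kmx Rmx_skew12 mulNmx mxE.
have s34 a b c d : Kmx a b d c y = - Kmx a b c d y.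
  by have := Rmx_skew34 a b Uy => /matrixP/(_ c d); rewrite mxE [RHS]mxE.
transitivity (\sum_i \sum_j \sum_k \sum_l Z 0 l * W 0 k * Y 0 j * X 0 i * Kmx l k j i y).
  do 4! apply: eq_bigr => ? _.
  by rewrite Rmx_pair // s12 s34; ring.
exact: (sum4_rev (fun i j k l => Z 0 i * W 0 j * Y 0 k * X 0 l * Kmx i j k l y)).
Qed.

End LeviCivita.


(** * Divergence and Ricci curvature *)

Section DivergenceFormulas.
Context {R : realType} {m : nat}.
Variables (U : set 'rV[R]_m) (G : 'rV[R]_m -> 'M[R]_m).
Hypothesis LM : local_metric U G.
Let oU : open U := lm_open LM.
Let smG : smooth_mx U G := lm_smooth LM.
Local Notation Gam := (Gam G).
Local Notation cov := (cov G).
Local Notation nab := (nab G).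
Local Notation Rmx := (Rmx G).

Lemma trace_nab (Y : 'rV[R]_m -> 'rV[R]_m) y : U y ->
  \tr (nab Y y) = \sum_k partial k (fun z => Y z 0 k) y + \sum_b Y y 0 b * \tr (Gam b y).
Proof.
move=> Uy.
transitivity (\sum_k (partial k (fun z => Y z 0 k) y + \sum_b Y y 0 b * Gam b y k k)).
  apply: eq_bigr => k _; rewrite !mxE; congr (_ + _); apply: eq_bigr => b _.
  by rewrite (torsion_free LM k b k Uy).
rewrite big_split; congr (_ + _); rewrite exchange_big; apply: eq_bigr => b _.
by rewrite mulr_sumr.
Qed.

(** Jacobi's formula for the determinant, where tr (G^-1 d_k G) = 2 tr (Gam k) by metric
    compatibility. *)
Lemma partial_sqrt_det k y : U y ->
  partial k (fun z => Num.sqrt (\det (G z))) y = Num.sqrt (\det (G y)) * \tr (Gam k y).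
Proof.
move=> Uy; have dG0 z : U z -> 0 < \det (G z) by exact: (detG LM).
have dG : smooth U (fun z => \det (G z)) by exact: smooth_det.
have sG := smooth_sqrt oU dG0 dG.
pose q z := Num.sqrt (\det (G z)).
have q0 : q y != 0 by rewrite gt_eqF // sqrtr_gt0 dG0.
have E : partial k (fun z => \det (G z)) y = q y * partial k q y + q y * partial k q y.
  rewrite -(partialM (U := U)) //; apply: (partial_eq_on oU) Uy => z Uz.
  by rewrite -expr2 sqr_sqrtr // ltW // dG0.
have tr : \tr (invmx (G y) *m pmx k G y) = 2 * \tr (Gam k y).
  rewrite (metric_compat LM) // mulmxDr mulmxA mxtraceD mulmxA mulVmx ?(unitG LM) //.
  rewrite mul1mx mxtrace_tr [X in X + _]mxtrace_mulC mulmxA mulmxV ?(unitG LM) // mul1mx.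
  by rewrite mulr_natl mulr2n.
move: E; rewrite (partial_det oU) ?(unitG LM) // tr.
move=> E; have D : \det (G y) = q y * q y by rewrite -expr2 sqr_sqrtr // ltW // dG0.
rewrite D in E; change (partial k q y = q y * \tr (Gam k y)).
apply: (mulfI q0); move: E.
move: (q y) (partial k q y) (\tr (Gam k y)) => a b c E; lra.
Qed.

(** The link between the trace of the covariant derivative and integration by parts against the
    Riemannian density. *)
Lemma div_density (Y : 'rV[R]_m -> 'rV[R]_m) y : smooth_mx U Y -> U y ->
  \sum_k partial k (fun z => Num.sqrt (\det (G z)) * Y z 0 k) y
  = Num.sqrt (\det (G y)) * \tr (nab Y y).
Proof.
move=> HY Uy.
have sG : smooth U (fun z => Num.sqrt (\det (G z))).
  by apply: smooth_sqrt => //; [exact: (detG LM)|exact: smooth_det].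
rewrite trace_nab // mulrDr !mulr_sumr -big_split; apply: eq_bigr => k _ /=.
by rewrite (partialM _ sG (HY 0 k) Uy) partial_sqrt_det //; ring.
Qed.

(** Bochner's formula for an arbitrary field Y: the divergence of the derivative of Y along itself.
    No closedness is required, so that it applies to J grad u as well as to grad u. The Ricci term
    arises from exchanging two covariant derivatives. *)
Lemma div_nab (Y : 'rV[R]_m -> 'rV[R]_m) y : smooth_mx U Y -> U y ->
  \tr (nab (fun z => Y z *m nab Y z) y) =
  \tr (nab Y y *m nab Y y) + \sum_k Y y 0 k * partial k (fun z => \tr (nab Y z)) y
  + \sum_a \sum_k Y y 0 k * (Y y *m Rmx a k y) 0 a.
Proof.
move=> HY Uy; have sB := smooth_nab LM HY.
have covE a : cov a (fun z => Y z *m nab Y z) y =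
    pmx a Y y *m nab Y y + \sum_k Y y 0 k *: cov a (cov k Y) y.
  rewrite /cov (pmxM oU) // -addrA; congr (_ + _).
  rewrite -mulmxA -mulmxDr mulmx_sum_row; apply: eq_bigr => k _; congr (_ *: _).
  apply/rowP => b; rewrite !mxE; congr (_ + _).
    by apply: (partial_eq_on oU) Uy => z Uz; rewrite mxE.
  by apply: eq_bigr => c _; rewrite !mxE.
have step1 a : cov a (fun z => Y z *m nab Y z) y 0 a =
    (pmx a Y y *m nab Y y) 0 a + \sum_k Y y 0 k * cov k (cov a Y) y 0 a
    + \sum_k Y y 0 k * (Y y *m Rmx a k y) 0 a.
  rewrite covE mxE -addrA; congr (_ + _); rewrite summxE -big_split; apply: eq_bigr => k _.
  rewrite mxE /= -mulrDr; congr (_ * _).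
  rewrite -(ricci_identity LM a k HY Uy) (mxDE (cov a (cov k Y) y)) (mxNE (cov k (cov a Y) y)).
  by rewrite addrC subrK.
transitivity (\sum_a cov a (fun z => Y z *m nab Y z) y 0 a).
  by apply: eq_bigr => a _; rewrite mxE.
under eq_bigr do rewrite step1.
rewrite !big_split /=; congr (_ + _).
rewrite [X in _ + X]exchange_big /=.
have -> : \sum_k \sum_a Y y 0 k * cov k (cov a Y) y 0 a =
    \sum_k Y y 0 k * partial k (fun z => \tr (nab Y z)) y
    + \sum_k Y y 0 k * \sum_a \sum_b nab Y y a b * Gam k y b a.
  rewrite -big_split; apply: eq_bigr => k _; rewrite -mulr_sumr /= -mulrDr; congr (_ * _).
  rewrite /mxtrace (partial_sum oU) // -big_split; apply: eq_bigr => a _ /=.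
  rewrite /cov mxE pmxE; congr (_ + _).
    by apply: (partial_eq_on oU) Uy => z Uz; rewrite nabE.
  by rewrite mxE; apply: eq_bigr => b _; rewrite nabE.
rewrite addrCA [RHS]addrC; congr (_ + _).
rewrite /mxtrace.
have -> : \sum_k Y y 0 k * (\sum_a \sum_b nab Y y a b * Gam k y b a) =
    \sum_a \sum_b nab Y y a b * (Y y *m Gam b y) 0 a.
  transitivity (\sum_k \sum_a \sum_b nab Y y a b * (Y y 0 k * Gam b y k a)).
    apply: eq_bigr => k _; rewrite mulr_sumr; apply: eq_bigr => a _.
    rewrite mulr_sumr; apply: eq_bigr => b _.
    by rewrite (torsion_free LM k b a Uy); ring.
  rewrite exchange_big; apply: eq_bigr => a _; rewrite exchange_big; apply: eq_bigr => b _.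
  by rewrite /= -mulr_sumr; congr (_ * _); rewrite [RHS]mxE.
have -> : \sum_a (pmx a Y y *m nab Y y) 0 a = \sum_a \sum_b nab Y y a b * pmx b Y y 0 a.
  rewrite exchange_big; apply: eq_bigr => a _; rewrite mxE; apply: eq_bigr => b _.
  by rewrite mulrC.
rewrite -big_split; apply: eq_bigr => a _; rewrite -big_split mxE; apply: eq_bigr => b _ /=.
by rewrite -mulrDr [nab Y y b a]nabE /cov mxDE.
Qed.

(** The Ricci curvature of X, as the trace of V |-> R(V, X) X. *)
Definition ric (X : 'rV[R]_m) (y : 'rV[R]_m) : R :=
  \sum_a \sum_k X 0 k * (X *m Rmx a k y) 0 a.

Lemma ric_frame (P : 'M[R]_m) X y : U y -> P *m G y *m P^T = 1%:M ->
  ric X y = \sum_j Rm G X (row j P) X (row j P) y.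
Proof.
move=> Uy PGP; have PP : P^T *m P = invmx (G y) by rewrite (frame_inv PGP).
have E k a : invmx (G y) *m Rmx k a y *m G y = - (Rmx k a y)^T.
  have := Rmx_skew34 LM k a Uy; rewrite trmx_mul (symG LM Uy) => H.
  rewrite -mulmxA -[Rmx k a y *m G y]opprK -H mulmxN mulmxA mulVmx ?(unitG LM) //.
  by rewrite mul1mx.
have -> : \sum_j Rm G X (row j P) X (row j P) y =
    \sum_k \sum_a X 0 k * \sum_j P j a * (row j P *m Rmx k a y *m G y *m X^T) 0 0.
  transitivity (\sum_j \sum_k \sum_a X 0 k * (P j a * (row j P *m Rmx k a y *m G y *m X^T) 0 0)).
    apply: eq_bigr => j _; rewrite -/(RmG _ _ _ _ _ _) Rm_matrix.
    apply: eq_bigr => k _; apply: eq_bigr => a _; rewrite mxE /inner; ring.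
  rewrite exchange_big; apply: eq_bigr => k _; rewrite exchange_big; apply: eq_bigr => a _.
  by rewrite mulr_sumr.
rewrite /ric exchange_big; apply: eq_bigr => k _; apply: eq_bigr => a _; congr (_ * _).
have -> : \sum_j P j a * (row j P *m Rmx k a y *m G y *m X^T) 0 0 =
    (invmx (G y) *m Rmx k a y *m G y *m X^T) a 0.
  rewrite -PP -!mulmxA mxE; apply: eq_bigr => j _; congr (_ * _).
    by rewrite mxE.
  by rewrite !mulmxA -!row_mul mxE.
by rewrite E mulNmx mxNE -trmx_mul [in RHS]mxE (Rmx_skew12 G k a) mulmxN mxNE.
Qed.

End DivergenceFormulas.


Lemma sqnorm_derivative {R : realType} m (X D : 'rV[R]_m) (G C : 'M[R]_m) : G^T = G ->
  (D *m G + X *m (C *m G + G *m C^T)) *m X^T + X *m G *m D^T =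
  (D + X *m C) *m G *m X^T + ((D + X *m C) *m G *m X^T)^T.
Proof.
move=> GT; rewrite !trmx_mul trmxK GT [(_ + _)^T]linearD /= trmx_mul.
rewrite !(mulmxDr, mulmxDl) !mulmxA.
by apply/matrixP => i j; rewrite !mxDE; ring.
Qed.

Section GradientFields.
Context {R : realType} {m : nat}.
Variables (U : set 'rV[R]_m) (G : 'rV[R]_m -> 'M[R]_m) (u : 'rV[R]_m -> R).
Hypothesis LM : local_metric U G.
Hypothesis smu : smooth U u.
Let oU : open U := lm_open LM.
Let smG : smooth_mx U G := lm_smooth LM.
Local Notation Gam := (Gam G).
Local Notation cov := (cov G).
Local Notation nab := (nab G).
Local Notation Rmx := (Rmx G).
Local Notation ric := (ric G).

Lemma cov_eq {p} k (Y Z : 'rV[R]_m -> 'M[R]_(p, m)) y :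
  (forall z, U z -> Y z = Z z) -> U y -> cov k Y y = cov k Z y.
Proof. by move=> E Uy; rewrite /cov (pmx_eq oU _ E Uy) E. Qed.

Definition drow (f : 'rV[R]_m -> R) (y : 'rV[R]_m) : 'rV[R]_m := \row_k partial k f y.

Lemma smooth_drow f : smooth U f -> smooth_mx U (drow f).
Proof.
move=> Hf i k; apply: smooth_ext (smooth_partial k Hf) => // y _; by rewrite mxE.
Qed.

Definition gradf (y : 'rV[R]_m) : 'rV[R]_m := drow u y *m invmx (G y).

Definition hess (y : 'rV[R]_m) : 'M[R]_m := \matrix_(k, l) hessian G u k l y.

Lemma smooth_gradf : smooth_mx U gradf.
Proof. by apply: smooth_mulmx => //; [exact: smooth_drow|exact: (smooth_invG LM)]. Qed.

Lemma gradf_G y : U y -> gradf y *m G y = drow u y.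
Proof. by move=> Uy; rewrite /gradf mulmxKV // (unitG LM). Qed.

(** Lowering the index is parallel, so both sides are the covariant derivative of the 1-form dual to
    Y. *)
Lemma cov_flat (Y : 'rV[R]_m -> 'rV[R]_m) k y : smooth_mx U Y -> U y ->
  cov k Y y *m G y = pmx k (fun z => Y z *m G z) y - Y y *m G y *m (Gam k y)^T.
Proof.
move=> HY Uy; rewrite (pmxM oU) // (metric_compat LM) // mulmxDl mulmxDr -!mulmxA.
by rewrite -addrA addrK.
Qed.

Lemma nab_grad_hess y : U y -> nab gradf y *m G y = hess y.
Proof.
move=> Uy; apply/row_matrixP => k; rewrite row_mul row_nab.
rewrite cov_flat //; last exact: smooth_gradf.
have -> : pmx k (fun z => gradf z *m G z) y = pmx k (drow u) y.
  by apply: (pmx_eq oU) Uy => z; exact: gradf_G.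
rewrite gradf_G //; apply/rowP => l; rewrite !mxE /hessian; congr (_ - _).
  by apply: (partial_eq_on oU) Uy => z _; rewrite mxE.
by apply: eq_bigr => a _; rewrite !mxE mulrC.
Qed.

Lemma hess_sym y : U y -> (hess y)^T = hess y.
Proof.
move=> Uy; apply/matrixP => k l; rewrite !mxE /hessian (smooth_partial_comm oU l k smu Uy).
congr (_ - _); apply: eq_bigr => a _; congr (_ * _).
by have := torsion_free LM l k a Uy; rewrite !mxE.
Qed.

Lemma trace_nab_grad y : U y ->
  \tr (nab gradf y) = \sum_i \sum_j invmx (G y) i j * hessian G u i j y.
Proof.
move=> Uy; rewrite -[nab _ _](mulmxK (unitG LM Uy)) nab_grad_hess //.
rewrite mxtrace_mulC; apply: eq_bigr => i _; rewrite mxE; apply: eq_bigr => j _.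
by rewrite -[in LHS](hess_sym Uy) !mxE.
Qed.

Definition sqnorm (y : 'rV[R]_m) : R := inner (G y) (gradf y) (gradf y).

Lemma drow_sqnorm y : U y -> drow sqnorm y = 2 *: (gradf y *m nab gradf y *m G y).
Proof.
move=> Uy; apply/rowP => k; rewrite mxE.
have sX := smooth_gradf.
have -> : partial k sqnorm y = (pmx k (fun y => gradf y *m G y *m (gradf y)^T) y) 0 0.
  by rewrite mxE.
rewrite (pmxM oU) //; [|exact: smooth_mulmx|exact: smooth_tr].
rewrite (pmxM oU) // (pmx_tr oU) // (metric_compat LM) //.
have -> : (pmx k gradf y *m G y + gradf y *m (Gam k y *m G y + G y *m (Gam k y)^T)) *m (gradf y)^T
   + gradf y *m G y *m (pmx k gradf y)^T =
   cov k gradf y *m G y *m (gradf y)^T + (cov k gradf y *m G y *m (gradf y)^T)^T.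
  exact: sqnorm_derivative (symG LM Uy).
have -> : cov k gradf y *m G y = row k (hess y).
  by rewrite -row_nab -row_mul nab_grad_hess.
rewrite -mulmxA nab_grad_hess // -[in RHS](hess_sym Uy) mxDE [X in _ + X]mxE -mulr2n [RHS]mxE -[LHS]mulr_natl.
congr (_ * _); rewrite !mxE; apply: eq_bigr => a _; rewrite !mxE; ring.
Qed.

Lemma div_grad_sqnorm y : U y -> (forall z, U z -> \tr (nab gradf z) = 0) ->
  \tr (nab (fun z => gradf z *m nab gradf z) y) =
  \tr (nab gradf y *m nab gradf y) + ric (gradf y) y.
Proof.
move=> Uy H; rewrite (div_nab LM smooth_gradf Uy) -/(ric _ _) [X in _ + X + _]big1 ?addr0 //.
move=> k _; rewrite [partial _ _ _](_ : _ = 0) ?mulr0 // -(partial_cst 0 k y).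
exact: (partial_eq_on oU).
Qed.

End GradientFields.

(** * Kaehler identities in a chart *)

Section KahlerCharts.
Context {R : realType} {m : nat}.
Variables (U : set 'rV[R]_m) (G J : 'rV[R]_m -> 'M[R]_m) (u : 'rV[R]_m -> R).
Hypothesis LM : local_metric U G.
Hypothesis smu : smooth U u.
Hypothesis smJ : smooth_mx U J.
Hypothesis JJ : forall y, U y -> J y *m J y = - 1%:M.
Hypothesis JG : forall y, U y -> J y *m G y *m (J y)^T = G y.
Hypothesis Jpar : forall y, U y -> forall k, pmx k J y = Gam G k y *m J y - J y *m Gam G k y.
Let oU : open U := lm_open LM.
Let smG : smooth_mx U G := lm_smooth LM.
Local Notation Gam := (Gam G).
Local Notation cov := (cov G).
Local Notation nab := (nab G).
Local Notation Rmx := (Rmx G).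
Local Notation ric := (ric G).
Local Notation gradf := (gradf G u).
Local Notation hess := (hess G u).

Lemma JG_skew y : U y -> J y *m G y = - (G y *m (J y)^T).
Proof.
move=> Uy; rewrite -{2}(JG Uy) -!mulmxA -trmx_mul (JJ Uy).
by rewrite linearN /= trmx1 mulmxN mulmx1 mulmxN opprK.
Qed.

Lemma cov_J {p} k (Y : 'rV[R]_m -> 'M[R]_(p, m)) y : smooth_mx U Y -> U y ->
  cov k (fun z => Y z *m J z) y = cov k Y y *m J y.
Proof.
move=> HY Uy; rewrite /cov (pmxM oU) // Jpar // mulmxBr mulmxDl !mulmxA.
by rewrite -addrA subrK.
Qed.

(** As J is parallel, [cov] commutes with right multiplication by J; the Ricci identities for the
    identity matrix and for J are then compared. *)
Lemma Rmx_J i j y : U y -> Rmx i j y *m J y = J y *m Rmx i j y.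
Proof.
move=> Uy.
have s1 : smooth_mx U (fun=> 1%:M : 'M[R]_m) by exact: smooth_mx_cst.
have E := ricci_identity LM i j s1 Uy.
have sJ' : smooth_mx U (fun z => (1%:M : 'M[R]_m) *m J z) by exact: smooth_mulmx.
have H := ricci_identity LM i j sJ' Uy.
have cc k l : cov k (cov l (fun z => (1%:M : 'M[R]_m) *m J z)) y =
    cov k (cov l (fun=> 1%:M : 'M[R]_m)) y *m J y.
  rewrite -cov_J //; last exact: (smooth_cov LM).
  by apply: (cov_eq LM) => // z Uz; rewrite cov_J.
have H2 : 1%:M *m Rmx i j y *m J y = 1%:M *m J y *m Rmx i j y.
  by rewrite -E mulmxBl -!cc; exact: H.
by rewrite !mul1mx in H2.
Qed.

(** That the curvature commutes with J gives invariance in the last pair of arguments; the pair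
    symmetry transfers it to the first pair. *)
Lemma Rm_J12 X Y Z W y : U y ->
  Rm G (X *m J y) (Y *m J y) Z W y = Rm G X Y Z W y.
Proof.
move=> Uy; rewrite -!/(RmG _ _ _ _ _ _) (Rm_pair LM) // [RHS](Rm_pair LM) // !Rm_matrix.
apply: eq_bigr => i _; apply: eq_bigr => j _; congr (_ * _).
rewrite -mulmxA -Rmx_J // mulmxA /inner trmx_mul -!mulmxA.
have -> // : J y *m (G y *m ((J y)^T *m X^T)) = G y *m X^T by rewrite !mulmxA JG.
Qed.

Lemma Rm_J X Y Z W y : U y ->
  Rm G (X *m J y) (Y *m J y) (Z *m J y) (W *m J y) y = Rm G X Y Z W y.
Proof.
move=> Uy; rewrite Rm_J12 // -!/(RmG _ _ _ _ _ _) (Rm_pair LM) //.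
by rewrite {1}/RmG Rm_J12 // -/(RmG _ _ _ _ _ _) (Rm_pair LM).
Qed.

(** J maps an orthonormal frame to an orthonormal frame, and the Ricci curvature may be computed in
    either. *)
Lemma ric_J X y : U y -> ric (X *m J y) y = ric X y.
Proof.
move=> Uy; have [P PGP] := orthonormal_frame (lm_posdef LM Uy).
have PGP' : (P *m J y) *m G y *m (P *m J y)^T = 1%:M.
  by rewrite trmx_mul !mulmxA -2!(mulmxA P) JG.
rewrite (ric_frame LM _ Uy PGP') (ric_frame LM _ Uy PGP).
by apply: eq_bigr => j _; rewrite row_mul Rm_J.
Qed.

(** The divergence of J grad u is the contraction of the Hessian, which is symmetric, with the skew
    matrix G^-1 J. *)
Lemma trace_nab_gradJ y : U y -> \tr (nab gradf y *m J y) = 0.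
Proof.
move=> Uy; have uG := unitG LM Uy.
have H : nab gradf y = hess y *m invmx (G y) by rewrite -(nab_grad_hess LM smu) // mulmxK.
have S : (invmx (G y) *m J y)^T = - (invmx (G y) *m J y).
  apply: (can_inj (mulKmx uG)); rewrite mulmxN mulKVmx //.
  apply: (can_inj (mulmxK uG)); rewrite mulNmx JG_skew // opprK.
  by rewrite trmx_mul trmx_inv (symG LM Uy) -!mulmxA mulVmx // mulmx1.
have : \tr (hess y *m (invmx (G y) *m J y)) = - \tr (hess y *m (invmx (G y) *m J y)).
  rewrite -{1}mxtrace_tr trmx_mul S mulNmx (hess_sym LM smu Uy) raddfN; congr (- _).
  by rewrite mxtrace_mulC.
rewrite H -mulmxA; set t := \tr _; lra.
Qed.

Lemma nab_J (Y : 'rV[R]_m -> 'rV[R]_m) y : smooth_mx U Y -> U y ->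
  nab (fun z => Y z *m J z) y = nab Y y *m J y.
Proof.
move=> HY Uy; apply/row_matrixP => k; rewrite row_mul !row_nab; exact: cov_J.
Qed.

(* twice the pairing of grad u with the J-commuting part of its covariant derivative *)
Definition plurifield (y : 'rV[R]_m) : 'rV[R]_m :=
  gradf y *m (nab gradf y - J y *m nab gradf y *m J y).

(** With X = grad u, the field is the derivative of X along X minus the derivative of JX along JX.
    Bochner's formula applies to both terms: X and JX are divergence free, and the two Ricci terms
    cancel by [ric_J]. No curvature assumption is therefore involved. *)
Lemma div_plurifield y : U y -> (forall z, U z -> \tr (nab gradf z) = 0) ->
  \tr (nab plurifield y) = \tr (nab gradf y *m nab gradf y)
    - \tr (nab gradf y *m J y *m (nab gradf y *m J y)).
Proof.
move=> Uy H; have sX := smooth_gradf LM smu.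
pose Z z := gradf z *m J z.
have sZ : smooth_mx U Z by exact: smooth_mulmx.
pose B z := Z z *m nab Z z.
have sB : smooth_mx U B by apply: smooth_mulmx => //; exact: (smooth_nab LM).
pose C z := gradf z *m nab gradf z.
have sC : smooth_mx U C by apply: smooth_mulmx => //; exact: (smooth_nab LM).
have E z : U z -> plurifield z = C z + - B z.
  by move=> Uz; rewrite /plurifield /B nab_J // mulmxBr !mulmxA.
have Enab : nab plurifield y = nab C y - nab B y.
  apply/row_matrixP => k; rewrite linearB /= !row_nab (cov_eq LM k E Uy) /cov.
  rewrite (pmxD oU) //; last exact: smooth_mxN.
  rewrite (pmxN oU) // mulmxDl mulNmx opprD; exact: addrACA.
rewrite Enab raddfB /= (div_grad_sqnorm LM smu Uy H).
rewrite (div_nab LM sZ Uy) -/(ric _ _) ric_J // [X in _ + X + _]big1 ?addr0.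
  by rewrite nab_J //; ring.
move=> k _; rewrite [partial _ _ _](_ : _ = 0) ?mulr0 // -(partial_cst 0 k y).
by apply: (partial_eq_on oU) Uy => z Uz; rewrite nab_J // trace_nab_gradJ.
Qed.

(* The same field in terms of the exterior derivative of the form g(J grad u, -),
   which is manifestly independent of the chart. *)
Definition dform (th : 'rV[R]_m -> 'rV[R]_m) (y : 'rV[R]_m) : 'M[R]_m :=
  \matrix_(a, b) (partial a (fun z => th z 0 b) y - partial b (fun z => th z 0 a) y).

Lemma plurifield_dform y : U y -> plurifield y =
  - (gradf y *m J y *m dform (fun z => gradf z *m J z *m G z) y *m invmx (G y)).
Proof.
move=> Uy; have sX := smooth_gradf LM smu.
pose Z z := gradf z *m J z.
have sZ : smooth_mx U Z by exact: smooth_mulmx.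
have D : dform (fun z => gradf z *m J z *m G z) y = nab Z y *m G y - (nab Z y *m G y)^T.
  apply/matrixP => a b; rewrite mxDE mxNE [(_^T) _ _]mxE.
  have E k l : (nab Z y *m G y) k l = partial k (fun z => (Z z *m G z) 0 l) y
      - (Z y *m G y *m (Gam k y)^T) 0 l.
    have := cov_flat LM k sZ Uy; rewrite -row_nab -row_mul => /rowP/(_ l).
    by rewrite mxE mxDE mxNE pmxE.
  rewrite mxE !E -/Z.
  have -> : (Z y *m G y *m (Gam b y)^T) 0 a = (Z y *m G y *m (Gam a y)^T) 0 b.
    rewrite mxE [RHS]mxE; apply: eq_bigr => c _; rewrite [X in _ * X]mxE [X in _ = _ * X]mxE.
    by rewrite (torsion_free LM b a c Uy).
  ring.
rewrite D nab_J // !trmx_mul (symG LM Uy).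
have uG := unitG LM Uy.
have AG : G y *m (nab gradf y)^T = nab gradf y *m G y.
  by rewrite -[in LHS](symG LM Uy) -trmx_mul (nab_grad_hess LM smu) // (hess_sym LM smu).
have E2 : G y *m ((J y)^T *m (nab gradf y)^T) = - (J y *m nab gradf y *m G y).
  have GJ : G y *m (J y)^T = - (J y *m G y) by rewrite JG_skew // opprK.
  by rewrite mulmxA GJ mulNmx -[J y *m G y *m _]mulmxA AG mulmxA.
rewrite E2 opprK -mulmxDl -[_ *m (_ *m G y) *m _]mulmxA mulmxK // /plurifield.
rewrite mulmxDr mulmxBr !mulmxA -(mulmxA (gradf y) (J y) (J y)) JJ // mulmxN mulmx1 mulNmx.
by rewrite opprD opprK addrC.
Qed.

End KahlerCharts.


(** * Pointwise inequalities in an orthonormal frame *)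

Section PointwiseBounds.
Context {R : realType} {m : nat}.
Variables (G P : 'M[R]_m).
Hypothesis GT : G^T = G.
Hypothesis PGP : P *m G *m P^T = 1%:M.

(* a vector and an endomorphism in the coordinates of the orthonormal frame P *)
Definition frv (x : 'rV[R]_m) := x *m G *m P^T.
Definition fr (A : 'M[R]_m) := P *m A *m G *m P^T.

Lemma frvK x : frv x *m P = x.
Proof. by rewrite /frv -!mulmxA [G *m _]mulmxA (frame_GPK PGP) mulmx1. Qed.

Lemma frP A : fr A *m P = P *m A.
Proof. by rewrite /fr -!mulmxA [G *m _]mulmxA (frame_GPK PGP) mulmx1. Qed.

Lemma frM A B : fr A *m fr B = fr (A *m B).
Proof. by rewrite [fr B]/fr !mulmxA frP [in RHS]/fr !mulmxA. Qed.

Lemma frvM x A : frv x *m fr A = frv (x *m A).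
Proof. by rewrite /fr !mulmxA frvK. Qed.

Lemma tr_fr A : \tr (fr A) = \tr A.
Proof.
by rewrite /fr -!mulmxA mxtrace_mulC -!mulmxA [G *m _]mulmxA (frame_GPK PGP) mulmx1.
Qed.

Lemma fr_sym A : A *m G = G *m A^T -> (fr A)^T = fr A.
Proof. by move=> H; rewrite /fr !trmx_mul trmxK GT -(mulmxA P A) H !mulmxA. Qed.

Lemma fr_skew A : A *m G = - (G *m A^T) -> (fr A)^T = - fr A.
Proof.
by move=> H; rewrite /fr !trmx_mul trmxK GT -(mulmxA P A) H mulmxN mulNmx opprK !mulmxA.
Qed.

Lemma fr1 : fr 1%:M = 1%:M.
Proof. by rewrite /fr mulmx1. Qed.

Lemma frN A : fr (- A) = - fr A.
Proof. by rewrite /fr mulmxN !mulNmx. Qed.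

Lemma dot_frv x y : dot (frv x) (frv y) = inner G x y.
Proof.
rewrite dotE /frv /inner !trmx_mul trmxK GT !mulmxA.
by rewrite -(mulmxA (x *m G) P^T P) -(mulmxA (x *m G) (P^T *m P) G) (frame_PG PGP) mulmx1.
Qed.

Variable J : 'M[R]_m.
Hypothesis JJ : J *m J = - 1%:M.
Hypothesis JG : J *m G = - (G *m J^T).

Lemma frJJ : fr J *m fr J = - 1%:M.
Proof. by rewrite frM JJ frN fr1. Qed.

Lemma frJT : (fr J)^T = - fr J.
Proof. exact: fr_skew. Qed.

(* twice the J-commuting part *)
Definition jpart (A : 'M[R]_m) := A - J *m A *m J.

Variable A : 'M[R]_m.
Hypothesis AG : A *m G = G *m A^T.

Lemma jpart_sym : jpart A *m G = G *m (jpart A)^T.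
Proof.
have JAJG : (J *m A *m J) *m G = G *m (J *m A *m J)^T.
  rewrite -(mulmxA (J *m A)) JG mulmxN (mulmxA (J *m A)) -(mulmxA J A G) AG.
  by rewrite (mulmxA J G) JG !mulNmx opprK !trmx_mul !mulmxA.
by rewrite /jpart mulmxBl AG JAJG [(_ - _)^T]linearB /= mulmxBr.
Qed.

(** [jpart A] is self-adjoint, so its square norm is the trace of its square, in which the four
    terms coincide in pairs up to J^2 = -1. *)
Lemma trace_jpart : \tr (fr (jpart A) *m (fr (jpart A))^T) =
  2 * (\tr (A *m A) - \tr (A *m J *m (A *m J))).
Proof.
rewrite (fr_sym jpart_sym) frM tr_fr /jpart mulmxBr !mulmxBl !raddfB /=.
have E1 : \tr (J *m A *m J *m A) = \tr (A *m J *m (A *m J)).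
  by rewrite -!mulmxA mxtrace_mulC !mulmxA.
have E2 : \tr (A *m (J *m A *m J)) = \tr (A *m J *m (A *m J)) by rewrite !mulmxA.
have E3 : \tr (J *m A *m J *m (J *m A *m J)) = \tr (A *m A).
  have -> : J *m A *m J *m (J *m A *m J) = - (J *m (A *m A *m J)).
    by rewrite !mulmxA -(mulmxA (J *m A) J J) JJ mulmxN mulmx1 !mulNmx.
  by rewrite raddfN /= (mxtrace_mulC J) -(mulmxA (A *m A)) JJ mulmxN mulmx1 raddfN opprK.
rewrite E1 E2 E3; ring.
Qed.

Lemma pluri_trace_ge0 : 0 <= \tr (A *m A) - \tr (A *m J *m (A *m J)).
Proof.
have : 0 <= \tr (fr (jpart A) *m (fr (jpart A))^T).
  apply: sumr_ge0 => i _; rewrite mxE; apply: sumr_ge0 => j _.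
  by rewrite [(fr (jpart A))^T _ _]mxE -expr2 sqr_ge0.
by rewrite trace_jpart pmulr_rge0.
Qed.

Lemma pluri_trace_eq0 : \tr (A *m A) - \tr (A *m J *m (A *m J)) = 0 ->
  J *m A = - (A *m J).
Proof.
move=> H; have fS0 : fr (jpart A) = 0.
  have := trace_jpart; rewrite H mulr0 => T0.
  have sq i : 0 <= (fr (jpart A) *m (fr (jpart A))^T) i i.
    by rewrite mxE; apply: sumr_ge0 => j _; rewrite [(fr (jpart A))^T _ _]mxE -expr2 sqr_ge0.
  apply/row_matrixP => i; rewrite row0; apply: dot_eq0.
  have := psumr_eq0P (fun i _ => sq i) T0 (i := i) isT; rewrite mxE => <-.
  by apply: eq_bigr => j _; rewrite !mxE.
have S0 : jpart A = 0.
  have uP := frame_unit PGP.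
  by apply: (can_inj (mulKmx uP)); rewrite -frP fS0 mul0mx mulmx0.
move/eqP: S0; rewrite subr_eq0 => /eqP S0.
by rewrite [in RHS]S0 -mulmxA JJ mulmxN mulmx1 opprK.
Qed.

(** The commuting case of [mulmx_sqr_le], whose factor 1/2 cancels the 2 in [trace_jpart]. *)
Lemma pluri_field_le x :
  inner G (x *m jpart A) (x *m jpart A) <= (\tr (A *m A) - \tr (A *m J *m (A *m J))) * inner G x x.
Proof.
have JS : fr J *m fr (jpart A) = fr (jpart A) *m fr J.
  rewrite !frM /jpart mulmxBr mulmxBl !mulmxA JJ !mulNmx mul1mx opprK.
  by rewrite -(mulmxA (J *m A)) JJ mulmxN mulmx1 opprK addrC.
have := mulmx_sqr_le frJT frJJ (frv x) (or_introl JS).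
rewrite frvM !dot_frv trace_jpart => H; apply: le_trans H _.
by rewrite mulrA mulVf ?mul1r.
Qed.

(** The anticommuting case of [mulmx_sqr_le]; the factor 1/2 is the gain over the Cauchy-Schwarz
    inequality. *)
Lemma kato x : J *m A = - (A *m J) ->
  inner G (x *m A) (x *m A) <= 2^-1 * \tr (A *m A) * inner G x x.
Proof.
move=> H; have JA : fr J *m fr A = - (fr A *m fr J) by rewrite !frM H frN.
have := mulmx_sqr_le frJT frJJ (frv x) (or_intror JA).
by rewrite frvM !dot_frv fr_sym // frM tr_fr.
Qed.

End PointwiseBounds.

Section RicciBound.
Context {R : realType} {n : nat}.
Local Notation m := (2 * n)%N.
Variables (U : set 'rV[R]_m) (G J : 'rV[R]_m -> 'M[R]_m).
Hypothesis LM : local_metric U G.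
Hypothesis smJ : smooth_mx U J.
Hypothesis JJ : forall y, U y -> J y *m J y = - 1%:M.
Hypothesis JG : forall y, U y -> J y *m G y *m (J y)^T = G y.
Hypothesis Jpar : forall y, U y -> forall k, pmx k J y = Gam G k y *m J y - J y *m Gam G k y.

(** Transfer of [ricci_lower_bound] to the tangent space: [bv] carries bivectors isometrically to
    skew matrices in an orthonormal frame and turns the equation defining u(n) into commutation with
    J. *)
Lemma ric_ge (T : {linear 'M[R]_m -> 'M[R]_m}) (E : 'I_(n ^ 2) -> 'M[R]_m)
    (mu : 'I_(n ^ 2) -> R) (x y : 'rV[R]_m) : U y ->
  (forall X Y Z W, inner2 (G y) (T (wedge X Y)) (wedge Z W) = Rm G X Y Z W y) ->
  (forall a, bivector (E a)) ->
  (forall a, so_of_bivector (G y) (E a) *m J y = J y *m so_of_bivector (G y) (E a)) ->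
  (forall a b, inner2 (G y) (E a) (E b) = (a == b)%:R) ->
  (forall a, T (E a) = mu a *: E a) ->
  (forall a b : 'I_(n ^ 2), (a <= b)%N -> mu a <= mu b) ->
  (\sum_(a < n ^ 2 | (a < n)%N) mu a) * inner (G y) x x <= ric G x y.
Proof.
move=> Uy HT Eb EJ Eo TE mono.
have GT := symG LM Uy.
have [P PGP] := orthonormal_frame (lm_posdef LM Uy).
have GPK := frame_GPK PGP; have PG := frame_PG PGP.
pose bv (A : 'M[R]_m) := P *m G y *m A *m G y *m P^T.
have bvK A : P^T *m bv A *m P = A.
  by rewrite /bv !mulmxA PG mul1mx -!mulmxA [G y *m _]mulmxA GPK mulmx1.
have ip_bv A B : ip (bv A) (bv B) = inner2 (G y) A B.
  rewrite ip_trace /inner2 /bv !trmx_mul trmxK GT; congr (_ * _).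
  rewrite !mulmxA -(mulmxA (P *m G y *m A^T) (G y) P^T).
  rewrite -(mulmxA (P *m G y *m A^T) (G y *m P^T) P) GPK mulmx1.
  rewrite -!mulmxA mxtrace_mulC -!mulmxA [G y *m (P^T *m P)]mulmxA GPK mulmx1.
  by rewrite mxtrace_mulC !mulmxA.
pose T' A := bv (T (P^T *m A *m P)).
have key X Y Z W : ip (T' (wedge X Y)) (wedge Z W) = Rm G (X *m P) (Y *m P) (Z *m P) (W *m P) y.
  have -> : wedge Z W = bv (wedge (Z *m P) (W *m P)).
    by rewrite wedge_mulmx /bv !mulmxA PGP mul1mx -!mulmxA [P *m _]mulmxA PGP mulmx1.
  by rewrite /T' -wedge_mulmx ip_bv HT.
have JGs := JG_skew JJ JG Uy.
have frJT' := frJT P GT JGs.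
have frJJ' := frJJ PGP (JJ Uy).
have Eu a : (bv (E a))^T = - bv (E a) /\ bv (E a) *m fr (G y) P (J y) = fr (G y) P (J y) *m bv (E a).
  split.
    by rewrite /bv !trmx_mul trmxK GT (Eb a : (E a)^T = - E a) !(mulNmx, mulmxN) !mulmxA.
  rewrite /bv /fr !mulmxA -(mulmxA (P *m G y *m E a) (G y) P^T).
  rewrite -(mulmxA (P *m G y *m E a) (G y *m P^T) P) GPK mulmx1.
  rewrite -(mulmxA (P *m J y) (G y) P^T) -(mulmxA (P *m J y) (G y *m P^T) P) GPK mulmx1.
  have := EJ a; rewrite /so_of_bivector => H.
  by rewrite -(mulmxA P (G y)) -(mulmxA P (_ *m _) (J y)) H !mulmxA.
have Eo' a b : ip (bv (E a)) (bv (E b)) = (a == b)%:R by rewrite ip_bv.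
have T'lin c A B : T' (c *: A + B) = c *: T' A + T' B.
  rewrite /T' mulmxDr mulmxDl -scalemxAr -scalemxAl linearP /= /bv.
  by rewrite mulmxDr !mulmxDl -scalemxAr -!scalemxAl.
have T'E a : T' (bv (E a)) = mu a *: bv (E a).
  by rewrite /T' bvK TE /bv -scalemxAr -!scalemxAl.
have T'J X Y Z W : ip (T' (wedge (X *m fr (G y) P (J y)) (Y *m fr (G y) P (J y)))) (wedge Z W) =
    ip (T' (wedge X Y)) (wedge Z W).
  have xfrP (v : 'rV[R]_m) : v *m fr (G y) P (J y) *m P = v *m P *m J y.
    by rewrite -(mulmxA v) (frP PGP) mulmxA.
  by rewrite !key !xfrP (Rm_J12 LM smJ JG Jpar).
have := ricci_lower_bound frJT' frJJ' Eu Eo' (frv (G y) P x) T'lin T'E mono T'J.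
rewrite (dot_frv GT PGP) (ric_frame LM _ Uy PGP) => H; apply: le_trans H _.
rewrite le_eqVlt; apply/orP; left; apply/eqP; apply: eq_bigr => j _.
by rewrite key (frvK PGP) -rowE.
Qed.

End RicciBound.

(** * Lower integrals *)

Section LowerIntegral.
Local Open Scope ereal_scope.

Lemma ereal_supD_le {R : realType} (A B : set (\bar R)) c :
  (forall a, A a -> 0 <= a) -> (forall b, B b -> 0 <= b) -> A !=set0 -> B !=set0 ->
  (forall a b, A a -> B b -> a + b <= c) -> ereal_sup A + ereal_sup B <= c.
Proof.
move=> A0 B0 [a1 Aa1] [b1 Bb1] H.
case: c H => [c| |] H; [|by rewrite leey|]; last first.
  have := H _ _ Aa1 Bb1; rewrite leeNy_eq => /eqP E.
  by have := adde_ge0 (A0 _ Aa1) (B0 _ Bb1); rewrite E.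
have fA a : A a -> a \is a fin_num.
  move=> Aa; rewrite ge0_fin_numE ?A0//; have := H _ _ Aa Bb1 => h.
  apply: le_lt_trans (ltry c); apply: le_trans h.
  by rewrite leeDl// B0.
have H2 a : A a -> ereal_sup B <= c%:E - a.
  move=> Aa; apply: ge_ereal_sup => b Bb.
  by rewrite leeBrDr ?fA// addeC H.
have fB : ereal_sup B \is a fin_num.
  rewrite ge0_fin_numE; last by apply: le_trans (ereal_sup_ubound Bb1); exact: B0.
  by apply: le_lt_trans (H2 _ Aa1) _; rewrite -(fineK (fA _ Aa1)) -EFinB ltry.
rewrite -leeBrDr//; apply: ge_ereal_sup => a Aa.
by rewrite leeBrDr// addeC -leeBrDr ?fA// H2.
Qed.

Context d (T : measurableType d) (R : realType) (mu : {measure set T -> \bar R}).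
Implicit Types f g : T -> \bar R.

(* For a nonnegative function, measurable or not, the integral is the supremum of
   the integrals of the simple functions below it. *)
Lemma ge0_le_lower_integral f g : (forall x, 0 <= f x) -> (forall x, f x <= g x) ->
  \int[mu]_x f x <= \int[mu]_x g x.
Proof.
move=> f0 fg; have g0 x : 0 <= g x by exact: le_trans (f0 x) (fg x).
rewrite !ge0_integralTE//; apply: le_ereal_sup => _ [h hf <-].
by exists h => // x; exact: le_trans (hf x) (fg x).
Qed.

Import HBNNSimple.

Lemma lower_integral_le f (c : \bar R) : (forall x, 0 <= f x) ->
  (forall h : {nnsfun T >-> R}, (forall x, (h x)%:E <= f x) ->
     \int[mu]_x (h x)%:E <= c) -> \int[mu]_x f x <= c.
Proof.
move=> f0 H; rewrite ge0_integralTE//; apply: ge_ereal_sup => _ [h hf <-].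
by rewrite -integralT_nnsfun; exact: H.
Qed.

Lemma lower_integralD f g : (forall x, 0 <= f x) -> (forall x, 0 <= g x) ->
  \int[mu]_x f x + \int[mu]_x g x <= \int[mu]_x (f x + g x).
Proof.
move=> f0 g0; rewrite !(ge0_integralTE _ f0, ge0_integralTE _ g0).
apply: ereal_supD_le.
- by move=> _ [h _ <-]; exact: sintegral_ge0.
- by move=> _ [h _ <-]; exact: sintegral_ge0.
- by exists (sintegral mu (@nnsfun0 _ T R)); exists nnsfun0.
- by exists (sintegral mu (@nnsfun0 _ T R)); exists nnsfun0.
move=> _ _ [h hf <-] [k kg <-]; rewrite -!integralT_nnsfun -ge0_integralD//.
- apply: ge0_le_lower_integral => x; first by rewrite adde_ge0// lee_fin.
  by apply: leeD; [exact: hf|exact: kg].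
- by move=> x _; rewrite lee_fin.
- exact/measurable_EFinP.
- by move=> x _; rewrite lee_fin.
- exact/measurable_EFinP.
Qed.

Lemma lower_integralZ_le f (r : R) : (0 < r)%R -> (forall x, 0 <= f x) ->
  r%:E * \int[mu]_x f x <= \int[mu]_x (r%:E * f x).
Proof.
move=> r0 f0; rewrite muleC -lee_pdivlMr//; apply: lower_integral_le => // h hf.
rewrite lee_pdivlMr// muleC -ge0_integralZl_EFin//.
- apply: ge0_le_lower_integral => x; first by rewrite mule_ge0// lee_fin// ltW.
  by apply: lee_wpmul2l; [rewrite lee_fin ltW|exact: hf].
- by move=> x _; rewrite lee_fin.
- exact/measurable_EFinP.
- exact: ltW.
Qed.

Lemma lower_integralZ f (r : R) : (0 <= r)%R -> (forall x, 0 <= f x) ->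
  \int[mu]_x (r%:E * f x) = r%:E * \int[mu]_x f x.
Proof.
rewrite le_eqVlt => /orP[/eqP <- f0|r0 f0].
  by rewrite mul0e; apply: integral0_eq => x _; rewrite mul0e.
apply/eqP; rewrite eq_le lower_integralZ_le// andbT muleC -lee_pdivrMr//.
rewrite muleC.
have ri0 : (0 < r^-1)%R by rewrite invr_gt0.
apply: le_trans (lower_integralZ_le ri0 _) _.
  by move=> x; rewrite mule_ge0// lee_fin ltW.
rewrite le_eqVlt; apply/orP; left; apply/eqP; apply: eq_integral => x _.
by rewrite muleA -EFinM mulVf ?mul1e// gt_eqF.
Qed.

End LowerIntegral.

(** * Translation invariance and iterated integrals *)

Section LebesgueShift.
Context {R : realType}.
Local Notation mu := (@lebesgue_measure R).
Local Open Scope ereal_scope.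

Lemma measurable_addr (t : R) : measurable_fun setT (+%R^~ t : measurableTypeR R -> measurableTypeR R).
Proof. by apply: continuous_measurable_fun => x; apply: cvgD; [exact: cvg_id|exact: cvg_cst]. Qed.

Lemma lebesgue_measure_addr (t : R) (A : set R) : measurable A ->
  pushforward mu (+%R^~ t : _ -> measurableTypeR R) A = mu A.
Proof.
move=> mA; have mt := measurable_addr t.
pose mix := isMeasurableFun.Build _ _ _ _ _ mt.
pose tp : {mfun _ >-> _} := HB.pack (+%R^~ t : measurableTypeR R -> measurableTypeR R) mix.
apply/esym; apply: (@lebesgue_measure_unique _ (pushforward mu tp)) => //= _ [[a b]] _ <-.
rewrite /pushforward.
rewrite (_ : _ @^-1` _ = `](a - t)%R, (b - t)%R]%classic); last first.
  by apply/seteqP; split=> x /=; rewrite !in_itv/= ltrBlDr lerBrDr.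
rewrite !lebesgue_measure_itv/= !lte_fin ltrD2r; case: ifP => // _.
by rewrite -!EFinB; congr EFin; ring.
Qed.

Import HBNNSimple.

(** Invariance of the measure gives one inequality, through simple functions; the other is the same
    inequality for the shifted function and the opposite shift. *)
Lemma lower_integral_shift (f : R -> \bar R) (t : R) : (forall x, 0 <= f x) ->
  \int[mu]_x f (x + t)%R = \int[mu]_x f x.
Proof.
suff H (g : R -> \bar R) s : (forall x, 0 <= g x) -> \int[mu]_x g x <= \int[mu]_x g (x + s)%R.
  move=> f0; apply/eqP; rewrite eq_le H// andbT.
  have := H (fun x => f (x + t)%R) (- t)%R (fun x => f0 _).
  by under [X in _ <= X -> _]eq_integral do rewrite addrNK.
move=> g0; apply: lower_integral_le => // h hg.
have : \int[mu]_x (h (x + s)%R)%:E <= \int[mu]_x g (x + s)%R.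
  by apply: ge0_le_lower_integral => x; [rewrite lee_fin|exact: hg].
apply: le_trans.
have := @ge0_integral_pushforward _ _ _ _ _ _ (measurable_addr s) mu setT (EFin \o h) measurableT.
rewrite preimage_setT /= => <-.
- rewrite le_eqVlt; apply/orP; left; apply/eqP/esym/eq_measure_integral.
    exact: measurable_addr.
  by move=> mt A mA _; exact: lebesgue_measure_addr.
- exact/measurable_EFinP.
- by move=> x _; rewrite lee_fin.
Qed.

End LebesgueShift.

Section IntegralRV.
Context {R : realType}.
Local Open Scope ereal_scope.

Lemma integral_rV_ge0 m (f : 'rV[R]_m -> \bar R) : (forall y, 0 <= f y) -> 0 <= integral_rV f.
Proof. by elim: m f => [|m IH] f f0 //=; apply: integral_ge0 => t _; exact: IH. Qed.

Lemma integral_rV_le m (f g : 'rV[R]_m -> \bar R) : (forall y, 0 <= f y) ->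
  (forall y, f y <= g y) -> integral_rV f <= integral_rV g.
Proof.
elim: m f g => [|m IH] f g f0 fg //=; apply: ge0_le_lower_integral => t; last exact: IH.
exact: integral_rV_ge0.
Qed.

Lemma eq_integral_rV m (f g : 'rV[R]_m -> \bar R) : f =1 g -> integral_rV f = integral_rV g.
Proof. by move=> /funext ->. Qed.

Lemma integral_rVD m (f g : 'rV[R]_m -> \bar R) : (forall y, 0 <= f y) ->
  (forall y, 0 <= g y) -> integral_rV f + integral_rV g <= integral_rV (fun y => f y + g y).
Proof.
elim: m f g => [|m IH] f g f0 g0 //=.
apply: le_trans (lower_integralD _ _ _) _ => [t|t|]; [exact: integral_rV_ge0|exact: integral_rV_ge0|].
apply: ge0_le_lower_integral => t; last exact: IH.
by apply: adde_ge0; exact: integral_rV_ge0.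
Qed.

Lemma integral_rVZ m (r : R) (f : 'rV[R]_m -> \bar R) : (0 <= r)%R -> (forall y, 0 <= f y) ->
  integral_rV (fun y => r%:E * f y) = r%:E * integral_rV f.
Proof.
elim: m f => [|m IH] f r0 f0 //=.
rewrite -lower_integralZ//; last by move=> t; exact: integral_rV_ge0.
by apply: eq_integral => t _; exact: IH.
Qed.

Lemma integral_rV0 m : integral_rV (fun _ : 'rV[R]_m => 0) = 0.
Proof. by elim: m => [|m IH] //=; apply: integral0_eq. Qed.

Lemma row_mx_ord0 m (t : R) (y : 'rV[R]_m) : (row_mx t%:M y : 'rV[R]_m.+1) 0%R ord0 = t.
Proof.
rewrite mxE; case: splitP => [j _|j]; last by [].
by rewrite mxE !ord1.
Qed.

Lemma row_mx_lift m (t : R) (y : 'rV[R]_m) k :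
  (row_mx t%:M y : 'rV[R]_m.+1) 0%R (lift ord0 k) = y 0%R k.
Proof.
rewrite mxE; case: splitP => [j|j]; first by rewrite lift0 ord1.
by rewrite lift0 => -[E]; congr (y _ _); apply: val_inj.
Qed.

Lemma integral_rV_shift m (v : 'rV[R]_m) (f : 'rV[R]_m -> \bar R) : (forall y, 0 <= f y) ->
  integral_rV (fun y => f (y + v)%R) = integral_rV f.
Proof.
elim: m v f => [|m IH] v f f0 /=; first by rewrite [v]thinmx0 addr0.
rewrite -[RHS](lower_integral_shift (v 0%R ord0)); last first.
  by move=> t; exact: integral_rV_ge0.
pose v' := (\row_(k < m) v 0%R (lift ord0 k))%R.
apply: eq_integral => t _.
rewrite -[RHS](IH v') //; apply: eq_integral_rV => y; congr f.
apply/rowP => k; rewrite mxDE; case: (unliftP ord0 k) => [j|] ->.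
  by rewrite !row_mx_lift mxDE mxE.
by rewrite !row_mx_ord0.
Qed.

Definition rcube m (c : 'rV[R]_m) (r : R) : set 'rV[R]_m :=
  [set y | forall k, (`|y 0%R k - c 0%R k| <= r)%R].

Lemma integral_rV_cube m (c : 'rV[R]_m) (r : R) : (0 <= r)%R ->
  integral_rV (fun y => (\1_(rcube c r) y)%:E) = ((2 * r) ^+ m)%:E.
Proof.
move=> r0; elim: m c => [|m IH] c /=.
  by rewrite indicE mem_set// => -[].
pose a : R := c 0%R ord0.
pose c' : 'rV[R]_m := (\row_(k < m) c 0%R (lift ord0 k))%R.
transitivity (\int[@lebesgue_measure R]_t
   (((2 * r) ^+ m)%:E * (\1_(`[(a - r)%R, (a + r)%R]%classic) t)%:E)).
  apply: eq_integral => t _.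
  rewrite -(IH c') muleC -integral_rVZ ?indicE; [|exact: ler0n|by move=> y; rewrite lee_fin indicE ler0n].
  apply: eq_integral_rV => y; rewrite -EFinM !indicE -natrM mulnb; congr ((nat_of_bool _)%:R%:E).
  have Ea : (t \in `[(a - r)%R, (a + r)%R]%classic) = (`|t - a| <= r)%R.
    by rewrite (ler_distl (t : R)); apply/idP/idP; rewrite inE /= in_itv /=.
  rewrite Ea; apply/idP/andP => [|[h1]]; rewrite !inE => H.
    split; first by have := H ord0; rewrite row_mx_ord0.
    by move=> k; have := H (lift ord0 k); rewrite row_mx_lift mxE.
  move=> k; case: (unliftP ord0 k) => [j|] ->; last by rewrite row_mx_ord0.
  by rewrite row_mx_lift; have := H j; rewrite mxE.
rewrite lower_integralZ; [|exact/exprn_ge0/mulr_ge0|by move=> t; rewrite lee_fin indicE ler0n].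
rewrite integral_indic//.
rewrite setIT [in RHS]exprSr EFinM; congr (_ * _).
rewrite [LHS](lebesgue_measure_itv `[(a - r)%R, (a + r)%R]) /= lte_fin.
case: ifP => [_|/negbT]; first by rewrite -EFinB; congr EFin; ring.
rewrite -leNgt => h; congr EFin; lra.
Qed.

End IntegralRV.

(** * Charts and tensor fields *)

Lemma compact_cover_seq (T : ptopologicalType) (K : set T) (U : T -> set T) : compact K ->
  (forall x, K x -> open (U x) /\ U x x) ->
  exists s : seq T, (forall x, x \in s -> K x) /\ forall z, K z -> exists2 x, x \in s & U x z.
Proof.
move=> cK H; move: (cK); rewrite compact_cover => /(_ T K U).
case=> [x /H[]//|x Kx|D DK DU]; first by exists x => //; have [] := H x Kx.
exists (finmap.enum_fset D); split=> [x xD|y /DU[x /= xD Uxy]]; last by exists x.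
by have := DK _ xD; rewrite inE.
Qed.

Section Charts.
Context {R : realType} {m : nat} {M : manifold R m}.
Implicit Types (i j : chart M) (x : M) (y : 'rV[R]_m).
Local Notation dom := (@chart_dom R m M).
Local Notation cod := (@chart_codom R m M).
Local Notation co := (@chart_coord R m M).
Local Notation pa := (@chart_param R m M).

Lemma codomP i y : cod i y -> dom i (pa i y) /\ co i (pa i y) = y.
Proof. by move=> [x dx <-]; rewrite coordK. Qed.

Lemma codom_coord i x : dom i x -> cod i (co i x).
Proof. by move=> dx; exists x. Qed.

Lemma open_cod i : open (cod i).
Proof. exact: open_codom. Qed.

Lemma near_dom i x : dom i x -> \forall z \near x, dom i z.
Proof. by move=> dx; apply: open_nbhs_nbhs; split=> //; exact: open_dom. Qed.

Lemma near_cod i y : cod i y -> \forall z \near y, cod i z.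
Proof. by move=> cy; apply: open_nbhs_nbhs; split=> //; exact: open_cod. Qed.

Lemma near_param i y (P : set M) : cod i y -> (\forall x \near pa i y, P x) ->
  \forall z \near y, P (pa i z).
Proof. by move=> /param_continuous; exact. Qed.

Lemma near_coord i x (P : set 'rV[R]_m) : dom i x -> (\forall y \near co i x, P y) ->
  \forall z \near x, P (co i z).
Proof. by move=> /Defs.coord_continuous; exact. Qed.

Definition overlap i j : set 'rV[R]_m := [set y | cod i y /\ dom j (pa i y)].

Lemma overlapE i j : overlap i j = co i @` (dom i `&` dom j).
Proof.
apply/seteqP; split=> [y [cy dj]|_ [x [di dj] <-]].
  by have [di E] := codomP cy; exists (pa i y).
by split; [exact: codom_coord|rewrite coordK].
Qed.

Lemma open_overlap i j : open (overlap i j).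
Proof.
rewrite openE => y [cy dj]; have h1 := near_cod cy.
have h2 := near_param cy (near_dom dj).
by apply: filterS2 h1 h2 => z ? ?; split.
Qed.

Lemma overlap_coord i j x : dom i x -> dom j x -> overlap i j (co i x).
Proof. by move=> di dj; split; [exact: codom_coord|rewrite coordK]. Qed.

Lemma smooth_transition i j l : smooth (overlap i j) (fun y => co j (pa i y) 0 l).
Proof.
have H := @transition_smooth _ _ M i j; rewrite -overlapE in H.
exact: (smooth_on_mx (@open_overlap i j) H 0 l).
Qed.

Lemma tjacE i j x k l : dom i x -> dom j x ->
  transition_jacobian i j x k l = partial k (fun y => co j (pa i y) 0 l) (co i x).
Proof.
move=> di dj; have ov := overlap_coord di dj.
have dT : differentiable (co j \o pa i) (co i x).
  by apply: differentiable_rV => l'; exact: (smooth_diff (@open_overlap i j) (@smooth_transition i j l') ov).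
rewrite /transition_jacobian.
transitivity ((delta_mx 0 k *m jacobian (co j \o pa i) (co i x) : 'rV[R]_m) 0 l).
  by move: (jacobian _ _) => A; rewrite -rowE mxE.
rewrite -deriveEjacobian // derive_mx ?mxE //; exact: diff_derivable.
Qed.

(* Functions and tensors on M are families of functions on the chart images. *)
Definition compat {T : Type} (f : chart M -> 'rV[R]_m -> T) :=
  forall i j x, dom i x -> dom j x -> f i (co i x) = f j (co j x).

Definition glue {T : Type} (f : chart M -> 'rV[R]_m -> T) (x : M) : T :=
  f (chart_at x) (coord_at x).

Lemma glueE {T : Type} (f : chart M -> 'rV[R]_m -> T) i x : compat f -> dom i x ->
  glue f x = f i (co i x).
Proof. by move=> cf dx; apply: cf => //; exact: chart_atP. Qed.

Lemma glue_param {T : Type} (f : chart M -> 'rV[R]_m -> T) i y : compat f -> cod i y ->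
  glue f (pa i y) = f i y.
Proof. by move=> cf /codomP[dx E]; rewrite (glueE cf dx) E. Qed.

Lemma glue_continuous (f : chart M -> 'rV[R]_m -> R) : compat f ->
  (forall i y, cod i y -> {for y, continuous (f i)}) -> continuous (glue f).
Proof.
move=> cf H x; pose i := chart_at x; have dx : dom i x by exact: chart_atP.
apply: (@continuous_at_eq _ _ (fun z => f i (co i z))).
  by have := near_dom dx; apply: filterS => z dz; rewrite (glueE cf dz).
apply: (@continuous_comp _ _ _ (co i) (f i)); first exact: Defs.coord_continuous.
exact/H/codom_coord.
Qed.

Lemma smooth_funP (f : M -> R) : smooth_fun f <-> forall i, smooth (cod i) (f \o pa i).
Proof. by split=> H i; apply/smooth_on_smooth; exact: H. Qed.

Lemma compat_fun {T : Type} (f : M -> T) : compat (fun i => f \o pa i).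
Proof. by move=> i j x di dj; rewrite /= !coordK. Qed.

Lemma glue_fun {T : Type} (f : M -> T) : glue (fun i => f \o pa i) = f.
Proof. by apply/funext => x; rewrite /glue /= coordK//; exact: chart_atP. Qed.

Lemma smooth_fun_continuous (f : M -> R) : smooth_fun f -> continuous f.
Proof.
move=> /smooth_funP H; rewrite -(glue_fun f); apply: glue_continuous (compat_fun f) _ => i y cy.
exact: smooth_continuous (H i) cy.
Qed.

Lemma glue_smooth (f : chart M -> 'rV[R]_m -> R) : compat f ->
  (forall i, smooth (cod i) (f i)) -> smooth_fun (glue f).
Proof.
move=> cf H; apply/smooth_funP => i; apply: (smooth_ext (@open_cod i)) (H i) => y cy.
by rewrite /= (glue_param cf cy).
Qed.

Lemma smooth_fun_cst (c : R) : smooth_fun (fun _ : M => c).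
Proof. by apply/smooth_funP => i; exact: smooth_cst (@open_cod i) c. Qed.

Lemma smooth_funD (f h : M -> R) : smooth_fun f -> smooth_fun h ->
  smooth_fun (fun x => f x + h x).
Proof.
by move=> /smooth_funP Hf /smooth_funP Hh; apply/smooth_funP => i; exact: smoothD (@open_cod i) _ _ (Hf i) (Hh i).
Qed.

Lemma smooth_funM (f h : M -> R) : smooth_fun f -> smooth_fun h ->
  smooth_fun (fun x => f x * h x).
Proof.
by move=> /smooth_funP Hf /smooth_funP Hh; apply/smooth_funP => i; exact: smoothM (@open_cod i) _ _ (Hf i) (Hh i).
Qed.

Lemma compact_param i (K : set 'rV[R]_m) : compact K -> K `<=` cod i ->
  compact (pa i @` K).
Proof.
move=> cK KU; apply: continuous_compact cK.
by apply: continuous_in_subspaceT => y /set_mem /KU; exact: param_continuous.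
Qed.

Lemma closed_param i (K : set 'rV[R]_m) : compact K -> K `<=` cod i ->
  closed (pa i @` K).
Proof.
by move=> cK KU; apply: compact_closed; [exact: manifold_hausdorff|exact: compact_param].
Qed.

Definition extend0 i (w : 'rV[R]_m -> R) (x : M) : R :=
  if x \in dom i then w (co i x) else 0.

Lemma extend0_in i w x : dom i x -> extend0 i w x = w (co i x).
Proof. by move=> dx; rewrite /extend0 mem_set. Qed.

Lemma extend0_param i w y : cod i y -> extend0 i w (pa i y) = w y.
Proof. by move=> /codomP[dx E]; rewrite extend0_in ?E. Qed.

Section Extend0.
Variables (i : chart M) (K : set 'rV[R]_m) (w : 'rV[R]_m -> R).
Hypotheses (cK : compact K) (KU : K `<=` cod i).
Hypothesis wK : forall y, cod i y -> ~ K y -> w y = 0.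

Lemma extend0_out x : ~ (pa i @` K) x -> extend0 i w x = 0.
Proof.
move=> nx; rewrite /extend0; case: ifPn => // /set_mem dx; apply: wK.
  exact: codom_coord.
by move=> Kx; apply: nx; exists (co i x) => //; exact: coordK.
Qed.

Lemma near_extend0_out x : ~ (pa i @` K) x -> \forall z \near x, extend0 i w z = 0.
Proof.
move=> nx; have : \forall z \near x, (~` (pa i @` K)) z.
  by apply: open_nbhs_nbhs; split=> //; exact/closed_openC/closed_param.
by apply: filterS => z; exact: extend0_out.
Qed.

Lemma extend0_continuous : (forall y, cod i y -> {for y, continuous w}) ->
  continuous (extend0 i w).
Proof.
move=> Hw x; have [dx|ndx] := pselect (dom i x).
  apply: (@continuous_at_eq _ _ (w \o co i)).
    by have := near_dom dx; apply: filterS => z dz; rewrite extend0_in.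
  apply: continuous_comp; [exact: Defs.coord_continuous|exact/Hw/codom_coord].
apply: (@continuous_at_eq _ _ (fun=> 0)); last exact: cst_continuous.
have nx : ~ (pa i @` K) x.
  by move=> [y Ky E]; apply: ndx; rewrite -E; have [] := codomP (KU Ky).
by have := near_extend0_out nx; apply: filterS => z ->.
Qed.

Lemma extend0_smooth : smooth (cod i) w -> smooth_fun (extend0 i w).
Proof.
move=> Hw; apply/smooth_funP => j; apply: smooth_glue => y cy.
have [dx|ndx] := pselect (dom i (pa j y)).
  exists (overlap j i), (fun z => w (co i (pa j z))); split.
  - exact: open_overlap.
  - by [].
  - apply: smooth_comp Hw; [exact: open_overlap|exact: open_cod| |].
      by move=> z [_ dz]; exact: codom_coord.
    by move=> l; exact: smooth_transition.
  - by move=> z [_ dz]; rewrite /= extend0_in.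
have nx : ~ (pa i @` K) (pa j y).
  by move=> [z Kz E]; apply: ndx; rewrite -E; have [] := codomP (KU Kz).
exists [set z | cod j z /\ (~` (pa i @` K)) (pa j z)], (fun=> 0).
have oC : open [set z | cod j z /\ (~` (pa i @` K)) (pa j z)].
  rewrite openE => z [cz nz]; have h1 := near_cod cz.
  have h2 : \forall z' \near z, (~` (pa i @` K)) (pa j z').
    apply: near_param => //; apply: open_nbhs_nbhs; split=> //.
    exact/closed_openC/closed_param.
  by apply: filterS2 h1 h2 => z' ? ?; split.
split=> //; first exact: smooth_cst.
by move=> z [_ nz]; rewrite /= extend0_out.
Qed.

End Extend0.

Lemma compact_supportP (f : M -> R) (C : set M) : compact C ->
  (forall x, ~ C x -> f x = 0) -> compactly_supported f.
Proof.
move=> cC H; apply: (subclosed_compact _ cC); first exact: closed_closure.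
have /closure_id -> : closed C by apply: compact_closed cC; exact: manifold_hausdorff.
by apply: closure_subset => x /=; apply: contra_neqP; exact: H.
Qed.

End Charts.

Lemma invmx_congr {F : fieldType} m (T G : 'M[F]_m) : T \in unitmx -> G \in unitmx ->
  invmx (T *m G *m T^T) = (invmx T)^T *m invmx G *m invmx T.
Proof.
move=> uT uG.
have uA : T *m G *m T^T \in unitmx by rewrite !unitmx_mul uT uG unitmx_tr.
set B := _ *m invmx T; suff E : T *m G *m T^T *m B = 1%:M by rewrite -[B](mulKmx uA) E mulmx1.
rewrite /B !mulmxA -(mulmxA (T *m G)) -trmx_mul mulVmx // trmx1 mulmx1.
by rewrite -(mulmxA T) mulmxV // mulmx1 mulmxV.
Qed.

Lemma drow_smooth {R : realType} m (U : set 'rV[R]_m) f : open U -> smooth U f ->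
  smooth_mx U (drow f).
Proof.
move=> oU sf i j; apply: smooth_ext (smooth_partial j sf) => //.
by move=> y _; rewrite mxE.
Qed.

(** * Vector fields, 1-forms and the metric *)

Section Tensors.
Context {R : realType} {m : nat} {M : manifold R m}.
Implicit Types (i j : chart M) (x : M) (y : 'rV[R]_m).
Local Notation dom := (@chart_dom R m M).
Local Notation cod := (@chart_codom R m M).
Local Notation co := (@chart_coord R m M).
Local Notation pa := (@chart_param R m M).
Local Notation tj := (@transition_jacobian R m M).

Lemma drow_compat (f : chart M -> 'rV[R]_m -> R) i j x : compat f ->
  (forall k, smooth (cod k) (f k)) -> dom i x -> dom j x ->
  drow (f i) (co i x) = drow (f j) (co j x) *m (tj i j x)^T.
Proof.
move=> cf sf di dj; have ov := overlap_coord di dj.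
apply/rowP => k; rewrite mxE.
transitivity (partial k (fun y => f j (co j (pa i y))) (co i x)).
  apply: (partial_eq_on (@open_overlap _ _ _ i j)) ov => y [cy dy].
  have [dy' E] := codomP cy.
  by rewrite -(cf i j (pa i y)) // E.
rewrite (partial_comp (@open_overlap _ _ _ i j) k (@open_cod _ _ _ j) (sf j) (@smooth_transition _ _ _ i j) ov) //.
  rewrite [RHS]mxE; apply: eq_bigr => l _; rewrite coordK // mulrC; congr (_ * _); first by rewrite mxE.
  by rewrite -tjacE // [RHS]mxE.
by rewrite coordK //; exact: codom_coord.
Qed.

Definition vfield (X : chart M -> 'rV[R]_m -> 'rV[R]_m) :=
  (forall i, smooth_mx (cod i) (X i)) /\
  forall i j x, dom i x -> dom j x -> X i (co i x) *m tj i j x = X j (co j x).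

Definition oneform (th : chart M -> 'rV[R]_m -> 'rV[R]_m) :=
  (forall i, smooth_mx (cod i) (th i)) /\
  forall i j x, dom i x -> dom j x -> th i (co i x) = th j (co j x) *m (tj i j x)^T.

Lemma drow_oneform (f : chart M -> 'rV[R]_m -> R) : compat f ->
  (forall k, smooth (cod k) (f k)) -> oneform (fun i => drow (f i)).
Proof.
move=> cf sf; split=> [i|i j x di dj]; last exact: drow_compat.
exact: (drow_smooth (@open_cod _ _ _ i) (sf i)).
Qed.

(* The second derivatives of the transition map cancel by symmetry. *)
Lemma dform_transition th i j x : oneform th -> dom i x -> dom j x ->
  dform (th i) (co i x) = tj i j x *m dform (th j) (co j x) *m (tj i j x)^T.
Proof.
move=> [sth cth] di dj; have ov := overlap_coord di dj.
have oO := @open_overlap _ _ _ i j; have oC := @open_cod _ _ _ j.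
pose T l y := co j (pa i y) 0 l.
have sT l : smooth (overlap i j) (T l) by exact: smooth_transition.
have sc : smooth_mx (overlap i j) (fun y => th j (co j (pa i y))).
  move=> a b; apply: (smooth_comp oO oC _ sT (sth j a b)) => y [_ dy]; exact: codom_coord.
have E b y : overlap i j y ->
    th i y 0 b = \sum_l th j (co j (pa i y)) 0 l * partial b (T l) y.
  move=> [cy dy]; have [dy' Ey] := codomP cy.
  rewrite -{1}Ey (cth i j (pa i y)) // mxE; apply: eq_bigr => l _.
  by rewrite mxE tjacE // Ey.
have D a b : partial a (fun y => th i y 0 b) (co i x) =
    \sum_l (th j (co j x) 0 l * partial a (partial b (T l)) (co i x)
     + tj i j x b l * \sum_p tj i j x a p * partial p (fun y => th j y 0 l) (co j x)).
  rewrite (partial_eq_on oO (E b) a ov) (partial_sum oO); last 2 first.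
  - by move=> l; apply: smoothM; [exact: oO|exact: sc|exact: smooth_partial].
  - exact: ov.
  apply: eq_bigr => l _.
  rewrite (partialM _ (sc 0 l) (smooth_partial b (sT l)) ov) /= coordK //; congr (_ + _).
  rewrite -tjacE //; congr (_ * _).
  rewrite (partial_comp oO a oC (sth j 0 l) sT ov) coordK //; last exact: codom_coord.
  by apply: eq_bigr => p _; rewrite -tjacE.
apply/matrixP => a b; rewrite {1}/dform mxE.
rewrite !D -sumrB mxE.
transitivity (\sum_l (tj i j x b l * (\sum_p tj i j x a p * partial p (fun y => th j y 0 l) (co j x))
    - tj i j x a l * (\sum_p tj i j x b p * partial p (fun y => th j y 0 l) (co j x)))).
  apply: eq_bigr => l _.
  rewrite (smooth_partial_comm oO a b (sT l) ov) opprD addrACA subrr add0r //.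
rewrite sumrB; under [X in _ - X]eq_bigr do rewrite mulr_sumr.
rewrite [X in _ - X]exchange_big /= -sumrB; apply: eq_bigr => l _.
rewrite [in RHS]mxE [((tj i j x)^T) l b]mxE mulrC.
rewrite [X in _ - X](_ : _ = (\sum_p tj i j x a p * partial l (fun y => th j y 0 p) (co j x)) * tj i j x b l); last first.
  by rewrite mulr_suml; apply: eq_bigr => p _; ring.
rewrite -mulrBl -sumrB; congr (_ * _); apply: eq_bigr => p _.
by rewrite [dform _ _ p l]mxE mulrBr.
Qed.

Variable g : metric M.

Lemma metric_local i : local_metric (cod i) (gmat g i).
Proof.
split; [exact: open_cod| |].
  exact: (smooth_on_mx (@open_cod _ _ _ i) (gmat_smooth g (i := i))).
by move=> y cy; split; [exact: gmat_sym|exact: gmat_posdef].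
Qed.

Lemma gmat_unit i y : cod i y -> gmat g i y \in unitmx.
Proof. by move=> cy; exact: posdef_unit (lm_posdef (metric_local i) cy). Qed.

Lemma tjac_unit i j x : dom i x -> dom j x -> tj i j x \in unitmx.
Proof.
move=> di dj; have := gmat_unit (codom_coord di).
by rewrite (gmat_transition g di dj) !unitmx_mul => /andP[/andP[]].
Qed.

Definition gradm (f : M -> R) i := gradf (gmat g i) (f \o pa i).

Lemma sharp_vfield th : oneform th -> vfield (fun i y => th i y *m invmx (gmat g i y)).
Proof.
move=> [sth cth]; split=> [i|i j x di dj].
  apply: smooth_mulmx => //; first exact: open_cod.
  exact: smooth_invG (metric_local i).
have uT := tjac_unit di dj; have uG := gmat_unit (codom_coord dj).
rewrite (cth i j x) // (gmat_transition g di dj).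
set T := tj i j x in uT *; set G := gmat g j _ in uG *.
rewrite invmx_congr //.
rewrite -!mulmxA mulVmx // mulmx1 (mulmxA T^T) -trmx_mul mulVmx // trmx1 mul1mx //.
Qed.

Lemma grad_vfield (f : M -> R) : smooth_fun f -> vfield (gradm f).
Proof.
move=> /smooth_funP sf; apply: (sharp_vfield (drow_oneform (compat_fun f) sf)).
Qed.

Lemma flat_oneform X : vfield X -> oneform (fun i y => X i y *m gmat g i y).
Proof.
move=> [sX cX]; split=> [i|i j x di dj].
  apply: smooth_mulmx => //; first exact: open_cod.
  exact: lm_smooth (metric_local i).
by rewrite (gmat_transition g di dj) -(cX i j x) // !mulmxA.
Qed.

Definition dpair (f : M -> R) (X : chart M -> 'rV[R]_m -> 'rV[R]_m) i y : R :=
  (drow (f \o pa i) y *m (X i y)^T) 0 0.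

Lemma dpair_compat (f : M -> R) X : smooth_fun f -> vfield X -> compat (dpair f X).
Proof.
move=> /smooth_funP sf [_ cX] i j x di dj; rewrite /dpair.
rewrite (drow_compat (compat_fun f) sf di dj) -(cX i j x) // trmx_mul.
by rewrite !mulmxA.
Qed.

Lemma dpair_smooth (f : M -> R) X : smooth_fun f -> vfield X -> smooth_fun (glue (dpair f X)).
Proof.
move=> sf vX; apply: glue_smooth; first exact: dpair_compat.
move=> i; have oC := @open_cod _ _ _ i.
apply: (smooth_mulmx oC (B := drow (f \o pa i)) (C := fun y => (X i y)^T)).
  by apply: drow_smooth => //; move/smooth_funP: sf.
by apply: smooth_tr => //; have [] := vX.
Qed.

Definition vinner (X Y : chart M -> 'rV[R]_m -> 'rV[R]_m) i y : R :=
  inner (gmat g i y) (X i y) (Y i y).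

Lemma vinner_compat X Y : vfield X -> vfield Y -> compat (vinner X Y).
Proof.
move=> [_ cX] [_ cY] i j x di dj; rewrite /vinner /inner.
by rewrite (gmat_transition g di dj) -(cX i j x) // -(cY i j x) // trmx_mul !mulmxA.
Qed.

Lemma vinner_smooth X Y : vfield X -> vfield Y -> smooth_fun (glue (vinner X Y)).
Proof.
move=> vX vY; apply: glue_smooth; first exact: vinner_compat.
move=> i; have oC := @open_cod _ _ _ i.
apply: (smooth_mulmx oC (B := fun y => X i y *m gmat g i y) (C := fun y => (Y i y)^T)).
  by apply: smooth_mulmx => //; [have [] := vX|exact: lm_smooth (metric_local i)].
by apply: smooth_tr => //; have [] := vY.
Qed.

Definition sqgrad (f : M -> R) : M -> R := glue (vinner (gradm f) (gradm f)).

Lemma sqgrad_smooth (f : M -> R) : smooth_fun f -> smooth_fun (sqgrad f).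
Proof. by move=> sf; apply: vinner_smooth; exact: grad_vfield. Qed.

Lemma vinner_ge0 X i y : cod i y -> 0 <= vinner X X i y.
Proof.
move=> cy; rewrite /vinner; have [->|n0] := eqVneq (X i y) 0.
  by rewrite /inner !mul0mx mxE.
exact/ltW/gmat_posdef.
Qed.

Lemma sqgrad_ge0 (f : M -> R) x : 0 <= sqgrad f x.
Proof. by apply: vinner_ge0; apply: codom_coord; exact: chart_atP. Qed.

Lemma grad_norm_sqr (f : M -> R) x : grad_norm g f x ^+ 2 = sqgrad f x.
Proof. by rewrite /grad_norm sqr_sqrtr //; exact: sqgrad_ge0. Qed.

Variable J : kahler_structure g.
Variable u : M -> R.
Hypothesis su : smooth_fun u.

Lemma kahler_local i :
  [/\ smooth_mx (cod i) (Jmat J i),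
      forall y, cod i y -> Jmat J i y *m Jmat J i y = - 1%:M,
      forall y, cod i y -> Jmat J i y *m gmat g i y *m (Jmat J i y)^T = gmat g i y &
      forall y, cod i y -> forall k, pmx k (Jmat J i) y =
        Gam (gmat g i) k y *m Jmat J i y - Jmat J i y *m Gam (gmat g i) k y].
Proof.
split.
- exact: (smooth_on_mx (@open_cod _ _ _ i) (Jmat_smooth J (i := i))).
- by move=> y; exact: Jmat_sqr.
- move=> y cy; apply/matrixP => a b.
  have := Jmat_orthogonal J cy (delta_mx 0 a) (delta_mx 0 b).
  rewrite /inner trmx_mul !mulmxA.
  have E (A : 'M[R]_m) : (delta_mx 0 a *m A *m (delta_mx 0 b)^T : 'M[R]_1) 0 0 = A a b.
    by rewrite trmx_delta -rowE -colE !mxE.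
  by rewrite E => <-; rewrite -[LHS]E !mulmxA.
- move=> y cy k; apply/matrixP => a b; rewrite pmxE.
  have := Jmat_parallel J cy k a b; rewrite /covariant_derivative_endo.
  move/eqP; rewrite addr_eq0 => /eqP ->.
  rewrite sumrB opprB mxDE mxNE ![(_ *m _) a b]mxE; congr (_ - _); apply: eq_bigr => c _; rewrite /Gam mxE //.
Qed.

Definition plurim i := plurifield (gmat g i) (Jmat J i) (u \o pa i).

Lemma plurim_smooth i : smooth_mx (cod i) (plurim i).
Proof.
have LM := metric_local i; have [sJ _ _ _] := kahler_local i.
have oC := @open_cod _ _ _ i; have su' : smooth (cod i) (u \o pa i) by move/smooth_funP: su.
have sg := smooth_gradf LM su'; have sn := smooth_nab LM sg.
rewrite /plurim /plurifield; apply: smooth_mulmx => //.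
apply: smooth_mxD => //; apply: smooth_mxN => //.
by apply: smooth_mulmx => //; apply: smooth_mulmx.
Qed.

(** The transformation law is checked on the expression by the exterior derivative, whose behaviour
    under a change of charts does not involve the Christoffel symbols. *)
Lemma plurim_vfield : vfield plurim.
Proof.
have [sX cX] := grad_vfield su.
have vJ : vfield (fun i y => gradm u i y *m Jmat J i y).
  split=> [i|i j x di dj].
    apply: smooth_mulmx => //; first exact: open_cod.
    by have [] := kahler_local i.
  by rewrite -mulmxA (Jmat_transition J di dj) mulmxA cX.
pose th i y := gradm u i y *m Jmat J i y *m gmat g i y.
have oth : oneform th := flat_oneform vJ.
split=> [i|i j x di dj]; first exact: plurim_smooth.
have E k z : cod k z -> plurim k z =
    - (gradm u k z *m Jmat J k z *m dform (th k) z *m invmx (gmat g k z)).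
  move=> cz; have [sJ JJ JG Jp] := kahler_local k; move/smooth_funP: su => /(_ k) su'.
  exact: (plurifield_dform (metric_local k) su' sJ JJ JG Jp cz).
rewrite !E; try exact: codom_coord.
rewrite mulNmx; congr (- _); rewrite (dform_transition oth di dj).
have uT := tjac_unit di dj; have uG := gmat_unit (codom_coord dj).
have uGi := gmat_unit (codom_coord di).
have [_ cJ] := vJ.
rewrite -(cJ i j x) //.
set T := tj i j x in uT *.
have -> : invmx (gmat g j (co j x)) = T^T *m invmx (gmat g i (co i x)) *m T.
  rewrite (gmat_transition g di dj) -/T.
  set G := gmat g j _ in uG *.
  rewrite invmx_congr //.
  by rewrite -!mulmxA mulVmx // mulmx1 mulmxA -trmx_mul mulVmx // trmx1 mul1mx.
by rewrite !mulmxA.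
Qed.

End Tensors.

(** * Volume and the divergence theorem *)

Lemma continuous_compact_bound {R : realType} (T : topologicalType) (f : T -> R) (K : set T) :
  compact K -> (forall x, K x -> {for x, continuous f}) ->
  exists2 B : R, 0 < B & forall x, K x -> `|f x| <= B.
Proof.
move=> cK cf; have : compact (f @` K).
  by apply: continuous_compact cK; apply: continuous_in_subspaceT => x /set_mem; exact: cf.
move=> /compact_bounded [B [_ HB]]; exists (Num.max B 0 + 1).
  by rewrite ltr_wpDl // le_max lexx orbT.
by move=> x Kx; apply: (HB (Num.max B 0 + 1)); [rewrite ltr_pwDr // le_max lexx|exists x].
Qed.

Lemma compact_rcube {R : realType} m (c : 'rV[R]_m) (r : R) : compact (rcube c r).
Proof.
rewrite (_ : rcube c r = [set v | forall k, `[c 0 k - r, c 0 k + r]%classic (v 0 k)]).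
  apply: (@rV_compact _ _ (fun k => `[c 0 k - r, c 0 k + r]%classic)) => k; exact: segment_compact.
by apply/seteqP; split=> v H k; have := H k; rewrite /= in_itv /= ler_distl.
Qed.

Lemma open_rcube_sub {R : realType} m (U : set 'rV[R]_m) (c : 'rV[R]_m) : open U -> U c ->
  exists2 r : R, 0 < r & rcube c r `<=` U.
Proof.
move=> oU Uc; have /nbhs_ballP[e /= e0 H] : \forall y \near c, U y by exact: open_nbhs_nbhs.
exists (e / 2); first by rewrite divr_gt0.
move=> y Hy; apply: H; rewrite -ball_normE /= distrC; apply: rV_norm_lt => // k.
rewrite !mxE; apply: le_lt_trans (Hy k) _; rewrite ltr_pdivrMr // ltr_pMr //; lra.
Qed.

Lemma rcube_nbhs {R : realType} m (c : 'rV[R]_m) (r : R) : 0 < r ->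
  \forall y \near c, rcube c r y.
Proof.
move=> r0; apply/nbhs_ballP; exists r => // y; rewrite -ball_normE /= => h k.
by apply: le_trans (ltW h); rewrite distrC; have := rV_coord_le (y - c) k; rewrite !mxE distrC [X in _ <= X]distrC.
Qed.

Lemma integral_rV_sum {R : realType} (I : Type) (s : seq I) m (f : I -> 'rV[R]_m -> \bar R) :
  (forall k y, (0 <= f k y)%E) ->
  (\sum_(k <- s) integral_rV (f k) <= integral_rV (fun y => \sum_(k <- s) f k y))%E.
Proof.
move=> f0; elim: s => [|k s IH].
  by rewrite big_nil; apply: integral_rV_ge0 => y; rewrite big_nil.
rewrite big_cons; apply: le_trans (leeD (lexx _) IH) _.
apply: le_trans (integral_rVD _ _) _ => // [y|].
  by apply: sume_ge0 => l _.
rewrite le_eqVlt; apply/orP; left; apply/eqP; apply: eq_integral_rV => y.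
by rewrite big_cons.
Qed.

Section Integration.
Context {R : realType} {m : nat} {M : manifold R m}.
Implicit Types (i j : chart M) (x : M) (y : 'rV[R]_m).
Local Notation dom := (@chart_dom R m M).
Local Notation cod := (@chart_codom R m M).
Local Notation co := (@chart_coord R m M).
Local Notation pa := (@chart_param R m M).
Variable g : metric M.
Variable vol : {measure set (borel M) -> \bar R}.
Hypothesis Hvol : riemannian_volume g vol.

Lemma measurable_open_set (A : set (borel M)) : open (A : set M) -> measurable A.
Proof. by move=> oA; exact: sub_sigma_algebra. Qed.

Lemma measurable_closed_set (A : set (borel M)) : closed (A : set M) -> measurable A.
Proof.
by move=> cA; rewrite -[A]setCK; apply: measurableC; apply: measurable_open_set; exact: closed_openC.
Qed.

Lemma measurable_continuous (f : M -> R) : continuous f ->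
  measurable_fun [set: borel M] (f : borel M -> R).
Proof.
move=> /continuousP cf; apply: (measurability _ (RGenOpens.measurableE R)).
move=> _ [_ [a [b ->] <-]]; rewrite setTI; apply: measurable_open_set.
exact/cf/interval_open.
Qed.

Lemma sqrt_det_gt0 i y : cod i y -> 0 < Num.sqrt (\det (gmat g i y)).
Proof. by move=> cy; rewrite sqrtr_gt0; exact: posdef_det (lm_posdef (metric_local g i) cy). Qed.

Lemma sqrt_det_smooth i : smooth (cod i) (fun y => Num.sqrt (\det (gmat g i y))).
Proof.
apply: smooth_sqrt; first exact: open_cod.
  by move=> y cy; exact: posdef_det (lm_posdef (metric_local g i) cy).
by apply: smooth_det; [exact: open_cod|exact: lm_smooth (metric_local g i)].
Qed.

Local Open Scope ereal_scope.

(** The indicator discards the points outside the image of the chart, where nothing is known of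
    [chart_param] and of the metric. *)
Definition chart_density i (s : M -> R) (y : 'rV[R]_m) : R :=
  (\1_(cod i) y * s (pa i y) * Num.sqrt (\det (gmat g i y)))%R.

Lemma chart_density_ge0 i s y : (forall x, (0 <= s x)%R) -> (0 <= chart_density i s y)%R.
Proof. by move=> s0; rewrite /chart_density !mulr_ge0 ?sqrtr_ge0 // indicE ler0n. Qed.

Lemma vol_chart i (A : set (borel M)) : measurable A -> A `<=` dom i ->
  vol A = integral_rV (fun y => (chart_density i (\1_A) y)%:E).
Proof.
move=> mA Ad; rewrite (Hvol mA Ad); apply: eq_integral_rV => y; congr (_%:E).
rewrite /chart_density; congr (_ * _)%R; rewrite !indicE -natrM mulnb; congr (nat_of_bool _)%:R.
apply/idP/andP => [|[]]; rewrite !inE.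
  by move=> [x Ax <-]; have dx := Ad _ Ax; rewrite coordK //; split=> //; exact: codom_coord.
by move=> cy Ay; have [_ E] := codomP cy; exists (pa i y).
Qed.

Import HBNNSimple.

(** The volume formula holds on each level set of s. Adding up the levels gives an inequality only,
    by superadditivity of the iterated integral. *)
Lemma nnsfun_chart_le i (A : set M) (s : {nnsfun (borel M) >-> R}) : A `<=` dom i ->
  (forall x, ~ A x -> s x = 0%R) ->
  \int[vol]_x (s x)%:E <= integral_rV (fun y => (chart_density i s y)%:E).
Proof.
move=> Ad sA; rewrite integralT_nnsfun sintegralE fsbig_finite //=.
set r := fset_set _.
(* The level t = 0 is treated apart, as it need not lie in the domain of the chart. *)
pose F (t : R) y := (t * (if t == 0 then 0 else chart_density i (\1_(s @^-1` [set t])) y))%R.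
have s0 x : (0 <= s x)%R by exact: fun_ge0.
have F0 (t : R) y : (t \in range s) -> 0 <= (F t y)%:E.
  rewrite inE => -[x _ <-]; rewrite lee_fin /F mulr_ge0 //; case: ifP => // _.
  by apply: chart_density_ge0 => z; rewrite indicE ler0n.
have H t : t \in range s -> t%:E * vol (s @^-1` [set t]) = integral_rV (fun y => (F t y)%:E).
  move=> tr; have t0 : (0 <= t)%R by move: tr; rewrite inE => -[x _ <-].
  rewrite /F; case: eqVneq => [->|tn].
    by rewrite mul0e -[LHS](integral_rV0 m); apply: eq_integral_rV => y; rewrite mulr0.
  rewrite (@vol_chart i); last 2 first.
  - exact: measurable_sfunP.
  - by move=> x /= sx; apply: Ad; apply: contrapT => /sA; rewrite sx => E; move: tn; rewrite E eqxx.
  rewrite -integral_rVZ //; last by move=> y; rewrite lee_fin; apply: chart_density_ge0 => z; rewrite indicE ler0n.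
(* Superadditivity is stated for families of functions that are nonnegative for every t; the
   truncation makes it so and does not affect the values of s. *)
rewrite big_seq (eq_bigr (fun t => integral_rV (fun y => (Num.max (F t y) 0)%:E))); last first.
  move=> t; rewrite in_fset_set // => tr; rewrite H //; apply: eq_integral_rV => y.
  by congr (_%:E); rewrite max_l // -lee_fin F0.
rewrite -big_seq; apply: le_trans (integral_rV_sum _ _) _.
  by move=> t y; rewrite lee_fin le_max lexx orbT.
apply: integral_rV_le => y; first by apply: sume_ge0 => t _; rewrite lee_fin le_max lexx orbT.
rewrite sumEFin lee_fin.
have -> : (\sum_(t <- finmap.enum_fset r) Num.max (F t y) 0 = \sum_(t <- finmap.enum_fset r) F t y)%R.
  rewrite big_seq [RHS]big_seq; apply: eq_bigr => t; rewrite in_fset_set // => tr.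
  by rewrite max_l // -lee_fin F0.
rewrite /chart_density (fimfunE s (pa i y)) fsbig_finite //= -/r mulr_sumr mulr_suml.
apply: ler_sum => t _; rewrite /F; case: eqVneq => [->|tn]; first by rewrite !(mul0r, mulr0).
rewrite le_eqVlt; apply/orP; left; apply/eqP; rewrite /chart_density; ring.
Qed.

Lemma integral_chart_le i (A : set M) (h : M -> R) : A `<=` dom i ->
  (forall x, (0 <= h x)%R) -> (forall x, ~ A x -> h x = 0%R) ->
  \int[vol]_x (h x)%:E <= integral_rV (fun y => (chart_density i h y)%:E).
Proof.
move=> Ad h0 hA; apply: lower_integral_le => [x|s sh]; first by rewrite lee_fin.
apply: le_trans (nnsfun_chart_le Ad _) _.
  move=> x /hA hx; apply/eqP; rewrite eq_le fun_ge0 andbT -hx -lee_fin; exact: sh.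
apply: integral_rV_le => y; first by rewrite lee_fin; apply: chart_density_ge0 => x; exact: fun_ge0.
rewrite lee_fin /chart_density ler_wpM2r ?sqrtr_ge0 // ler_wpM2l ?indicE ?ler0n //.
by rewrite -lee_fin; exact: sh.
Qed.

Lemma sub_param_dom i (K : set 'rV[R]_m) : K `<=` cod i -> pa i @` K `<=` dom i.
Proof. by move=> KU _ [y /KU /codomP[d _] <-]. Qed.

Lemma measurable_param i (K : set 'rV[R]_m) : compact K -> K `<=` cod i ->
  measurable (pa i @` K : set (borel M)).
Proof. by move=> cK KU; apply: measurable_closed_set; exact: closed_param. Qed.

Lemma param_memE i (K : set 'rV[R]_m) y : K `<=` cod i -> cod i y ->
  (pa i @` K) (pa i y) -> K y.
Proof.
move=> KU cy [z Kz E]; have [_ Ez] := codomP (KU _ Kz); have [_ Ey] := codomP cy.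
by rewrite -Ey -E Ez.
Qed.

Lemma vol_param_lty i (K : set 'rV[R]_m) : compact K -> K `<=` cod i ->
  vol (pa i @` K) < +oo.
Proof.
move=> cK KU.
rewrite (vol_chart (measurable_param cK KU) (sub_param_dom KU)).
have [B B0 HB] : exists2 B : R, (0 < B)%R & forall y, K y ->
    (`|Num.sqrt (\det (gmat g i y))| <= B)%R.
  apply: continuous_compact_bound => // y /KU cy.
  exact: smooth_continuous (sqrt_det_smooth i) cy.
have [r r0 Hr] : exists2 r : R, (0 < r)%R & forall y, K y -> (`| `|y| | <= r)%R.
  by apply: continuous_compact_bound => // y _; exact: norm_continuous.
apply: (@le_lt_trans _ _ (integral_rV (fun y : 'rV[R]_m => B%:E * (\1_(rcube 0%R r) y)%:E))).
  apply: integral_rV_le => y.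
    by rewrite lee_fin; apply: chart_density_ge0 => x; rewrite indicE ler0n.
  rewrite -EFinM lee_fin /chart_density !indicE.
  have [cy|ncy] := boolP (y \in cod i); last by rewrite !mul0r mulr_ge0 ?ler0n // ltW.
  have [/set_mem Ky|nKy] := boolP (_ \in pa i @` K); last by rewrite mulr0 mul0r mulr_ge0 ?ler0n // ltW.
  have {}Ky : K y by apply: param_memE Ky => //; exact/set_mem.
  rewrite !mul1r mem_set ?mulr1 //; first by apply: le_trans (HB _ Ky); exact: ler_norm.
  move=> k; rewrite mxE subr0; apply: le_trans (rV_coord_le y k) _.
  by have := Hr _ Ky; rewrite normr_id.
rewrite integral_rVZ ?(ltW B0) //.
by rewrite integral_rV_cube ?(ltW r0) // -EFinM ltry.
Qed.

Lemma vol_param_gt0 i (c : 'rV[R]_m) (r : R) : (0 < r)%R -> rcube c r `<=` cod i ->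
  0 < vol (pa i @` rcube c r).
Proof.
move=> r0 KU; have cK := @compact_rcube R m c r.
rewrite (vol_chart (measurable_param cK KU) (sub_param_dom KU)).
have [B B0 HB] : exists2 B : R, (0 < B)%R & forall y, rcube c r y ->
    (`|(Num.sqrt (\det (gmat g i y)))^-1| <= B)%R.
  apply: continuous_compact_bound => // y /KU cy.
  apply: continuousV; first by rewrite gt_eqF // sqrt_det_gt0.
  exact: smooth_continuous (sqrt_det_smooth i) cy.
apply: (@lt_le_trans _ _ (integral_rV (fun y : 'rV[R]_m => (B^-1)%:E * (\1_(rcube c r) y)%:E))).
  rewrite integral_rVZ ?invr_ge0 ?(ltW B0) //.
  by rewrite integral_rV_cube ?(ltW r0) // -EFinM lte_fin mulr_gt0 ?invr_gt0 ?exprn_gt0 ?mulr_gt0.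
apply: integral_rV_le => y.
  by rewrite -EFinM lee_fin mulr_ge0 ?invr_ge0 ?(ltW B0) // indicE ler0n.
rewrite -EFinM lee_fin {1}indicE.
have [/set_mem Ky|_] := boolP (y \in _); last first.
  by rewrite mulr0; apply: chart_density_ge0 => x; rewrite indicE ler0n.
have cy := KU _ Ky; rewrite /chart_density !indicE !mem_set //.
rewrite !mulr1 mul1r -[leRHS]invrK lef_pV2 ?posrE ?invr_gt0 ?sqrt_det_gt0 //.
by apply: le_trans (HB _ Ky); exact: ler_norm.
Qed.

(** [integral_chart_le] gives one inequality for h and also for the complement [k], equal to B on
    the compact set minus h. Superadditivity bounds the sum of the two iterated integrals by B vol
    A, which is the sum of the integrals over M. As this is finite, both inequalities are
    equalities. *)
Lemma integral_chartE i (K : set 'rV[R]_m) (h : M -> R) (B : R) : compact K -> K `<=` cod i ->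
  measurable_fun [set: borel M] (h : borel M -> R) ->
  (forall x, (0 <= h x <= B)%R) -> (forall x, ~ (pa i @` K) x -> h x = 0%R) ->
  \int[vol]_x (h x)%:E = integral_rV (fun y => (chart_density i h y)%:E).
Proof.
move=> cK KU mh hB hK.
set A : set M := pa i @` K; have mA : measurable (A : set (borel M)) := measurable_param cK KU.
have Ad : A `<=` dom i := sub_param_dom KU.
have h0 x : (0 <= h x)%R by have /andP[] := hB x.
have B0 : (0 <= B)%R by have /andP[h1 h2] := hB point; exact: le_trans h1 h2.
pose k x : R := (B * \1_A x - h x)%R.
have k0 x : (0 <= k x)%R.
  rewrite /k subr_ge0 indicE; have [_|nA] := boolP (x \in A).
    by rewrite mulr1; have /andP[] := hB x.
  by rewrite hK ?mulr0 // => Ax; move: nA; rewrite mem_set.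
have kA x : ~ A x -> k x = 0%R.
  by move=> nA; rewrite /k indicE memNset // mulr0 hK // subrr.
have mk : measurable_fun [set: borel M] (k : borel M -> R).
  apply: measurable_funB => //; apply: measurable_funM; first exact: measurable_cst.
  exact: measurable_indic.
have le1 := integral_chart_le Ad h0 hK; have le2 := integral_chart_le Ad k0 kA.
have E1 : \int[vol]_x (h x)%:E + \int[vol]_x (k x)%:E = B%:E * vol A.
  rewrite -ge0_integralD //; last 4 first.
  - by move=> x _; rewrite lee_fin.
  - exact/measurable_EFinP.
  - by move=> x _; rewrite lee_fin.
  - exact/measurable_EFinP.
  rewrite -(setIT A) -(integral_indic vol measurableT mA) -lower_integralZ //.
  by apply: eq_integral => x _; rewrite -EFinD -EFinM; congr EFin; rewrite /k addrC subrK.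
have E2 : integral_rV (fun y => (chart_density i h y)%:E) +
    integral_rV (fun y => (chart_density i k y)%:E) <= B%:E * vol A.
  apply: le_trans (integral_rVD _ _) _.
  - by move=> y; rewrite lee_fin; exact: chart_density_ge0.
  - by move=> y; rewrite lee_fin; exact: chart_density_ge0.
  rewrite (vol_chart mA Ad) -integral_rVZ //; last first.
    by move=> y; rewrite lee_fin; apply: chart_density_ge0 => x; rewrite indicE ler0n.
  rewrite le_eqVlt; apply/orP; left; apply/eqP; apply: eq_integral_rV => y.
  rewrite -EFinD -EFinM; congr EFin; rewrite /chart_density /k; ring.
have fA : B%:E * vol A < +oo.
  rewrite lte_mul_pinfty ?lee_fin //; exact: vol_param_lty.
have ge1 : 0 <= \int[vol]_x (h x)%:E by apply: integral_ge0 => x _; rewrite lee_fin.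
have ge2 : 0 <= \int[vol]_x (k x)%:E by apply: integral_ge0 => x _; rewrite lee_fin.
move: le1 le2 E1 E2 fA ge1 ge2.
set a := (\int[vol]_x (h x)%:E); set b := (\int[vol]_x (k x)%:E).
set a' := integral_rV _; set b' := integral_rV _; set C := _ * _.
move=> le1 le2 E1 E2 fC ge1 ge2; apply/eqP; rewrite eq_le le1 /=.
have fb : b \is a fin_num.
  by rewrite ge0_fin_numE //; apply: le_lt_trans fC; rewrite -E1 leeDr.
rewrite -(leeD2rE _ _ fb); apply: le_trans (leeD (lexx _) le2) _.
by rewrite E1.
Qed.

Lemma integral_extend0 i (K : set 'rV[R]_m) (w : 'rV[R]_m -> R) : compact K -> K `<=` cod i ->
  continuous w -> (forall y, (0 <= w y)%R) -> (forall y, ~ K y -> w y = 0%R) ->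
  \int[vol]_x (extend0 i (fun y => w y / Num.sqrt (\det (gmat g i y)))%R x)%:E =
  integral_rV (fun y => (w y)%:E).
Proof.
move=> cK KU cw w0 wK; set h := extend0 i _.
have cq y : cod i y -> {for y, continuous (fun y => w y / Num.sqrt (\det (gmat g i y)))%R}.
  move=> cy; apply: continuousM; first exact: cw.
  apply: continuousV; first by rewrite gt_eqF // sqrt_det_gt0.
  exact: smooth_continuous (sqrt_det_smooth i) cy.
have qK y : cod i y -> ~ K y -> (w y / Num.sqrt (\det (gmat g i y)) = 0)%R.
  by move=> _ /wK ->; rewrite mul0r.
have ch : continuous h by exact: (extend0_continuous cK KU qK cq).
have hK x : ~ (pa i @` K) x -> h x = 0%R by exact: extend0_out qK x.
have h0 x : (0 <= h x)%R.
  by rewrite /h /extend0; case: ifP => // _; rewrite divr_ge0 // sqrtr_ge0.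
have [B B0 HB] : exists2 B : R, (0 < B)%R & forall x, (pa i @` K) x -> (`|h x| <= B)%R.
  by apply: continuous_compact_bound => [|x _]; [exact: compact_param|exact: ch].
rewrite (@integral_chartE i K h B) //; last 2 first.
- exact: measurable_continuous.
- move=> x; rewrite h0 /=; have [Ax|nA] := pselect ((pa i @` K) x).
    by apply: le_trans (HB _ Ax); exact: ler_norm.
  by rewrite hK // ltW.
apply: eq_integral_rV => y; congr EFin; rewrite /chart_density indicE.
have [/set_mem cy|ncy] := boolP (y \in cod i).
  by rewrite mul1r /h extend0_param // divfK // gt_eqF // sqrt_det_gt0.
rewrite !mul0r wK // => Ky; move: ncy; rewrite mem_set //; exact: KU.
Qed.

Lemma chart_compact_nbhs x : exists2 K : set 'rV[R]_m,
  [/\ compact K, K `<=` cod (chart_at x) & (forall y, K y -> cod (chart_at x) y)] &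
  \forall z \near x, (pa (chart_at x) @` K) z.
Proof.
have dx : dom (chart_at x) x by exact: chart_atP.
have [r r0 KU] := open_rcube_sub (@open_cod _ _ _ _) (codom_coord dx).
exists (rcube (co (chart_at x) x) r) => //; first by split=> //; exact: compact_rcube.
have h1 := near_dom dx; have h2 := near_coord dx (rcube_nbhs _ r0).
by apply: filterS2 h1 h2 => z dz Kz; exists (co (chart_at x) z) => //; exact: coordK.
Qed.

Lemma vol_open_gt0 (U : set M) x : open U -> U x -> 0 < vol U.
Proof.
move=> oU Ux; pose i := chart_at x; have dx : dom i x by exact: chart_atP.
have oV : open [set y | cod i y /\ U (pa i y)].
  rewrite openE => y [cy Uy]; have h1 := near_cod cy.
  have h2 : \forall z \near y, U (pa i z) by apply: near_param => //; exact: open_nbhs_nbhs.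
  by apply: filterS2 h1 h2 => z ? ?; split.
have [|r r0 KU] := open_rcube_sub (c := co i x) oV.
  by split; [exact: codom_coord|rewrite coordK].
have KU' : rcube (co i x) r `<=` cod i by move=> y /KU[].
apply: (lt_le_trans (vol_param_gt0 r0 KU')); apply: le_measure.
- by rewrite inE; apply: measurable_param => //; exact: compact_rcube.
- by rewrite inE; exact: measurable_open_set.
- by move=> _ [y /KU[_ Uy] <-].
Qed.

Lemma vol_compact_lty (K : set M) : compact K -> vol K < +oo.
Proof.
move=> cK.
have /choice[A HA] x : exists A : set M, [/\ measurable (A : set (borel M)), vol A < +oo & nbhs x A].
  have [L [cL LU _] nL] := chart_compact_nbhs x.
  by exists (pa (chart_at x) @` L); split; [exact: measurable_param|exact: vol_param_lty|].
have [|s [_ Hs]] := compact_cover_seq (U := fun x => interior (A x)) cK.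
  by move=> x _; split; [exact: open_interior|have [_ _] := HA x].
pose B := \big[setU/set0]_(x <- s) (A x : set (borel M)).
have mB : measurable B by apply: bigsetU_measurable => x _; have [] := HA x.
apply: (@le_lt_trans _ _ (vol B)).
  apply: le_measure; rewrite ?inE //.
    by apply: measurable_closed_set; apply: compact_closed cK; exact: manifold_hausdorff.
  move=> z /Hs[x xs /interior_subset Az]; rewrite /B -bigcup_seq; by exists x.
rewrite /B; elim: s {Hs B mB} => [|x s IH]; first by rewrite big_nil measure0 ltry.
rewrite big_cons; have [mA fA _] := HA x.
have mB : measurable (\big[setU/set0]_(j <- s) (A j : set (borel M))).
  by apply: bigsetU_measurable => z _; have [] := HA z.
by apply: (le_lt_trans (measureU2 vol mA mB)); rewrite lte_add_pinfty.
Qed.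

Lemma integrable_compact (f : M -> R) (C : set M) : continuous f -> compact C ->
  (forall x, ~ C x -> f x = 0%R) -> vol.-integrable [set: borel M] (EFin \o f).
Proof.
move=> cf cC fC.
have mC : measurable (C : set (borel M)).
  by apply: measurable_closed_set; apply: compact_closed cC; exact: manifold_hausdorff.
have -> : EFin \o f = (EFin \o f) \_ C.
  apply/funext => x; rewrite /patch; case: ifPn => // xC; rewrite /= fC //.
  by move=> Cx; move: xC; rewrite mem_set.
apply/(integrable_mkcond _ mC); apply: measurable_bounded_integrable => //.
- exact: vol_compact_lty.
- by apply: measurable_funTS; exact: measurable_continuous.
have [B B0 HB] : exists2 B : R, (0 < B)%R & forall x, C x -> (`|f x| <= B)%R.
  by apply: continuous_compact_bound => // x _; exact: cf.
exists B; split; first exact: num_real.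
by move=> t Bt x Cx; apply: le_trans (HB _ Cx) (ltW Bt).
Qed.

End Integration.

Lemma cvg_inv_nat {R : realType} (d : R) : d / n.+1%:R @[n --> \oo] --> 0.
Proof.
rewrite -[X in _ --> X](mulr0 d); apply: cvgM; first exact: cvg_cst.
exact: cvg_harmonic.
Qed.

Lemma partial_zero_out {R : realType} m (K : set 'rV[R]_m) (w : 'rV[R]_m -> R) k y :
  closed K -> (forall z, ~ K z -> w z = 0) -> ~ K y -> partial k w y = 0.
Proof.
move=> cK wK nK; rewrite (partial_eq_on (f := w) (g := fun=> 0) (closed_openC cK) wK k nK).
exact: partial_cst.
Qed.

Lemma integrable_cst_indic {R : realType} d (T : measurableType d)
    (mu : {measure set T -> \bar R}) (c : R) (A : set T) :
  0 <= c -> measurable A -> (mu A < +oo)%E ->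
  mu.-integrable setT (fun x => (c * \1_A x)%:E).
Proof.
move=> c0 mA fA; apply/integrableP; split.
  apply/measurable_EFinP; apply: measurable_funM; first exact: measurable_cst.
  exact: measurable_indic.
rewrite (eq_integral (fun x => c%:E * (\1_A x)%:E)%E); last first.
  by move=> x _; rewrite -EFinM gee0_abs // lee_fin mulr_ge0 // indicE ler0n.
rewrite lower_integralZ //.
by rewrite integral_indic // setIT lte_mul_pinfty ?lee_fin.
Qed.

Definition thicken {R : realType} m (K : set 'rV[R]_m) (dl : R) : set 'rV[R]_m :=
  [set y | exists2 z, K z & rcube z dl y].

Lemma sub_thicken {R : realType} m (K : set 'rV[R]_m) (dl : R) y : K y -> rcube y dl `<=` thicken K dl.
Proof. by move=> Ky z h; exists y. Qed.

Lemma compact_thicken {R : realType} m (K : set 'rV[R]_m) (dl : R) : compact K ->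
  compact (thicken K dl).
Proof.
move=> cK.
rewrite (_ : thicken K dl = (fun p : 'rV[R]_m * 'rV[R]_m => p.1 + p.2) @` (K `*` rcube 0 dl)).
  apply: continuous_compact; last by apply: compact_setX => //; exact: compact_rcube.
  by apply: continuous_subspaceT => p; apply: cvgD; [exact: cvg_fst|exact: cvg_snd].
apply/seteqP; split=> [y [z Kz H]|_ [[z v] [/= Kz Hv] <-]].
  by exists (z, y - z) => /=; [split=> //= k; have := H k; rewrite !mxE subr0|rewrite addrC subrK].
by exists z => // k; have := Hv k; rewrite !mxE subr0 addrAC subrr add0r.
Qed.

Lemma compact_thickening {R : realType} m (K U : set 'rV[R]_m) : compact K -> open U -> K `<=` U ->
  exists2 dl : R, 0 < dl & thicken K dl `<=` U.
Proof.
move=> cK oU KU.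
have /choice[r Hr] z : exists r : R, 0 < r /\ (K z -> rcube z (2 * r) `<=` U).
  have [Kz|nK] := pselect (K z); last by exists 1.
  have [r r0 H] := open_rcube_sub oU (KU _ Kz); exists (r / 2); split=> [|_]; first exact: divr_gt0.
  by rewrite mulrC divfK.
have [z Kz|s [sK Hs]] := compact_cover_seq (U := fun z => interior (rcube z (r z))) cK.
  by split; [exact: open_interior|apply: rcube_nbhs; have [] := Hr z].
have [dl [dl0 Hdl]] : exists dl : R, 0 < dl /\ forall z, z \in s -> dl <= r z.
  elim: s {sK Hs} => [|z s [dl [dl0 IH]]]; first by exists 1.
  exists (Num.min dl (r z)); split; first by rewrite lt_min dl0; have [] := Hr z.
  move=> x; rewrite inE => /predU1P[->|/IH h]; first by rewrite ge_min lexx orbT.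
  by rewrite ge_min h.
exists dl => // y [z /Hs[x xs /interior_subset Hx] Hy].
have [_] := Hr x; apply; [exact: sK|move=> k].
have := Hy k; have := Hx k; have := Hdl _ xs; rewrite !ler_distl => h0 /andP[h1 h2] /andP[h3 h4].
by apply/andP; split; lra.
Qed.

(** * Integration by parts in a chart *)

Section ByParts.
Context {R : realType} {m : nat} {M : manifold R m}.
Implicit Types (i j : chart M) (x : M) (y : 'rV[R]_m).
Local Notation dom := (@chart_dom R m M).
Local Notation cod := (@chart_codom R m M).
Local Notation co := (@chart_coord R m M).
Local Notation pa := (@chart_param R m M).
Variable g : metric M.
Variable vol : {measure set (borel M) -> \bar R}.
Hypothesis Hvol : riemannian_volume g vol.

Local Notation dens i := (fun y => Num.sqrt (\det (gmat g i y))).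

(** Dividing by the density makes the integral over M equal to the flat integral of w. *)
Definition pullback i (w : 'rV[R]_m -> R) : M -> R := extend0 i (fun y => w y / dens i y).

Section Cube.
Variables (i : chart M) (K : set 'rV[R]_m).
Hypotheses (cK : compact K) (KU : K `<=` cod i).

Lemma pullback_continuous (w : 'rV[R]_m -> R) : continuous w -> (forall y, ~ K y -> w y = 0) ->
  continuous (pullback i w).
Proof.
move=> cw wK; apply: (extend0_continuous cK KU) => [y _ /wK ->|y cy]; first by rewrite mul0r.
apply: continuousM; first exact: cw.
apply: continuousV; first by rewrite gt_eqF // sqrt_det_gt0.
exact: smooth_continuous (sqrt_det_smooth g i) cy.
Qed.

Lemma pullback_out (w : 'rV[R]_m -> R) x : (forall y, ~ K y -> w y = 0) ->
  ~ (pa i @` K) x -> pullback i w x = 0.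
Proof. by move=> wK; apply: extend0_out => y _ /wK ->; rewrite mul0r. Qed.

Lemma pullback_integrable (w : 'rV[R]_m -> R) : continuous w -> (forall y, ~ K y -> w y = 0) ->
  vol.-integrable [set: borel M] (EFin \o (pullback i w : borel M -> R)).
Proof.
move=> cw wK; apply: (integrable_compact Hvol (C := pa i @` K)).
- exact: pullback_continuous.
- exact: compact_param.
- by move=> x; exact: pullback_out.
Qed.

(** Positive and negative parts are separated because the comparison with [integral_rV] concerns
    nonnegative functions. *)
Lemma integral_pullback (w : 'rV[R]_m -> R) : continuous w -> (forall y, ~ K y -> w y = 0) ->
  (\int[vol]_x (pullback i w x)%:E =
   integral_rV (fun y => (Num.max (w y) 0)%:E) - integral_rV (fun y => (Num.max (- w y) 0)%:E))%E.
Proof.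
move=> cw wK.
have cp (s : R) : continuous (fun y => Num.max (s * w y) 0).
  move=> y; apply: (@continuous_max _ _ (fun y => s * w y) (fun=> 0)); last exact: cst_continuous.
  by apply: continuousM; [exact: cst_continuous|exact: cw].
have pK (s : R) y : ~ K y -> Num.max (s * w y) 0 = 0 by move=> /wK ->; rewrite mulr0 maxxx.
have p0 (s : R) y : 0 <= Num.max (s * w y) 0 by rewrite le_max lexx orbT.
have I s := integral_extend0 Hvol cK KU (cp s) (p0 s) (pK s).
rewrite (_ : (fun y => (Num.max (w y) 0)%:E) = (fun y => (Num.max (1 * w y) 0)%:E)); last first.
  by apply/funext => y; rewrite mul1r.
rewrite (_ : (fun y => (Num.max (- w y) 0)%:E) = (fun y => (Num.max (-1 * w y) 0)%:E)); last first.
  by apply/funext => y; rewrite mulN1r.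
rewrite -!I -integralB //=; last 2 first.
- exact: pullback_integrable (cp 1) (pK 1).
- exact: pullback_integrable (cp (-1)) (pK (-1)).
apply: eq_integral => x _; rewrite -EFinB; congr EFin; rewrite /pullback /extend0.
case: ifP => _; last by rewrite subr0.
rewrite -mulrBl; congr (_ / _); rewrite mul1r mulN1r.
by have [w0|w0] := leP 0 (w (co i x)); [rewrite max_r ?oppr_le0 // subr0|rewrite max_l ?oppr_ge0 ?ltW //; ring].
Qed.

End Cube.

Lemma integral_pullback_shift i (K K' : set 'rV[R]_m) (w : 'rV[R]_m -> R) v :
  compact K' -> K' `<=` cod i -> continuous w -> (forall y, ~ K y -> w y = 0) ->
  K `<=` K' -> (forall y, K (y + v) -> K' y) ->
  (\int[vol]_x (pullback i (fun y => w (y + v)) x)%:E = \int[vol]_x (pullback i w x)%:E)%E.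
Proof.
move=> cK' KU cw wK KK' Kv.
rewrite (integral_pullback cK' KU cw); last by move=> y nK; apply: wK => /KK'.
rewrite (integral_pullback cK' KU (w := fun y => w (y + v))); last 2 first.
- move=> y; apply: (@continuous_comp _ _ _ (fun y => y + v) w); last exact: cw.
  by apply: continuousD; [exact: cvg_id|exact: cst_continuous].
- by move=> y nK; apply: wK => /Kv.
congr (_ - _)%E.
  by apply: (integral_rV_shift v (f := fun y => (Num.max (w y) 0)%:E)) => y; rewrite lee_fin le_max lexx orbT.
by apply: (integral_rV_shift v (f := fun y => (Num.max (- w y) 0)%:E)) => y; rewrite lee_fin le_max lexx orbT.
Qed.

Lemma smooth_increment_le (w : 'rV[R]_m -> R) k (C : R) : smooth setT w ->
  (forall y, `|partial k w y| <= C) -> forall y (s : R),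
  `|w (y + s *: delta_mx 0 k) - w y| <= C * `|s|.
Proof.
move=> sw HC y s.
have := @line_increment R _ w y (delta_mx 0 k) s 0 C; rewrite mulr0 subr0; apply=> t _.
by split; [exact: smooth_derivable sw _|rewrite subr0; exact: HC].
Qed.

(* Translation invariance makes the integrals of all difference quotients vanish. *)
Lemma integral_partial0 i (K K' : set 'rV[R]_m) (dl : R) (w : 'rV[R]_m -> R) k : 0 < dl ->
  compact K -> compact K' -> K' `<=` cod i -> (forall y, K y -> rcube y dl `<=` K') ->
  smooth setT w -> (forall y, ~ K y -> w y = 0) ->
  (\int[vol]_x (pullback i (partial k w) x)%:E = 0)%E.
Proof.
move=> dl0 cK cK' KU HK sw wK.
have clK : closed K by apply: compact_closed cK; exact: norm_hausdorff.
have KK' : K `<=` K' by move=> y Ky; apply: (HK y) => // l; rewrite subrr normr0 ltW.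
have cw : continuous w by move=> y; exact: smooth_continuous sw _.
have sp := smooth_partial k sw.
have cp : continuous (partial k w) by move=> y; exact: smooth_continuous sp _.
have pK y : ~ K y -> partial k w y = 0 by exact: partial_zero_out.
have [C C0 HC] : exists2 C : R, 0 < C & forall y, `|partial k w y| <= C.
  have [C C0 H] := continuous_compact_bound cK (fun y _ => cp y); exists C => // y.
  by have [/H//|/pK ->] := pselect (K y); rewrite normr0 ltW.
have [B B0 HB] : exists2 B : R, 0 < B & forall y, K' y -> `|(dens i y)^-1| <= B.
  apply: continuous_compact_bound => // y /KU cy.
  apply: continuousV; first by rewrite gt_eqF // sqrt_det_gt0.
  exact: smooth_continuous (sqrt_det_smooth g i) cy.
(* Steps of length at most dl, so that all translated supports stay in K'. *)
pose t n : R := dl / n.+1%:R.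
have t0 n : 0 < t n by rewrite divr_gt0.
have tle n : t n <= dl by rewrite ler_pdivrMr // ler_peMr ?ler1n // ltW.
pose e : 'rV[R]_m := delta_mx 0 k.
have Kt n y : K (y + t n *: e) -> K' y.
  move=> H; apply: (HK _ H) => l; rewrite !mxE eqxx /= opprD addrA subrr sub0r normrN.
  case: (l == k) => /=; rewrite ?mulr1 ?mulr0 ?normr0 ?(ltW dl0) //.
  by rewrite gtr0_norm.
pose D n : borel M -> R := pullback i (fun y => (t n)^-1 * (w (y + t n *: e) - w y)).
have cs n : continuous (fun y => w (y + t n *: e)).
  move=> y; apply: (@continuous_comp _ _ _ (fun y => y + t n *: e) w); last exact: cw.
  by apply: continuousD; [exact: cvg_id|exact: cst_continuous].
have ID n : (\int[vol]_x (D n x)%:E = 0)%E.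
  have i1 := pullback_integrable cK' KU (cs n) (fun y nK => wK _ (fun h => nK (Kt n y h))).
  have i2 := pullback_integrable cK' KU cw (fun y nK => wK _ (fun h => nK (KK' y h))).
  transitivity (\int[vol]_x ((t n)^-1%:E * ((pullback i (fun y => w (y + t n *: e)) x)%:E - (pullback i w x)%:E)))%E.
    apply: eq_integral => x _; rewrite -EFinB -EFinM; congr EFin.
    rewrite /D /pullback /extend0; case: ifP => _; last by rewrite subr0 mulr0.
    by rewrite -mulrBl mulrA.
  rewrite integralZl //; last exact: integrableB.
  rewrite integralB // (integral_pullback_shift cK' KU cw wK KK' (Kt n)) subee ?mule0 //.
  exact: integrable_fin_num.
have cD n : continuous (D n).
  apply: (pullback_continuous cK' KU) => [y|y nK].
    have h : {for y, continuous (fun z : 'rV[R]_m => w (z + t n *: e) - w z)}.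
      by apply: continuousB; [exact: cs|exact: cw].
    exact: continuousM (@cst_continuous _ _ (t n)^-1 y) h.
  by rewrite wK ?(wK y) ?subrr ?mulr0 // => h; apply: nK; [exact: KK'|exact: (Kt n)].
pose A : set (borel M) := pa i @` K'.
have mA : measurable A by exact: measurable_param.
have DA n x : ~ A x -> D n x = 0.
  apply: (pullback_out (K := K')) => y nK.
  by rewrite wK ?(wK y) ?subrr ?mulr0 // => h; apply: nK; [exact: KK'|exact: (Kt n)].
have bD n x : `|D n x| <= C * B * \1_A x.
  have [Ax|nA] := pselect (A x); last by rewrite DA // normr0 mulr_ge0 ?indicE ?ler0n // mulr_ge0 ?ltW.
  rewrite indicE mem_set // mulr1; case: Ax => y Ky <-.
  rewrite /D /pullback extend0_param; last exact: KU.
  rewrite normrM; apply: ler_pM => //; last exact: HB.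
  rewrite normrM normfV (gtr0_norm (t0 n)) mulrC ler_pdivrMr //.
  by have := smooth_increment_le sw HC y (t n); rewrite (gtr0_norm (t0 n)).
have cvD x : D n x @[n --> \oo] --> pullback i (partial k w) x.
  rewrite /D /pullback /extend0; case: ifP => _; last exact: cvg_cst.
  apply: cvgM; last exact: cvg_cst.
  have : derivable w (co i x) e by exact: smooth_derivable sw I.
  rewrite /derivable => /cvg_ex[l Hl].
  have El : partial k w (co i x) = l by rewrite /partial /derive; apply: cvg_lim.
  rewrite El; move: Hl => /cvgr_dnbhsP /(_ t).
  move=> Ht; suff <- : (fun n => (t n)^-1 *: ((w \o shift (co i x)) (t n *: e) - w (co i x)) : R) =
      (fun n => (t n)^-1 * (w (co i x + t n *: e) - w (co i x))).
    apply: Ht.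
    by split=> [n|]; [rewrite gt_eqF|exact: cvg_inv_nat].
  by apply/funext => n; rewrite /= [co i x + _]addrC.
have cvE x : (D n x)%:E @[n --> \oo] --> (pullback i (partial k w) x)%:E.
  by apply: cvg_EFin; [exact: nearW|exact: cvD].
have mg : measurable_fun [set: borel M] (fun x => (C * B * \1_A x)%:E).
  apply/measurable_EFinP; apply: measurable_funM; first exact: measurable_cst.
  exact: measurable_indic.
have ig : vol.-integrable [set: borel M] (fun x => (C * B * \1_A x)%:E).
  apply: integrable_cst_indic => //; first exact/ltW/mulr_gt0.
  exact: (vol_param_lty Hvol).
have [_ _] := @dominated_convergence _ _ _ vol setT measurableT
  (fun n x => (D n x)%:E) (fun x => (pullback i (partial k w) x)%:E) (fun x => (C * B * \1_A x)%:E)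
  (fun n => (measurable_EFinP _ _).2 (measurable_continuous (cD n)))
  ((measurable_EFinP _ _).2 (measurable_continuous
     (pullback_continuous cK (fun y h => KU y (KK' y h)) cp pK)))
  (aeW vol (fun x _ => cvE x)) ig
  (aeW vol (fun x n _ => bD n x)).
have -> : [sequence (\int[vol]_x (D n x)%:E)%E]_n = (fun=> 0%E).
  by apply/funext => n; exact: ID.
by move=> /cvg_lim <- //; rewrite lim_cst.
Qed.

Lemma smooth_extend_set (U K : set 'rV[R]_m) (f : 'rV[R]_m -> R) : open U -> closed K -> K `<=` U ->
  smooth U f -> (forall y, U y -> ~ K y -> f y = 0) ->
  smooth setT (fun y => if y \in U then f y else 0).
Proof.
move=> oU cK KU sf fK; apply: smooth_glue => y _.
have [Uy|nU] := pselect (U y); first by exists U, f; split=> // z Uz; rewrite mem_set.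
exists (~` K), (fun=> 0); have oK : open (~` K) by exact: closed_openC.
split=> //; [by move=> /KU|exact: smooth_cst|].
by move=> z nK; case: ifPn => // /set_mem Uz; rewrite fK.
Qed.

(** By [div_density] the integrand is the sum of the partial derivatives of the components of
    density times phi X, divided by the density. These components extend by 0 to smooth functions on
    the whole space, and each term has integral 0. *)
Lemma integral_divergence_chart i (K : set 'rV[R]_m) (phi : M -> R) (X : 'rV[R]_m -> 'rV[R]_m) :
  compact K -> K `<=` cod i -> smooth_fun phi -> smooth_mx (cod i) X ->
  (forall x, ~ (pa i @` K) x -> phi x = 0) ->
  (\int[vol]_x (extend0 i (fun y => phi (pa i y) * \tr (nab (gmat g i) X y)
     + (drow (phi \o pa i) y *m (X y)^T) 0 0) x)%:E = 0)%E.
Proof.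
move=> cK KU' sphi sX phiK.
have [dl dl0 KU] := compact_thickening cK (@open_cod _ _ _ i) KU'.
have cK' := @compact_thicken R m K dl cK; have KK' := @sub_thicken R m K dl.
have clK : closed K by apply: compact_closed cK; exact: norm_hausdorff.
have oC := @open_cod _ _ _ i; have sp : smooth (cod i) (phi \o pa i) by move/smooth_funP: sphi.
have sd := sqrt_det_smooth g i.
have pK y : cod i y -> ~ K y -> phi (pa i y) = 0.
  by move=> cy nK; apply: phiK => /(param_memE KU' cy).
pose f k y := phi (pa i y) * (dens i y * X y 0 k).
have sdX k : smooth (cod i) (fun y => dens i y * X y 0 k) by exact: smoothM.
have sf k : smooth (cod i) (f k) by exact: smoothM.
have fK k y : cod i y -> ~ K y -> f k y = 0 by move=> cy /(pK _ cy) h; rewrite /f h mul0r.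
pose w k y := if y \in cod i then f k y else 0.
have sw k : smooth setT (w k) by exact: smooth_extend_set (sf k) (fK k).
have wK k y : ~ K y -> w k y = 0.
  by move=> nK; rewrite /w; case: ifPn => // /set_mem cy; exact: fK.
have E y : cod i y -> \sum_k partial k (w k) y = dens i y *
    (phi (pa i y) * \tr (nab (gmat g i) X y) + (drow (phi \o pa i) y *m (X y)^T) 0 0).
  move=> cy.
  have -> : \sum_k partial k (w k) y = \sum_k (phi (pa i y) * partial k (fun y => dens i y * X y 0 k) y
      + dens i y * X y 0 k * partial k (phi \o pa i) y).
    apply: eq_bigr => k _; rewrite (partial_eq_on (g := f k) oC _ _ cy); last first.
      by move=> z cz; rewrite /w mem_set.
    exact: (partialM k sp (sdX k) cy).
  rewrite big_split /= -mulr_sumr (div_density (metric_local g i) sX cy) mulrDr mulrCA; congr (_ + _).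
  rewrite [X in _ = _ * X]mxE mulr_sumr; apply: eq_bigr => k _.
  by rewrite [drow _ _ _ _]mxE [(_^T) _ _]mxE; ring.
rewrite (eq_integral (fun x : borel M => \sum_(k <- index_enum 'I_m) (pullback i (partial k (w k)) x)%:E)%E); last first.
  move=> x _; rewrite sumEFin; congr EFin; rewrite /pullback /extend0.
  case: ifPn => [/set_mem dx|_]; last by rewrite big1.
  rewrite -mulr_suml E; last exact: codom_coord.
  by rewrite mulrAC divff ?mul1r // gt_eqF // sqrt_det_gt0 //; exact: codom_coord.
have sk k := smooth_partial k (sw k).
rewrite (integral_sum measurableT (f := fun (k : 'I_m) (x : borel M) => (pullback i (partial k (w k)) x)%:E)); last first.
  move=> k; apply: (pullback_integrable cK KU') => y; first exact: smooth_continuous (sk k) _.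
  by move=> nK; apply: (partial_zero_out k clK _ nK); exact: wK.
by apply: big1 => k _; exact: (integral_partial0 k dl0 cK cK' KU KK' (sw k) (wK k)).
Qed.

End ByParts.

(** * Bump functions *)

Section Bumps.
Context {R : realType}.

Lemma flat1_ge0 (t : R) : 0 <= flat 1 t.
Proof. by rewrite /flat; case: ifP => // _; rewrite hornerC mul1r expR_ge0. Qed.

Lemma flat1_gt0 (t : R) : 0 < t -> 0 < flat 1 t.
Proof. by move=> t0; rewrite /flat t0 hornerC mul1r expR_gt0. Qed.

Lemma flat1_eq0 (t : R) : t <= 0 -> flat 1 t = 0.
Proof. by move=> t0; rewrite /flat ltNge t0. Qed.

Definition smoothstep (t : R) : R := flat 1 t / (flat 1 t + flat 1 (1 - t)).

Lemma smoothstep_den (t : R) : 0 < flat 1 t + flat 1 (1 - t).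
Proof.
have [t0|t0] := leP t 0; last by rewrite ltr_pwDl ?flat1_gt0 ?flat1_ge0.
by rewrite ltr_wpDl ?flat1_ge0 // flat1_gt0 //; lra.
Qed.

Lemma smoothstep_ge0 t : 0 <= smoothstep t.
Proof. by rewrite divr_ge0 ?flat1_ge0 // ltW ?smoothstep_den. Qed.

Lemma smoothstep_le1 t : smoothstep t <= 1.
Proof. by rewrite ler_pdivrMr ?smoothstep_den // mul1r lerDl flat1_ge0. Qed.

Lemma smoothstep0 t : t <= 0 -> smoothstep t = 0.
Proof. by move=> t0; rewrite /smoothstep flat1_eq0 // mul0r. Qed.

Lemma smoothstep1 t : 1 <= t -> smoothstep t = 1.
Proof.
move=> t1; have t0 : 0 < t by lra.
by rewrite /smoothstep (@flat1_eq0 (1 - t)) ?addr0 ?divff ?gt_eqF ?flat1_gt0 // subr_le0.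
Qed.

Lemma smooth_smoothstep m (U : set 'rV[R]_m) f : open U -> smooth U f ->
  smooth U (fun y => smoothstep (f y)).
Proof.
move=> oU sf; apply: smoothM => //; first exact: smooth_flat.
apply: smooth_inv => // [y _|]; first exact: smoothstep_den.
apply: smoothD => //; first exact: smooth_flat.
by apply: smooth_flat => //; apply: smoothB => //; exact: smooth_cst.
Qed.

(* The profile 4/3 (1 - s^2) is >= 1 for |s| <= 1/2 and <= 0 for |s| >= 1. *)
Definition cubebump m (c : 'rV[R]_m) (r : R) (y : 'rV[R]_m) : R :=
  \prod_k smoothstep (4 / 3 * (1 - ((y 0 k - c 0 k) / r) ^+ 2)).

Lemma cubebump_smooth m (c : 'rV[R]_m) r : smooth setT (cubebump c r).
Proof.
have oT : open [set: 'rV[R]_m] by exact: openT.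
apply: smooth_prod => // k; apply: smooth_smoothstep => //.
apply: smoothM => //; first exact: smooth_cst.
apply: smoothB => //; first exact: smooth_cst.
have sq : smooth setT (fun y : 'rV[R]_m => (y 0 k - c 0 k) / r).
  apply: smoothM => //; last exact: smooth_cst.
  by apply: smoothB => //; [exact: smooth_coord|exact: smooth_cst].
exact: (smoothM oT sq sq).
Qed.

Lemma cubebump_ge0 m (c : 'rV[R]_m) r y : 0 <= cubebump c r y.
Proof. by apply: prodr_ge0 => k _; exact: smoothstep_ge0. Qed.

Lemma cubebump_le1 m (c : 'rV[R]_m) r y : cubebump c r y <= 1.
Proof. by apply: prodr_ile1 => k _; rewrite smoothstep_ge0 smoothstep_le1. Qed.

Lemma cubebump1 m (c : 'rV[R]_m) r y : 0 < r -> rcube c (r / 2) y -> cubebump c r y = 1.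
Proof.
move=> r0 H; apply: big1 => k _; apply: smoothstep1.
have h : `|(y 0 k - c 0 k) / r| <= 2^-1.
  by rewrite normrM normfV (gtr0_norm r0) ler_pdivrMr // mulrC; exact: H.
have : ((y 0 k - c 0 k) / r) ^+ 2 <= 4^-1.
  rewrite -real_normK ?num_real // (_ : 4^-1 = 2^-1 ^+ 2); last by lra.
  by rewrite lerXn2r ?nnegrE.
by move=> h2; lra.
Qed.

Lemma cubebump0 m (c : 'rV[R]_m) r y : 0 < r -> ~ rcube c r y -> cubebump c r y = 0.
Proof.
move=> r0 /existsNP[k /negP]; rewrite -ltNge => h.
rewrite /cubebump (bigD1 k) //= smoothstep0 ?mul0r //.
have h1 : 1 < `|(y 0 k - c 0 k) / r| by rewrite normrM normfV (gtr0_norm r0) ltr_pdivlMr // mul1r.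
have : 1 <= ((y 0 k - c 0 k) / r) ^+ 2.
  by rewrite -real_normK ?num_real // expr_ge1 // ltW.
by move=> h2; lra.
Qed.

End Bumps.

Section Plateaus.
Context {R : realType} {m : nat} {M : manifold R m}.
Local Notation dom := (@chart_dom R m M).
Local Notation cod := (@chart_codom R m M).
Local Notation co := (@chart_coord R m M).
Local Notation pa := (@chart_param R m M).

Lemma smooth_funB (f h : M -> R) : smooth_fun f -> smooth_fun h ->
  smooth_fun (fun x => f x - h x).
Proof.
by move=> /smooth_funP Hf /smooth_funP Hh; apply/smooth_funP => i; exact: smoothB (@open_cod _ _ _ i) _ _ (Hf i) (Hh i).
Qed.

Record plateau (i : chart M) (K : set 'rV[R]_m) (b : M -> R) : Prop := Plateau {
  plateau_compact : compact K;
  plateau_sub : K `<=` cod i;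
  plateau_smooth : smooth_fun b;
  plateau_ge0 : forall x, 0 <= b x;
  plateau_le1 : forall x, b x <= 1;
  plateau_out : forall x, ~ (pa i @` K) x -> b x = 0
}.

Lemma plateau_exists i x (U : set M) : dom i x -> nbhs x U ->
  exists K b, [/\ plateau i K b, pa i @` K `<=` U & \forall z \near x, b z = 1].
Proof.
move=> dx Ux; have Ux' : \forall z \near x, (interior U) z.
  by apply: open_nbhs_nbhs; split=> //; exact: open_interior.
have oV : open [set y | cod i y /\ (interior U) (pa i y)].
  rewrite openE => y [cy Uy]; have h1 := near_cod cy.
  have h2 : \forall z \near y, (interior U) (pa i z).
    by apply: near_param => //; apply: open_nbhs_nbhs; split=> //; exact: open_interior.
  by apply: filterS2 h1 h2 => z ? ?; split.
have [|r r0 HK] := open_rcube_sub (c := co i x) oV.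
  by split; [exact: codom_coord|rewrite /= coordK].
have cK := @compact_rcube R m (co i x) r.
have KU : rcube (co i x) r `<=` cod i by move=> y /HK[].
have b0 y : cod i y -> ~ rcube (co i x) r y -> cubebump (co i x) r y = 0.
  by move=> _; exact: cubebump0.
exists (rcube (co i x) r), (extend0 i (cubebump (co i x) r)); split.
- split=> //.
  + apply: (extend0_smooth cK KU b0); case: (cubebump_smooth (co i x) r) => H; split=> n.
    have oT : open [set: 'rV[R]_m] by exact: openT.
    by have := H n; elim: n (cubebump _ _) {b0 H} => [|n IH] f /=; [move=> h y _; exact: h|move=> [h1 h2]; split=> [y _|k]; [exact: h1|exact/IH/h2]].
  + by move=> z; rewrite /extend0; case: ifP => // _; exact: cubebump_ge0.
  + by move=> z; rewrite /extend0; case: ifP => // _; exact: cubebump_le1.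
  + by move=> z; exact: (extend0_out b0).
- by move=> _ [y /HK[_ /interior_subset Uy] <-].
have h1 := near_dom dx; have h2 := near_coord dx (@rcube_nbhs _ _ (co i x) (r / 2) (divr_gt0 r0 (ltr0Sn _ 1))).
apply: filterS2 h1 h2 => z dz Hz; rewrite extend0_in // cubebump1 //.
Qed.

End Plateaus.

Lemma half_lt {R : realFieldType} (a : R) : 0 < a -> a / 2 < a.
Proof. by move=> a0; lra. Qed.

(** * The divergence theorem on the manifold *)

Section Divergence.
Context {R : realType} {m : nat} {M : manifold R m}.
Implicit Types (i j : chart M) (x : M) (y : 'rV[R]_m).
Local Notation dom := (@chart_dom R m M).
Local Notation cod := (@chart_codom R m M).
Local Notation co := (@chart_coord R m M).
Local Notation pa := (@chart_param R m M).
Variable g : metric M.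
Variable vol : {measure set (borel M) -> \bar R}.
Hypothesis Hvol : riemannian_volume g vol.

Lemma integral_gt0 (h : M -> R) (c : R) (V : set M) x : (forall z, 0 <= h z) -> 0 < c ->
  open V -> V x -> (forall z, V z -> c <= h z) -> (0 < \int[vol]_z (h z)%:E)%E.
Proof.
move=> h0 c0 oV Vx hV; have mV : measurable (V : set (borel M)) by exact: measurable_open_set.
apply: (@lt_le_trans _ _ (\int[vol]_z (c%:E * (\1_V z)%:E))%E).
  rewrite lower_integralZ ?(ltW c0) // integral_indic // setIT.
  by rewrite mule_gt0 ?lte_fin //; exact: (vol_open_gt0 Hvol oV Vx).
apply: ge0_le_lower_integral => z; first by rewrite -EFinM lee_fin mulr_ge0 ?(ltW c0) // indicE ler0n.
rewrite -EFinM lee_fin indicE; have [/set_mem Vz|_] := boolP (z \in V); first by rewrite mulr1 hV.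
by rewrite mulr0.
Qed.

Lemma drow_out (phi : M -> R) (C : set M) i y : closed C -> (forall x, ~ C x -> phi x = 0) ->
  cod i y -> ~ C (pa i y) -> drow (phi \o pa i) y = 0.
Proof.
move=> cC phiC cy nC; apply/rowP => k; rewrite !mxE.
have oO : open [set z | cod i z /\ (~` C) (pa i z)].
  rewrite openE => z [cz nz]; have h1 := near_cod cz.
  have h2 : \forall z' \near z, (~` C) (pa i z').
    by apply: near_param => //; apply: open_nbhs_nbhs; split=> //; exact: closed_openC.
  by apply: filterS2 h1 h2 => z' ? ?; split.
rewrite (partial_eq_on (g := fun=> 0) oO) //; first exact: partial_cst.
by move=> z [_ nz]; exact: phiC.
Qed.

Section Field.
Variable X : chart M -> 'rV[R]_m -> 'rV[R]_m.
Hypothesis vX : vfield X.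

Definition divm i y : R := \tr (nab (gmat g i) (X i) y).

Lemma divm_smooth i : smooth (cod i) (divm i).
Proof.
have oC := @open_cod _ _ _ i; have [sX _] := vX.
have sn := smooth_nab (metric_local g i) (sX i).
by apply: (smooth_sum oC) => k; exact: sn.
Qed.

Lemma divm_continuous i y : cod i y -> {for y, continuous (divm i)}.
Proof. by move=> cy; exact: smooth_continuous (divm_smooth i) cy. Qed.

(** The divergence of phi X by the product rule, computed in the chart i and extended by 0. *)
Definition chart_stokes i (phi : M -> R) : M -> R :=
  extend0 i (fun y => phi (pa i y) * divm i y + dpair phi X i y).

Section Supported.
Variables (i : chart M) (K : set 'rV[R]_m) (phi : M -> R).
Hypotheses (cK : compact K) (KU : K `<=` cod i) (sphi : smooth_fun phi).
Hypothesis phiK : forall x, ~ (pa i @` K) x -> phi x = 0.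

Lemma stokes_out y : cod i y -> ~ K y -> phi (pa i y) * divm i y + dpair phi X i y = 0.
Proof.
move=> cy nK; have nC : ~ (pa i @` K) (pa i y) by move=> /(param_memE KU cy).
rewrite phiK // mul0r add0r /dpair (drow_out (closed_param cK KU) phiK) //.
by rewrite mul0mx mxE.
Qed.

Lemma chart_stokes_continuous : continuous (chart_stokes i phi).
Proof.
apply: (extend0_continuous cK KU); first exact: stokes_out.
have oC := @open_cod _ _ _ i; have sp : smooth (cod i) (phi \o pa i) by move/smooth_funP: sphi.
have [sX _] := vX.
move=> y cy; apply: (smooth_continuous _ cy); apply: smoothD => //.
  by apply: smoothM => //; exact: divm_smooth.
apply: (smooth_mulmx oC (B := drow (phi \o pa i)) (C := fun y => (X i y)^T)).
  exact: drow_smooth.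
exact: smooth_tr.
Qed.

Lemma chart_stokes_out x : ~ (pa i @` K) x -> chart_stokes i phi x = 0.
Proof. by apply: extend0_out; exact: stokes_out. Qed.

Lemma chart_stokes_integrable :
  vol.-integrable [set: borel M] (EFin \o (chart_stokes i phi : borel M -> R)).
Proof.
apply: (integrable_compact Hvol chart_stokes_continuous (compact_param cK KU)).
exact: chart_stokes_out.
Qed.

Lemma integral_chart_stokes : (\int[vol]_x (chart_stokes i phi x)%:E = 0)%E.
Proof. by have [sX _] := vX; exact: (integral_divergence_chart Hvol cK KU sphi (sX i) phiK). Qed.

End Supported.

(* Two charts give divergences with the same integral against every test
   function, hence equal ones. *)
Lemma divm_compat : compat divm.
Proof.
suff H i j x : dom i x -> dom j x -> divm i (co i x) <= divm j (co j x).
  by move=> i j x di dj; apply/le_anti/andP; split; apply: H.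
move=> di dj; rewrite leNgt; apply/negP => lt.
pose f z := divm i (co i z) - divm j (co j z).
have fx : 0 < f x by rewrite subr_gt0.
have cf : {for x, continuous f}.
  apply: continuousB.
    by apply: (@continuous_comp _ _ _ (co i) (divm i)); [exact: Defs.coord_continuous|exact/divm_continuous/codom_coord].
  by apply: (@continuous_comp _ _ _ (co j) (divm j)); [exact: Defs.coord_continuous|exact/divm_continuous/codom_coord].
have nf : \forall z \near x, f x / 2 < f z.
  have := cf [set t | f x / 2 < t]; apply; apply: open_nbhs_nbhs; split; first exact: open_gt.
  exact: half_lt.
have nU : nbhs x (dom i `&` dom j `&` [set z | f x / 2 < f z]).
  by apply: filterI => //; apply: filterI; exact: near_dom.
have [K [b [[cK KU sb b0 b1 bK] KV nb]]] := plateau_exists di nU.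
pose K' := co j @` (pa i @` K).
have KV' z : (pa i @` K) z -> [/\ dom i z, dom j z & f x / 2 < f z] by move=> /KV[[]].
have cK' : compact K'.
  apply: continuous_compact; last exact: compact_param.
  by apply: continuous_in_subspaceT => z /set_mem /KV'[_ dz _]; exact: Defs.coord_continuous.
have KU' : K' `<=` cod j by move=> _ [z /KV'[_ dz _] <-]; exact: codom_coord.
have EK : pa j @` K' = pa i @` K.
  apply/seteqP; split=> [_ [_ [z Kz <-] <-]|z Kz].
    by have [_ dz _] := KV' z Kz; rewrite coordK.
  by have [_ dz _] := KV' z Kz; exists (co j z); [exists z|exact: coordK].
have bK' z : ~ (pa j @` K') z -> b z = 0 by rewrite EK; exact: bK.
(* The terms d b (X) agree in both charts and cancel, so h is b times the difference of the two
   divergences. Its integral is 0, although it is nonnegative and positive near x. *)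
pose h z := chart_stokes i b z - chart_stokes j b z.
have Eh z : h z = if z \in pa i @` K then b z * f z else 0.
  rewrite /h; case: ifPn => [/set_mem Kz|nK].
    have [dz dz' _] := KV' z Kz; rewrite /chart_stokes !extend0_in // !coordK //.
    rewrite (dpair_compat sb vX dz dz') /f.
    by move: (divm i _) (divm j _) (dpair _ _ _ _) (b z) => p q r s; ring.
  have {}nK : ~ (pa i @` K) z by move=> Kz; move: nK; rewrite mem_set.
  by rewrite (chart_stokes_out cK KU bK) // (chart_stokes_out cK' KU' bK') ?EK // subrr.
have h0 z : 0 <= h z.
  rewrite Eh; case: ifPn => [/set_mem /KV'[_ _ fz]|_]; last exact: lexx.
  apply: mulr_ge0; first exact: b0.
  apply: ltW; apply: lt_trans fz; exact: divr_gt0 fx (ltr0Sn _ 1).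
have I0 : (\int[vol]_z (h z)%:E = 0)%E.
  transitivity (\int[vol]_z ((chart_stokes i b z)%:E - (chart_stokes j b z)%:E))%E.
    by apply: eq_integral => z _; rewrite -EFinB.
  rewrite integralB //; last 2 first.
  - exact: (chart_stokes_integrable cK KU sb bK).
  - exact: (chart_stokes_integrable cK' KU' sb bK').
  by rewrite (integral_chart_stokes cK KU sb bK) (integral_chart_stokes cK' KU' sb bK') subee.
pose V := interior [set z | b z = 1].
suff : (0 < \int[vol]_z (h z)%:E)%E by rewrite I0 ltxx.
apply: (@integral_gt0 h (f x / 2) V x h0 (divr_gt0 fx (ltr0Sn _ 1)) (@open_interior _ _) nb).
move=> z /interior_subset /= bz.
have Kz : (pa i @` K) z by apply: contrapT => /bK; rewrite bz => /eqP; rewrite oner_eq0.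
by rewrite Eh (mem_set Kz) bz mul1r; have [_ _ fz] := KV' z Kz; exact: ltW.
Qed.

Definition Div : M -> R := glue divm.

Lemma Div_smooth : smooth_fun Div.
Proof. exact: (glue_smooth divm_compat divm_smooth). Qed.

Definition stokes (phi : M -> R) (x : M) : R := phi x * Div x + glue (dpair phi X) x.

Lemma stokes_continuous phi : smooth_fun phi -> continuous (stokes phi).
Proof.
move=> sphi; apply: smooth_fun_continuous; apply: smooth_funD.
  exact: smooth_funM sphi Div_smooth.
exact: dpair_smooth.
Qed.

Lemma stokes_support phi (C : set M) x : closed C -> (forall x, ~ C x -> phi x = 0) ->
  ~ C x -> stokes phi x = 0.
Proof.
move=> cC phiC nC; rewrite /stokes phiC // mul0r add0r /glue /dpair.
rewrite (drow_out cC phiC) ?mul0mx ?mxE //; first by apply: codom_coord; exact: chart_atP.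
by rewrite /coord_at coordK //; exact: chart_atP.
Qed.

Lemma stokes_integrable phi (C : set M) : smooth_fun phi -> compact C ->
  (forall x, ~ C x -> phi x = 0) -> vol.-integrable [set: borel M] (EFin \o (stokes phi : borel M -> R)).
Proof.
move=> sphi cC phiC; apply: (integrable_compact Hvol (stokes_continuous sphi) cC) => x.
by apply: stokes_support => //; apply: compact_closed cC; exact: manifold_hausdorff.
Qed.

Lemma drowD (U : set 'rV[R]_m) (f h : 'rV[R]_m -> R) y : smooth U f -> smooth U h -> U y ->
  drow (fun z => f z + h z) y = drow f y + drow h y.
Proof.
by move=> sf sh Uy; apply/rowP => k; rewrite [RHS]mxDE !mxE (partialD k sf sh Uy).
Qed.

Lemma stokesD phi psi x : smooth_fun phi -> smooth_fun psi ->
  stokes (fun z => phi z + psi z) x = stokes phi x + stokes psi x.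
Proof.
move=> /smooth_funP sphi /smooth_funP spsi; rewrite /stokes /glue /dpair.
set i := chart_at x; have cy : cod i (coord_at x) by apply: codom_coord; exact: chart_atP.
rewrite (drowD (sphi i) (spsi i) cy) mulmxDl mxDE; ring.
Qed.

(** Instead of a partition of unity, an induction on the number of plateau functions covering the
    points where phi is nonzero: with b one of them, phi b lives in a single chart, and phi (1 - b)
    vanishes where b = 1, so the remaining ones cover it. *)
Lemma integral_stokes phi (C : set M) : smooth_fun phi -> compact C ->
  (forall x, ~ C x -> phi x = 0) -> (\int[vol]_x (stokes phi x)%:E = 0)%E.
Proof.
move=> sphi cC phiC.
have /choice[B HB] x : exists b : M -> R, (exists i K, plateau i K b) /\ \forall z \near x, b z = 1.
  have [K [b [pb _ nb]]] := plateau_exists (chart_atP x) (@filterT _ (nbhs x) _).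
  by exists b; split=> //; exists (chart_at x), K.
have [x _|s [_ Hs]] := compact_cover_seq (U := fun x => interior [set z | B x z = 1]) cC.
  by split; [exact: open_interior|have [] := HB x].
have {}Hs z : phi z != 0 -> exists2 x, x \in s & B x z = 1.
  move=> nz; have Cz : C z by apply: contrapT => /phiC /eqP; exact/negP.
  by have [x xs /interior_subset Bx] := Hs z Cz; exists x.
elim: s phi sphi phiC Hs => [|x s IH] phi sphi phiC Hs.
  have p0 z : phi z = 0 by apply/eqP/negPn/negP => /Hs[].
  apply: integral0_eq => z _; rewrite (stokes_support (C := set0)) //; exact: closed0.
have [[i [K [cK KU sb b0 b1 bK]]] _] := HB x.
pose p1 z := phi z * B x z; pose p2 z := phi z * (1 - B x z).
have s1 : smooth_fun p1 by exact: (smooth_funM sphi sb).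
have s2 : smooth_fun p2.
  exact: (smooth_funM sphi (smooth_funB (smooth_fun_cst 1) sb)).
have p1K z : ~ (pa i @` K) z -> p1 z = 0 by move=> /bK h; rewrite /p1 h mulr0.
have p1C z : ~ C z -> p1 z = 0 by move=> /phiC h; rewrite /p1 h mul0r.
have p2C z : ~ C z -> p2 z = 0 by move=> /phiC h; rewrite /p2 h mul0r.
have -> : (\int[vol]_z (stokes phi z)%:E = \int[vol]_z ((stokes p1 z)%:E + (stokes p2 z)%:E))%E.
  apply: eq_integral => z _; rewrite -EFinD -stokesD //; congr (stokes _ _)%:E.
  by apply/funext => z'; rewrite /p1 /p2; move: (phi z') (B x z') => p q; ring.
rewrite integralD //; last 2 first.
- exact: stokes_integrable p1C.
- exact: stokes_integrable p2C.
rewrite (IH p2) //; last first.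
  move=> z; rewrite mulf_eq0 negb_or subr_eq0 => /andP[/Hs[x']].
  rewrite inE => /predU1P[->|xs E _]; last by exists x'.
  by move=> -> /eqP.
rewrite adde0 -(integral_chart_stokes cK KU s1 p1K); apply: eq_integral => z _.
congr EFin; have [dz|ndz] := pselect (dom i z).
  rewrite /stokes /chart_stokes extend0_in // coordK // /Div (glueE divm_compat dz).
  by rewrite (glueE (dpair_compat s1 vX) dz).
have nK : ~ (pa i @` K) z by move=> /(sub_param_dom KU).
by rewrite (stokes_support (closed_param cK KU) p1K) // (chart_stokes_out cK KU p1K).
Qed.

End Field.
End Divergence.

(** * Curves and cutoff functions *)

Section Ramp.
Context {R : realType}.
Variable k : R.
Hypothesis k0 : 0 < k.

(* [ramp r = r exp (- k / r)] for r > 0 is a smooth substitute for the positive part. *)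
Definition ramp (r : R) : R := r * flat 1 (r / k).

Lemma flatE_pos (P : {poly R}) (r : R) : 0 < r -> flat P (r / k) = P.[k / r] * expR (- (k / r)).
Proof. by move=> r0; rewrite /flat divr_gt0 // invf_div. Qed.

Lemma flatE_neg (P : {poly R}) (r : R) : r <= 0 -> flat P (r / k) = 0.
Proof.
by move=> r0; rewrite /flat ltNge (_ : r / k <= 0) // pmulr_lle0 // invr_gt0.
Qed.

Lemma ramp0 (r : R) : r <= 0 -> ramp r = 0.
Proof. by move=> r0; rewrite /ramp flatE_neg // mulr0. Qed.

Lemma ramp_ge0 (r : R) : 0 <= ramp r.
Proof.
have [r0|r0] := leP r 0; first by rewrite ramp0.
by rewrite /ramp mulr_ge0 ?flat1_ge0 // ltW.
Qed.

Lemma ramp_ge (r : R) : r - k <= ramp r.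
Proof.
have [r0|r0] := leP r 0; first by rewrite ramp0 //; move: k0 => ?; lra.
rewrite /ramp flatE_pos // hornerC mul1r.
have e1 : 1 - k / r <= expR (- (k / r)) by exact: expR_ge1Dx.
rewrite (_ : r - k = r * (1 - k / r)); first by rewrite ler_pM2l.
by rewrite mulrBr mulr1 mulrCA divff ?mulr1 // gt_eqF.
Qed.

Definition dramp (r : R) : R := flat 1 (r / k) + r / k * flat 'X^2 (r / k).

Lemma is_derive_ramp (r : R) : is_derive r 1 ramp (dramp r).
Proof.
have d1 : is_derive r 1 (fun t : R => flat 1 (t / k)) (k^-1 * flat 'X^2 (r / k)).
  have df := is_derive_flat 1 (r / k).
  have -> : 'X^2 = 'X^2 * (1 - 1^`()) :> {poly R} by rewrite -[1 in RHS]/(1%:P) derivC subr0 mulr1.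
  have dl : is_derive r 1 (fun t : R => t / k) (k^-1).
    have : is_derive r 1 (k^-1 *: (@id R)) (k^-1 *: 1) by exact: is_deriveZ.
    rewrite (_ : k^-1 *: (@id R) = (fun t => t / k)); last by apply/funext => t; rewrite /= [t / k]mulrC.
    by rewrite /GRing.scale /= mulr1.
  by rewrite mulrC; exact: (is_derive_comp_real dl df).
have -> : dramp r = r *: (k^-1 * flat 'X^2 (r / k)) + flat 1 (r / k) *: 1.
  by rewrite /dramp /GRing.scale /= mulr1 addrC mulrA.
exact: (is_deriveM (is_derive_id r 1) d1).
Qed.

Lemma dramp0 (r : R) : r <= 0 -> dramp r = 0.
Proof. by move=> r0; rewrite /dramp !flatE_neg // mulr0 addr0. Qed.

Lemma drampE (r : R) : 0 < r -> dramp r = (1 + k / r) * expR (- (k / r)).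
Proof.
move=> r0; rewrite /dramp !flatE_pos // hornerC hornerXn mul1r mulrDl mul1r; congr (_ + _).
rewrite mulrA; congr (_ * _); rewrite expr2 mulrA.
by rewrite (_ : r / k * (k / r) = 1) ?mul1r // mulrA divfK ?gt_eqF // divff // gt_eqF.
Qed.

Lemma dramp_bounds (r : R) : 0 <= dramp r <= 1.
Proof.
have [r0|r0] := leP r 0; first by rewrite dramp0 // lexx ler01.
rewrite drampE //; have q0 : 0 < k / r by exact: divr_gt0.
apply/andP; split; first by rewrite mulr_ge0 ?expR_ge0 // addr_ge0 // ltW.
by rewrite expRN ler_pdivrMr ?expR_gt0 // mul1r expR_ge1Dx.
Qed.

Lemma smooth_ramp m (U : set 'rV[R]_m) f : open U -> smooth U f -> smooth U (fun y => ramp (f y)).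
Proof.
move=> oU sf; apply: smoothM => //; apply: smooth_flat => //.
by apply: smoothM => //; exact: smooth_cst.
Qed.

End Ramp.

Lemma lincomb_mulmx00 {R : realType} p (a b : R) (A B : 'rV[R]_p) (C : 'cV[R]_p) :
  ((a *: A + b *: B) *m C) 0 0 = a * (A *m C) 0 0 + b * (B *m C) 0 0.
Proof. by rewrite mulmxDl -!scalemxAl mxDE !(mxE _ _ 0 0). Qed.

(** * Functions of slope at most one *)

Section Slopes.
Context {R : realType} {m : nat} {M : manifold R m}.
Implicit Types (i j : chart M) (x : M) (y : 'rV[R]_m).
Local Notation dom := (@chart_dom R m M).
Local Notation cod := (@chart_codom R m M).
Local Notation co := (@chart_coord R m M).
Local Notation pa := (@chart_param R m M).
Variable g : metric M.

(** The bound |d f| <= 1 in dual form: it passes to convex combinations of differentials and applies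
    directly to velocities of curves. *)
Definition slope_at i y (f : M -> R) := forall V : 'rV[R]_m,
  `|(drow (f \o pa i) y *m V^T) 0 0| <= Num.sqrt (inner (gmat g i y) V V).

Definition slope1 (f : M -> R) := forall i y, cod i y -> slope_at i y f.

Lemma slope1_local (f : M -> R) : smooth_fun f ->
  (forall x, exists2 i, dom i x & slope_at i (co i x) f) -> slope1 f.
Proof.
move=> /smooth_funP sf H j y cy V; have [dj Ey] := codomP cy.
have [i di Hi] := H (pa j y).
have := Hi (V *m transition_jacobian j i (pa j y)).
have Ed := drow_compat (compat_fun f) sf dj di; rewrite Ey in Ed.
have Eg := gmat_transition g dj di; rewrite Ey in Eg.
rewrite Ed -mulmxA -trmx_mul => h.
apply: le_trans h _; rewrite le_eqVlt; apply/orP; left; apply/eqP; congr Num.sqrt.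
by rewrite /inner Eg trmx_mul !mulmxA.
Qed.

Lemma slope1_sqgrad (f : M -> R) x : slope1 f -> sqgrad g f x <= 1.
Proof.
move=> sf; pose i := chart_at x; have cy : cod i (coord_at x) by apply: codom_coord; exact: chart_atP.
have := sf _ _ cy (gradm g f i (coord_at x)).
have uG := gmat_unit g cy.
rewrite (_ : (drow _ _ *m _) 0 0 = sqgrad g f x); last first.
  by rewrite /sqgrad /glue /vinner /inner /gradm /gradf mulmxKV.
rewrite (_ : inner _ _ _ = sqgrad g f x) //.
have s0 := sqgrad_ge0 g f x; rewrite ger0_norm // => h.
have : sqgrad g f x ^+ 2 <= sqgrad g f x.
  by rewrite -[leRHS](sqr_sqrtr s0) lerXn2r ?nnegrE // sqrtr_ge0.
move: s0; set q := sqgrad g f x; rewrite le_eqVlt => /predU1P[<- _|q0]; first exact: ler01.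
by rewrite expr2 ger_pMl.
Qed.

Lemma slope_comb i y (f h phi : M -> R) (a b : R) : 0 <= a -> 0 <= b -> a + b <= 1 ->
  slope_at i y f -> slope_at i y h ->
  drow (phi \o pa i) y = a *: drow (f \o pa i) y + b *: drow (h \o pa i) y -> slope_at i y phi.
Proof.
move=> a0 b0 ab sf sh E V; rewrite E lincomb_mulmx00.
have := sf V; have := sh V; have := sqrtr_ge0 (inner (gmat g i y) V V).
move: (Num.sqrt _) ((drow (f \o _) _ *m _) 0 0) ((drow (h \o _) _ *m _) 0 0) => s p q s0 hq hp.
apply: le_trans (ler_normD _ _) _; rewrite !normrM (ger0_norm a0) (ger0_norm b0).
apply: (@le_trans _ _ (a * s + b * s)); first by apply: lerD; exact: ler_wpM2l.
by rewrite -mulrDl ler_piMl.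
Qed.

Lemma drow_comp1 (U : set 'rV[R]_m) (phi : R -> R) (d : R) (f : 'rV[R]_m -> R) y : smooth U f ->
  open U -> U y -> is_derive (f y) 1 phi d -> drow (fun z => phi (f z)) y = d *: drow f y.
Proof.
move=> sf oU Uy dp; apply/rowP => k; rewrite [RHS]mxE !mxE.
exact: (partial_comp1 oU k sf Uy dp).
Qed.

(** A smooth maximum: as the derivative of [ramp] lies in [0, 1], the differential is a convex
    combination of those of f and h. Nothing is lost with respect to f, and at most k with respect
    to h. *)
Definition smax (k : R) (f h : M -> R) (x : M) : R := f x + ramp k (h x - f x).

Lemma smax_smooth k f h : 0 < k -> smooth_fun f -> smooth_fun h -> smooth_fun (smax k f h).
Proof.
move=> k0 sf sh; apply: (smooth_funD sf); apply/smooth_funP => i.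
apply: (@smooth_ramp _ _ _ _ (fun y => h (pa i y) - f (pa i y))); first exact: open_cod.
by have /smooth_funP H := smooth_funB sh sf; exact: H.
Qed.

Lemma smax_slope k f h : 0 < k -> smooth_fun f -> smooth_fun h -> slope1 f -> slope1 h ->
  slope1 (smax k f h).
Proof.
move=> k0 sf sh lf lh i y cy; have oC := @open_cod _ _ _ i.
have sf' : smooth (cod i) (f \o pa i) by move/smooth_funP: sf.
have sh' : smooth (cod i) (h \o pa i) by move/smooth_funP: sh.
pose q z := h (pa i z) - f (pa i z).
have sq : smooth (cod i) q by exact: (smoothB oC).
pose a := dramp k (q y); have /andP[a0 a1] : 0 <= a <= 1 by exact: dramp_bounds.
apply: (slope_comb (a := 1 - a) (b := a) _ a0 _ (lf _ _ cy) (lh _ _ cy)).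
- by rewrite subr_ge0.
- by rewrite subrK.
have -> : drow (smax k f h \o pa i) y = drow (f \o pa i) y + drow (fun z => ramp k (q z)) y.
  exact: (drowD (U := cod i) sf' (smooth_ramp k oC sq) cy).
rewrite (drow_comp1 sq oC cy (is_derive_ramp k (q y))) -/a.
have -> : drow q y = drow (h \o pa i) y - drow (f \o pa i) y.
  have -> : q = fun z => (h \o pa i) z + (-1) * (f \o pa i) z by apply/funext => z; rewrite /= mulN1r.
  rewrite (drowD (U := cod i) sh' _ cy); last exact: (smoothM oC (smooth_cst oC _)).
  congr (_ + _); apply/rowP => l; rewrite [RHS]mxE !mxE (partialM l (smooth_cst oC _) sf' cy).
  by rewrite partial_cst mulr0 addr0 mulN1r.
by rewrite scalerBr scalerBl scale1r addrA addrAC.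
Qed.

Lemma smax_ge k f h x : 0 < k -> f x <= smax k f h x /\ h x - k <= smax k f h x.
Proof.
move=> k0; rewrite /smax; have := ramp_ge0 k0 (h x - f x); have := ramp_ge k0 (h x - f x).
by move: (ramp _ _) => r h1 h2; split; lra.
Qed.

Lemma smax_eq0 k f h x : 0 < k -> f x = 0 -> h x = 0 -> smax k f h x = 0.
Proof. by move=> k0 f0 h0; rewrite /smax f0 h0 subrr ramp0 // addr0. Qed.

Lemma slope1_smax_seq (s : seq M) (psi : M -> M -> R) (C : M -> set M) (e : R) : 0 < e ->
  (forall x, x \in s -> [/\ smooth_fun (psi x), slope1 (psi x), compact (C x) &
     forall z, ~ C x z -> psi x z = 0]) ->
  exists Psi D, [/\ smooth_fun Psi, slope1 Psi, compact D, forall z, ~ D z -> Psi z = 0 &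
    (forall z, D z -> exists2 x, x \in s & C x z) /\
    (forall x z, x \in s -> psi x z - e <= Psi z)].
Proof.
elim: s e => [|x s IH] e e0 H.
  exists (fun=> 0), set0; split=> //.
  - exact: smooth_fun_cst.
  - move=> i y cy V; rewrite (_ : drow _ _ = 0); first by rewrite mul0mx mxE normr0 sqrtr_ge0.
    by apply/rowP => k; rewrite !mxE; exact: partial_cst.
  - exact: compact0.
have [|P [D [sP lP cD PD [D1 D2]]]] := IH (e / 2) (divr_gt0 e0 (ltr0Sn _ 1)).
  by move=> z zs; apply: H; rewrite inE zs orbT.
have [sx lx cC xC] := H x (mem_head _ _).
have e2 : 0 < e / 2 by exact: divr_gt0 e0 (ltr0Sn _ 1).
(* Half of the allowance e is spent on the new function; the other half was given to the induction
   hypothesis. *)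
exists (smax (e / 2) P (psi x)), (D `|` C x); split.
- exact: smax_smooth.
- exact: smax_slope.
- exact: compactU.
- by move=> z /not_orP[/PD Pz /xC xz]; exact: smax_eq0.
split=> [z [/D1[w ws Cw]|Cz]|w z].
- by exists w => //; rewrite inE ws orbT.
- by exists x => //; rewrite inE eqxx.
have [h1 h2] := smax_ge P (psi x) z e2; rewrite inE => /predU1P[->|ws].
  by apply: le_trans h2; rewrite lerD2l lerN2 ltW // half_lt.
by apply: le_trans h1; apply: le_trans (D2 w z ws); rewrite lerD2l lerN2 ltW // half_lt.
Qed.

(** Finitely many of the sets where psi x exceeds the mean of h and psi x x cover K. The loss e of
    the smooth maximum is taken below half of every excess psi x x - h, so the bound by h stays
    strict. *)
Lemma slope1_cover (K : set M) (psi : M -> M -> R) (C : M -> set M) (h : R) : compact K ->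
  (forall x, K x -> [/\ smooth_fun (psi x), slope1 (psi x), compact (C x),
     forall z, ~ C x z -> psi x z = 0 & h < psi x x]) ->
  exists Psi D, [/\ smooth_fun Psi, slope1 Psi, compact D, forall z, ~ D z -> Psi z = 0 &
    (forall z, D z -> exists2 x, K x & C x z) /\ (forall z, K z -> h < Psi z)].
Proof.
move=> cK H.
have [x Kx|s [sK Hs]] := compact_cover_seq (U := fun x => interior [set z | (h + psi x x) / 2 < psi x z]) cK.
  have [sx _ _ _ hx] := H x Kx; split; first exact: open_interior.
  have cx : {for x, continuous (psi x)} by exact: smooth_fun_continuous.
  have := cx [set t | (h + psi x x) / 2 < t]; apply.
  by apply: open_nbhs_nbhs; split; [exact: open_gt|move: (psi x x) hx => p hx /=; lra].
have [e [e0 He]] : exists e : R, 0 < e /\ forall x, x \in s -> e < (psi x x - h) / 2.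
  elim: s sK {Hs} => [|x s IH] sK; first by exists 1.
  have [|e [e0 He]] := IH; first by move=> z zs; apply: sK; rewrite inE zs orbT.
  have [_ _ _ _ hx] := H x (sK x (mem_head _ _)).
  exists (Num.min e ((psi x x - h) / 4)); split.
    by rewrite lt_min e0 divr_gt0 // subr_gt0.
  move=> z; rewrite inE => /predU1P[->|/He hz]; last by rewrite gt_min hz.
  rewrite gt_min; apply/orP; right; move: (psi x x) hx => p hx; lra.
have [|P [D [sP lP cD PD [D1 D2]]]] := @slope1_smax_seq s psi C e e0.
  by move=> x /sK /H[].
exists P, D; split=> //; split=> [z /D1[x /sK Kx Cz]|z /Hs[x xs /interior_subset /= hz]]; first by exists x.
have := D2 x z xs; have := He x xs; move: (psi x x) (psi x z) (P z) hz => p q r; lra.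
Qed.

End Slopes.

(** * Curves and the Riemannian distance *)

Section Curves.
Context {R : realType} {m : nat} {M : manifold R m}.
Implicit Types (i j : chart M) (x : M) (y : 'rV[R]_m).
Local Notation dom := (@chart_dom R m M).
Local Notation cod := (@chart_codom R m M).
Local Notation co := (@chart_coord R m M).
Local Notation pa := (@chart_param R m M).
Variable g : metric M.

Definition speed i (c : R -> 'rV[R]_m) (t : R) : R :=
  Num.sqrt (inner (gmat g i (c t)) (derive1 c t) (derive1 c t)).

Lemma continuous_row_form (T : topologicalType) (u v : T -> 'rV[R]_m) (B : T -> 'M[R]_m) (t : T) :
  {for t, continuous u} -> {for t, continuous v} ->
  (forall a b, {for t, continuous (fun s => B s a b)}) ->
  {for t, continuous (fun s => (u s *m B s *m (v s)^T) 0 0)}.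
Proof.
move=> /continuous_rVP cu /continuous_rVP cv cB.
rewrite (_ : (fun s => _) = fun s => \sum_b (\sum_a u s 0 a * B s a b) * v s 0 b); last first.
  by apply/funext => s; rewrite mxE; apply: eq_bigr => b _; rewrite [(_^T) _ _]mxE mxE.
apply: cvg_sumr => b; apply: (@continuousM _ _ (fun s => \sum_a u s 0 a * B s a b) (fun s => v s 0 b)) => //.
by apply: cvg_sumr => a; apply: (@continuousM _ _ (fun s => u s 0 a) (fun s => B s a b)).
Qed.

Section OneCurve.
Variables (i : chart M) (c : R -> 'rV[R]_m).
Hypothesis cod_c : forall t, 0 <= t <= 1 -> cod i (c t).
Hypothesis der_c : forall t, derivable c t 1.
Hypothesis cont_c : continuous (derive1 c).

Lemma curve_continuous : continuous c.
Proof. by move=> t; apply: differentiable_continuous; apply/derivable1_diffP. Qed.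

Lemma speed_continuous t : 0 <= t <= 1 -> {for t, continuous (speed i c)}.
Proof.
move=> t01; apply: (@continuous_comp _ _ _ _ (@Num.sqrt R)); last exact: sqrt_continuous.
apply: continuous_row_form; [exact: cont_c|exact: cont_c|move=> a b].
apply: (@continuous_comp _ _ _ c (fun y => gmat g i y a b)); first exact: curve_continuous.
exact: smooth_continuous (lm_smooth (metric_local g i) a b) (cod_c t01).
Qed.

Lemma speed_integrable : (@lebesgue_measure R).-integrable `[0, 1] (EFin \o speed i c).
Proof.
apply: continuous_compact_integrable; first exact: segment_compact.
apply: continuous_in_subspaceT => t; rewrite inE /= in_itv /=; exact: speed_continuous.
Qed.

(** Fundamental theorem of calculus for f along c: the derivative is d f applied to the velocity,
    bounded by the speed. *)
Lemma curve_lipschitz (f : M -> R) : smooth_fun f -> slope1 g f ->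
  `|f (pa i (c 1)) - f (pa i (c 0))| <= \int[@lebesgue_measure R]_(t in `[0, 1]) speed i c t.
Proof.
move=> /smooth_funP sf lf; have sfi := sf i; have oC := @open_cod _ _ _ i.
pose F t := f (pa i (c t)); pose G t := (drow (f \o pa i) (c t) *m (derive1 c t)^T) 0 0.
have dF (t : R) : 0 <= t <= 1 -> is_derive t 1 F (G t).
  move=> t01; have dc : differentiable c t by apply/derivable1_diffP.
  have df : differentiable (f \o pa i) (c t) by exact: (smooth_diff oC sfi (cod_c t01)).
  have := is_derive_comp_rV (1 : R) dc df; rewrite (_ : \sum_j _ = G t) //.
  rewrite /G mxE; apply: eq_bigr => k _.
  by rewrite [drow _ _ _ _]mxE [(_^T) _ _]mxE mulrC derive1E derive_mx // [in RHS]mxE.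
have cF (t : R) : 0 <= t <= 1 -> {for t, continuous F}.
  move=> /dF [d _]; apply: differentiable_continuous; exact/derivable1_diffP.
have cG (t : R) : 0 <= t <= 1 -> {for t, continuous G}.
  move=> t01.
  rewrite (_ : G = fun s => (drow (f \o pa i) (c s) *m 1%:M *m (derive1 c s)^T) 0 0); last first.
    by apply/funext => s; rewrite mulmx1.
  apply: continuous_row_form; [|exact: cont_c|by move=> a b; exact: cst_continuous].
  apply: (@continuous_comp _ _ _ c (drow (f \o pa i))); first exact: curve_continuous.
  apply/continuous_rVP => k.
  exact: smooth_continuous (drow_smooth oC sfi 0 k) (cod_c t01).
have wG : {within `[0, 1], continuous G}.
  apply: continuous_in_subspaceT => t; rewrite inE /= in_itv /=; exact: cG.
have iG : (@lebesgue_measure R).-integrable `[0, 1] (EFin \o G).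
  by apply: continuous_compact_integrable => //; exact: segment_compact.
have FTC : \int[@lebesgue_measure R]_(t in `[0, 1]) G t = F 1 - F 0.
  rewrite /Rintegral (continuous_FTC2 (F := F) ltr01 wG) //; first split.
  - by move=> t; rewrite in_itv /= => /andP[t0 t1]; have [] := dF t; rewrite ?(ltW t0) ?(ltW t1).
  - by apply: cvg_at_right_filter; apply: cF; rewrite lexx ler01.
  - by apply: cvg_at_left_filter; apply: cF; rewrite lexx ler01.
  - move=> t; rewrite in_itv /= => /andP[t0 t1]; rewrite derive1E.
    by apply: is_deriveE; apply: dF; rewrite (ltW t0) (ltW t1).
rewrite -[f (pa i (c 1))]/(F 1) -[f (pa i (c 0))]/(F 0) -FTC.
apply: le_trans (le_normr_Rintegral _ iG) _ => //.
apply: le_Rintegral => //; [|exact: speed_integrable|].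
  by have := integrable_norm iG.
by move=> t; rewrite /= in_itv /= => t01; exact: lf (cod_c t01) _.
Qed.

End OneCurve.

Lemma chart_curve_lipschitz (f : M -> R) p q L : smooth_fun f -> slope1 g f ->
  chart_curve_length g p q L -> `|f q - f p| <= L.
Proof.
move=> sf lf [i [c [[dp c0] [dq c1] cc [dc cdc] ->]]].
by have := curve_lipschitz cc dc cdc sf lf; rewrite c0 c1 !coordK.
Qed.

Lemma curve_length_lipschitz (f : M -> R) p q L : smooth_fun f -> slope1 g f ->
  curve_length g p q L -> `|f q - f p| <= L.
Proof.
move=> sf lf; elim=> [p'|p' q' r L1 L2 h _ IH]; first by rewrite subrr normr0.
have h1 := chart_curve_lipschitz sf lf h.
have -> : f r - f p' = (f r - f q') + (f q' - f p') by rewrite addrA subrK.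
by apply: le_trans (ler_normD _ _) _; rewrite addrC lerD.
Qed.

Lemma curve_length_ge0 p q L : curve_length g p q L -> 0 <= L.
Proof.
elim=> [//|p' q' r L1 L2 [i [c [_ _ _ _ ->]]] _ IH].
by apply: addr_ge0 => //; apply: Rintegral_ge0 => t _; exact: sqrtr_ge0.
Qed.

Lemma curve_length_cat p q r L1 L2 : curve_length g p q L1 -> curve_length g q r L2 ->
  curve_length g p r (L1 + L2).
Proof.
move=> h; elim: h => [p'|p' q' r' K1 K2 h1 _ IH] h2; first by rewrite add0r.
by rewrite -addrA; apply: curve_length_cons h1 (IH h2).
Qed.

Lemma distance_le p q L : curve_length g p q L -> riemannian_distance g p q <= L.
Proof. by move=> h; apply: ge_inf => //; exists 0 => l /curve_length_ge0. Qed.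

(** An upper bound on the distance witnessed by a curve. The relation is directed, so later
    statements record it both ways. *)
Definition reach p q (B : R) := exists2 L, curve_length g p q L & L <= B.

Lemma reach_trans p q r B1 B2 : reach p q B1 -> reach q r B2 -> reach p r (B1 + B2).
Proof.
move=> [L1 h1 l1] [L2 h2 l2]; exists (L1 + L2); first exact: curve_length_cat h1 h2.
exact: lerD.
Qed.

Lemma reach_refl p B : 0 <= B -> reach p p B.
Proof. by move=> B0; exists 0 => //; exact: curve_length_nil. Qed.

Lemma reach_le p q B B' : B <= B' -> reach p q B -> reach p q B'.
Proof. by move=> h [L h1 h2]; exists L => //; exact: le_trans h2 h. Qed.

Lemma rcube_segment (c a b : 'rV[R]_m) r t : 0 <= t <= 1 -> rcube c r a -> rcube c r b ->
  rcube c r (a + t *: (b - a)).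
Proof.
move=> /andP[t0 t1] ha hb k; have := ha k; have := hb k; rewrite !mxE !ler_distl.
move: (a 0 k) (b 0 k) (c 0 k) => p q s /andP[h1 h2] /andP[h3 h4]; apply/andP; split; nra.
Qed.

Lemma reach_segment i (S : set 'rV[R]_m) (a b : 'rV[R]_m) (B : R) :
  (forall t, 0 <= t <= 1 -> S (a + t *: (b - a))) -> S `<=` cod i ->
  (forall y, S y -> inner (gmat g i y) (b - a) (b - a) <= B ^+ 2) -> 0 <= B ->
  reach (pa i a) (pa i b) B.
Proof.
move=> Sab SU HB B0; pose c t := a + t *: (b - a).
have c0 : c 0 = a by rewrite /c scale0r addr0.
have c1 : c 1 = b by rewrite /c scale1r addrC subrK.
have dc (t : R) : is_derive t 1 c (b - a).
  have := is_derive_line (f := @id 'rV[R]_m) (a := a) (v := b - a) (t := t).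
  by rewrite derive_id; apply; exact: derivable_id.
have Edc : derive1 c = fun=> b - a by apply/funext => t; rewrite derive1E; exact: is_deriveE.
have cc t : 0 <= t <= 1 -> cod i (c t) by move=> t01; exact/SU/Sab.
have derc t : derivable c t 1 by have [] := dc t.
have contc : continuous (derive1 c) by rewrite Edc => t; exact: cst_continuous.
pose L := \int[@lebesgue_measure R]_(t in `[0, 1]) speed i c t.
have ca : cod i a by rewrite -c0; apply: cc; rewrite lexx ler01.
have cb : cod i b by rewrite -c1; apply: cc; rewrite lexx ler01.
have [da Ea] := codomP ca; have [db Eb] := codomP cb.
exists (L + 0); last first.
  rewrite addr0 /L; have EB : \int[@lebesgue_measure R]_(t in `[0, 1]) B = B.
    by rewrite Rintegral_cst // [X in _ * fine X](lebesgue_measure_itv `[0 : R, 1]) /= lte_fin ltr01 oppr0 adde0 mulr1.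
  rewrite -[leRHS]EB; apply: le_Rintegral => //; first exact: speed_integrable.
    apply: continuous_compact_integrable; first exact: segment_compact.
    by apply: continuous_subspaceT => t; exact: cst_continuous.
  move=> t; rewrite /= in_itv /= => /Sab St; rewrite /speed Edc -[leRHS](ger0_norm B0) -sqrtr_sqr.
  by rewrite ler_wsqrtr // HB.
apply: (@curve_length_cons _ _ _ g _ (pa i b)); last exact: curve_length_nil.
exists i, c; split; last by [].
- by split; [exact: da|rewrite c0 Ea].
- by split; [exact: db|rewrite c1 Eb].
- exact: cc.
- by split; [exact: derc|exact: contc].
Qed.

Lemma reach_chart i (y0 : 'rV[R]_m) : cod i y0 -> exists2 r : R, 0 < r & forall a b,
  rcube y0 r a -> rcube y0 r b -> exists B, reach (pa i a) (pa i b) B.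
Proof.
move=> cy; have [r r0 KU] := open_rcube_sub (@open_cod _ _ _ i) cy.
exists r => // a b ha hb; have cK := @compact_rcube R m y0 r.
have [B B0 HB] : exists2 B : R, 0 < B & forall y, rcube y0 r y ->
    `|inner (gmat g i y) (b - a) (b - a)| <= B.
  apply: continuous_compact_bound => // y /KU cz.
  apply: continuous_row_form; [exact: cst_continuous|exact: cst_continuous|move=> k l].
  exact: smooth_continuous (lm_smooth (metric_local g i) k l) cz.
exists (Num.sqrt B); apply: (reach_segment (S := rcube y0 r)) => //.
- by move=> t t01; exact: rcube_segment.
- by move=> y /HB h; rewrite sqr_sqrtr ?(ltW B0) //; apply: le_trans h; exact: ler_norm.
Qed.

(** The set of points reached from p is open and closed, as all points of a small cube in a chart
    are joined by segments. *)
Lemma reach_connected p q : exists B, reach p q B.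
Proof.
have near_reach x : \forall z \near x, (exists B, reach x z B) /\ exists B, reach z x B.
  have dx := chart_atP x; have [r r0 Hr] := reach_chart (codom_coord dx).
  have h1 := near_dom dx; have h2 := near_coord dx (@rcube_nbhs _ _ _ r r0).
  apply: filterS2 h1 h2 => z dz hz.
  have hx : rcube (co (chart_at x) x) r (co (chart_at x) x) by move=> k; rewrite subrr normr0 ltW.
  have := Hr _ _ hx hz; have := Hr _ _ hz hx; rewrite !coordK //.
pose A := [set z | exists B, reach p z B].
suff EA : A = setT by have : [set: M] q by []; rewrite -EA.
apply: (@manifold_connected _ _ M).
- by exists p; exists 0; exact: reach_refl.
- exists A; last by rewrite setTI.
  rewrite openE => z [B Bz]; have := near_reach z; apply: filterS => w [[B' Bw] _].
  by exists (B + B'); exact: reach_trans Bz Bw.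
- exists A; last by rewrite setTI.
  rewrite -[A]setCK; apply: open_closedC; rewrite openE => z nz.
  have := near_reach z; apply: filterS => w [_ [B' Bw]] [B Bz]; apply: nz.
  by exists (B + B'); exact: reach_trans Bz Bw.
Qed.

(** Connectedness makes the set of lengths nonempty; the infimum is then a genuine one and not the
    default value 0, and a curve of length below e exists. *)
Lemma distance_reach p q (e : R) : riemannian_distance g p q < e -> reach p q e.
Proof.
move=> h; have [B [L0 hL0 _]] := reach_connected p q.
have [||L hL lt] := @inf_adherent _ [set L | curve_length g p q L] (e - riemannian_distance g p q).
- by rewrite subr_gt0.
- by split; [exists L0|exists 0 => l /curve_length_ge0].
by exists L => //; apply: ltW; move: lt; rewrite addrC subrK.
Qed.

End Curves.

(** * Comparison of quadratic forms *)

Section Forms.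
Context {R : realType} {m : nat}.
Implicit Types (G A : 'M[R]_m) (X Y V : 'rV[R]_m).

Lemma innerDl G X Y V : inner G (X + Y) V = inner G X V + inner G Y V.
Proof. by rewrite /inner !mulmxDl mxDE. Qed.

Lemma innerZl G (c : R) X V : inner G (c *: X) V = c * inner G X V.
Proof. by rewrite /inner -!scalemxAl mxE. Qed.

Lemma innerDr G X Y V : inner G V (X + Y) = inner G V X + inner G V Y.
Proof. by rewrite /inner linearD mulmxDr mxDE. Qed.

Lemma innerZr G (c : R) X V : inner G V (c *: X) = c * inner G V X.
Proof. by rewrite /inner linearZ /= -scalemxAr mxE. Qed.

Lemma innerC G X Y : G^T = G -> inner G X Y = inner G Y X.
Proof.
move=> Gs; transitivity (((X *m G *m Y^T)^T) 0 0); first by rewrite mxE.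
by rewrite !trmx_mul trmxK Gs mulmxA.
Qed.

Lemma inner_ge0 G X : posdef G -> 0 <= inner G X X.
Proof.
move=> [_ Gp]; have [->|n0] := eqVneq X 0; first by rewrite /inner !mul0mx mxE.
exact/ltW/Gp.
Qed.

Lemma inner_cs G X Y : posdef G -> inner G X Y ^+ 2 <= inner G X X * inner G Y Y.
Proof.
move=> pG; have [Y0|n0] := eqVneq Y 0.
  by rewrite Y0 /inner trmx0 !mulmx0 !mxE expr0n mulr0.
have yy : 0 < inner G Y Y by have [_] := pG; exact.
pose t := inner G X Y / inner G Y Y.
have := inner_ge0 (X + (- t) *: Y) pG.
rewrite innerDl !innerDr !innerZl !innerZr (innerC Y X); last by have [] := pG.
move: (inner G X X) (inner G X Y) (inner G Y Y) @t yy => p q r t r0; rewrite /t.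
have -> : p + - (q / r) * q + (- (q / r) * q + - (q / r) * (- (q / r) * r)) = (p * r - q ^+ 2) / r.
  by field; rewrite gt_eqF.
by rewrite pmulr_lge0 ?invr_gt0 // subr_ge0.
Qed.

Lemma dot_coord (W : 'rV[R]_m) j : `|W 0 j| <= Num.sqrt (dot W W).
Proof.
rewrite -sqrtr_sqr ler_wsqrtr // dot_sqr (bigD1 j) //= lerDl.
by apply: sumr_ge0 => k _; exact: sqr_ge0.
Qed.

Lemma form_lower A : posdef A -> exists2 l : R, 0 < l & forall V, l * `|V| ^+ 2 <= inner A V V.
Proof.
move=> pA; have [P PAP] := orthonormal_frame pA; have uP := frame_unit PAP.
pose C : R := 1 + \sum_j \sum_k `|P j k|.
have C0 : 0 < C by rewrite ltr_pwDl // sumr_ge0 // => j _; apply: sumr_ge0.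
exists (C ^- 2) => [|V]; first by rewrite invr_gt0 exprn_gt0.
pose W := V *m invmx P; have EV : V = W *m P by rewrite /W mulmxKV.
have Ei : inner A V V = dot W W by rewrite EV -inner_congr PAP inner1.
have s0 : 0 <= Num.sqrt (dot W W) by exact: sqrtr_ge0.
have nV : `|V| <= C * Num.sqrt (dot W W).
  apply: rV_norm_le => [|k]; first by rewrite mulr_ge0 // ltW.
  rewrite EV mxE; apply: le_trans (ler_norm_sum _ _ _) _.
  apply: (@le_trans _ _ (\sum_j `|P j k| * Num.sqrt (dot W W))).
    by apply: ler_sum => j _; rewrite normrM mulrC; apply: ler_wpM2l => //; exact: dot_coord.
  rewrite -mulr_suml; apply: ler_wpM2r => //; rewrite /C.
  apply: (@le_trans _ _ (\sum_j \sum_k `|P j k|)); last by rewrite lerDr.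
  by apply: ler_sum => j _; rewrite (bigD1 k) //= lerDl sumr_ge0.
rewrite Ei mulrC ler_pdivrMr ?exprn_gt0 // -[dot W W](sqr_sqrtr (dot_ge0 W)) mulrC -exprMn.
by rewrite lerXn2r // nnegrE // mulr_ge0 // ltW.
Qed.

(** The factor 4 on squares is a factor 2 on lengths. With l the constant of [form_lower], entries
    within a total of 3 l change the form by at most three times its value at y0. *)
Lemma form_near (B : 'rV[R]_m -> 'M[R]_m) (y0 : 'rV[R]_m) : posdef (B y0) ->
  (forall a b, {for y0, continuous (fun y => B y a b)}) ->
  \forall y \near y0, forall V, inner (B y) V V <= 4 * inner (B y0) V V.
Proof.
move=> pB cB; have [l l0 Hl] := form_lower pB.
pose D y : R := \sum_a \sum_b `|B y a b - B y0 a b|.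
have cD : {for y0, continuous D}.
  apply: (@cvg_sumr _ _ _ (nbhs y0) _ _ (fun a y => \sum_b `|B y a b - B y0 a b|)
    (fun a => \sum_b `|B y0 a b - B y0 a b|)) => a.
  apply: (@cvg_sumr _ _ _ (nbhs y0) _ _ (fun b y => `|B y a b - B y0 a b|)
    (fun b => `|B y0 a b - B y0 a b|)) => b.
  apply: cvg_norm; apply: cvgB; [exact: cB|exact: cvg_cst].
have D0 : D y0 = 0 by apply: big1 => a _; apply: big1 => b _; rewrite subrr normr0.
have : \forall y \near y0, D y < 3 * l.
  have := cD [set t | t < 3 * l]; apply; apply: open_nbhs_nbhs; split; first exact: open_lt.
  by rewrite /= D0 mulr_gt0.
apply: filterS => y Dy V.
have E : inner (B y) V V - inner (B y0) V V = \sum_b \sum_a V 0 a * (B y a b - B y0 a b) * V 0 b.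
  rewrite /inner !mxE -sumrB; apply: eq_bigr => b _.
  rewrite ![(V *m _) _ _]mxE [(V^T) _ _]mxE !mulr_suml -sumrB; apply: eq_bigr => a _.
  by rewrite mulrBr mulrBl.
have le1 : inner (B y) V V - inner (B y0) V V <= D y * `|V| ^+ 2.
  rewrite E /D exchange_big /= mulr_suml; apply: ler_sum => a _; rewrite mulr_suml; apply: ler_sum => b _.
  apply: le_trans (ler_norm _) _; rewrite !normrM mulrAC mulrC; apply: ler_wpM2l => //.
  by rewrite expr2 ler_pM // rV_coord_le.
have le2 : D y * `|V| ^+ 2 <= 3 * inner (B y0) V V.
  apply: (@le_trans _ _ (3 * l * `|V| ^+ 2)); first by rewrite ler_wpM2r ?sqr_ge0 // ltW.
  by rewrite -mulrA ler_wpM2l // Hl.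
by move: le1 le2; move: (inner _ _ _) (inner _ _ _) (D y * _) => p q r; lra.
Qed.

Lemma partial_coord (k j : 'I_m) (y : 'rV[R]_m) : partial k (fun z => z 0 j) y = (j == k)%:R.
Proof.
have d : derivable (@id 'rV[R]_m) y (delta_mx 0 k) by exact: derivable_id.
have := derive_mx d; move=> /matrixP /(_ 0 j); rewrite derive_id [RHS]mxE mxE eqxx /= => ->; by [].
Qed.

Lemma smooth_subc (a : 'rV[R]_m) : smooth_mx setT (fun y => y - a).
Proof.
have oT : open [set: 'rV[R]_m] by exact: openT.
move=> i j; rewrite ord1.
apply: (smooth_ext oT) (smoothB oT (smooth_coord oT j) (smooth_cst oT (a 0 j))) => y _.
by rewrite mxDE mxNE.
Qed.

Lemma drow_form A (a y : 'rV[R]_m) : A^T = A ->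
  drow (fun z => inner A (z - a) (z - a)) y = 2 *: ((y - a) *m A).
Proof.
move=> As; have oT : open [set: 'rV[R]_m] by exact: openT.
have ss := smooth_subc a; have sA := smooth_mx_cst oT A.
have st := smooth_tr oT ss; have sp := smooth_mulmx oT ss sA.
have dk k : pmx k (fun z : 'rV[R]_m => z - a) y = delta_mx 0 k.
  apply/rowP => j; rewrite mxE.
  transitivity (partial k (fun z : 'rV[R]_m => z 0 j + (- a 0 j)) y).
    by apply: (partial_eq_on oT) => // z _; rewrite mxDE mxNE.
  rewrite (partialD k (smooth_coord oT j) (smooth_cst oT _)) // partial_cst addr0 partial_coord.
  by rewrite mxE.
apply/rowP => k; rewrite mxE -/(inner _ _ _).
have -> : partial k (fun z => inner A (z - a) (z - a)) y =
    pmx k (fun z => (z - a) *m A *m (z - a)^T) y 0 0 by rewrite [RHS]mxE.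
rewrite (pmxM oT k sp st) // (pmxM oT k ss sA) // pmx_cst mulmx0 addr0 (pmx_tr oT) // dk.
rewrite mxDE [RHS]mxE mulr2n mulrDl mul1r; congr (_ + _).
  rewrite -mulmxA -rowE mxE -[in LHS]As -trmx_mul mxE //.
by rewrite trmx_delta -colE mxE.
Qed.

End Forms.

Lemma flat_bounded {R : realType} (P : {poly R}) : exists2 B : R, 0 < B & forall t, t <= 1 -> `|flat P t| <= B.
Proof.
have [C C0 H] := flat_quadratic P; exists (C + 1) => [|t t1]; first by rewrite ltr_wpDl.
have [t0|t0] := leP t 0.
  by rewrite /flat ltNge t0 normr0 addr_ge0.
apply: le_trans (H t) _; apply: (@le_trans _ _ C); last by rewrite lerDl.
by rewrite ler_piMr // exprn_ile1 // ltW.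
Qed.

(** * Bumps at small scales *)

Section LocalBump.
Context {R : realType} {m : nat} {M : manifold R m}.
Implicit Types (i j : chart M) (x : M) (y : 'rV[R]_m).
Local Notation dom := (@chart_dom R m M).
Local Notation cod := (@chart_codom R m M).
Local Notation co := (@chart_coord R m M).
Local Notation pa := (@chart_param R m M).
Variable g : metric M.

Lemma slope1_supported i (K : set 'rV[R]_m) (f : M -> R) : compact K -> K `<=` cod i ->
  smooth_fun f -> (forall x, ~ (pa i @` K) x -> f x = 0) ->
  (forall y, K y -> slope_at g i y f) -> slope1 g f.
Proof.
move=> cK KU sf fK H; apply: slope1_local => // x.
have [[y Ky <-]|nK] := pselect ((pa i @` K) x).
  by have [dy Ey] := codomP (KU _ Ky); exists i => //; rewrite Ey; exact: H.
have dx := chart_atP x; exists (chart_at x) => // V.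
rewrite (drow_out (closed_param cK KU) fK) ?mul0mx ?mxE ?normr0 ?sqrtr_ge0 //.
  exact: codom_coord.
by rewrite coordK.
Qed.

Section Ellipsoid.
Variables (i : chart M) (A : 'M[R]_m) (U : set 'rV[R]_m) (a : 'rV[R]_m) (s c B : R).
Hypotheses (pA : posdef A) (UU : U `<=` cod i) (cU : compact U).
Hypotheses (s0 : 0 < s) (B0 : 0 < B).
Hypothesis HB : forall t : R, t <= 1 -> `|flat ('X^2 * (1 - 1^`())) t| <= B.
Hypothesis HU : forall y, U y -> forall V, inner (gmat g i y) V V <= 4 * inner A V V.
Hypothesis HV : forall y, U y -> forall V,
  inner (A *m invmx (gmat g i y) *m A) V V <= 4 * inner A V V.
Hypothesis Hc : 8 * expR 1 * B <= c.
Let r : R := c * s.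
Hypothesis HE : forall y, inner A (y - a) (y - a) <= r ^+ 2 -> U y.

Let c0 : 0 < c.
Proof. by apply: lt_le_trans Hc; rewrite !mulr_gt0 ?expR_gt0. Qed.

Let r0 : 0 < r. Proof. exact: mulr_gt0. Qed.

Definition ellipsoid : set 'rV[R]_m := [set y | inner A (y - a) (y - a) <= r ^+ 2].

(** The factor e = [expR 1] normalises the height at the centre to 2 s, as [flat 1 1] is 1 / e. The
    ellipsoid has radius r = c s for the metric frozen at one point, so the slope, of order s / r,
    is controlled by c alone. *)
Definition ellbump (y : 'rV[R]_m) : R :=
  2 * s * expR 1 * flat 1 (1 - inner A (y - a) (y - a) / r ^+ 2).

Let oT : open [set: 'rV[R]_m]. Proof. exact: openT. Qed.

Lemma quad_smooth : smooth setT (fun y : 'rV[R]_m => inner A (y - a) (y - a)).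
Proof.
have ss := smooth_subc a.
apply: (smooth_mulmx oT (B := fun y => (y - a) *m A) (C := fun y => (y - a)^T)).
  exact: (smooth_mulmx oT ss (smooth_mx_cst oT A)).
exact: (smooth_tr oT ss).
Qed.

Lemma ellbump_smooth : smooth setT ellbump.
Proof.
apply: (smoothM oT (smooth_cst oT _)); apply: (smooth_flat oT).
apply: (smoothB oT (smooth_cst oT _)); exact: (smoothM oT quad_smooth (smooth_cst oT _)).
Qed.

Lemma ellipsoid_compact : compact ellipsoid.
Proof.
apply: (subclosed_compact _ cU); last exact: HE.
have cq : continuous (fun y : 'rV[R]_m => inner A (y - a) (y - a)).
  by move=> y; exact: smooth_continuous quad_smooth I.
have := (continuous_closedP _).1 cq [set t | t <= r ^+ 2]; apply; exact: closed_le.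
Qed.

Lemma ellbump_out y : ~ ellipsoid y -> ellbump y = 0.
Proof.
move=> /negP; rewrite -ltNge => h; rewrite /ellbump flat1_eq0 ?mulr0 //.
by rewrite subr_le0 ler_pdivlMr ?exprn_gt0 // mul1r ltW.
Qed.

Lemma ellbump_center : ellbump a = 2 * s.
Proof.
rewrite /ellbump subrr /inner !mul0mx mxE mul0r subr0 /flat ltr01 hornerC mul1r invr1.
by rewrite -mulrA -expRD subrr expR0 mulr1.
Qed.

Lemma ellipsoid_sub : ellipsoid `<=` cod i. Proof. by move=> y /HE /UU. Qed.

Definition ellfun : M -> R := extend0 i ellbump.

Lemma ellfun_smooth : smooth_fun ellfun.
Proof.
have h y : cod i y -> ~ ellipsoid y -> ellbump y = 0 by move=> _; exact: ellbump_out.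
apply: (extend0_smooth ellipsoid_compact ellipsoid_sub h).
apply: smooth_glue => y cy; exists setT, ellbump; split=> //; exact: ellbump_smooth.
Qed.

Lemma ellfun_out x : ~ (pa i @` ellipsoid) x -> ellfun x = 0.
Proof. by apply: extend0_out => y _; exact: ellbump_out. Qed.

(** The differential is, up to sign, 4 s e |d| / r^2 times the form (y - a) A, with d the derivative
    of the profile. By [HV] the dual vector [xi] has length at most 2 r, so the slope is at most 8 s
    e B / r = 8 e B / c, and [Hc] makes this at most 1. *)
Lemma ellfun_slope1 : slope1 g ellfun.
Proof.
apply: (slope1_supported ellipsoid_compact ellipsoid_sub ellfun_smooth ellfun_out) => y Ey V.
have Uy := HE Ey; have cy := UU Uy; have pG := lm_posdef (metric_local g i) cy.
set G := gmat g i y in pG *; have uG := posdef_unit pG.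
have As : A^T = A by have [] := pA.
have Gs : G^T = G by have [] := pG.
pose q := inner A (y - a) (y - a).
have q0 : 0 <= q by exact: inner_ge0.
have r20 : 0 < r ^+ 2 by rewrite exprn_gt0.
pose d := flat ('X^2 * (1 - 1^`())) (1 - q / r ^+ 2).
have dB : `|d| <= B by apply: HB; rewrite gerBl divr_ge0 // ltW.
have E : drow (ellfun \o pa i) y = (2 * s * expR 1 * d * (- r ^- 2) * 2) *: ((y - a) *m A).
  transitivity (drow ellbump y).
    apply/rowP => k; rewrite !mxE; apply: (partial_eq_on (@open_cod _ _ _ i)) => // z cz.
    by rewrite /= /ellfun extend0_param.
  have dphi : is_derive q 1 (fun t : R => 2 * s * expR 1 * flat 1 (1 - t / r ^+ 2)) (2 * s * expR 1 * (d * (- r ^- 2))).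
    have dl : is_derive q 1 (fun t : R => 1 - t / r ^+ 2) (- r ^- 2).
      have h : is_derive q 1 (fun t : R => r ^- 2 *: t) (r ^- 2 *: 1) by exact: is_deriveZ.
      have h2 := is_deriveB (is_derive_cst (1 : R) q (1 : R)) h.
      rewrite sub0r /GRing.scale /= mulr1 in h2.
      rewrite (_ : (fun t : R => 1 - t / r ^+ 2) = cst 1 - (fun t : R => r ^- 2 * t)) //.
      by apply/funext => t; rewrite /= [t / _]mulrC.
    have df := is_derive_comp_real dl (is_derive_flat 1 (1 - q / r ^+ 2)).
    exact: (is_deriveZ (2 * s * expR 1) df).
  have := drow_comp1 quad_smooth oT I dphi; rewrite -/ellbump => ->.
  by rewrite (drow_form _ _ As) scalerA; congr (_ *: _); ring.
pose xi := (y - a) *m A *m invmx G.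
have Exi : ((y - a) *m A *m V^T) 0 0 = inner G xi V by rewrite /inner /xi mulmxKV.
have Eq : inner G xi xi = inner (A *m invmx G *m A) (y - a) (y - a).
  rewrite /inner /xi mulmxKV // !trmx_mul trmx_inv Gs As !mulmxA //.
have xi4 : inner G xi xi <= 4 * r ^+ 2.
  by rewrite Eq; apply: le_trans (HV Uy _) _; rewrite ler_pM2l.
have V0 : 0 <= inner G V V by exact: inner_ge0.
have cs : `|inner G xi V| <= 2 * r * Num.sqrt (inner G V V).
  rewrite -sqrtr_sqr; apply: (@le_trans _ _ (Num.sqrt (inner G xi xi * inner G V V))).
    by rewrite ler_wsqrtr // inner_cs.
  rewrite sqrtrM ?inner_ge0 // ler_wpM2r ?sqrtr_ge0 //.
  rewrite (_ : 2 * r = Num.sqrt ((2 * r) ^+ 2)); last by rewrite sqrtr_sqr ger0_norm // mulr_ge0 // ltW.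
  by rewrite ler_wsqrtr // exprMn (_ : 2 ^+ 2 = 4) //; ring.
rewrite E -scalemxAl mxE Exi normrM.
have e0 : 0 < expR 1 :> R by exact: expR_gt0.
have n1 : `|2 * s * expR 1 * d * (- r ^- 2) * 2| = 4 * s * expR 1 * `|d| / r ^+ 2.
  rewrite !normrM normrN normfV !(gtr0_norm s0) (gtr0_norm e0) (gtr0_norm r20) !normr_nat.
  by ring.
rewrite n1; apply: (@le_trans _ _ (4 * s * expR 1 * B / r ^+ 2 * (2 * r * Num.sqrt (inner G V V)))).
  apply: ler_pM => //; first by rewrite !mulr_ge0 ?invr_ge0 ?expR_ge0 ?(ltW s0) ?(ltW r20).
  rewrite ler_wpM2r ?invr_ge0 ?(ltW r20) // ler_wpM2l // !mulr_ge0 ?expR_ge0 ?(ltW s0) //.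
have -> : 4 * s * expR 1 * B / r ^+ 2 * (2 * r * Num.sqrt (inner G V V)) =
    (8 * expR 1 * B / c) * Num.sqrt (inner G V V).
  rewrite /r; move: (expR 1) (Num.sqrt _) => e w; field.
  by rewrite !gt_eqF.
by rewrite ler_piMl ?sqrtr_ge0 // ler_pdivrMr // mul1r.
Qed.

Lemma ellipsoid_reach y : ellipsoid y -> reach g (pa i a) (pa i y) (2 * c * s) /\
  reach g (pa i y) (pa i a) (2 * c * s).
Proof.
move=> Ey; have K0 : 0 <= 2 * c * s by rewrite !mulr_ge0 // ltW.
have seg (t : R) : 0 <= t <= 1 -> inner A (t *: (y - a)) (t *: (y - a)) <= r ^+ 2.
  move=> /andP[t0 t1]; rewrite innerZl innerZr mulrA -expr2.
  by apply: le_trans Ey; rewrite ler_piMl ?inner_ge0 // exprn_ile1.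
have le2 z : U z -> inner (gmat g i z) (y - a) (y - a) <= (2 * c * s) ^+ 2.
  move=> Uz; apply: le_trans (HU Uz _) _.
  have -> : (2 * c * s) ^+ 2 = 4 * (c * s) ^+ 2 by ring.
  by rewrite ler_pM2l //; exact: Ey.
split; (apply: (reach_segment (S := U)); [|exact: UU| |exact: K0]).
- by move=> t t01; apply: HE; rewrite addrAC subrr add0r; exact: seg.
- exact: le2.
- move=> t t01; apply: HE; have -> : y + t *: (a - y) - a = (1 - t) *: (y - a).
    by rewrite scalerBl scale1r -[a - y]opprB scalerN addrAC.
  by apply: seg; move: t01 => /andP[h1 h2]; apply/andP; split; lra.
- move=> z Uz; have -> : inner (gmat g i z) (a - y) (a - y) = inner (gmat g i z) (y - a) (y - a); last exact: le2.
  by rewrite -opprB -scaleN1r innerZl innerZr mulrA mulN1r opprK mul1r.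
Qed.

End Ellipsoid.

Definition good (K : R) x s := exists psi C,
  [/\ smooth_fun psi, slope1 g psi, compact C, forall z, ~ C z -> psi z = 0 & s < psi x] /\
  forall z, C z -> reach g x z (K * s) /\ reach g z x (K * s).

Lemma local_bump : exists2 K : R, 0 < K & forall (p : M) (W : set M), nbhs p W ->
  exists2 s0 : R, 0 < s0 & \forall x \near p, forall s : R, 0 < s -> s <= s0 ->
  exists psi C,
  [/\ smooth_fun psi, slope1 g psi, compact C, forall z, ~ C z -> psi z = 0 & s < psi x] /\
  forall z, C z -> [/\ W z, reach g x z (K * s) & reach g z x (K * s)].
Proof.
have [B B0 HB] := @flat_bounded R ('X^2 * (1 - 1^`())).
pose c : R := 8 * expR 1 * B; have c0 : 0 < c by rewrite !mulr_gt0 ?expR_gt0.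
exists (2 * c) => [|p W nW]; first exact: mulr_gt0.
pose i := chart_at p; have dp : dom i p by exact: chart_atP.
pose y0 := co i p; have cy : cod i y0 by exact: codom_coord.
pose A := gmat g i y0; have LM := metric_local g i.
have pA : posdef A := lm_posdef LM cy.
have Ey0 : pa i y0 = p by exact: coordK.
have n1 : \forall y \near y0, forall V, inner (gmat g i y) V V <= 4 * inner A V V.
  by apply: form_near => // a b; exact: smooth_continuous (lm_smooth LM a b) cy.
have n2 : \forall y \near y0, forall V, inner (A *m invmx (gmat g i y) *m A) V V <= 4 * inner A V V.
  have E0 : A *m invmx (gmat g i y0) *m A = A by rewrite -/A mulmxV ?mul1mx // posdef_unit.
  have sB : smooth_mx (cod i) (fun y => A *m invmx (gmat g i y) *m A).
    have oC := @open_cod _ _ _ i.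
    apply: (smooth_mulmx oC _ (smooth_mx_cst oC A)); apply: (smooth_mulmx oC (smooth_mx_cst oC A)).
    exact: smooth_invG LM.
  have := @form_near _ _ (fun y => A *m invmx (gmat g i y) *m A) y0; rewrite E0; apply=> // a b.
  exact: smooth_continuous (sB a b) cy.
have n3 : \forall y \near y0, W (pa i y) by apply: near_param => //; rewrite Ey0.
have [e e0 He] : exists2 e : R, 0 < e & forall y, rcube y0 e y ->
    [/\ cod i y, W (pa i y), forall V, inner (gmat g i y) V V <= 4 * inner A V V &
      forall V, inner (A *m invmx (gmat g i y) *m A) V V <= 4 * inner A V V].
  have n4 := near_cod cy.
  have : \forall y \near y0, [/\ cod i y, W (pa i y), forall V, inner (gmat g i y) V V <= 4 * inner A V V &
      forall V, inner (A *m invmx (gmat g i y) *m A) V V <= 4 * inner A V V].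
    near=> y; split; near: y; [exact: n4|exact: n3|exact: n1|exact: n2].
  set Q := (X in \forall y \near y0, X y) => nQ.
  have [|r r0 Hr] := open_rcube_sub (U := interior Q) (c := y0) (@open_interior _ _); first exact: nQ.
  by exists r => // y /Hr /interior_subset.
have [l l0 Hl] := form_lower pA.
have e2 : 0 < e / 2 by rewrite divr_gt0.
(* At this scale the ellipsoid of radius c s has coordinate radius at most e / 2, so around a centre
   within e / 2 of y0 it stays in the cube of radius e. *)
exists (Num.sqrt l * (e / 2) / c); first by rewrite divr_gt0 // mulr_gt0 // sqrtr_gt0.
have h1 := near_dom dp; have h2 := near_coord dp (@rcube_nbhs _ _ y0 (e / 2) e2).
apply: filterS2 h1 h2 => x dx hx s s0 ss.
pose a := co i x.
have HE y : inner A (y - a) (y - a) <= (c * s) ^+ 2 -> rcube y0 e y.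
  move=> h.
  have cs : c * s <= Num.sqrt l * (e / 2) by rewrite mulrC -ler_pdivlMr.
  have : l * `|y - a| ^+ 2 <= l * (e / 2) ^+ 2.
    apply: le_trans (Hl _) _; apply: le_trans h _.
    rewrite -[l in leRHS](sqr_sqrtr (ltW l0)) -exprMn lerXn2r // nnegrE mulr_ge0 ?sqrtr_ge0 ?(ltW c0) ?(ltW s0) ?(ltW e2) //.
  rewrite ler_pM2l // => h3.
  have {}h3 : `|y - a| <= e / 2 by rewrite -(ler_pXn2r (n := 2)) ?nnegrE // ltW.
  move=> k; have := hx k; have := rV_coord_le (y - a) k; rewrite !mxE -/a => h4 h5.
  have -> : y 0 k - y0 0 k = (y 0 k - a 0 k) + (a 0 k - y0 0 k) by rewrite addrA subrK.
  apply: le_trans (ler_normD _ _) _; rewrite [leRHS](splitr e); apply: lerD => //.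
  exact: le_trans h4 h3.
have UU : rcube y0 e `<=` cod i by move=> y /He[].
have HU y : rcube y0 e y -> forall V, inner (gmat g i y) V V <= 4 * inner A V V by move=> /He[].
have HV y : rcube y0 e y -> forall V, inner (A *m invmx (gmat g i y) *m A) V V <= 4 * inner A V V.
  by move=> /He[].
have cU := @compact_rcube R m y0 e.
exists (ellfun i A a s c), (pa i @` ellipsoid A a s c); split.
  split.
  - exact: (ellfun_smooth UU cU s0 B0 (lexx _) HE).
  - exact: (ellfun_slope1 pA UU cU s0 B0 HB HV (lexx _) HE).
  - apply: compact_param; first exact: (ellipsoid_compact cU HE).
    exact: (ellipsoid_sub UU HE).
  - exact: (ellfun_out s0 B0 (lexx _)).
  - rewrite /ellfun extend0_in // (ellbump_center A a s c); move: s0; lra.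
have Ea : pa i a = x by exact: coordK.
move=> _ [y Ey <-]; have [r1 r2] := ellipsoid_reach pA UU s0 B0 HU (lexx _) HE Ey.
rewrite Ea in r1 r2; split=> //.
by have [] := He y (HE y Ey).
Unshelve. all: by end_near. Qed.

End LocalBump.

(** * Cutoffs on complete manifolds *)

Section Cutoffs.
Context {R : realType} {m : nat} {M : manifold R m}.
Implicit Types (i j : chart M) (x : M) (y : 'rV[R]_m).
Local Notation dom := (@chart_dom R m M).
Local Notation cod := (@chart_codom R m M).
Local Notation co := (@chart_coord R m M).
Local Notation pa := (@chart_param R m M).
Variable g : metric M.

(* [ramp k b - ramp k (b - P)] grows with slope at most one where P < b and is
   constant where P >= b, so it can be added to f without steepening it. *)
Lemma raise_slope (f P : M -> R) (C : set M) (k b : R) : 0 < k -> smooth_fun f -> smooth_fun P ->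
  slope1 g f -> slope1 g P -> closed C -> (forall z, ~ C z -> f z = 0) ->
  (forall z, C z -> b < P z) ->
  let phi z := f z + (ramp k b - ramp k (b - P z)) in smooth_fun phi /\ slope1 g phi.
Proof.
move=> k0 sf sP lf lP clC fC PC phi.
have sf' i : smooth (cod i) (f \o pa i) by move: i; exact/smooth_funP.
have sP' i : smooth (cod i) (P \o pa i) by move: i; exact/smooth_funP.
have sb i : smooth (cod i) (fun y => b - P (pa i y)).
  exact: (smoothB (@open_cod _ _ _ i) (smooth_cst (@open_cod _ _ _ i) b) (sP' i)).
have sr i : smooth (cod i) (fun y => ramp k b - ramp k (b - P (pa i y))).
  have oC := @open_cod _ _ _ i.
  exact: (smoothB oC (smooth_cst oC _) (smooth_ramp k oC (sb i))).
split; first by apply/smooth_funP => i; exact: (smoothD (@open_cod _ _ _ i) (sf' i) (sr i)).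
move=> i y cy; have oC := @open_cod _ _ _ i.
pose d := dramp k (b - P (pa i y)).
have E : drow (phi \o pa i) y = drow (f \o pa i) y + d *: drow (P \o pa i) y.
  rewrite (_ : phi \o pa i = fun z => (f \o pa i) z + (ramp k b - ramp k (b - P (pa i z)))) //.
  rewrite (drowD (sf' i) (sr i) cy); congr (_ + _).
  have dphi : is_derive (P (pa i y)) 1 (fun t : R => ramp k b - ramp k (b - t)) d.
    have dl : is_derive (P (pa i y)) 1 (fun t : R => b - t) (- 1).
      have := is_deriveB (is_derive_cst b (P (pa i y)) (1 : R)) (is_derive_id (P (pa i y)) (1 : R)).
      by rewrite sub0r.
    have dr := is_derive_comp_real dl (is_derive_ramp k (b - P (pa i y))).
    have := is_deriveB (is_derive_cst (ramp k b) (P (pa i y)) (1 : R)) dr.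
    by rewrite sub0r mulrN1 opprK.
  exact: (drow_comp1 (sP' i) oC cy dphi).
have [Cz|nC] := pselect (C (pa i y)).
  apply: (slope_comb (a := 1) (b := 0) _ _ _ (lf i y cy) (lP i y cy)) => //.
  rewrite E /d dramp0 ?scale0r ?scale1r //.
  by rewrite subr_le0 ltW // PC.
have /andP[d0 d1] : 0 <= d <= 1 by exact: dramp_bounds.
apply: (slope_comb (a := 0) (b := d) _ d0 _ (lf i y cy) (lP i y cy)) => //; first by rewrite add0r.
by rewrite E (drow_out clC fC cy nC) scaler0.
Qed.

(** A function f of height above h / 2 at x has compact support C; the functions given at the points
    of C yield P above h / 2 on C, and [raise_slope] lifts f by almost h / 2. The two extents K h /
    2 add up to K h. *)
Lemma good_step (K h : R) x : 0 < K -> 0 < h ->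
  (forall (y : M), reach g x y (K * (h / 2)) -> reach g y x (K * (h / 2)) -> good g K y (h / 2)) ->
  good g K x h.
Proof.
move=> K0 h0 H; have h2 : 0 < h / 2 by rewrite divr_gt0.
have Kh0 : 0 <= K * (h / 2) by rewrite mulr_ge0 // ltW.
have [f [C [[sf lf cC fC fx] rC]]] := H x (reach_refl g x Kh0) (reach_refl g x Kh0).
have Cx : C x by apply: contrapT => /fC E; move: fx; rewrite E => /lt_trans /(_ h2); rewrite ltxx.
have /choice[psi Hpsi] z : exists psi : M -> R, exists D : set M, C z ->
    [/\ smooth_fun psi, slope1 g psi, compact D, forall w, ~ D w -> psi w = 0 & h / 2 < psi z] /\
    forall w, D w -> reach g z w (K * (h / 2)) /\ reach g w z (K * (h / 2)).
  have [Cz|nC] := pselect (C z); last by exists (fun=> 0), set0.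
  have [r1 r2] := rC z Cz; have [psi [D HD]] := H z r1 r2.
  by exists psi, D.
have /choice[D HD] := Hpsi.
have [|P [E [sP lP cE PE [E1 E2]]]] := @slope1_cover _ _ _ g C psi D (h / 2) cC.
  by move=> z /HD[].
(* The lift is at least h / 2 - k; with k half the excess of f x over h / 2, the value at x still
   exceeds h. *)
pose k := (f x - h / 2) / 2; have k0 : 0 < k by rewrite divr_gt0 // subr_gt0.
have clC : closed C by apply: compact_closed cC; exact: manifold_hausdorff.
have [sphi lphi] := raise_slope k0 sf sP lf lP clC fC E2.
exists (fun z => f z + (ramp k (h / 2) - ramp k (h / 2 - P z))), (C `|` E); split.
  split=> //; first exact: compactU.
    by move=> z /not_orP[/fC -> /PE ->]; rewrite subr0 subrr addr0.
  rewrite (@ramp0 _ k k0 (h / 2 - P x)); last by rewrite subr_le0 ltW // E2.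
  have := ramp_ge k0 (h / 2); rewrite subr0 /k; move: (ramp ((f x - h / 2) / 2) (h / 2)) fx; move: (f x) => q p; lra.
have half : K * (h / 2) + K * (h / 2) = K * h by field.
move=> z [Cz|/E1[w Cw Dz]].
  have [r1 r2] := rC z Cz; have le : K * (h / 2) <= K * h by rewrite -half lerDl.
  by split; [exact: reach_le le r1|exact: reach_le le r2].
have [r1 r2] := rC w Cw; have [_ /(_ z Dz)[r3 r4]] := HD w Cw.
by rewrite -half; split; [exact: reach_trans r1 r3|exact: reach_trans r4 r2].
Qed.

Lemma cvg_pow2 (C e : R) : 0 <= C -> 0 < e -> exists N, forall k, (N <= k)%N -> C / 2 ^+ k < e.
Proof.
move=> C0 e0; have := cvg_inv_nat C => /cvgrPdist_lt /(_ e e0) [N _ HN]; exists N => k Nk.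
have := HN k Nk; rewrite /= sub0r normrN => h; apply: le_lt_trans h; apply: le_trans (ler_norm _).
rewrite ler_wpM2l // lef_pV2 ?posrE ?exprn_gt0 //.
by rewrite -natrX ler_nat ltn_expl.
Qed.

(* If the construction failed at x at scale h, it would fail at a point at distance
   O(h) at scale h / 2; the resulting Cauchy sequence converges, but near its limit
   the construction succeeds at all small scales. *)
Lemma complete_good : metrically_complete g ->
  exists2 K : R, 0 < K & forall x (s : R), 0 < s -> good g K x s.
Proof.
move=> cg; have [K K0 HK] := local_bump g; exists K => // x h h0; apply: contrapT => bad.
have /choice[f Hf] (p : M * R) : exists y : M, 0 < p.2 -> ~ good g K p.1 p.2 ->
    [/\ ~ good g K y (p.2 / 2), reach g p.1 y (K * (p.2 / 2)) & reach g y p.1 (K * (p.2 / 2))].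
  case: p => z s /=; have [[y Hy]|no] := pselect (exists (y : M), [/\ ~ good g K y (s / 2),
      reach g z y (K * (s / 2)) & reach g y z (K * (s / 2))]); first by exists y.
  exists z => s0 nz; exfalso; apply: nz; apply: good_step => // y r1 r2.
  by apply: contrapT => ny; apply: no; exists y.
pose u := fix u n := if n is n'.+1 then f (u n', h / 2 ^+ n') else x.
have hn n : 0 < h / 2 ^+ n by rewrite divr_gt0 // exprn_gt0.
have hS n : h / 2 ^+ n / 2 = h / 2 ^+ n.+1 by rewrite exprSr invfM mulrA.
have ubad n : ~ good g K (u n) (h / 2 ^+ n).
  elim: n => [|n IH]; first by rewrite expr0 divr1.
  by have [] := Hf (u n, h / 2 ^+ n) (hn n) IH; rewrite /= hS.
have ustep n : reach g (u n) (u n.+1) (K * (h / 2 ^+ n.+1)) /\ reach g (u n.+1) (u n) (K * (h / 2 ^+ n.+1)).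
  by have [] := Hf (u n, h / 2 ^+ n) (hn n) (ubad n); rewrite /= hS.
have ureach n (j : nat) : reach g (u n) (u (n + j)%N) (K * (h / 2 ^+ n)) /\
    reach g (u (n + j)%N) (u n) (K * (h / 2 ^+ n)).
  (* Subtracting the remaining tail of the geometric series makes the induction on j close. *)
  suff [r1 r2] : reach g (u n) (u (n + j)%N) (K * (h / 2 ^+ n) - K * (h / 2 ^+ (n + j))) /\
      reach g (u (n + j)%N) (u n) (K * (h / 2 ^+ n) - K * (h / 2 ^+ (n + j))).
    have le : K * (h / 2 ^+ n) - K * (h / 2 ^+ (n + j)) <= K * (h / 2 ^+ n).
      by rewrite gerBl mulr_ge0 // ltW.
    by split; [exact: reach_le le r1|exact: reach_le le r2].
  elim: j => [|j [r1 r2]]; first by rewrite addn0 subrr; split; exact: reach_refl.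
  have [s1 s2] := ustep (n + j)%N; rewrite addnS.
  have E : K * (h / 2 ^+ n) - K * (h / 2 ^+ (n + j).+1) =
      (K * (h / 2 ^+ n) - K * (h / 2 ^+ (n + j))) + K * (h / 2 ^+ (n + j).+1).
    rewrite -(hS (n + j)%N); move: (h / 2 ^+ (n + j)) (K * (h / 2 ^+ n)) => a b; by field.
  rewrite E; split; first exact: reach_trans r1 s1.
  by rewrite addrC; exact: reach_trans s2 r2.
have [e e0|p Hp] := cg u.
  have [N HN] := cvg_pow2 (ltW (mulr_gt0 K0 h0)) e0; exists N.
  have key k l : (N <= k)%N -> (k <= l)%N -> riemannian_distance g (u k) (u l) < e /\
      riemannian_distance g (u l) (u k) < e.
    move=> Nk kl; have [[L1 h1 l1] [L2 h3 l2]] := ureach k (l - k)%N; rewrite subnKC // in h1 h3.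
    have lt : K * (h / 2 ^+ k) < e by rewrite mulrA; exact: HN.
    by split; [apply: le_lt_trans (distance_le h1) _|apply: le_lt_trans (distance_le h3) _];
      [exact: le_lt_trans l1 lt|exact: le_lt_trans l2 lt].
  move=> k l Nk Nl; have [kl|lk] := leqP k l; first by have [] := key k l Nk kl.
  by have [] := key l k Nl (ltnW lk).
have [s0 s00 ns0] := HK p setT (@filterT _ (nbhs p) _).
pose W := [set z | forall s, 0 < s -> s <= s0 -> good g K z s].
have nW : nbhs p W.
  move: ns0; apply: filterS => z Hz s s1 s2; have [psi [C [h1 h2]]] := Hz s s1 s2.
  by exists psi, C; split=> // w /h2[].
have [s1 s10 ns1] := HK p W nW.
(* This bump replaces a comparison of the distance with the topology: as its slope is at most 1, a
   point whose distance to p is below psi p / 2 cannot leave its support, hence lies in W. *)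
have [psi [C [[spsi lpsi _ psiC psip] CW]]] := nbhs_singleton ns1 s1 s10 (lexx _).
have p0 : 0 < psi p by exact: lt_trans psip.
have [N1 HN1] := Hp (psi p / 2) (divr_gt0 p0 (ltr0Sn _ 1)).
have [N2 HN2] := cvg_pow2 (ltW h0) s00.
pose n := maxn N1 N2.
have [L hL Ll] := distance_reach (HN1 n (leq_maxl _ _)).
have := curve_length_lipschitz spsi lpsi hL => hl.
have Cn : C (u n).
  apply: contrapT => /psiC E; move: hl; rewrite E subr0 (gtr0_norm p0) => hl.
  have := le_trans hl Ll; rewrite leNgt half_lt //.
have [Wn _ _] := CW _ Cn.
by apply: (ubad n); apply: Wn => //; apply/ltW/HN2; exact: leq_maxr.
Qed.

(** A function of slope at most one that exceeds b = h^(-1/2) on K is divided by b; heights b are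
    available at every point by [complete_good]. *)
Lemma complete_cutoff : metrically_complete g -> forall (K : set M) (h : R), compact K -> 0 < h ->
  exists phi C, [/\ smooth_fun phi, compact C, forall z, ~ C z -> phi z = 0,
    forall z, K z -> 1 <= phi z & forall z, sqgrad g phi z <= h].
Proof.
move=> cg K h cK h0; have [K1 K10 HK] := complete_good cg.
pose b : R := (Num.sqrt h)^-1; have sh : 0 < Num.sqrt h by rewrite sqrtr_gt0.
have b0 : 0 < b by rewrite invr_gt0.
have /choice[psi Hpsi] z : exists psi : M -> R, exists D : set M,
    [/\ smooth_fun psi, slope1 g psi, compact D, forall w, ~ D w -> psi w = 0 & b < psi z].
  by have [psi [D [HD _]]] := HK z b b0; exists psi, D.
have /choice[D HD] := Hpsi.
have [|P [E [sP lP cE PE [_ E2]]]] := @slope1_cover _ _ _ g K psi D b cK.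
  by move=> z _; exact: HD.
exists (fun z => b^-1 * P z), E; split.
- exact: (smooth_funM (smooth_fun_cst b^-1) sP).
- exact: cE.
- by move=> z /PE ->; rewrite mulr0.
- by move=> z /E2 h1; rewrite mulrC ler_pdivlMr // mul1r ltW.
move=> z; have l1 := slope1_sqgrad z lP.
rewrite (_ : sqgrad g (fun z => b^-1 * P z) z = h * sqgrad g P z); last first.
  rewrite /sqgrad /glue /vinner /gradm /gradf.
  set i := chart_at z; set y := coord_at z.
  have cy : cod i y by apply: codom_coord; exact: chart_atP.
  have oC := @open_cod _ _ _ i; have sP' : smooth (cod i) (P \o pa i) by move/smooth_funP: sP.
  have -> : drow ((fun z => b^-1 * P z) \o pa i) y = b^-1 *: drow (P \o pa i) y.
    apply/rowP => k; rewrite [RHS]mxE !mxE.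
    have := partialM k (smooth_cst oC b^-1) sP' cy.
    by rewrite partial_cst mulr0 addr0.
  rewrite -scalemxAl innerZl innerZr mulrA; congr (_ * _).
  by rewrite /b invrK -expr2 sqr_sqrtr // ltW.
by rewrite ler_piMr // ltW.
Qed.

End Cutoffs.

(** * Bochner formula and the energy estimate *)

Section PointwiseEstimates.
Context {R : realType} {m : nat} {M : manifold R m}.
Implicit Types (i j : chart M) (x : M) (f h : M -> R).
Local Notation dom := (@chart_dom R m M).
Local Notation cod := (@chart_codom R m M).
Local Notation co := (@chart_coord R m M).
Local Notation pa := (@chart_param R m M).
Variable g : metric M.

Lemma codom_at x : cod (chart_at x) (coord_at x).
Proof. by apply: codom_coord; exact: chart_atP. Qed.

Definition gdot f h : M -> R := glue (dpair f (gradm g h)).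

Lemma dpair_inner f X i y : cod i y -> dpair f X i y = inner (gmat g i y) (gradm g f i y) (X i y).
Proof.
by move=> cy; rewrite /dpair /inner /gradm /gradf mulmxKV //; exact: gmat_unit.
Qed.

Lemma gdot_diag f x : gdot f f x = sqgrad g f x.
Proof. by rewrite /gdot /glue (dpair_inner f (gradm g f) (codom_at x)). Qed.

Lemma dpair_cs f X x :
  glue (dpair f X) x ^+ 2 <= sqgrad g f x * glue (vinner g X X) x.
Proof.
rewrite /glue (dpair_inner f X (codom_at x)).
exact: (inner_cs _ _ (lm_posdef (metric_local g _) (codom_at x))).
Qed.

Lemma gdot_cs f h x : gdot f h x ^+ 2 <= sqgrad g f x * sqgrad g h x.
Proof. exact: dpair_cs. Qed.

Lemma drowM (U : set 'rV[R]_m) (a b : 'rV[R]_m -> R) y : smooth U a -> smooth U b -> U y ->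
  drow (fun z => a z * b z) y = a y *: drow b y + b y *: drow a y.
Proof.
move=> sa sb Uy; apply/rowP => k; rewrite [RHS]mxDE !mxE.
exact: (partialM k sa sb Uy).
Qed.

Lemma dpairM f h X x : smooth_fun f -> smooth_fun h ->
  glue (dpair (fun z => f z * h z) X) x = f x * glue (dpair h X) x + h x * glue (dpair f X) x.
Proof.
move=> /smooth_funP sf /smooth_funP sh; rewrite /glue /dpair.
have := drowM (sf (chart_at x)) (sh (chart_at x)) (codom_at x) => /= E.
have Ex : pa (chart_at x) (coord_at x) = x by apply: coordK; exact: chart_atP.
rewrite Ex in E.
rewrite (_ : _ \o _ = fun z => f (pa (chart_at x) z) * h (pa (chart_at x) z)); last by [].
by rewrite E lincomb_mulmx00.
Qed.

Lemma sqgrad_inner2 f x (a b : R) X Y :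
  gradm g f (chart_at x) (coord_at x) = a *: X + b *: Y ->
  let G := g_at g x in
  sqgrad g f x = a ^+ 2 * inner G X X + 2 * (a * b) * inner G X Y + b ^+ 2 * inner G Y Y.
Proof.
move=> E G; rewrite /sqgrad /glue /vinner E innerDl !innerDr !innerZl !innerZr.
rewrite -/(g_at g x) -/G (innerC Y X); last exact: (symG (metric_local g _) (codom_at x)).
by move: (inner G X X) (inner G X Y) (inner G Y Y) => p q r; ring.
Qed.

Lemma sqgradM f h x : smooth_fun f -> smooth_fun h -> sqgrad g (fun z => f z * h z) x =
  f x ^+ 2 * sqgrad g h x + 2 * (f x * h x) * gdot f h x + h x ^+ 2 * sqgrad g f x.
Proof.
move=> sf sh.
have Ex : pa (chart_at x) (coord_at x) = x by apply: coordK; exact: chart_atP.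
have := drowM ((smooth_funP f).1 sf (chart_at x)) ((smooth_funP h).1 sh (chart_at x)) (codom_at x).
rewrite /= Ex => E.
rewrite (sqgrad_inner2 (a := f x) (b := h x) (X := gradm g h (chart_at x) (coord_at x))
  (Y := gradm g f (chart_at x) (coord_at x))).
  rewrite /gdot /glue (dpair_inner f _ (codom_at x)).
  by rewrite (innerC (gradm g f _ _)) //; exact: (symG (metric_local g _) (codom_at x)).
by rewrite /gradm /gradf E mulmxDl -!scalemxAl.
Qed.

Lemma sqgrad_comp1 f (phi : R -> R) (d : R) x : smooth_fun f -> is_derive (f x) 1 phi d ->
  (sqgrad g (fun z => phi (f z)) x = d ^+ 2 * sqgrad g f x) *
  (forall h, gdot h (fun z => phi (f z)) x = d * gdot h f x).
Proof.
move=> /smooth_funP sf dp.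
have Ex : pa (chart_at x) (coord_at x) = x by apply: coordK; exact: chart_atP.
have E : gradm g (fun z => phi (f z)) (chart_at x) (coord_at x) = d *: gradm g f (chart_at x) (coord_at x).
  have := drow_comp1 (sf (chart_at x)) (@open_cod _ _ _ _) (codom_at x).
  by rewrite /= Ex => /(_ phi d dp); rewrite /gradm /gradf scalemxAl => <-.
split; first by rewrite /sqgrad /glue /vinner E innerZl innerZr mulrA -expr2.
by move=> h; rewrite /gdot /glue /dpair E linearZ /= -scalemxAr mxE.
Qed.

Variable vol : {measure set (borel M) -> \bar R}.
Hypothesis Hvol : riemannian_volume g vol.
Variable u : M -> R.
Hypothesis hu : harmonic_fun g u.

Let su : smooth_fun u. Proof. by have [] := hu. Qed.

(** Harmonicity is given at each point in the chart chosen there. Chart independence of the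
    divergence yields the equation throughout a fixed chart, as is needed to differentiate it. *)
Lemma chart_harmonic i y : cod i y -> \tr (nab (gmat g i) (gradm g u i) y) = 0.
Proof.
move=> cy; have [dy Ey] := codomP cy.
have := divm_compat Hvol (grad_vfield g su) dy (chart_atP (pa i y)).
rewrite Ey /divm => ->.
have := hu.2 (pa i y); rewrite /laplacian => <-.
have su' : smooth (cod (chart_at (pa i y))) (u \o pa (chart_at (pa i y))) by move/smooth_funP: su.
exact: (trace_nab_grad (metric_local g _) su' (codom_at (pa i y))).
Qed.

Local Notation F := (sqgrad g u).

Lemma sqgrad_param i y : cod i y -> F (pa i y) = sqnorm (gmat g i) (u \o pa i) y.
Proof.
move=> cy; have [dy Ey] := codomP cy.
have vg := grad_vfield g su.
by rewrite /sqgrad (glueE (vinner_compat g vg vg) dy) Ey.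
Qed.

Lemma sqgrad_sqgrad x : let G := g_at g x in
  let X := gradm g u (chart_at x) (coord_at x) in
  let A := nab (gmat g (chart_at x)) (gradm g u (chart_at x)) (coord_at x) in
  sqgrad g F x = 4 * inner G (X *m A) (X *m A).
Proof.
move=> G X A; have cx := codom_at x; have oC := @open_cod _ _ _ (chart_at x).
have su' : smooth (cod (chart_at x)) (u \o pa (chart_at x)) by move/smooth_funP: su.
have E : gradm g F (chart_at x) (coord_at x) = 2 *: (X *m A).
  rewrite /gradm /gradf.
  have -> : drow (F \o pa (chart_at x)) (coord_at x) =
      drow (sqnorm (gmat g (chart_at x)) (u \o pa (chart_at x))) (coord_at x).
    apply/rowP => k; rewrite !mxE; apply: (partial_eq_on oC) cx => y; exact: sqgrad_param.
  rewrite (drow_sqnorm (metric_local g _) su' cx) -scalemxAl mulmxK //; exact: gmat_unit.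
by rewrite /sqgrad /glue /vinner E innerZl innerZr mulrA -natrM.
Qed.

Lemma laplacian_sqgrad x : Div g (gradm g F) x =
  2 * (\tr (nab (gmat g (chart_at x)) (gradm g u (chart_at x)) (coord_at x) *m
       nab (gmat g (chart_at x)) (gradm g u (chart_at x)) (coord_at x)) +
     ric (gmat g (chart_at x)) (gradm g u (chart_at x) (coord_at x)) (coord_at x)).
Proof.
have cx := codom_at x; have oC := @open_cod _ _ _ (chart_at x).
have su' : smooth (cod (chart_at x)) (u \o pa (chart_at x)) by move/smooth_funP: su.
have LM := metric_local g (chart_at x).
rewrite /Div /glue /divm.
set i := chart_at x in cx oC su' LM *; set y := coord_at x in cx *.
have E z : cod i z -> gradm g F i z = 2 *: (gradm g u i z *m nab (gmat g i) (gradm g u i) z).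
  move=> cz; rewrite /gradm /gradf.
  have -> : drow (F \o pa i) z = drow (sqnorm (gmat g i) (u \o pa i)) z.
    by apply/rowP => k; rewrite !mxE; apply: (partial_eq_on oC) cz => w; exact: sqgrad_param.
  by rewrite (drow_sqnorm LM su' cz) -scalemxAl mulmxK //; exact: gmat_unit.
have sX := smooth_gradf LM su'; have sn := smooth_nab LM sX.
have sY : smooth_mx (cod i) (fun z => gradm g u i z *m nab (gmat g i) (gradm g u i) z).
  exact: (smooth_mulmx oC sX sn).
rewrite -(div_grad_sqnorm LM su' cx (@chart_harmonic i)) -linearZ /=; congr (\tr _).
apply/row_matrixP => k; rewrite linearZ /= !row_nab (cov_eq LM k E cx) /cov.
rewrite scalerDr -scalemxAl; congr (_ + _).
apply/rowP => l; rewrite [RHS]mxE !pmxE.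
rewrite (partial_eq_on oC (f := fun z => (2 *: (gradm g u i z *m nab (gmat g i) (gradm g u i) z)) 0 l)
  (g := fun z => 2 * (gradm g u i z *m nab (gmat g i) (gradm g u i) z) 0 l)) //; last by move=> z _; rewrite mxE.
rewrite (partialM k (smooth_cst oC 2) (sY 0 l) cx) partial_cst mulr0 addr0 //.
Qed.

End PointwiseEstimates.

(** * Kaehler case: pluriharmonicity defect and Bochner's formula *)

Section KahlerEstimates.
Context {R : realType} {n : nat} {M : manifold R (2 * n)}.
Local Notation m := (2 * n)%N.
Implicit Types (i j : chart M) (x : M) (f h : M -> R).
Local Notation dom := (@chart_dom R m M).
Local Notation cod := (@chart_codom R m M).
Local Notation co := (@chart_coord R m M).
Local Notation pa := (@chart_param R m M).
Variables (g : metric M) (J : kahler_structure g).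
Variable vol : {measure set (borel M) -> \bar R}.
Hypothesis Hvol : riemannian_volume g vol.
Variable u : M -> R.
Hypothesis hu : harmonic_fun g u.
Let su : smooth_fun u. Proof. by have [] := hu. Qed.
Local Notation F := (sqgrad g u).

Definition hess_at x : 'M[R]_m := nab (gmat g (chart_at x)) (gradm g u (chart_at x)) (coord_at x).

Lemma hess_at_sym x : hess_at x *m g_at g x = g_at g x *m (hess_at x)^T.
Proof.
have cx := codom_at x; have LM := metric_local g (chart_at x).
have su' : smooth (cod (chart_at x)) (u \o pa (chart_at x)) by move/smooth_funP: su.
have GT : (g_at g x)^T = g_at g x := symG LM cx.
rewrite -[in RHS]GT -trmx_mul /hess_at /g_at.
by rewrite (nab_grad_hess LM su') // (hess_sym LM su').
Qed.

Lemma plurim_div x : [/\ 0 <= Div g (plurim J u) x,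
  glue (vinner g (plurim J u) (plurim J u)) x <= Div g (plurim J u) x * F x &
  Div g (plurim J u) x = 0 -> J_at J x *m hess_at x = - (hess_at x *m J_at J x)].
Proof.
have cx := codom_at x; have LM := metric_local g (chart_at x).
have su' : smooth (cod (chart_at x)) (u \o pa (chart_at x)) by move/smooth_funP: su.
have [sJ JJ JG Jp] := kahler_local J (chart_at x).
have [P PGP] := orthonormal_frame (lm_posdef LM cx).
have GT : (g_at g x)^T = g_at g x := symG LM cx.
have JGs := JG_skew JJ JG cx.
have AG := hess_at_sym x.
have E : Div g (plurim J u) x = \tr (hess_at x *m hess_at x) -
    \tr (hess_at x *m J_at J x *m (hess_at x *m J_at J x)).
  exact: (div_plurifield LM su' sJ JJ JG Jp cx (chart_harmonic Hvol hu (i := chart_at x))).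
rewrite E; split.
- exact: (pluri_trace_ge0 GT PGP (JJ _ cx) JGs AG).
- exact: (pluri_field_le GT PGP (JJ _ cx) JGs AG).
- exact: (pluri_trace_eq0 GT PGP (JJ _ cx) JGs AG).
Qed.

(** The witness [t] is the square norm of the Hessian A. As |dF|^2 = 4 |X A|^2 with X = grad u, the
    refined Kato inequality reads |dF|^2 <= 2 t F. *)
Lemma bochner (mu : 'I_(n ^ 2) -> R) (kappa : R) x :
  kahler_curvature_eigenvalues J x mu ->
  (\sum_(a < n ^ 2 | (a < n)%N) mu a) / (n%:R + 1) >= kappa ->
  J_at J x *m hess_at x = - (hess_at x *m J_at J x) ->
  exists2 t : R, sqgrad g F x <= 2 * t * F x /\ 0 <= t &
    2 * t + 2 * ((n%:R + 1) * kappa) * F x <= Div g (gradm g F) x.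
Proof.
move=> [mono [T [E [[_ HT] EU Eo TE]]]] hk HA.
have cx := codom_at x; have LM := metric_local g (chart_at x).
have [sJ JJ JG Jp] := kahler_local J (chart_at x).
have [P PGP] := orthonormal_frame (lm_posdef LM cx).
have GT : (g_at g x)^T = g_at g x := symG LM cx.
have JGs := JG_skew JJ JG cx.
have AG := hess_at_sym x.
exists (\tr (hess_at x *m hess_at x)).
  split.
    rewrite (sqgrad_sqgrad hu); have := kato GT PGP (JJ _ cx) JGs AG (gradm g u (chart_at x) (coord_at x)) HA.
    rewrite -/(hess_at x) -[inner _ (gradm _ _ _ _) _]/(F x).
    move: (inner _ _ _) (\tr _) (F x) => p q r; lra.
  have fT := fr_sym P GT AG.
  rewrite -(tr_fr PGP) -(frM PGP) -[X in _ *m X]fT.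
  apply: sumr_ge0 => k _; rewrite mxE; apply: sumr_ge0 => l _.
  by rewrite [(fr _ _ _)^T _ _]mxE -expr2 sqr_ge0.
rewrite (laplacian_sqgrad Hvol hu) mulrDr lerD2l.
rewrite -mulrA ler_pM2l //.
have Eb a : bivector (E a) by have [] := EU a.
have EJ a : so_of_bivector (g_at g x) (E a) *m J_at J x = J_at J x *m so_of_bivector (g_at g x) (E a).
  by have [] := EU a.
have := ric_ge LM sJ JJ JG Jp (gradm g u (chart_at x) (coord_at x)) cx HT Eb EJ Eo TE mono.
apply: le_trans; apply: ler_wpM2r; first exact: sqgrad_ge0.
by rewrite mulrC -ler_pdivlMr // ltr_wpDl // ler0n.
Qed.

End KahlerEstimates.

(** * Integrals of continuous functions with compact support *)

Section CompactIntegrals.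
Context {R : realType} {m : nat} {M : manifold R m}.
Implicit Types (x : M) (f h : M -> R).
Variable g : metric M.
Variable vol : {measure set (borel M) -> \bar R}.
Hypothesis Hvol : riemannian_volume g vol.

Definition ccont f := continuous f /\ exists2 C, compact C & forall x, ~ C x -> f x = 0.

Lemma ccontD f h : ccont f -> ccont h -> ccont (fun x => f x + h x).
Proof.
move=> [cf [C cC fC]] [ch [D cD hD]]; split; first by move=> x; apply: cvgD; [exact: cf|exact: ch].
exists (C `|` D); first exact: compactU.
by move=> x /not_orP[/fC -> /hD ->]; rewrite addr0.
Qed.

Lemma ccontM f h : ccont f -> continuous h -> ccont (fun x => f x * h x).
Proof.
move=> [cf [C cC fC]] ch; split; first by move=> x; apply: cvgM; [exact: cf|exact: ch].
by exists C => // x /fC ->; rewrite mul0r.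
Qed.

Lemma ccontZ (a : R) f : ccont f -> ccont (fun x => a * f x).
Proof.
move=> [cf [C cC fC]]; split; first by move=> x; apply: cvgM; [exact: cvg_cst|exact: cf].
by exists C => // x /fC ->; rewrite mulr0.
Qed.

Lemma ccont_integrable f : ccont f -> vol.-integrable [set: borel M] (EFin \o (f : borel M -> R)).
Proof. by move=> [cf [C cC fC]]; exact: (integrable_compact Hvol cf cC fC). Qed.

Definition cint f : R := fine (\int[vol]_x (f x)%:E).

Lemma cintE f : ccont f -> (\int[vol]_x (f x)%:E = (cint f)%:E)%E.
Proof. by move=> /ccont_integrable If; rewrite /cint fineK //; exact: integrable_fin_num. Qed.

Lemma cint_le f h : ccont f -> ccont h -> (forall x, f x <= h x) -> cint f <= cint h.
Proof.
move=> cf ch fh; rewrite -lee_fin -!cintE //.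
apply: le_integral => //; try exact: ccont_integrable.
by move=> x _; rewrite lee_fin.
Qed.

Lemma cintD f h : ccont f -> ccont h -> cint (fun x => f x + h x) = cint f + cint h.
Proof.
move=> cf ch; apply: EFin_inj; rewrite EFinD -!cintE //; last exact: ccontD.
by rewrite -integralD //; exact: ccont_integrable.
Qed.

Lemma cintZ (a : R) f : ccont f -> cint (fun x => a * f x) = a * cint f.
Proof.
move=> cf; apply: EFin_inj; rewrite EFinM -!cintE //; last exact: ccontZ.
by rewrite -integralZl //; exact: ccont_integrable.
Qed.

Lemma cint_le_lower f F (h : R) : ccont f -> (forall x, 0 <= f x) -> 0 <= h -> (forall x, 0 <= F x) ->
  (forall x, f x <= h * F x) -> (\int[vol]_x (F x)%:E < +oo)%E ->
  cint f <= h * fine (\int[vol]_x (F x)%:E).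
Proof.
move=> cf f0 h0 F0 fF IF; have I0 : (0 <= \int[vol]_x (F x)%:E)%E by apply: integral_ge0 => x _; rewrite lee_fin.
rewrite -lee_fin EFinM -cintE // fineK ?ge0_fin_numE //.
rewrite -lower_integralZ //.
by apply: ge0_le_lower_integral => x; rewrite ?lee_fin // -EFinM lee_fin.
Qed.

(** Positivity at one point becomes a lower bound for integrals. K and r depend on f only, so the
    bound is uniform over the functions h, which will involve cutoffs chosen later; r is the volume
    of the interior of K. *)
Lemma positive_mass f x : continuous f -> 0 < f x -> exists K (r : R),
  [/\ compact K, 0 < r, forall z, K z -> f x / 2 <= f z &
    forall (h : M -> R) (c : R), (forall z, 0 <= h z) -> 0 <= c -> (forall z, K z -> c <= h z) ->
    ((c * r)%:E <= \int[vol]_z (h z)%:E)%E].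
Proof.
move=> cf fx; have [L [cL LU _] nL] := chart_compact_nbhs x.
pose Lx := chart_param (chart_at x) @` L.
have nf : \forall z \near x, f x / 2 < f z.
  have := cf x [set t | f x / 2 < t]; apply; apply: open_nbhs_nbhs; split; first exact: open_gt.
  exact: half_lt.
pose K := Lx `&` [set z | f x / 2 <= f z].
have cK : compact K.
  have clf : closed [set z | f x / 2 <= f z].
    by apply: (@closed_comp _ _ f [set t : R | f x / 2 <= t]); [move=> z _; exact: cf|exact: closed_ge].
  have clL : closed Lx by exact: closed_param.
  apply: (subclosed_compact (B := Lx)); [exact: closedI|exact: compact_param|by move=> z []].
have nK : nbhs x K by apply: filterS2 nL nf => z h1 h2; split=> //; exact: ltW.
pose V : set M := interior K; have oV : open V := @open_interior _ _.
have mV : measurable (V : set (borel M)) by exact: measurable_open_set.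
have V0 : (0 < vol V)%E by exact: (vol_open_gt0 Hvol oV nK).
have Vf : (vol V < +oo)%E.
  apply: le_lt_trans (vol_compact_lty Hvol cK); apply: le_measure; rewrite ?inE //.
    apply: measurable_closed_set; apply: compact_closed cK; exact: manifold_hausdorff.
  exact: interior_subset.
have Vn : vol V \is a fin_num by rewrite ge0_fin_numE // ltW.
exists K, (fine (vol V)); split=> //.
- by rewrite -lte_fin fineK.
- by move=> z [].
move=> h c h0 c0 hK; rewrite EFinM fineK //.
have <- : (\int[vol]_z (\1_V z)%:E = vol V)%E by rewrite integral_indic // setIT.
rewrite -lower_integralZ //.
apply: ge0_le_lower_integral => z; first by rewrite -EFinM lee_fin mulr_ge0 // indicE ler0n.
rewrite -EFinM lee_fin indicE; have [/set_mem Vz|_] := boolP (z \in V); last by rewrite mulr0.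
by rewrite mulr1; apply: hK; exact: interior_subset.
Qed.

Lemma cint_stokes X phi : vfield X -> smooth_fun phi -> (exists2 C, compact C & forall x, ~ C x -> phi x = 0) ->
  ccont (stokes g X phi) /\ cint (stokes g X phi) = 0.
Proof.
move=> vX sphi [C cC phiC].
split; last by rewrite /cint (integral_stokes Hvol vX sphi cC phiC).
split; first exact: (stokes_continuous Hvol vX sphi).
have clC : closed C by apply: compact_closed cC; exact: manifold_hausdorff.
by exists C => // x nC; exact: (stokes_support _ _ clC phiC nC).
Qed.

Lemma ccont_sqgrad phi : smooth_fun phi -> (exists2 C, compact C & forall x, ~ C x -> phi x = 0) ->
  ccont (sqgrad g phi).
Proof.
move=> sphi [C cC phiC]; split; first exact: (smooth_fun_continuous (sqgrad_smooth g sphi)).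
exists C => // x nC; rewrite -gdot_diag /gdot /glue /dpair (drow_out _ phiC) ?mul0mx ?mxE //.
- by apply: compact_closed cC; exact: manifold_hausdorff.
- exact: codom_at.
- by rewrite /coord_at coordK //; exact: chart_atP.
Qed.

End CompactIntegrals.

Lemma amgm {R : realFieldType} (x a b : R) : 0 <= a -> 0 <= b -> x ^+ 2 <= 4 * (a * b) -> x <= a + b.
Proof.
move=> a0 b0 h; apply: le_trans (ler_norm x) _.
rewrite -(ler_pXn2r (n := 2)) ?nnegrE ?addr_ge0 // real_normK ?num_real //.
apply: le_trans h _; rewrite -subr_ge0.
by rewrite (_ : _ - _ = (a - b) ^+ 2) ?sqr_ge0 //; ring.
Qed.

(** Meant for D the divergence of the field V = [plurim], d = d phi (V) and P = |d phi|^2. The cross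
    term in the divergence of phi^2 V is absorbed by half of phi^2 D, because |V|^2 <= D F. *)
Lemma pluri_amgm {R : realFieldType} (phi d D P F : R) : 0 <= D -> 0 <= P -> 0 <= F ->
  d ^+ 2 <= P * (D * F) ->
  2^-1 * (phi * phi * D) <= phi * phi * D + (phi * d + phi * d) + 2 * (P * F).
Proof.
move=> D0 P0 F0 h.
have : - (phi * d + phi * d) <= 2^-1 * (phi * phi * D) + 2 * (P * F).
  have h1 : 0 <= 2^-1 * (phi * phi * D) by rewrite -expr2 mulr_ge0 // mulr_ge0 // sqr_ge0.
  have h2 : 0 <= 2 * (P * F) by rewrite !mulr_ge0.
  apply: amgm => //.
  rewrite (_ : (- _) ^+ 2 = 4 * phi ^+ 2 * d ^+ 2); last by ring.
  rewrite (_ : 4 * (_ * _) = 4 * phi ^+ 2 * (P * (D * F))); last by field.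
  by apply: ler_wpM2l => //; rewrite mulr_ge0 // sqr_ge0.
move: (phi * d) (phi * phi * D) (P * F) => p q r; lra.
Qed.

(** * Harmonic functions of finite energy are pluriharmonic *)

Section Pluriharmonic.
Context {R : realType} {n : nat} {M : manifold R (2 * n)}.
Variables (g : metric M) (J : kahler_structure g).
Variable vol : {measure set (borel M) -> \bar R}.
Hypothesis Hvol : riemannian_volume g vol.
Hypothesis complete : metrically_complete g.
Variable u : M -> R.
Hypothesis hu : harmonic_fun g u.
Local Notation F := (sqgrad g u).
Hypothesis energy : (\int[vol]_x (F x)%:E < +oo)%E.
Let su : smooth_fun u. Proof. by have [] := hu. Qed.

Let F0 x : 0 <= F x. Proof. exact: sqgrad_ge0. Qed.

Local Notation D := (Div g (plurim J u)).

Lemma pluri_caccioppoli phi h : smooth_fun phi -> (exists2 C, compact C & forall x, ~ C x -> phi x = 0) ->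
  0 <= h -> (forall x, sqgrad g phi x <= h) ->
  ccont (fun x => phi x * phi x * D x) /\
  cint vol (fun x => phi x * phi x * D x) <= 4 * (h * fine (\int[vol]_x (F x)%:E)).
Proof.
move=> sphi [C cC phiC] h0 hphi.
have vV : vfield (plurim J u) := plurim_vfield J su.
have sD : smooth_fun D := Div_smooth Hvol vV.
have cD : continuous D := smooth_fun_continuous sD.
have s2 : smooth_fun (fun x => phi x * phi x) := smooth_funM sphi sphi.
have phi2C x : ~ C x -> phi x * phi x = 0 by move=> /phiC ->; rewrite mul0r.
have c2 : ccont (fun x => phi x * phi x).
  by split; [exact: (smooth_fun_continuous s2)|exists C].
have cA := ccontM c2 cD; split=> //.
have [cS IS] := cint_stokes Hvol vV s2 (ex_intro2 _ _ C cC phi2C).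
have cP := ccont_sqgrad g sphi (ex_intro2 _ _ C cC phiC).
have cPF := ccontM cP (smooth_fun_continuous (sqgrad_smooth g su)).
have le x : 2^-1 * (phi x * phi x * D x) <= stokes g (plurim J u) (fun x => phi x * phi x) x
    + 2 * (sqgrad g phi x * F x).
  have [D0 hV _] := plurim_div J Hvol hu x.
  rewrite /stokes (dpairM _ x sphi sphi).
  apply: pluri_amgm => //; first exact: sqgrad_ge0.
  apply: le_trans (dpair_cs g phi (plurim J u) x) _.
  by apply: ler_wpM2l => //; exact: sqgrad_ge0.
have := cint_le Hvol (ccontZ 2^-1 cA) (ccontD cS (ccontZ 2 cPF)) le.
rewrite (cintZ Hvol _ cA) (cintD Hvol cS (ccontZ 2 cPF)) IS (cintZ Hvol _ cPF) add0r.
have := @cint_le_lower _ _ _ _ _ Hvol _ F h cPF _ h0 F0 _ energy.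
move=> /(_ (fun x => mulr_ge0 (sqgrad_ge0 g phi x) (F0 x))).
move=> /(_ (fun x => ler_wpM2r (F0 x) (hphi x))).
move: (cint _ _) (cint _ _) (h * _) => p q r; lra.
Qed.

Lemma plurim_div_eq0 x : D x = 0.
Proof.
have [D0 _ _] := plurim_div J Hvol hu x.
apply/eqP/negPn/negP => nz; have {nz}{}D0 : 0 < D x by rewrite lt_def nz.
have vV : vfield (plurim J u) := plurim_vfield J su.
have cD : continuous D := smooth_fun_continuous (Div_smooth Hvol vV).
have [K [r [cK r0 DK Hr]]] := positive_mass Hvol cD D0.
set E := fine (\int[vol]_x (F x)%:E).
have E0 : 0 <= E by apply: fine_ge0; apply: integral_ge0 => z _; rewrite lee_fin.
(* With c = D x / 2 * r the lower bound for the integral of phi^2 D, the upper bound 4 h E equals c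
   / 2 times E / (E + 1), which is below c; the 1 is added because E may vanish. *)
pose h := D x / 2 * r / (8 * (E + 1)).
have h0 : 0 < h by rewrite !(divr_gt0, mulr_gt0) // ltr_wpDl.
have [phi [C [sphi cC phiC phiK hphi]]] := complete_cutoff complete cK h0.
have [cA] := pluri_caccioppoli sphi (ex_intro2 _ _ C cC phiC) (ltW h0) hphi.
rewrite -/E; have := Hr (fun z => phi z * phi z * D z) (D x / 2).
move=> /(_ _ (ltW (divr_gt0 D0 (ltr0Sn _ 1))) _) H.
have {H} : ((D x / 2 * r)%:E <= (cint vol (fun z => phi z * phi z * D z))%:E)%E.
  rewrite -(cintE Hvol cA); apply: H => z.
    have [Dz _ _] := plurim_div J Hvol hu z; rewrite -expr2.
    exact: (mulr_ge0 (sqr_ge0 _) Dz).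
  move=> Kz; apply: le_trans (DK z Kz) _; have [Dz _ _] := plurim_div J Hvol hu z.
  rewrite (ler_peMl Dz) //.
  by rewrite -expr2 exprn_ege1 // phiK.
rewrite lee_fin => /le_trans h1 /h1; rewrite leNgt => /negP; apply.
rewrite /h; have : 0 < D x / 2 * r by rewrite mulr_gt0 // divr_gt0.
move: (D x / 2 * r) => c c0.
have -> : 4 * (c / (8 * (E + 1)) * E) = c * (2^-1 * (E / (E + 1))).
  by field; move: E0; lra.
rewrite gtr_pMr //.
have : E / (E + 1) < 1 by rewrite ltr_pdivrMr ?mul1r ?ltrDl // ltr_wpDl.
have : 0 <= E / (E + 1) by rewrite divr_ge0 // addr_ge0.
move: (E / _) => e; lra.
Qed.

End Pluriharmonic.

(** * The curvature term: Hoelder and Sobolev inequalities *)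

Section HoelderSobolev.
Context {R : realType} {m : nat} {M : manifold R m}.
Variable g : metric M.
Variable vol : {measure set (borel M) -> \bar R}.
Hypothesis Hvol : riemannian_volume g vol.

Lemma le_lower_Lnorm (f h : M -> R) (p r : R) : 0 < p -> r = p^-1 -> (forall x, `|f x| <= h x) ->
  ('N[vol]_p%:E[EFin \o (f : borel M -> R)] <= (\int[vol]_x (h x `^ p)%:E) `^ r)%E.
Proof.
move=> p0 -> fh; rewrite unlock.
have I0 k : (0 <= \int[vol]_x ((k : borel M -> R) x `^ p)%:E)%E.
  by apply: integral_ge0 => x _; rewrite lee_fin powR_ge0.
have r0 : 0 <= p^-1 by rewrite invr_ge0 ltW.
apply: (gt0_ler_poweR r0); rewrite ?in_itv/= ?leey ?andbT.
- by apply: integral_ge0 => x _; rewrite lee_fin powR_ge0.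
- exact: I0.
apply: ge0_le_lower_integral => x /=; first by rewrite lee_fin powR_ge0.
rewrite lee_fin; apply: (ge0_ler_powR (ltW p0)); rewrite ?nnegrE //.
exact: le_trans (fh x).
Qed.

(** The exponents nu / 2 and nu / (nu - 2) are conjugate, and the second one applied to psi^2 gives
    the integrand of the Sobolev inequality. Hoelder's inequality is used for the continuous [k0];
    [kappa] enters only by monotonicity of the integral. *)
Lemma hoelder_sobolev (nu C k : R) (kappa k0 psi : M -> R) : 2 < nu -> 0 < C ->
  sobolev_inequality g vol nu C ->
  ((\int[vol]_x (`|kappa x| `^ (nu / 2))%:E) `^ (2 / nu) <= k%:E)%E ->
  continuous k0 -> (forall x, 0 <= k0 x <= `|kappa x|) ->
  smooth_fun psi -> (exists2 C, compact C & forall x, ~ C x -> psi x = 0) ->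
  cint vol (fun x => psi x * psi x * k0 x) <= k * (C * cint vol (sqgrad g psi)).
Proof.
move=> nu2 C0 sob hk ck0 k0k spsi [D cD psiD].
have nu0 : 0 < nu by move: nu2; lra.
have cpsi := smooth_fun_continuous spsi.
have cp2 : ccont (fun x => psi x * psi x).
  split; first by move=> x; apply: cvgM; exact: cpsi.
  by exists D => // x /psiD ->; rewrite mul0r.
pose p := nu / 2; pose q := nu / (nu - 2).
have p0 : 0 < p by rewrite divr_gt0.
have q0 : 0 < q by rewrite divr_gt0 // subr_gt0.
have pq : p^-1 + q^-1 = 1 by rewrite /p /q !invf_div; field; move: nu0; lra.
have mk0 : measurable_fun [set: borel M] (k0 : borel M -> R) := measurable_continuous ck0.
have mp2 : measurable_fun [set: borel M] ((fun x => psi x * psi x) : borel M -> R) := measurable_continuous cp2.1.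
have := hoelder vol mp2 mk0 q0 p0 _; rewrite addrC => /(_ pq).
rewrite Lnorm1.
have N1 : (\int[vol]_x `|(EFin \o ((fun x : borel M => psi x * psi x) \* k0)%R) x| =
    (cint vol (fun x => psi x * psi x * k0 x))%:E)%E.
  rewrite -(cintE Hvol (ccontM cp2 ck0)); apply: eq_integral => x _.
  have /andP[k1 _] := k0k x; rewrite /= ger0_norm //.
  by rewrite -expr2; exact: (mulr_ge0 (sqr_ge0 _) k1).
rewrite N1 => {N1} H.
rewrite -lee_fin; apply: le_trans H _; rewrite mulrC [X in (_ <= X)%E]EFinM.
apply: lee_pmul; [exact: Lnorm_ge0|exact: Lnorm_ge0| |]; last first.
  apply: le_trans hk; apply: (le_lower_Lnorm p0); first by rewrite /p invf_div.
  by move=> x; have /andP[k1 k2] := k0k x; rewrite ger0_norm.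
have := sob psi spsi (compact_supportP cD psiD).
have -> : (\int[vol]_x (grad_norm g psi x ^+ 2)%:E = (cint vol (sqgrad g psi))%:E)%E.
  rewrite -(cintE Hvol (ccont_sqgrad g spsi (ex_intro2 _ _ D cD psiD))).
  by apply: eq_integral => x _; rewrite grad_norm_sqr.
apply: le_trans.
have -> : (fun x : borel M => (`|psi x| `^ (2 * nu / (nu - 2)))%:E) = (fun x : borel M => ((psi x * psi x) `^ q)%:E).
  apply/funext => x; by rewrite -mulrA powRrM powR_mulrn ?normr_ge0 // real_normK ?num_real //.
apply: (le_lower_Lnorm q0); first by rewrite /q invf_div.
by move=> x; rewrite ger0_norm // -expr2 sqr_ge0.
Qed.

End HoelderSobolev.

Lemma two_fourths_lt {R : realFieldType} (q : R) : 0 < q -> q / 4 + q / 4 < q.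
Proof. by lra. Qed.

(** Here v2 = v^2 = F + e, W = |dF|^2, P = |d phi|^2, L is the Laplacian of F and X the product of d
    phi and dF, so that a = |dv|^2 and phi^2 a + phi X + v2 P = |d (phi v)|^2. The positive part q
    of 2 a - L / 2 measures how far curvature spoils the Bochner inequality. The term L and one X
    combine into the divergence of phi^2 grad F, and the second copy of |d (phi v)|^2, divided by 1
    + d, is paid by the extra a of the refined Kato inequality. *)
Lemma bochner_amgm {R : realFieldType} (phi v2 W P L t F X N kap d q : R) :
  0 < v2 -> 0 <= F <= v2 -> 0 <= P -> 0 <= W -> W <= 2 * t * F -> 0 <= t -> 0 <= N -> kap <= 0 ->
  2 * t + 2 * (N * kap) * F <= L -> X ^+ 2 <= P * W -> 0 < d ->
  let a := W / (4 * v2) in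
  q = (2 * a - L / 2 + `|2 * a - L / 2|) / 2 ->
  q <= N * `|kap| * F /\
  (phi * phi * a + phi * X + v2 * P) * (1 + (1 + d)^-1) <=
    (1 + d^-1) * (v2 * P) + 2^-1 * (phi * phi * L + (phi * X + phi * X)) + phi * phi * q.
Proof.
move=> v0 /andP[F0 Fv] P0 W0 Wt t0 N0 k0 hL hX d0 a Eq.
have a2t : 2 * a <= t.
  have vn : v2 != 0 by rewrite gt_eqF.
  rewrite (_ : 2 * a = W / (2 * v2)); last by rewrite /a; field.
  rewrite ler_pdivrMr ?mulr_gt0 //; apply: le_trans Wt _.
  rewrite mulrA (mulrC t 2); apply: ler_wpM2l => //; exact: mulr_ge0.
have a0 : 0 <= a by rewrite divr_ge0 // mulr_ge0 // ltW.
have q1 : 2 * a - L / 2 <= N * `|kap| * F.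
  rewrite ler0_norm // mulrN mulNr; move: hL a2t; rewrite -mulrA.
  move: (N * kap * F) => z; lra.
have q2 : 2 * a - L / 2 <= q.
  by rewrite Eq ler_pdivlMr // mulr_natr mulr2n lerD2l ler_norm.
split.
  have Z0 : 0 <= N * `|kap| * F by rewrite !mulr_ge0.
  rewrite Eq; move: q1 Z0; move: (2 * a - L / 2) (N * _ * F) => y z yz z0.
  have : `|y| <= z \/ `|y| = - y by have [y0|y0] := leP 0 y; [left; rewrite ger0_norm|right; rewrite ltr0_norm].
  by move=> [h|->]; [move: h|]; lra.
(* Young's inequality with parameter d: X^2 <= P W and W = 4 v2 a. *)
have key : phi * X <= d^-1 * (v2 * P) + d * (phi * phi * a).
  have p0 : 0 <= phi * phi by rewrite -expr2 sqr_ge0.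
  apply: amgm; [|exact: (mulr_ge0 (ltW d0) (mulr_ge0 p0 a0))|].
    by rewrite !mulr_ge0 ?invr_ge0 ?(ltW d0) ?(ltW v0).
  rewrite exprMn; have vn : v2 != 0 by rewrite gt_eqF.
  have dn : d != 0 by rewrite gt_eqF.
  rewrite (_ : 4 * _ = phi ^+ 2 * (P * W)); last by rewrite /a; field; rewrite vn dn.
  by apply: ler_wpM2l => //; exact: sqr_ge0.
have h1 : phi * phi * (2 * a - L / 2) <= phi * phi * q.
  by apply: ler_wpM2l => //; rewrite -expr2 sqr_ge0.
have h2 : (phi * phi * a + phi * X + v2 * P) * (1 + d)^-1 <= d^-1 * (v2 * P) + phi * phi * a.
  rewrite ler_pdivrMr; last by move: d0; lra.
  have -> : (d^-1 * (v2 * P) + phi * phi * a) * (1 + d) =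
      (d^-1 * (v2 * P) + d * (phi * phi * a)) + (v2 * P + phi * phi * a).
    by field; rewrite gt_eqF.
  by move: key; move: (phi * X) (v2 * P) (phi * phi * a) (d^-1 * _) (d * _) => x y z w s; lra.
rewrite (_ : phi * phi * (2 * a - L / 2) = 2 * (phi * phi * a) - 2^-1 * (phi * phi * L)) in h1; last by ring.
move: h1 h2; rewrite mulrDr mulr1 [(1 + d^-1) * _]mulrDl mul1r.
move: (phi * phi * L) (phi * phi * q) (phi * phi * a) (phi * X) (v2 * P) (d^-1 * _) (_ / (1 + d)).
move=> y1 y2 y3 y4 y5 y6 y7; lra.
Qed.

(** * The energy estimate and the vanishing of the gradient *)

Section EnergyEstimate.
Context {R : realType} {n : nat} {M : manifold R (2 * n)}.
Variables (g : metric M) (J : kahler_structure g).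
Variable vol : {measure set (borel M) -> \bar R}.
Hypothesis Hvol : riemannian_volume g vol.
Hypothesis complete : metrically_complete g.
Variables (u : M -> R) (mu : M -> 'I_(n ^ 2) -> R) (kappa : M -> R) (nu C k : R).
Hypothesis hu : harmonic_fun g u.
Local Notation F := (sqgrad g u).
Hypothesis energy : (\int[vol]_x (F x)%:E < +oo)%E.
Hypothesis nu2 : 2 < nu.
Hypothesis C0 : 0 < C.
Hypothesis sob : sobolev_inequality g vol nu C.
Hypothesis Hmu : forall x, kahler_curvature_eigenvalues J x (mu x).
Hypothesis kappa0 : forall x, kappa x <= 0.
Hypothesis mu_ge : forall x, (\sum_(a < n ^ 2 | (a < n)%N) mu x a) / (n%:R + 1) >= kappa x.
Hypothesis kappa_norm : ((\int[vol]_x (`|kappa x| `^ (nu / 2))%:E) `^ (2 / nu) <= k%:E)%E.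
Let su : smooth_fun u. Proof. by have [] := hu. Qed.
Let F0 x : 0 <= F x. Proof. exact: sqgrad_ge0. Qed.
Let sF : smooth_fun F. Proof. exact: sqgrad_smooth. Qed.
Local Notation E := (fine (\int[vol]_x (F x)%:E)).
Local Notation N := (n%:R + 1 : R).

Definition rgrad (e : R) x := Num.sqrt (F x + e).

Lemma rgrad_smooth e : 0 < e -> smooth_fun (rgrad e).
Proof.
move=> e0; apply/smooth_funP => i; have oC := @open_cod _ _ _ i.
have sFi : smooth (chart_codom i) (F \o chart_param i) by move: i {oC}; exact/smooth_funP.
apply: (smooth_sqrt oC (f := fun y => F (chart_param i y) + e)).
  by move=> y _; exact: ltr_wpDl.
exact: (smoothD oC sFi (smooth_cst oC e)).
Qed.

Lemma rgrad_sqgrad e x : 0 < e ->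
  (sqgrad g (rgrad e) x = sqgrad g F x / (4 * (F x + e))) *
  (forall h, 2 * rgrad e x * gdot g h (rgrad e) x = gdot g h F x).
Proof.
move=> e0; have p0 : 0 < F x + e by exact: ltr_wpDl.
have d : is_derive (F x) 1 (fun t : R => Num.sqrt (t + e)) (2 * Num.sqrt (F x + e))^-1.
  have dl : is_derive (F x) 1 (fun t : R => t + e) 1.
    have := is_deriveD (is_derive_id (F x) (1 : R)) (is_derive_cst e (F x) (1 : R)).
    by rewrite addr0.
  by have := is_derive_comp_real dl (is_derive1_sqrt p0); rewrite mulr1.
have [E1 E2] := sqgrad_comp1 g sF d.
have s0 : Num.sqrt (F x + e) != 0 by rewrite gt_eqF // sqrtr_gt0.
split.
  rewrite /rgrad E1 exprVn exprMn sqr_sqrtr ?(ltW p0) // mulrC; congr (_ / (_ * _)).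
  by rewrite expr2 -natrM.
by move=> h; rewrite /rgrad E2 mulrA divff ?mul1r // mulf_neq0.
Qed.

Lemma energy_estimate (phi : M -> R) (h e d : R) : smooth_fun phi ->
  (exists2 C, compact C & forall x, ~ C x -> phi x = 0) -> 0 <= h -> (forall x, sqgrad g phi x <= h) ->
  0 < e -> 0 < d ->
  cint vol (sqgrad g (fun x => phi x * rgrad e x)) * (1 + (1 + d)^-1 - N * (k * C)) <=
  (1 + d^-1) * (h * E + e * cint vol (sqgrad g phi)).
Proof.
move=> sphi [D cD phiD] h0 hphi e0 d0.
pose psi x := phi x * rgrad e x.
have sv := rgrad_smooth e0.
have spsi : smooth_fun psi := smooth_funM sphi sv.
have psiD : exists2 C, compact C & forall x, ~ C x -> psi x = 0.
  by exists D => // x /phiD p0; rewrite /psi p0 mul0r.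
have cT := ccont_sqgrad g spsi psiD.
have vF := grad_vfield g sF.
have sL : smooth_fun (Div g (gradm g F)) := Div_smooth Hvol vF.
have cF := smooth_fun_continuous sF.
have cL := smooth_fun_continuous sL.
have cW := smooth_fun_continuous (sqgrad_smooth g sF).
have Fe x : 0 < F x + e by exact: ltr_wpDl.
have cFe : continuous (fun x => F x + e).
  by move=> x; apply: cvgD; [exact: cF|exact: cvg_cst].
pose y x := 2 * (sqgrad g F x / (4 * (F x + e))) - Div g (gradm g F) x / 2.
pose q x := (y x + `|y x|) / 2.
have cy : continuous y.
  move=> x; apply: cvgB; last by apply: cvgM; [exact: cL|exact: cvg_cst].
  apply: cvgM; first exact: cvg_cst.
  apply: cvgM; first exact: cW.
  by apply: cvgV; [rewrite gt_eqF // mulr_gt0|apply: cvgM; [exact: cvg_cst|exact: cFe]].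
have cq : continuous q.
  move=> x; apply: cvgM; last exact: cvg_cst.
  by apply: cvgD; [exact: cy|apply: cvg_norm; exact: cy].
(* The continuous substitute for |kappa|: it lies between 0 and |kappa| by the bound on q, and phi^2
   q is exactly N psi^2 k0. *)
pose k0 x := q x / (N * (F x + e)).
have N0 : 0 < N by rewrite ltr_wpDl.
have ck0 : continuous k0.
  move=> x; apply: cvgM; first exact: cq.
  by apply: cvgV; [rewrite gt_eqF // mulr_gt0|apply: cvgM; [exact: cvg_cst|exact: cFe]].
pose S := stokes g (gradm g F) (fun x => phi x * phi x).
have s2 : smooth_fun (fun x => phi x * phi x) := smooth_funM sphi sphi.
have phi2D : exists2 C, compact C & forall x, ~ C x -> phi x * phi x = 0.
  by exists D => // x /phiD ->; rewrite mul0r.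
have [cS IS] := cint_stokes Hvol vF s2 phi2D.
have point x : q x <= N * `|kappa x| * F x /\
   sqgrad g psi x * (1 + (1 + d)^-1) <=
   (1 + d^-1) * (sqgrad g phi x * (F x + e)) + (2^-1 * S x + phi x * phi x * q x).
  have HA := (plurim_div J Hvol hu x).
  have {}HA : J_at J x *m hess_at g u x = - (hess_at g u x *m J_at J x).
    by have [_ _] := HA; apply; exact: (plurim_div_eq0 J Hvol complete hu energy x).
  have [t [Wt t0] hL] := bochner Hvol hu (Hmu x) (mu_ge x) HA.
  have [E1 E2] := rgrad_sqgrad x e0.
  have [] := @bochner_amgm R (phi x) (F x + e) (sqgrad g F x) (sqgrad g phi x) (Div g (gradm g F) x) t (F x)
     (gdot g phi F x) N (kappa x) d (q x) (Fe x) _ (sqgrad_ge0 g phi x) (sqgrad_ge0 g F x) Wt t0 (ltW N0)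
     (kappa0 x) hL (gdot_cs g phi F x) d0 erefl.
    by rewrite F0 lerDl ltW.
  move=> h1 h2; split=> //.
  move: h2; rewrite /psi (sqgradM g x sphi sv) E1 /S /stokes (dpairM _ x sphi sphi) -/(gdot g phi F x).
  have Ev : rgrad e x ^+ 2 = F x + e by rewrite sqr_sqrtr // ltW.
  rewrite Ev -(E2 phi) [phi x ^+ 2]expr2.
  rewrite (_ : 2 * (phi x * rgrad e x) * gdot g phi (rgrad e) x =
    phi x * (2 * rgrad e x * gdot g phi (rgrad e) x)); last by ring.
  by move=> h2; apply: le_trans h2 _; rewrite -addrA [_ * sqgrad g phi x]mulrC lexx.
have cP := ccont_sqgrad g sphi (ex_intro2 _ _ D cD phiD).
have cPF := ccontM cP cF.
have cPFe := ccontM cP cFe.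
have cpk : ccont (fun x => psi x * psi x * k0 x).
  apply: ccontM ck0; split; last by case: psiD => B cB psiB; exists B => // x /psiB ->; rewrite mul0r.
  exact: (smooth_fun_continuous (smooth_funM spsi spsi)).
have hk : cint vol (fun x => psi x * psi x * k0 x) <= k * (C * cint vol (sqgrad g psi)).
  apply: (hoelder_sobolev Hvol nu2 C0 sob kappa_norm ck0 _ spsi psiD) => x.
  have q0 : 0 <= q x.
    rewrite /q divr_ge0 //; have := ler_norm (- y x); rewrite normrN.
    by rewrite lerNl -subr_ge0 opprK addrC.
  apply/andP; split; first by rewrite divr_ge0 // mulr_ge0 // ltW.
  have [h1 _] := point x; rewrite ler_pdivrMr ?mulr_gt0 //; apply: le_trans h1 _.
  rewrite -mulrA mulrCA; apply: ler_wpM2l => //; apply: ler_wpM2l; first exact: ltW.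
  by rewrite lerDl ltW.
have le x : (1 + (1 + d)^-1) * sqgrad g psi x <= (1 + d^-1) * (sqgrad g phi x * (F x + e)) +
    (2^-1 * S x + N * (psi x * psi x * k0 x)).
  have [_ h2] := point x; rewrite mulrC; apply: le_trans h2 _; rewrite !lerD2l.
  rewrite /k0 /psi le_eqVlt; apply/orP; left; apply/eqP.
  have Ev : rgrad e x * rgrad e x = F x + e by rewrite -expr2 sqr_sqrtr // ltW.
  rewrite [X in N * (X * _)]mulrACA Ev; have := Fe x; have := N0.
  move: (F x + e) N (phi x) (q x) => a b c r b0 a0; field.
  by rewrite !gt_eqF.
have cR := ccontD (ccontZ 2^-1 cS) (ccontZ N cpk).
have := cint_le Hvol (ccontZ (1 + (1 + d)^-1) cT) (ccontD (ccontZ (1 + d^-1) cPFe) cR) le.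
rewrite (cintZ Hvol _ cT) (cintD Hvol (ccontZ _ cPFe) cR) (cintZ Hvol _ cPFe).
rewrite (cintD Hvol (ccontZ _ cS) (ccontZ _ cpk)) (cintZ Hvol _ cS) (cintZ Hvol _ cpk) IS mulr0 add0r.
have -> : cint vol (fun x => sqgrad g phi x * (F x + e)) =
    cint vol (fun x => sqgrad g phi x * F x) + e * cint vol (sqgrad g phi).
  rewrite -(cintZ Hvol _ cP) -(cintD Hvol cPF (ccontZ e cP)); congr (cint vol _).
  by apply/funext => x; rewrite mulrDr [_ * e]mulrC.
have := @cint_le_lower _ _ _ _ _ Hvol _ F h cPF _ h0 F0 _ energy.
move=> /(_ (fun x => mulr_ge0 (sqgrad_ge0 g phi x) (F0 x))).
move=> /(_ (fun x => ler_wpM2r (F0 x) (hphi x))) h3 h4.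
have d1 : 0 <= 1 + d^-1 by rewrite addr_ge0 // invr_ge0 ltW.
have h5 := ler_wpM2l d1 (lerD h3 (lexx (e * cint vol (sqgrad g phi)))).
have h6 := ler_wpM2l (ltW N0) hk.
rewrite mulrC mulrBl lerBlDr; apply: le_trans h4 _; apply: lerD; first exact: h5.
by rewrite -(mulrA N) -(mulrA k); exact: h6.
Qed.

Lemma sqgrad_eq0 : N * (k * C) < 2 -> forall x, F x = 0.
Proof.
move=> th x0; apply/eqP/negPn/negP => nz; have {nz} Fx : 0 < F x0 by rewrite lt_def nz F0.
have [K [r [cK r0 FK Hr]]] := positive_mass Hvol (smooth_fun_continuous sF) Fx.
have E0 : 0 <= E by apply: fine_ge0; apply: integral_ge0 => z _; rewrite lee_fin.
have nu0 : 0 < nu by move: nu2; lra.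
have nup : 0 < nu - 2 by rewrite subr_gt0.
(* As (1 + d)^-1 >= 1 - d and N k C = 2 - 2 d, the coefficient [eps] is at least d. *)
pose d := (2 - N * (k * C)) / 2; have d0 : 0 < d by rewrite divr_gt0 // subr_gt0.
pose eps := 1 + (1 + d)^-1 - N * (k * C).
have eps0 : 0 < eps.
  have h1 : 1 - d <= (1 + d)^-1.
    rewrite -[leRHS]mul1r ler_pdivlMr; last by rewrite addr_gt0.
    by rewrite -subr_sqr expr1n gerBl sqr_ge0.
  have Ed : N * (k * C) = 2 - 2 * d by rewrite /d [2 * (_ / 2)]mulrC divfK // subKr.
  rewrite /eps Ed; move: (1 + d)^-1 h1 => s; move: d d0 {Ed eps} => t; lra.
pose p := 2 * nu / (nu - 2).
have p0 : 0 <= p by rewrite divr_ge0 ?mulr_ge0 // ltW.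
(* A lower bound for |phi v|^p on K, for every cutoff phi >= 1 on K and every e > 0. By the Sobolev
   inequality b <= C int |d (phi v)|^2, with b independent of phi and e. *)
pose c := Num.sqrt (F x0 / 2) `^ p.
have c0 : 0 < c by rewrite powR_gt0 // sqrtr_gt0 divr_gt0.
pose b := (c * r) `^ ((nu - 2) / nu).
have b0 : 0 < b by rewrite powR_gt0 // mulr_gt0.
have D0 : 0 < C * (1 + d^-1) by rewrite mulr_gt0 // addr_gt0 // invr_gt0.
(* The energy estimate forces q <= h E + e P, where P is the integral of |d phi|^2; h and e are
   chosen to make each term at most q / 4. *)
pose q := b * eps / (C * (1 + d^-1)).
have q0 : 0 < q by rewrite divr_gt0 // mulr_gt0.
pose h := q / (4 * (E + 1)).
have h0 : 0 < h by rewrite divr_gt0 // mulr_gt0 // ltr_wpDl.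
have [phi [D [sphi cD phiD phiK hphi]]] := complete_cutoff complete cK h0.
pose P := cint vol (sqgrad g phi).
have P0 : 0 <= P by apply: fine_ge0; apply: integral_ge0 => z _; rewrite lee_fin; exact: sqgrad_ge0.
(* P depends on phi, hence on h, so e can only be fixed now. *)
pose e := q / (4 * (P + 1)).
have e0 : 0 < e by rewrite divr_gt0 // mulr_gt0 // ltr_wpDl.
have phiD' : exists2 C, compact C & forall x, ~ C x -> phi x = 0 by exists D.
have est := energy_estimate sphi phiD' (ltW h0) hphi e0 d0.
have spsi : smooth_fun (fun x => phi x * rgrad e x) := smooth_funM sphi (rgrad_smooth e0).
have psiD x : ~ D x -> phi x * rgrad e x = 0 by move=> /phiD ->; rewrite mul0r.
have cT := ccont_sqgrad g spsi (ex_intro2 _ _ D cD psiD).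
pose T := cint vol (sqgrad g (fun x => phi x * rgrad e x)).
have bT : b <= C * T.
  have := sob spsi (compact_supportP cD psiD).
  have -> : (\int[vol]_x (grad_norm g (fun x => phi x * rgrad e x) x ^+ 2)%:E = T%:E)%E.
    by rewrite -(cintE Hvol cT); apply: eq_integral => x _; rewrite grad_norm_sqr.
  rewrite -EFinM -lee_fin; apply: le_trans; rewrite -poweR_EFin.
  have lb : ((c * r)%:E <= \int[vol]_x (`|phi x * rgrad e x| `^ (2 * nu / (nu - 2)))%:E)%E.
    apply: (Hr (fun x => `|phi x * rgrad e x| `^ p) c); [by move=> z; exact: powR_ge0|exact: ltW|].
    move=> z Kz; apply: (ge0_ler_powR p0); rewrite ?nnegrE ?sqrtr_ge0 ?normr_ge0 //.
    have v0 : 0 <= rgrad e z by exact: sqrtr_ge0.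
    have f1 := phiK z Kz.
    rewrite ger0_norm; last by rewrite mulr_ge0 // (le_trans ler01 f1).
    apply: (@le_trans _ _ (rgrad e z)); last by rewrite ler_peMl.
    rewrite /rgrad ler_wsqrtr //; apply: le_trans (FK z Kz) _.
    by rewrite lerDl ltW.
  apply: gt0_ler_poweR; rewrite ?in_itv/= ?leey ?andbT //.
  - by rewrite divr_ge0 // ltW.
  - by rewrite lee_fin mulr_ge0 // ltW.
  - by apply: le_trans lb; rewrite lee_fin mulr_ge0 // ltW.
have qle : q <= h * E + e * P.
  rewrite /q ler_pdivrMr //; apply: (@le_trans _ _ (C * T * eps)).
    by rewrite ler_pM2r.
  by rewrite -mulrA [leRHS]mulrC -mulrA ler_pM2l //; exact: est.
have small (y : R) : 0 <= y -> q / (4 * (y + 1)) * y <= q / 4.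
  move=> y0; rewrite mulrAC ler_pdivrMr; last by rewrite mulr_gt0 // ltr_wpDl.
  by rewrite mulrA divfK // ler_pM2l // lerDl.
have s1 : h * E <= q / 4 := small E E0.
have s2 : e * P <= q / 4 := small P P0.
have := le_trans qle (lerD s1 s2); rewrite leNgt => /negP; apply.
exact: two_fourths_lt.
Qed.

End EnergyEstimate.

(** * Functions with vanishing gradient, and the theorem *)

Section Constant.
Context {R : realType} {m : nat} {M : manifold R m}.
Variable g : metric M.

Lemma sqgrad_eq0_drow (f : M -> R) i y : smooth_fun f -> (forall x, sqgrad g f x = 0) ->
  chart_codom i y -> drow (f \o chart_param i) y = 0.
Proof.
move=> sf f0 cy; have [dy Ey] := codomP cy; have vg := grad_vfield g sf.
have := f0 (chart_param i y); rewrite /sqgrad (glueE (vinner_compat g vg vg) dy) Ey /vinner => Z.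
have [G0|nz] := eqVneq (gradm g f i y) 0; last first.
  by have := gmat_posdef g cy nz; rewrite Z ltxx.
have uG := gmat_unit g cy.
by rewrite -[LHS](mulmxKV uG) -/(gradf _ _ y) -/(gradm g f i y) G0 mul0mx.
Qed.

(* All multiples of f have slope at most one, so f varies by at most L / N along
   a curve of length L, for every N. *)
Lemma sqgrad_eq0_constant (f : M -> R) : smooth_fun f -> (forall x, sqgrad g f x = 0) ->
  exists c, forall x, f x = c.
Proof.
move=> sf f0; exists (f point) => x.
have [B [L hL _]] := reach_connected g point x.
have le (N : R) : 0 < N -> N * `|f x - f point| <= L.
  move=> N0; have sN : smooth_fun (fun z => N * f z) := smooth_funM (smooth_fun_cst N) sf.
  have l1 : slope1 g (fun z => N * f z).
    move=> i y cy V.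
    have -> : drow ((fun z => N * f z) \o chart_param i) y = 0.
      have sf' : smooth (chart_codom i) (f \o chart_param i) by move/smooth_funP: sf.
      have := drowM (smooth_cst (@open_cod _ _ _ i) N) sf' cy.
      rewrite (sqgrad_eq0_drow sf f0 cy) scaler0 add0r => E.
      rewrite [LHS]E; apply/rowP => l.
      by rewrite !mxE partial_cst mulr0.
    by rewrite mul0mx mxE normr0 sqrtr_ge0.
  have := curve_length_lipschitz sN l1 hL.
  by rewrite -mulrBr normrM gtr0_norm.
apply/eqP; rewrite -subr_eq0 -normr_le0 leNgt; apply/negP => a0.
have L0 : 0 <= L by apply: le_trans (le 1 ltr01); rewrite mul1r.
have := le ((L + 1) / `|f x - f point|) (divr_gt0 (ltr_wpDl L0 ltr01) a0).
by rewrite divfK ?gt_eqF // gerDl ler10.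
Qed.

End Constant.

Theorem corollary1p10 (R : realType) (n : nat) (M : manifold R (2 * n))
    (g : metric M) (J : kahler_structure g)
    (vol : {measure set (borel M) -> \bar R})
    (nu C_S : R) (mu : M -> 'I_(n ^ 2) -> R) (kappa : M -> R) (u : M -> R) :
  riemannian_volume g vol ->
  metrically_complete g ->
  2 < nu -> 0 < C_S ->
  sobolev_inequality g vol nu C_S ->
  (forall x : M, kahler_curvature_eigenvalues J x (mu x)) ->
  (forall x : M, kappa x <= 0) ->
  (forall x : M,
     (\sum_(a < n ^ 2 | (a < n)%N) mu x a) / (n%:R + 1) >= kappa x) ->
  harmonic_fun g u ->
  (\int[vol]_x (grad_norm g u x ^+ 2)%:E < +oo)%E ->
  ((\int[vol]_x (`|kappa x| `^ (nu / 2))%:E) `^ (2 / nu)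
     < (2 / (C_S * (n%:R + 1)))%:E)%E ->
  exists c : R, forall x : M, u x = c.

Proof.
move=> Hvol complete nu2 C0 sob Hmu kappa0 mu_ge hu energy0 hk.
have su : smooth_fun u by have [] := hu.
have energy : (\int[vol]_x (sqgrad g u x)%:E < +oo)%E.
  by apply: le_lt_trans energy0; rewrite le_eqVlt; apply/orP; left; apply/eqP;
    apply: eq_integral => x _; rewrite grad_norm_sqr.
apply: (sqgrad_eq0_constant (g := g) su).
set kE := (_ `^ _)%E in hk.
have k0 : (0 <= kE)%E by exact: poweR_ge0.
(* The strict bound on the norm makes it finite, so its real value can serve as the constant k of
   the energy estimate. *)
have kf : kE \is a fin_num by rewrite ge0_fin_numE // (lt_trans hk) // ltry.
have N0 : 0 < n%:R + 1 :> R by rewrite ltr_wpDl // ler0n.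
apply: (sqgrad_eq0 Hvol complete hu energy nu2 C0 sob Hmu kappa0 mu_ge (k := fine kE)).
  by rewrite fineK.
move: hk; rewrite -[kE in X in X -> _]fineK // lte_fin ltr_pdivlMr ?mulr_gt0 //.
by rewrite [(n%:R + 1) * (_ * _)]mulrC mulrA.
Qed.
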